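(* Assume that Hypotheses I and Hypotheses II listed in the context hold. Then, for every $T>0$ and every $x\in H$, pathwise uniqueness holds for the equation $$dX(t)=AX(t)\,dt+\widetilde{\mathscr L}B(X(t))\,dt+G\,dW(t),\quad t\in[0,T],\qquad X(0)=x .$$ Moreover, for every $T>0$ there exists $C_T>0$ such that for every $x_1,x_2\in H$, if $X(\cdot,x_1)$ and $X(\cdot,x_2)$ are two weak mild solutions (with initial data $x_1$ and $x_2$, respectively) defined on the same filtered probability space with respect to the same cylindrical Wiener process $W$, then $$\sup_{t\in[0,T]}\mathbb E\big[\|X(t,x_1)-X(t,x_2)\|_H^2\big]\le C_T\|x_1-x_2\|_H^2 .$$
   Context: **Notation.** $\mathbb N=\{1,2,\dots\}$. $U,H$ are real separable Hilbert spaces. $\mathcal L(\mathcal X;\mathcal Y)$ is the space of bounded linear operators, $\mathcal L(\mathcal X)=\mathcal L(\mathcal X;\mathcal X)$. For $\theta\in(0,1)$, $C_b^\theta(\mathcal X;\mathcal Y)$ is the space of bounded $\theta$-Hölder continuous functions with norm $\|f\|_{C_b^\theta}=\sup_x\|f(x)\|+\sup_{x\ne y}\|f(x)-f(y)\|/\|x-y\|^\theta$; $C_b^\theta(H)$ denotes the case of scalar values. A $U$-cylindrical Wiener process on a normal filtered probability space is $W(t)=\sum_k\beta_k(t)g_k$ with $(g_k)$ an orthonormal basis of $U$ and $(\beta_k)$ independent real Brownian motions. **Equation and solutions.** For $T>0$, $x\in H$ consider $$dX(t)=AX(t)\,dt+\widetilde{\mathscr L}B(X(t))\,dt+G\,dW(t),\quad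 t\in[0,T],\qquad X(0)=x. \quad (\mathrm E)$$ A weak mild solution is a couple $(X,W)$ where $W$ is a $U$-cylindrical Wiener process on some normal filtered probability space $(\Omega,\mathcal F,\{\mathcal F_t\},\mathbb P)$ and $X=\{X(t,x)\}_{t\in[0,T]}$ is an $H$-valued adapted process such that for every $t\in[0,T]$, $\mathbb P$-a.s., $$X(t,x)=e^{tA}x+\int_0^te^{(t-s)A}\widetilde{\mathscr L}B(X(s,x))\,ds+\int_0^te^{(t-s)A}G\,dW(s).$$ Pathwise uniqueness for (E) means: two weak mild solutions with the same initial datum $x$, on the same filtered probability space and with respect to the same $W$, satisfy $X_1(t)=X_2(t)$ $\mathbb P$-a.s. for every $t\in[0,T]$. Standing assumption: for every $T>0$ and $x\in H$, equation (E) admits a unique weak mild solution. **Hypotheses I.** (i) $A:\mathrm{Dom}(A)\subseteq H\to H$ generates a strongly continuous semigroup $(e^{tA})_{t\ge0}$. (ii) $G=\widetilde G\mathcal V$ with $\widetilde G\in\mathcal L(U;H)$, $\mathcal V\in\mathcal L(U)$. (iii) $B:H\to H$ is bounded and $\theta$-Hölder continuous for some $\theta\in(0,1)$, and $B=\widetilde G\widetilde B$ with $\widetilde B\in C_b^\theta(H;U)$. (iv) $\widetilde{\mathscr L}\in\mathcal L(H)$ and there is $\mathcal K\in\mathcal L(U)$ with $\widetilde{\mathscr L}\widetilde G=\widetilde G\mathcal K$. (v) There is $\eta\in(0,1)$ such that $\int_0^ts^{-\eta}\,\mathrm{Trace}_H[e^{sA}GG^*e^{sA^*}]\,ds<\infty$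 for every $t>0$. (vi) There are finite-dimensional subspaces $\{H_n\}_{n\in\mathbb N}$ of $H$ with $H=\overline{\bigcup_nH_n}$, $H_0:=\{0\}$, and for every $n\in\mathbb N$: $H_{n-1}\subseteq H_n$, $H_{n}\subseteq\mathrm{Dom}(A)$, and, denoting by $K_n$ the orthogonal complement of $H_{n-1}$ in $H_n$, $A(K_n)\subseteq K_n$. Moreover $\widetilde{\mathscr L}$ commutes with the orthogonal projection $P_n$ onto $H_n$. (vii) With $Q_t:=\int_0^te^{sA}GG^*e^{sA^*}ds$, for every $t>0$ one has $e^{tA}(H)\subseteq Q_t^{1/2}(H)$ and, with $\Gamma_t:=Q_t^{-1/2}e^{tA}$ ($Q_t^{-1/2}$ the pseudo-inverse), $\int_0^t\|\Gamma_s\|_{\mathcal L(H)}^{1-\theta}\|\Gamma_s\widetilde G\|_{\mathcal L(U;H)}\,ds<\infty$; the functions $s\mapsto\|\Gamma_s\|^{1-\theta}_{\mathcal L(H)}$ and $s\mapsto\|\Gamma_s\widetilde G\|_{\mathcal L(U;H)}$ are bounded from below by a positive constant on $(0,t)$ for every $t>0$; and there is $\theta'<\theta$ with $\int_0^t\|\Gamma_s\|^{1-\theta'}_{\mathcal L(H)}ds<\infty$ for every $t>0$. Set $A_n:=AP_n$, $\widetilde{\mathscr L}_n:=P_n\widetilde{\mathscr L}$. **Hypotheses II** (if necessary $H$ is replaced by its complexification). (i) There are $\beta\in[0,1)$ and, for every $T>0$, $K_T>0$ such that $\sup_{n}\|A_ne^{tA_n}\widetilde{\mathscr L}_n\|_{\mathcal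 L(H_n)}\le K_Tt^{-\beta}$ for $t\in(0,T]$. (ii) There is a family $\{f_n:n\in\mathbb N\}$ of normalized (not necessarily orthogonal) eigenvectors of $A^*$ with $H=\overline{\mathrm{span}\{f_n\}}$ and a sequence $(d_n)\subseteq\mathbb N$ such that: (a) for every $n$, $\{f_1,\dots,f_{s_n}\}=\bigcup_{i=1}^n\{e^i_1,\dots,e^i_{d_i}\}$ with $s_n=d_1+\dots+d_n=\dim H_n$, $H_n=\mathrm{span}\{f_1,\dots,f_{s_n}\}$, and $\langle e^i_k,e^j_h\rangle_H=0$ for $i\ne j$, $k=1,\dots,d_i$, $h=1,\dots,d_j$; (b) there is $d\in\mathbb N$ with $d_n\le d$ for all $n$; (c) $K_n$ is invariant for $\widetilde{\mathscr L}$ (hence also for $\widetilde{\mathscr L}^*$), and $\zeta_n:=\|\widetilde{\mathscr L}\|_{\mathcal L(K_n)}=\|\widetilde{\mathscr L}^*\|_{\mathcal L(K_n)}$; (d) for every $n$ and $j=1,\dots,d_n$ the eigenvalue $\rho^n_j$ of $A^*$ associated with $e^n_j$ has negative real part, and, with $B^n_j(\cdot):=\langle B(\cdot),e^n_j\rangle_H$, $$-\sum_{n\in\mathbb N}\zeta_n^2\sum_{j=1}^{d_n}\frac{\|B^n_j\|^2_{C_b^\theta(H)}}{\mathrm{Re}(\rho^n_j)}<\infty .$$ *)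

(* Defs.v *)
From HB Require Import structures.
From mathcomp Require Import all_boot all_order all_algebra.
From mathcomp Require Import complex.
From mathcomp Require Import all_classical all_reals all_analysis.

Set Implicit Arguments.
Unset Strict Implicit.
Unset Printing Implicit Defensive.

Import Order.TTheory GRing.Theory Num.Theory.
Import numFieldNormedType.Exports.

Local Open Scope classical_set_scope.
Local Open Scope ring_scope.

HB.mixin Record isHilbert (R : realType) H of CompleteNormedModule R H := {
  dot : H -> H -> R ;
  dotC : forall x y, dot x y = dot y x ;
  dotDZl : forall a x y z, dot (a *: x + y) z = a * dot x z + dot y z ;
  dotxx : forall x, dot x x = `|x| ^+ 2
}.

#[short(type="hilbertType")]
HB.structure Definition Hilbert (R : realType) :=
  {H of isHilbert R H & CompleteNormedModule R H}.

Definition separable_space (T : topologicalType) :=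
  exists D : set T, countable D /\ dense D.

Definition bounded_operator (R : realType) (E F : normedModType R)
  (f : E -> F) := linear f /\ continuous f.

Definition opnorm_on (R : realType) (E F : normedModType R) (V : set E)
  (f : E -> F) : R := sup [set `|f x| | x in V `&` [set x | `|x| <= 1]].

Definition opnorm (R : realType) (E F : normedModType R) (f : E -> F) : R :=
  opnorm_on setT f.

Definition has_dim (R : realType) (E : normedModType R) (V : set E) (m : nat) :=
  exists v : 'I_m -> E,
    (forall c : 'I_m -> R, \sum_i c i *: v i = 0 -> forall i, c i = 0) /\
    V = [set x | exists c : 'I_m -> R, x = \sum_i c i *: v i].

Section Holder.
Variables (R : realType) (E : normedModType R).

Definition in_Cb (F : normedModType R) (theta : R) (f : E -> F) :=
  (exists M : R, forall x, `|f x| <= M) /\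
  (exists M : R, forall x y, `|f x - f y| <= M * `|x - y| `^ theta).

(* [N] is the norm of the codomain, which is real-valued also for R[i]. *)
Definition Cb_norm (V : zmodType) (N : V -> R) (theta : R) (f : E -> V) : R :=
  sup [set N (f x) | x in [set: E]] +
  sup [set N (f p.1 - f p.2) / `|p.1 - p.2| `^ theta
      | p in [set p : E * E | p.1 != p.2]].

End Holder.

Section BochnerIntegral.
Variables (R : realType) (E : completeNormedModType R).
Local Notation mu := (@lebesgue_measure R).

(* [f] is Bochner integrable on the set [D], assumed of finite Lebesgue
   measure, with integral [I]; phi n is a sequence of simple functions. *)
Definition has_bochner (D : set R) (f : R -> E) (I : E) :=
  exists (m : nat -> nat) (A : nat -> nat -> set R) (v : nat -> nat -> E),
    let phi n s := \sum_(i < m n) \1_(A n i) s *: v n i in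
    [/\ forall n i, measurable (A n i),
        forall n, measurable_fun D (fun s => `|f s - phi n s|),
        (\int[mu]_(s in D) `|f s - phi n s|%R%:E)%E @[n --> \oo] --> 0%E &
        \sum_(i < m n) fine (mu (D `&` A n i)) *: v n i @[n --> \oo] --> I].

Definition bochner (D : set R) (f : R -> E) : E :=
  xget 0 [set I | has_bochner D f I].

End BochnerIntegral.

Section Operators.
Variable R : realType.
Local Notation mu := (@lebesgue_measure R).

Definition adjoint (E F : hilbertType R) (f : E -> F) : F -> E :=
  fun y => xget 0 [set z | forall x, dot (f x) y = dot x z].

(* Orthonormal basis indexed by [J]; [J] is finite in finite dimension. *)
Definition orthonormal_basis (E : hilbertType R) (J : set nat) (g : nat -> E) :=
  (forall j k, J j -> J k -> dot (g j) (g k) = (j == k)%:R) /\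
  closure [set x | exists (s : seq nat) (c : nat -> R),
    (forall k, k \in s -> J k) /\ x = \sum_(k <- s) c k *: g k] = setT.

(* Trace of a nonnegative self-adjoint operator, with values in [0, +oo]. The
   basis is an arbitrary one: the trace does not depend on it. *)
Definition trace (E : hilbertType R) (f : E -> E) : \bar R :=
  let b := xget (set0, fun=> 0)
    [set b : set nat * (nat -> E) | orthonormal_basis b.1 b.2] in
  (\esum_(k in b.1) (dot (f (b.2 k)) (b.2 k))%:E)%E.

Definition orthogonal_projection (E : hilbertType R) (V : set E) : E -> E :=
  fun x => xget 0 [set y | V y /\ forall z, V z -> dot (x - y) z = 0].

Definition sqrt_operator (E : hilbertType R) (Q : E -> E) : E -> E :=
  xget (fun=> 0) [set f | [/\ bounded_operator f,
    forall x y, dot (f x) y = dot x (f y),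
    forall x, 0 <= dot (f x) x & forall x, f (f x) = Q x]].

(* The pseudo-inverse: [pseudo_inverse f y] is the preimage of [y] which is
   orthogonal to the kernel of [f]; it is only meaningful on the range of f. *)
Definition pseudo_inverse (E F : hilbertType R) (f : E -> F) : F -> E :=
  fun y => xget 0 [set x | f x = y /\ forall z, f z = 0 -> dot x z = 0].

(* e^{tf} for a bounded operator f *)
Definition exp_operator (E : hilbertType R) (f : E -> E) (t : R) : E -> E :=
  fun x => limn (series (fun k => (t ^+ k / k`!%:R) *: iter k f x)).

Definition C0_semigroup (E : hilbertType R) (S : R -> E -> E) :=
  [/\ forall t, 0 <= t -> bounded_operator (S t),
      forall x, S 0 x = x,
      forall s t x, 0 <= s -> 0 <= t -> S (s + t) x = S s (S t x) &
      forall x, S t x @[t --> 0^'+] --> x].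

(* Unbounded operators are given by a domain [Dom] and a total function [A]
   whose values outside of [Dom] are irrelevant. *)
Definition generates (E : hilbertType R) (Dom : set E) (A : E -> E)
    (S : R -> E -> E) :=
  C0_semigroup S /\
  forall x y, (Dom x /\ A x = y) <->
    (h^-1 *: (S h x - x) @[h --> 0^'+] --> y).

(* [y] is in the domain of A^* and A^* y = z *)
Definition adjoint_graph (E : hilbertType R) (Dom : set E) (A : E -> E)
  (y z : E) := forall x, Dom x -> dot (A x) y = dot x z.

End Operators.

(** * Complexification: the pair (a, b) in E * E stands for a + i b *)

Section Complexification.
Variables (R : realType) (E : hilbertType R).
Local Open Scope complex_scope.

Definition cscale (z : R[i]) (f : E * E) : E * E :=
  (complex.Re z *: f.1 - complex.Im z *: f.2,
   complex.Re z *: f.2 + complex.Im z *: f.1).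

(* linear on the left, antilinear on the right *)
Definition cdot (f g : E * E) : R[i] :=
  (dot f.1 g.1 + dot f.2 g.2) +i* (dot f.2 g.1 - dot f.1 g.2).

Definition cnorm (f : E * E) : R := Num.sqrt (`|f.1| ^+ 2 + `|f.2| ^+ 2).

Definition cspan (f : nat -> E * E) (n : nat) : set (E * E) :=
  [set g | exists c : nat -> R[i], g = \sum_(1 <= m < n.+1) cscale (c m) (f m)].

(* [f] is an eigenvector, with eigenvalue [rho], of the complexification of the
   adjoint of the unbounded operator (Dom, A). *)
Definition adjoint_eigenvector (Dom : set E) (A : E -> E) (rho : R[i])
    (f : E * E) :=
  [/\ f <> 0, adjoint_graph Dom A f.1 (cscale rho f).1 &
      adjoint_graph Dom A f.2 (cscale rho f).2].

End Complexification.

Section Probability.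
Context (R : realType) (d : measure_display) (Omega : measurableType d)
  (P : probability Omega R).

Definition normal_filtration (F : R -> set (set Omega)) :=
  [/\ forall t, 0 <= t -> sigma_algebra setT (F t) /\ F t `<=` measurable,
      forall s t, 0 <= s -> s <= t -> F s `<=` F t,
      forall t, 0 <= t -> F t = \bigcap_(s in [set s | t < s]) F s &
      forall N, measurable N -> P N = 0%E -> F 0 N].

Definition indep2 (S1 S2 : set (set Omega)) :=
  forall A B, S1 A -> S2 B -> P (A `&` B) = (P A * P B)%E.

Definition mutually_indep (J : set nat) (S : nat -> set (set Omega)) :=
  forall (s : seq nat) (A : nat -> set Omega), uniq s ->
    (forall k, k \in s -> J k /\ S k (A k)) ->
    P (\bigcap_(k in [set` s]) A k) = (\prod_(k <- s) fine (P (A k)))%:E.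

Definition sigma_of (I : Type) (D : set I) (Y : I -> Omega -> R) :
    set (set Omega) :=
  <<s [set A | exists i C, [/\ D i, measurable C & A = Y i @^-1` C]] >>.

Definition brownian_motion (b : R -> Omega -> R) :=
  [/\ forall t, 0 <= t -> measurable_fun setT (b t),
      {ae P, forall w, b 0 w = 0},
      forall s t (C : set R), 0 <= s -> s < t -> measurable C ->
        P ((fun w => b t w - b s w) @^-1` C) =
        normal_prob 0 (Num.sqrt (t - s)) C,
      forall s, 0 <= s ->
        indep2 (sigma_of [set u | 0 <= u <= s] b)
               (sigma_of [set u | s <= u] (fun u w => b u w - b s w)) &
      {ae P, forall w, {within `[0, +oo[, continuous (b^~ w)}}].

(* The cylindrical process sum_(k in wI) wb k t *: wg k. *)
Record cylindrical (U : hilbertType R) := Cylindrical {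
  wI : set nat ;
  wg : nat -> U ;
  wb : nat -> R -> Omega -> R
}.

Definition cylindrical_wiener (F : R -> set (set Omega)) (U : hilbertType R)
    (W : cylindrical U) :=
  [/\ orthonormal_basis (wI W) (wg W),
      forall k, wI W k -> brownian_motion (wb W k),
      mutually_indep (wI W) (fun k => sigma_of [set t | 0 <= t] (wb W k)),
      forall k t C, wI W k -> 0 <= t -> measurable C ->
        F t (wb W k t @^-1` C) &
      forall s, 0 <= s ->
        indep2 (F s) (sigma_of [set q : nat * R | wI W q.1 /\ s <= q.2]
          (fun q w => wb W q.1 q.2 w - wb W q.1 s w))].

(** Stochastic integral of a deterministic operator-valued integrand.
    An elementary integrand is a finite sum of terms (k, a, b, h), each of which
    stands for  s |-> 1_{]a, b]}(s) <g_k, .> h. *)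
Section StochasticIntegral.
Variables (U H : hilbertType R) (W : cylindrical U).
Local Notation mu := (@lebesgue_measure R).

(* the value at time s, applied to g_k *)
Definition elem_val (e : seq (nat * R * R * H)) (s : R) (k : nat) : H :=
  \sum_(x <- e) let: (j, a, b, h) := x in
    if (j == k) && (a < s <= b) then h else 0.

Definition elem_int (e : seq (nat * R * R * H)) (w : Omega) : H :=
  \sum_(x <- e) let: (j, a, b, h) := x in (wb W j b w - wb W j a w) *: h.

(* [Z] is (a version of) the integral of [Phi] over [0, t] with respect to W:
   elementary integrands converge to Phi in L^2 for the Hilbert-Schmidt norm,
   and their integrals converge to Z in mean square. *)
Definition stoch_integral (t : R) (Phi : R -> U -> H) (Z : Omega -> H) :=
  (forall O : set H, open O -> measurable (Z @^-1` O)) /\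
  exists e : nat -> seq (nat * R * R * H),
    [/\ forall n j a b h, (j, a, b, h) \in e n ->
          [/\ wI W j, 0 <= a, a <= b & b <= t],
        (\int[mu]_(s in `[0%R, t]) \esum_(k in wI W)
           (`|Phi s (wg W k) - elem_val (e n) s k| ^+ 2)%R%:E)%E
           @[n --> \oo] --> 0%E &
        ('E_P[fun w => (`|Z w - elem_int (e n) w| ^+ 2)%R])%E
           @[n --> \oo] --> 0%E].

End StochasticIntegral.
End Probability.

(** * The equation dX = A X dt + L B(X) dt + G dW, X(0) = x,
      where [S] is the semigroup generated by A *)

Section Equation.
Variables (R : realType) (H U : hilbertType R).
Variables (S : R -> H -> H) (L B : H -> H) (G : U -> H).

(* Besides being adapted, [X] is jointly measurable in (t, w), as is needed for
   the drift integral to be a random variable. *)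
Definition weak_mild_solution (T : R) (x : H)
    (d : measure_display) (Omega : measurableType d) (P : probability Omega R)
    (F : R -> set (set Omega)) (W : cylindrical Omega U)
    (X : R -> Omega -> H) :=
  [/\ normal_filtration P F,
      cylindrical_wiener P F W,
      forall t (O : set H), 0 <= t <= T -> open O -> F t (X t @^-1` O),
      forall O : set H, open O ->
        measurable [set p : R * Omega | 0 <= p.1 <= T /\ O (X p.1 p.2)] &
      forall t, 0 <= t <= T -> exists Z : Omega -> H,
        stoch_integral P W t (fun s u => S (t - s) (G u)) Z /\
        {ae P, forall w, exists I : H,
          has_bochner `[0, t] (fun s => S (t - s) (L (B (X s w)))) I /\
          X t w = S t x + I + Z w}].

(* Solutions are only determined up to modification, so that their law is given
   by the finite-dimensional distributions on [0, T]. *)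
Definition same_law (T : R)
    (d1 : measure_display) (Omega1 : measurableType d1)
    (P1 : probability Omega1 R) (X1 : R -> Omega1 -> H)
    (d2 : measure_display) (Omega2 : measurableType d2)
    (P2 : probability Omega2 R) (X2 : R -> Omega2 -> H) :=
  forall (m : nat) (t : 'I_m -> R) (C : 'I_m -> set H),
    (forall i, 0 <= t i <= T) -> (forall i, <<s open >> (C i)) ->
    P1 [set w | forall i, C i (X1 (t i) w)] =
    P2 [set w | forall i, C i (X2 (t i) w)].

Definition unique_weak_mild_solution (T : R) (x : H) :=
  (exists (d : measure_display) (Omega : measurableType d)
     (P : probability Omega R) (F : R -> set (set Omega))
     (W : cylindrical Omega U) (X : R -> Omega -> H),
     weak_mild_solution T x P F W X) /\
  (forall (d1 : measure_display) (Omega1 : measurableType d1)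
     (P1 : probability Omega1 R) (F1 : R -> set (set Omega1))
     (W1 : cylindrical Omega1 U) (X1 : R -> Omega1 -> H)
     (d2 : measure_display) (Omega2 : measurableType d2)
     (P2 : probability Omega2 R) (F2 : R -> set (set Omega2))
     (W2 : cylindrical Omega2 U) (X2 : R -> Omega2 -> H),
     weak_mild_solution T x P1 F1 W1 X1 ->
     weak_mild_solution T x P2 F2 W2 X2 ->
     same_law T P1 X1 P2 X2).

Definition pathwise_uniqueness (T : R) (x : H) :=
  forall (d : measure_display) (Omega : measurableType d)
    (P : probability Omega R) (F : R -> set (set Omega))
    (W : cylindrical Omega U) (X1 X2 : R -> Omega -> H),
    weak_mild_solution T x P F W X1 -> weak_mild_solution T x P F W X2 ->
    forall t, 0 <= t <= T -> {ae P, forall w, X1 t w = X2 t w}.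

End Equation.

Section Hypotheses.
Variables (R : realType) (H U : hilbertType R).
Local Notation mu := (@lebesgue_measure R).

(* e^{sA} G G^* e^{sA^*} *)
Definition cov_integrand (S : R -> H -> H) (G : U -> H) (s : R) : H -> H :=
  fun h => S s (G (adjoint G (adjoint (S s) h))).

Definition Qop (S : R -> H -> H) (G : U -> H) (t : R) : H -> H :=
  fun h => bochner `[0, t] (fun s => cov_integrand S G s h).

Definition Gamma_op (S : R -> H -> H) (G : U -> H) (t : R) : H -> H :=
  fun h => pseudo_inverse (sqrt_operator (Qop S G t)) (S t h).

(* orthogonal complement of H_(n-1) in H_n *)
Definition Kspace (Hn : nat -> set H) (n : nat) : set H :=
  [set x | Hn n x /\ forall y, Hn n.-1 y -> dot x y = 0].

Record hypotheses_I (theta : R) (Dom : set H) (A : H -> H) (S : R -> H -> H)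
    (G Gt : U -> H) (L B : H -> H) (Hn : nat -> set H) : Prop := HypothesesI {
  hI_generator : generates Dom A S ;
  hI_G : bounded_operator Gt /\
    exists V : U -> U, bounded_operator V /\ forall u, G u = Gt (V u) ;
  hI_theta : 0 < theta < 1 ;
  hI_B : in_Cb theta B /\
    exists Bt : H -> U, in_Cb theta Bt /\ forall x, B x = Gt (Bt x) ;
  hI_L : bounded_operator L /\
    exists K : U -> U, bounded_operator K /\ forall u, L (Gt u) = Gt (K u) ;
  hI_trace : exists eta : R, 0 < eta < 1 /\ forall t, 0 < t ->
    (\int[mu]_(s in `]0%R, t[)
       ((s `^ (- eta))%R%:E * trace (cov_integrand S G s)) < +oo)%E ;
  hI_H0 : Hn 0%N = [set 0] ;
  hI_Hn : forall n, (0 < n)%N ->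
    [/\ exists m, has_dim (Hn n) m, Hn n.-1 `<=` Hn n, Hn n `<=` Dom &
        A @` Kspace Hn n `<=` Kspace Hn n] ;
  hI_dense : closure (\bigcup_n Hn n) = setT ;
  hI_commute : forall n x, (0 < n)%N ->
    L (orthogonal_projection (Hn n) x) = orthogonal_projection (Hn n) (L x) ;
  hI_range : forall t, 0 < t ->
    range (S t) `<=` range (sqrt_operator (Qop S G t)) ;
  hI_Gamma : forall t, 0 < t ->
    (\int[mu]_(s in `]0%R, t[)
       (opnorm (Gamma_op S G s) `^ (1 - theta) *
        opnorm (Gamma_op S G s \o Gt))%R%:E < +oo)%E ;
  hI_Gamma_lower : forall t, 0 < t -> exists c : R, 0 < c /\
    forall s, 0 < s < t ->
      c <= opnorm (Gamma_op S G s) `^ (1 - theta) /\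
      c <= opnorm (Gamma_op S G s \o Gt) ;
  hI_Gamma' : exists theta' : R, theta' < theta /\ forall t, 0 < t ->
    (\int[mu]_(s in `]0%R, t[)
       (opnorm (Gamma_op S G s) `^ (1 - theta'))%R%:E < +oo)%E
}.

(* Sequences indexed by the positive integers are functions on nat whose value
   at 0 is irrelevant. Eigenvectors live in the complexification of H. *)
Record spectral_hypothesis (theta : R) (Dom : set H) (A : H -> H)
    (L B : H -> H) (Hn : nat -> set H)
    (f : nat -> H * H) (dn : nat -> nat) (e : nat -> nat -> H * H)
    (rho : nat -> nat -> R[i]) : Prop := SpectralHypothesis {
  hS_dn_gt0 : forall n, (0 < n)%N -> (0 < dn n)%N ;
  hS_eigen : forall m, (0 < m)%N -> cnorm (f m) = 1 /\
    exists r : R[i], adjoint_eigenvector Dom A r (f m) ;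
  hS_total : closure (\bigcup_n cspan f n) = setT ;
  hS_family : forall n, (0 < n)%N ->
    let sn := (\sum_(1 <= i < n.+1) dn i)%N in
    [/\ [set f m | m in [set m : nat | (0 < m <= sn)%N]] =
        [set v | exists i j, [/\ (0 < i <= n)%N, (0 < j <= dn i)%N & v = e i j]],
        has_dim (Hn n) sn &
        [set v : H * H | Hn n v.1 /\ Hn n v.2] = cspan f sn] ;
  hS_orthogonal : forall i j k h, (0 < i)%N -> (0 < j)%N -> i != j ->
    (0 < k <= dn i)%N -> (0 < h <= dn j)%N -> cdot (e i k) (e j h) = 0 ;
  hS_bound : exists d : nat, forall n, (0 < n)%N -> (dn n <= d)%N ;
  hS_invariant : forall n, (0 < n)%N -> L @` Kspace Hn n `<=` Kspace Hn n ;
  hS_eigenvalue : forall n j, (0 < n)%N -> (0 < j <= dn n)%N ->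
    adjoint_eigenvector Dom A (rho n j) (e n j) /\ complex.Re (rho n j) < 0 ;
  hS_series :
    let zeta n := opnorm_on (Kspace Hn n) L in
    let Bnorm n j := Cb_norm (@Normc.normc R) theta (fun x => cdot (B x, 0) (e n j)) in
    (\sum_(1 <= n <oo)
       (- (zeta n ^+ 2 * \sum_(1 <= j < (dn n).+1)
             (Bnorm n j ^+ 2 / complex.Re (rho n j))))%R%:E < +oo)%E
}.

Record hypotheses_II (theta : R) (Dom : set H) (A : H -> H)
    (L B : H -> H) (Hn : nat -> set H) : Prop := HypothesesII {
  hII_bound : exists beta : R, 0 <= beta < 1 /\
    forall T : R, 0 < T -> exists KT : R, 0 < KT /\
      forall n t, (0 < n)%N -> 0 < t <= T ->
        let Pn := orthogonal_projection (Hn n) in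
        let An := A \o Pn in
        opnorm_on (Hn n) (An \o exp_operator An t \o Pn \o L) <=
          KT * t `^ (- beta) ;
  hII_spectral : exists f dn e rho,
    spectral_hypothesis theta Dom A L B Hn f dn e rho
}.

End Hypotheses.

(* Main.v *)
Require Import Defs.
From HB Require Import structures.
From mathcomp Require Import all_boot all_order all_algebra.
From mathcomp Require Import all_classical all_reals all_analysis.
From mathcomp Require Import measurable_realfun ring lra.

Set Implicit Arguments.
Unset Strict Implicit.
Unset Printing Implicit Defensive.

Import Order.TTheory GRing.Theory Num.Theory.
Import numFieldNormedType.Exports.

Local Open Scope classical_set_scope.
Local Open Scope ring_scope.

(** Let X1 and X2 be two solutions driven by the same W, put D = X1 - X2,
    a(s) = |Gamma_s|^(1 - theta) and k(s) = |Gamma_s Gt|. Shifting the stochastic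
    convolution over an interval of length s by e^{sA} h changes its law by at
    most C |Gamma_s h| in total variation. Averaging a function f of the unit ball
    of C_b^theta against that law therefore yields a C a(s)-Lipschitz function g,
    and g(. + eps L B(.)) - g has C_b^theta norm at most C eps k(s). Iterating this
    along a fine time grid, one finds that
      n(u) = sup_f |E 1_A (f(X1(u)) - f(X2(u)))|   (A in F_s, u > s)
    satisfies the Volterra inequality
      n(u) <= C a(u - s) E 1_A |D(s)| + C int_s^u k(u - r) n(r) dr,
    so that the integral of n over [s, s + h] is at most omega(h) E 1_A |D(s)|,
    where omega(h) = C int_0^h a.

    Consequently the increments K(u, v) = e^{(t - v)A} D(v) - e^{(t - u)A} D(u) are
    almost orthogonal to the past: E <K(u, v), xi> <= omega(v - u) E |xi| |D(u)| if
    xi is F_u-measurable. If m bounds D in mean square, bisection of the interval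
    shows that the mean square norm kappa(h) of the increments over intervals of
    length h satisfies kappa(h) <= sqrt 2 kappa(h / 2) + m omega(h / 2). Hence
    kappa(h) <= m V(h) with V(h) = C int_0^h a(s) (sqrt (h / s) - 1) ds, which is
    finite because k(s) >= c s^(-1/2) and a k is integrable. Since V(h) tends to 0,
    D is controlled by D(s) on short intervals [s, s + h], hence on [0, T]. *)

(** * Hilbert spaces and bounded operators *)

(** The drift is only Hölder continuous, so a pathwise Gronwall argument would bound [|D|] by an
    integral of [|D|^theta], which does not force [D = 0]. Differences of drifts are therefore
    estimated in mean over events of the past, where the noise of the following interval turns the
    Hölder bound into a Lipschitz one. Conditional expectations are encoded as means over sets [A]
    in [F u]. Total variation bounds are obtained for elementary integrals, which are finite
    Gaussian sums subject to the Cameron-Martin formula, and then passed to the limit in mean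
    square. This is why the test functions are uniformly continuous, in a quantitative form that
    survives expectations. The factor [sqrt 2] in the recursion for the increments is Pythagoras'
    theorem for two nearly orthogonal halves. The triangle inequality would give 2, and halving the
    interval would then gain nothing over the crude bound, which is linear in the length. Solutions
    are only determined up to modification, so every estimate is made at fixed times. *)

Section HilbertTheory.
Context {R : realType} {E : hilbertType R}.
Implicit Types (x y z : E) (a : R).

Lemma dotDl x y z : dot (x + y) z = dot x z + dot y z.
Proof. by rewrite -{1}[x]scale1r dotDZl mul1r. Qed.

Lemma dot0l z : dot 0 z = 0.
Proof. by have := dotDl 0 0 z; rewrite addr0 => /eqP; rewrite -subr_eq0 opprD addNKr oppr_eq0 => /eqP. Qed.

Lemma dotZl a x z : dot (a *: x) z = a * dot x z.
Proof. by rewrite -[a *: x]addr0 dotDZl dot0l addr0. Qed.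

Lemma dotNl x z : dot (- x) z = - dot x z.
Proof. by rewrite -scaleN1r dotZl mulN1r. Qed.

Lemma dotBl x y z : dot (x - y) z = dot x z - dot y z.
Proof. by rewrite dotDl dotNl. Qed.

Lemma dotDr x y z : dot z (x + y) = dot z x + dot z y.
Proof. by rewrite dotC dotDl !(dotC z). Qed.

Lemma dot0r z : dot z 0 = 0. Proof. by rewrite dotC dot0l. Qed.

Lemma dotZr a x z : dot z (a *: x) = a * dot z x.
Proof. by rewrite dotC dotZl (dotC z). Qed.

Lemma dotNr x z : dot z (- x) = - dot z x.
Proof. by rewrite dotC dotNl (dotC z). Qed.

Lemma dotBr x y z : dot z (x - y) = dot z x - dot z y.
Proof. by rewrite dotDr dotNr. Qed.

Lemma dot_suml (I : Type) (r : seq I) (F : I -> E) z :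
  dot (\sum_(i <- r) F i) z = \sum_(i <- r) dot (F i) z.
Proof. by elim/big_rec2: _ => [|i a x _ <-]; rewrite ?dot0l ?dotDl. Qed.

Lemma dot_sumr (I : Type) (r : seq I) (F : I -> E) z :
  dot z (\sum_(i <- r) F i) = \sum_(i <- r) dot z (F i).
Proof. by rewrite dotC dot_suml; apply: eq_bigr => i _; rewrite dotC. Qed.

Lemma normD_sqr x y : `|x + y| ^+ 2 = `|x| ^+ 2 + 2 * dot x y + `|y| ^+ 2.
Proof. by rewrite -!dotxx !dotDl !dotDr (dotC y x); ring. Qed.

Lemma normB_sqr x y : `|x - y| ^+ 2 = `|x| ^+ 2 - 2 * dot x y + `|y| ^+ 2.
Proof. by rewrite normD_sqr dotNr normrN; ring. Qed.

Lemma dot_sqr_le x y : dot x y ^+ 2 <= `|x| ^+ 2 * `|y| ^+ 2.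
Proof.
have [->|y0] := eqVneq y 0; first by rewrite dot0r normr0 !expr0n mulr0.
have ny : 0 < `|y| ^+ 2 by rewrite exprn_gt0// normr_gt0.
have := sqr_ge0 `| `|y| ^+ 2 *: x - dot x y *: y|.
rewrite normB_sqr !normrZ !exprMn dotZl dotZr !real_normK ?num_real//.
set n := `|y| ^+ 2 => h.
have {}h : 0 <= n * (n * `|x| ^+ 2 - dot x y ^+ 2) by apply: le_trans h _; rewrite /n; lra.
by rewrite pmulr_rge0// in h; rewrite mulrC -subr_ge0.
Qed.

Lemma dot_le x y : `|dot x y| <= `|x| * `|y|.
Proof.
rewrite -ler_sqr ?nnegrE ?mulr_ge0//.
by rewrite exprMn real_normK ?num_real// dot_sqr_le.
Qed.

Lemma dot_ler x y : dot x y <= `|x| * `|y|.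
Proof. exact: le_trans (ler_norm _) (dot_le x y). Qed.

Lemma norm_le_dot x c : 0 <= c -> dot x x <= c * `|x| -> `|x| <= c.
Proof.
move=> c0; rewrite dotxx expr2; have [->|x0] := eqVneq x 0; first by rewrite normr0.
by rewrite ler_pM2r// normr_gt0.
Qed.

Lemma dot_ext x y : (forall z, dot x z = dot y z) -> x = y.
Proof.
move=> h; apply/eqP; rewrite -subr_eq0 -normr_eq0 -[_ == 0]/((0 < 2)%N && (`|x - y| == 0)).
by rewrite -(@expf_eq0 R `|x - y| 2) -dotxx dotBl h subrr.
Qed.

Lemma continuous_dotl y : continuous (fun x => dot x y).
Proof.
move=> x; apply/cvgrPdist_lt => e e0; near=> x'.
rewrite -dotBl; apply: le_lt_trans (dot_le _ _) _.
apply: le_lt_trans (_ : `|x - x'| * (`|y| + 1) < _); first by rewrite ler_wpM2l// lerDl.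
rewrite -ltr_pdivlMr ?ltr_wpDl//; near: x'; apply: cvgr_dist_lt => //.
by rewrite divr_gt0// ltr_wpDl.
Unshelve. all: by end_near. Qed.

(** Stability under midpoints is the only form of convexity that the parallelogram identity uses: a
    minimizing sequence satisfies [|u m - u n|^2 <= 2 / (m + 1) + 2 / (n + 1)], hence is Cauchy. *)
Lemma min_norm_exists (C : set E) : C !=set0 -> closed C ->
  (forall x y, C x -> C y -> C (2^-1 *: (x + y))) ->
  exists2 x, C x & forall y, C y -> `|x| <= `|y|.
Proof.
move=> [x0 Cx0] clC midC.
pose D := [set `|x| ^+ 2 | x in C].
have hD : has_inf D by split; [exists (`|x0| ^+ 2), x0|exists 0 => _ [x _ <-]; rewrite sqr_ge0].
have /choice[u hu] : forall n : nat, exists x, C x /\ `|x| ^+ 2 < inf D + n.+1%:R^-1.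
  move=> n; have e0 : 0 < n.+1%:R^-1 :> R by rewrite invr_gt0.
  by have [_ [x Cx <-] h] := inf_adherent e0 hD; exists x.
have lbD x : C x -> inf D <= `|x| ^+ 2 by move=> Cx; apply: ge_inf; [exact: hD.2|exists x].
have uB m n : `|u m - u n| ^+ 2 <= 2 * m.+1%:R^-1 + 2 * n.+1%:R^-1.
  have := lbD _ (midC _ _ (hu m).1 (hu n).1).
  have -> : `|2^-1 *: (u m + u n)| ^+ 2 = 4^-1 * `|u m + u n| ^+ 2.
    by rewrite normrZ exprMn ger0_norm ?invr_ge0//; congr (_ * _); field.
  rewrite normD_sqr normB_sqr; have := (hu m).2; have := (hu n).2.
  move: (`|u m| ^+ 2) (`|u n| ^+ 2) (inf D) (dot _ _) (m.+1%:R^-1) (n.+1%:R^-1) => a b c e f g.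
  by clear=> ? ? ?; lra.
have cu : cauchy (u @ \oo).
  apply/cauchy_ballP => e e0.
  have e24 : 0 < e ^+ 2 / 4 by rewrite divr_gt0 ?exprn_gt0.
  pose N := (Num.truncn (e ^+ 2 / 4)^-1).+1.
  have hN n : (N <= n)%N -> n.+1%:R^-1 < e ^+ 2 / 4.
    move=> Nn; rewrite invf_plt ?posrE//.
    by apply: lt_le_trans (truncnS_gt _) _; rewrite ler_nat (leq_trans Nn).
  pose V := u @` [set n | (N <= n)%N].
  exists (V, V) => /=; first by split; exists N => // n Nn; exists n.
  move=> [_ _] /= [[m Nm <-] [n Nn <-]]; rewrite -ball_normE /ball_ /=.
  rewrite -(@ltr_pXn2r _ 2)// ?nnegrE ?normr_ge0// ?(ltW e0)//.
  apply: le_lt_trans (uB _ _) _; move: (hN _ Nm) (hN _ Nn).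
  by move: (m.+1%:R^-1 : R) (n.+1%:R^-1 : R) (e ^+ 2 : R) => a b c; lra.
have /cauchy_cvgP/cvg_ex[/= x ux] := cu.
have Cx : C x.
  by apply: (closed_cvg C clC _ x ux); near=> n; exact: (hu n).1.
exists x => // y Cy.
rewrite -(@ler_pXn2r _ 2)// ?nnegrE//; apply: le_trans (lbD _ Cy).
have ux2 : (fun n => `|u n| ^+ 2) @ \oo --> `|x| ^+ 2.
  by rewrite expr2; under eq_fun do rewrite expr2; apply: cvgM; apply: cvg_norm.
have vx2 : (fun n => inf D + n.+1%:R^-1) @ \oo --> inf D + 0.
  by apply: cvgD; [exact: cvg_cst|exact: cvg_harmonic].
rewrite addr0 in vx2; apply: (ler_cvg_to ux2 vx2); near=> n; exact: ltW (hu n).2.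
Unshelve. all: by end_near. Qed.

(** First variation: the competitor with [t = - dot x v / |v|^2] is strictly shorter than [x] unless
    [dot x v = 0]. *)
Lemma min_norm_orth (C : set E) x v : C x -> (forall y, C y -> `|x| <= `|y|) ->
  (forall t : R, C (x + t *: v)) -> dot x v = 0.
Proof.
move=> Cx hx hv; have [->|v0] := eqVneq v 0; first by rewrite dot0r.
have nv : 0 < `|v| ^+ 2 by rewrite exprn_gt0// normr_gt0.
have := hx _ (hv (- dot x v / `|v| ^+ 2)).
rewrite -(@ler_pXn2r _ 2)// ?nnegrE// normD_sqr normrZ exprMn dotZr real_normK ?num_real// => h.
have {}h : dot x v ^+ 2 / `|v| ^+ 2 <= 0.
  have -> : dot x v ^+ 2 / `|v| ^+ 2 = - (2 * (- dot x v / `|v| ^+ 2 * dot x v) +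
     (- dot x v / `|v| ^+ 2) ^+ 2 * `|v| ^+ 2) by field; rewrite normr_eq0.
  lra.
move: h; rewrite pmulr_lle0 ?invr_gt0// => h.
by apply/eqP; rewrite -sqrf_eq0 eq_le h sqr_ge0.
Qed.

End HilbertTheory.

(** Vector identities are tested against an arbitrary vector, which reduces them to identities in
    [R]. *)
Ltac hring := apply: dot_ext => ?; rewrite ?(dotDl, dotNl, dotZl, dot0l); ring.
Ltac hfield := apply: dot_ext => ?; rewrite ?(dotDl, dotNl, dotZl, dot0l); field.

Section BoundedOperators.
Context {R : realType}.

Section basics.
Context {E F : normedModType R}.
Variable f : E -> F.
Hypothesis bf : bounded_operator f.

Let pack : {linear E -> F} := HB.pack f (GRing.isLinear.Build _ _ _ _ _ bf.1).

Lemma bopD x y : f (x + y) = f x + f y. Proof. exact: (linearD pack). Qed.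
Lemma bopB x y : f (x - y) = f x - f y. Proof. exact: (linearB pack). Qed.
Lemma bop0 : f 0 = 0. Proof. exact: (linear0 pack). Qed.
Lemma bopZ a x : f (a *: x) = a *: f x. Proof. by have := bf.1 a x 0; rewrite bop0 !addr0. Qed.
Lemma bop_sum (I : Type) (r : seq I) (G : I -> E) :
  f (\sum_(i <- r) G i) = \sum_(i <- r) f (G i).
Proof. exact: (linear_sum pack). Qed.

Lemma bop_bound : exists2 C : R, 0 <= C & forall x, `|f x| <= C * `|x|.
Proof.
have /linear_bounded_continuous/linear_boundedP : continuous pack := bf.2.
move=> -[M [Mr hM]]; exists (`|M| + 1); first by rewrite addr_ge0.
by move=> x; apply: hM; rewrite (le_lt_trans (ler_norm _))// ltrDl.
Qed.

End basics.

Lemma bopP (E F : normedModType R) (f : E -> F) C : linear f ->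
  (forall x, `|f x| <= C * `|x|) -> bounded_operator f.
Proof.
move=> lf hf; split => //.
pose p : {linear E -> F} := HB.pack f (GRing.isLinear.Build _ _ _ _ _ lf).
apply/(@linear_bounded_continuous _ _ _ p)/linear_boundedP.
exists C; split; first exact: num_real.
by move=> r Cr x; apply: le_trans (hf x) _; rewrite ler_wpM2r// ltW.
Qed.

Lemma bop_comp (E F G : normedModType R) (f : E -> F) (g : F -> G) :
  bounded_operator f -> bounded_operator g -> bounded_operator (g \o f).
Proof.
move=> bf bg; split => [a x y /=|x]; first by rewrite bf.1 bg.1.
by apply: continuous_comp; [exact: bf.2|exact: bg.2].
Qed.

Section Riesz.
Context {E : hilbertType R}.

(** The vector of minimal norm in the hyperplane [l = 1] is orthogonal to the kernel of [l]; divided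
    by its squared norm, it represents [l]. *)
Lemma riesz (l : E -> R) : bounded_operator (l : E -> R^o) ->
  exists z, forall x, l x = dot x z.
Proof.
move=> bl; have [l0|] := pselect (forall x, l x = 0).
  by exists 0 => x; rewrite l0 dot0r.
move=> /existsNP[x0 /eqP lx0].
pose C := [set x | l x = 1].
have [|||x Cx hx] := @min_norm_exists _ _ C.
- by exists ((l x0)^-1 *: x0); rewrite /C/= (bopZ bl) /GRing.scale/= mulVf.
- by apply: (@closed_comp _ _ (l : E -> R^o) [set 1]) => [x _|]; [exact: bl.2|exact: closed_eq].
- by move=> y z; rewrite /C/= => hy hz; rewrite (bopZ bl) (bopD bl) hy hz /GRing.scale/=; field.
have xn : `|x| ^+ 2 != 0.
  rewrite sqrf_eq0 normr_eq0; apply/eqP => x00; move: Cx; rewrite /C/= x00 (bop0 bl) => /esym/eqP.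
  by rewrite oner_eq0.
have orth v : l v = 0 -> dot x v = 0.
  move=> lv; apply: (min_norm_orth Cx hx) => t.
  by rewrite /C/= (bopD bl) (bopZ bl) lv scaler0 addr0.
exists ((`|x| ^+ 2)^-1 *: x) => y.
have := orth (y - l y *: x); rewrite (bopB bl) (bopZ bl) Cx /GRing.scale/= mulr1 subrr => /(_ erefl).
rewrite dotBr dotZr dotxx => /eqP; rewrite subr_eq0 => /eqP h.
by rewrite dotZr dotC h; field; rewrite -sqrf_eq0.
Qed.

(** The shortest vector [w] of [z] minus the closed range is orthogonal to the range, so [q w = 0]
    by symmetry. Then [z] is orthogonal to [w], and since [z - w] is a limit of values of [q], also
    [dot w w = 0]. *)
Lemma orth_ker_closure_range (q : E -> E) z : bounded_operator q ->
  (forall x y, dot (q x) y = dot x (q y)) ->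
  (forall x, q x = 0 -> dot z x = 0) ->
  forall e, 0 < e -> exists y, `|q y - z| < e.
Proof.
move=> bq sq zq e e0.
pose C := [set z - v | v in closure (range q)].
have CE x : C x <-> closure (range q) (z - x).
  split=> [[v cv <-]|h]; first by rewrite subKr.
  by exists (z - x) => //; rewrite subKr.
have Ve x : closure (range q) x <-> (forall e, 0 < e -> exists y, `|q y - x| < e).
  split=> [cx d d0|h B].
    have [_ [[y _ <-]]] := cx _ (nbhsx_ballx x d d0).
    by rewrite -ball_normE /ball_/= distrC; exists y.
  move=> /nbhs_ballP[d /= d0 dB]; have [y hy] := h _ d0.
  by exists (q y); split; [exists y|apply: dB; rewrite -ball_normE /ball_/= distrC].
have [||x1 x2 /CE/Ve h1 /CE/Ve h2|w /CE/Ve Cw hw] := @min_norm_exists _ _ C.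
- exists z, 0; last by rewrite subr0.
  by apply: subset_closure; exists 0 => //; rewrite (bop0 bq).
- rewrite (_ : C = (fun x => z - x) @^-1` (closure (range q))); last first.
    by apply/seteqP; split => x /CE.
  apply: closed_comp; last exact: closed_closure.
  by move=> x _; apply: cvgB; [exact: cvg_cst|exact: cvg_id].
- apply/CE/Ve => d d0; have [y1 hy1] := h1 _ d0; have [y2 hy2] := h2 _ d0.
  exists (2^-1 *: (y1 + y2)); rewrite (bopZ bq) (bopD bq).
  rewrite (_ : _ - _ = 2^-1 *: ((q y1 - (z - x1)) + (q y2 - (z - x2)))); last by hfield.
  rewrite normrZ ger0_norm// (le_lt_trans (ler_wpM2l _ (ler_normD _ _)))//.
  lra.
have qw0 : q w = 0.
  apply: dot_ext => y; rewrite dot0l sq; apply: (@min_norm_orth _ _ C) => //; first by apply/CE/Ve.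
  move=> t; apply/CE/Ve => d d0; have [y1 hy1] := Cw _ d0.
  exists (y1 - t *: y); rewrite (bopB bq) (bopZ bq).
  by rewrite (_ : _ - _ = q y1 - (z - w))//; hring.
have zw := zq _ qw0.
have w0 : w = 0.
  apply/eqP; rewrite -normr_eq0 eq_le normr_ge0 andbT; apply/ler_addgt0Pl => d d0; rewrite addr0.
  have [y1 hy1] := Cw _ d0.
  apply: norm_le_dot; first exact: ltW.
  have -> : dot w w = dot (q y1 - (z - w)) w by rewrite !dotBl sq qw0 dot0r zw; ring.
  by apply: le_trans (dot_ler _ _) _; rewrite ler_wpM2r// ltW.
by move: Cw; rewrite w0 subr0; exact.
Qed.

End Riesz.

Lemma adjointP (E F : hilbertType R) (f : E -> F) : bounded_operator f ->
  forall x y, dot (f x) y = dot x (adjoint f y).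
Proof.
move=> bf x y; rewrite /adjoint; case: xgetP => [z _ h|h]; first exact: h.
exfalso; have [C C0 hC] := bop_bound bf.
have [|z hz] := @riesz E (fun x => dot (f x) y).
  apply: (@bopP _ _ _ (C * `|y|)) => [a u v|u]; first by rewrite bf.1 dotDZl.
  by apply: le_trans (dot_le _ _) _; rewrite mulrAC ler_wpM2r.
exact: (h z hz).
Qed.

Lemma adjoint_le (E F : hilbertType R) (f : E -> F) C : bounded_operator f -> 0 <= C ->
  (forall x, `|f x| <= C * `|x|) -> forall y, `|adjoint f y| <= C * `|y|.
Proof.
move=> bf C0 hC y; apply: norm_le_dot; first by rewrite mulr_ge0.
rewrite -adjointP//; apply: le_trans (dot_ler _ _) _.
by rewrite mulrAC ler_wpM2r.
Qed.

(** The preimage of minimal norm is orthogonal to the kernel, so on the range of [q] the operator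
    [xget] does not fall back on its default value 0. *)
Lemma pseudo_inverseP (E F : hilbertType R) (q : E -> F) y : bounded_operator q -> range q y ->
  q (pseudo_inverse q y) = y /\ forall z, q z = 0 -> dot (pseudo_inverse q y) z = 0.
Proof.
move=> bq [x0 _ qx0]; rewrite /pseudo_inverse; case: xgetP => [z _ //|h]; exfalso.
pose C := [set x | q x = y].
have [||x1 x2|x Cx hx] := @min_norm_exists _ _ C.
- by exists x0.
- by apply: (@closed_comp _ _ q [set y]) => [x _|]; [exact: bq.2|exact: (accessible_closed_set1 (hausdorff_accessible (@norm_hausdorff _ F)))].
- rewrite /C/= => q1 q2; by rewrite (bopZ bq) (bopD bq) q1 q2; hfield.
apply: (h x); split => // z qz; apply: (min_norm_orth Cx hx) => t.
by rewrite /C/= (bopD bq) (bopZ bq) qz scaler0 addr0.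
Qed.

End BoundedOperators.

(** * Borel maps into separable spaces *)

Section BorelMaps.
Context {R : realType}.

(** The space [E] carries no measurable structure, so measurability is stated through open sets. The
    domain [D] accommodates maps that are only meaningful on a time interval. *)
Definition borel_on d (T : measurableType d) (E : normedModType R) (D : set T) (X : T -> E) :=
  forall O : set E, open O -> measurable (D `&` X @^-1` O).

Lemma dense_seq (E : normedModType R) : separable_space E ->
  exists q : nat -> E, forall x (e : R), 0 < e -> exists i, `|x - q i| < e.
Proof.
move=> [Q [/pfcard_geP[Q0|[q]] dQ]].
  by have [||x []] := dQ setT; rewrite ?Q0 ?inE//; [exists 0|exact: openT].
exists q => x e e0; have [||y [xy Qy]] := dQ (ball x e).
- by exists x; exact: ballxx.
- exact: ball_open.
have [i _ qi] := @surj _ _ _ _ q _ Qy.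
by exists i; rewrite qi; move: xy; rewrite -ball_normE.
Qed.

Lemma borel_open (E : normedModType R) d (T : measurableType d) (D : set T) (X : T -> E) x (e : R) :
  borel_on D X -> measurable (D `&` [set p | `|X p - x| < e]).
Proof.
move=> bX; have [e0|e0] := leP e 0.
  rewrite (_ : [set p | `|X p - x| < e] = set0) ?setI0//.
  by apply/seteqP; split => p //=; rewrite ltNge (le_trans e0).
have -> : [set p | `|X p - x| < e] = X @^-1` (ball x e).
  by apply/seteqP; split => p /=; rewrite -ball_normE /ball_/= distrC.
by apply: bX; exact: ball_open.
Qed.

Section separable.
Context {E : normedModType R} (sepE : separable_space E).
Context d {T : measurableType d} {D : set T} (mD : measurable D).
Implicit Type X : T -> E.

(** The code [c n x] is the least index of a point of a dense sequence within [1 / (n + 1)] of [x].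
    Any Borel map is thus uniformly approximated by maps with countably many values, whose level
    sets are measurable. *)
Lemma borel_code : exists (q : nat -> E) (c : nat -> E -> nat),
  (forall n x, `|x - q (c n x)| < n.+1%:R^-1) /\
  (forall X, borel_on D X -> forall n i, measurable (D `&` [set p | c n (X p) = i])).
Proof.
have [q hq] := dense_seq sepE.
have e0 n : 0 < n.+1%:R^-1 :> R by rewrite invr_gt0.
have hd n x : exists i, `|x - q i| < n.+1%:R^-1 by exact: hq.
exists q, (fun n x => ex_minn (hd n x)); split=> [n x|X bX n i]; first by case: ex_minnP.
rewrite (_ : _ `&` _ = (D `&` [set p | `|X p - q i| < n.+1%:R^-1]) `\`
   \bigcup_(j in [set j | (j < i)%N]) (D `&` [set p | `|X p - q j| < n.+1%:R^-1])).
  apply: measurableD; first exact: borel_open.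
  by apply: bigcup_measurable => j _; exact: borel_open.
apply/seteqP; split => p /=.
  move=> [Dp]; case: ex_minnP => m hm mm <-; split => //.
  by move=> [j /= jm [_ /mm]]; rewrite leqNgt jm.
move=> [[Dp hi] nb]; split => //; case: ex_minnP => m hm mm.
apply/eqP; rewrite eqn_leq mm//= leqNgt; apply/negP => mi.
by apply: nb; exists m.
Qed.

(** On each level set of the code of [X] the second argument is frozen; continuity in that argument
    gives the limit. This replaces measurability on products of [E], which has no sigma-algebra
    here. *)
Lemma measurable_caratheodory X (Psi : T -> E -> R) : borel_on D X ->
  (forall x, measurable_fun D (Psi^~ x)) -> (forall p, D p -> continuous (Psi p)) ->
  measurable_fun D (fun p => Psi p (X p)).
Proof.
move=> bX mPsi cPsi; have [q [c [hc mc]]] := borel_code.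
apply: (@measurable_fun_cvg _ _ _ _ (fun n p => Psi p (q (c n (X p))))) => [n _ B mB|p Dp].
  rewrite (_ : _ `&` _ = \bigcup_i ((D `&` [set p | c n (X p) = i]) `&`
       (D `&` (Psi^~ (q i)) @^-1` B))).
    by apply: bigcup_measurable => i _; apply: measurableI; [exact: mc|exact: mPsi].
  apply/seteqP; split=> p /= [Dp]; first by exists (c n (X p)).
  by move=> _ [[? /= <-] [_ ?]].
have : Psi p x @[x --> X p] --> Psi p (X p) by exact: cPsi.
apply: cvg_comp; apply/cvgrPdist_lt => e e0; near=> n.
apply: lt_trans (hc _ _) _; near: n.
exact: (near_infty_natSinv_lt (PosNum e0)).
Unshelve. all: by end_near. Qed.

Lemma borel_continuous X (f : E -> R) : continuous f -> borel_on D X ->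
  measurable_fun D (f \o X).
Proof. by move=> cf bX; apply: (@measurable_caratheodory X (fun=> f)). Qed.

(** By separability an open set is a countable union of balls, so distances to points decide
    measurability; Borel maps are from here on checked through real functions. *)
Lemma borel_normP X :
  borel_on D X <-> forall x, measurable_fun D (fun p => `|X p - x|).
Proof.
split=> [bX x|h O oO].
  apply: (@borel_continuous X (fun y => `|y - x|)) => // y.
  by apply: cvg_norm; apply: cvgB; [exact: cvg_id|exact: cvg_cst].
have [q hq] := dense_seq sepE.
pose J i n := ball (q i) (n.+1%:R^-1) `<=` O.
rewrite (_ : _ `&` _ = \bigcup_i \bigcup_(n in J i) (D `&` [set p | `|X p - q i| < n.+1%:R^-1])).
  apply: bigcup_measurable => i _; apply: bigcup_measurable => n _.
  have := h (q i) mD _ (measurable_itv `]-oo, (n.+1%:R^-1)[).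
  by congr (measurable _); apply/seteqP; split => p /=; rewrite in_itv.
apply/seteqP; split => p /=; last first.
  move=> [i _ [n Jin [Dp /= hp]]]; split => //; apply: Jin.
  by rewrite -ball_normE /ball_/= distrC.
move=> [Dp Op]; have /nbhs_ballP[e /= e0 eO] := open_nbhs_nbhs (conj oO Op).
have [n hn] : exists n : nat, n.+1%:R^-1 < e / 2.
  exists (Num.truncn (e / 2)^-1); rewrite invf_plt ?posrE ?divr_gt0//.
  exact: truncnS_gt.
have [i hi] := hq (X p) (n.+1%:R^-1) ltac:(by rewrite invr_gt0).
exists i => //; exists n => // y; rewrite -ball_normE /ball_/= => hy; apply: eO.
rewrite -ball_normE /ball_/= (le_lt_trans (ler_distD (q i) _ _))//.
by move: hi hy hn; move: (n.+1%:R^-1 : R) => a; lra.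
Qed.

(** The distance [|y + Y p - x|] is measurable in [p] and continuous in [y], so the sum is a
    Carathéodory function of [X]. *)
Lemma borelD X Y : borel_on D X -> borel_on D Y -> borel_on D (fun p => X p + Y p).
Proof.
move=> bX bY; apply/borel_normP => x.
apply: (@measurable_caratheodory X (fun p y => `|y + Y p - x|)) => // [y|p _ y].
  have /borel_normP/(_ (x - y)) := bY.
  by congr (measurable_fun _ _); apply/funext => p; rewrite opprB addrCA addrA.
by apply: cvg_norm; apply: cvgB; [apply: cvgD; [exact: cvg_id|exact: cvg_cst]|exact: cvg_cst].
Qed.

Lemma borel_scale (a : T -> R) (x : E) :
  measurable_fun D a -> borel_on D (fun p => a p *: x).
Proof.
move=> ma; apply/borel_normP => y.
have cf : continuous (fun t : R => `|t *: x - y|).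
  move=> t; apply: cvg_norm; apply: cvgB; [|exact: cvg_cst].
  by apply: cvgZr_tmp; exact: cvg_id.
by apply: (measurableT_comp (continuous_measurable_fun cf)).
Qed.

Lemma borel_cst (x : E) : borel_on D (fun=> x).
Proof. by apply/borel_normP => y; exact: measurable_cst. Qed.

Lemma borel_sum (I : Type) (r : seq I) (X : I -> T -> E) (P : pred I) :
  (forall i, P i -> borel_on D (X i)) -> borel_on D (fun p => \sum_(i <- r | P i) X i p).
Proof.
move=> bX; elim: r => [|i r IH].
  by under [fun p => _]eq_fun do rewrite big_nil; exact: borel_cst.
have [Pi|/negPf Pi] := boolP (P i); last by under [fun p => _]eq_fun do rewrite big_cons Pi.
by under [fun p => _]eq_fun do rewrite big_cons Pi; apply: borelD => //; exact: bX.
Qed.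

End separable.

Lemma borel_comp (E F : normedModType R) d (T : measurableType d) (D : set T) (X : T -> E)
  (f : E -> F) : continuous f -> borel_on D X -> borel_on D (f \o X).
Proof. by move=> cf bX O oO; apply: (bX (f @^-1` O)); exact: open_comp. Qed.

Lemma borelB (E : normedModType R) (sepE : separable_space E) d (T : measurableType d) (D : set T)
    (mD : measurable D) (X Y : T -> E) :
  borel_on D X -> borel_on D Y -> borel_on D (fun p => X p - Y p).
Proof.
move=> bX bY; apply: borelD => //; apply: (@borel_comp _ _ _ _ _ Y (fun x => - x)) => //.
exact: opp_continuous.
Qed.

End BorelMaps.

(** * Independence, densities and reflections of Lebesgue measure *)

Section Independence.
Context {R : realType} d (Omega : measurableType d) (P : probability Omega R).

(** The law of the pair [(X, Y)] agrees with the product of the laws on rectangles, hence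
    everywhere; Tonelli's theorem then applies. *)
Lemma fubini_indep d1 d2 (T1 : measurableType d1) (T2 : measurableType d2)
    (X : Omega -> T1) (Y : Omega -> T2) (Phi : T1 * T2 -> \bar R) :
  measurable_fun setT X -> measurable_fun setT Y ->
  (forall A B, measurable A -> measurable B ->
     P (X @^-1` A `&` Y @^-1` B) = (P (X @^-1` A) * P (Y @^-1` B))%E) ->
  measurable_fun [set: T1 * T2] Phi -> (forall z, 0 <= Phi z)%E ->
  (\int[P]_w Phi (X w, Y w) = \int[P]_w \int[P]_w' Phi (X w, Y w'))%E.
Proof.
move=> mX mY ind mPhi Phi0.
pose X' : {mfun Omega >-> T1} := HB.pack X (isMeasurableFun.Build _ _ _ _ _ mX).
pose Y' : {mfun Omega >-> T2} := HB.pack Y (isMeasurableFun.Build _ _ _ _ _ mY).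
have mXY : measurable_fun setT (fun w => (X w, Y w)) by exact: measurable_fun_pair.
pose Z : {mfun Omega >-> (T1 * T2)%type} := HB.pack (fun w => (X w, Y w)) (isMeasurableFun.Build _ _ _ _ _ mXY).
rewrite -[LHS]/(\int[P]_w (Phi \o Z) w)%E -ge0_integral_distribution//.
have -> : (\int[distribution P Z]_y Phi y = \int[distribution P X' \x distribution P Y']_y Phi y)%E.
  apply: eq_measure_integral => A mA _; apply/esym.
  apply: product_measure_unique => // B C mB mC.
rewrite fubini_tonelli1// (@ge0_integral_distribution _ _ _ _ _ _ X')//; last 2 first.
- exact: measurable_fun_fubini_tonelli_F.
- by move=> x; apply: integral_ge0.
apply: eq_integral => w _ /=; rewrite /fubini_F.
rewrite (@ge0_integral_distribution _ _ _ _ _ _ Y')//.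
exact: measurableT_comp mPhi (measurable_pair1 _).
Qed.

(** For a fixed [B] in [S], the events independent of [B] form a lambda-system that contains the
    pi-system [G]. *)
Lemma indep2_gen (G S : set (set Omega)) : setI_closed G -> G `<=` measurable ->
  S `<=` measurable -> indep2 P G S -> indep2 P <<s G >> S.
Proof.
move=> GI Gm Sm ind A B; move=> sA SB; have mB := Sm _ SB.
have sm : <<s G >> `<=` measurable by apply: smallest_sub => //; exact: sigma_algebra_measurable.
suff : <<s G >> `<=` [set A | measurable A /\ P (A `&` B) = (P A * P B)%E] by move=> /(_ _ sA)[].
apply: lambda_system_subset => //; last first.
  by move=> C GC; split; [exact: Gm|exact: ind].
apply/dynkin_lambda_system; split => [|C [mC hC]|F tF hF].
- by split=> //; rewrite setTI probability_setT mul1e.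
- split; first exact: measurableC.
  rewrite setIC -[B `&` ~` C]setDE.
  have -> : P (B `\` C) = (P B - P (C `&` B))%E.
    have Boo : (P B < +oo)%E by rewrite (le_lt_trans (probability_le1 P mB))// ltry.
    by rewrite (measureD mB mC Boo) setIC.
  by rewrite hC probability_setC// muleBl ?mul1e//; exact: fin_num_measure.
- split; first by apply: bigcup_measurable => i _; exact: (hF i).1.
  rewrite setI_bigcupl.
  have h1 : P (\bigcup_k (F k `&` B)) = (\sum_(0 <= k <oo) P (F k `&` B))%E.
    rewrite measure_bigcup//; first by apply: eq_eseriesl => i /=; rewrite mem_setT.
      by move=> i _; apply: measurableI => //; exact: (hF i).1.
    by apply: trivIset_setIr.
  rewrite h1 (_ : P (\bigcup_k F k) = (\sum_(0 <= k <oo) P (F k))%E); last first.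
    rewrite measure_bigcup//; first by apply: eq_eseriesl => i /=; rewrite mem_setT.
    by move=> i _; exact: (hF i).1.
  rewrite muleC -(@fineK _ (P B)) ?fin_num_measure// -nneseriesZl//.
  by apply: eq_eseriesr => i _; rewrite (hF i).2 muleC fineK ?fin_num_measure.
Qed.

End Independence.

Section Density.
Context {R : realType} d (T : measurableType d).
Variables (nu mu : {measure set T -> \bar R}) (p : T -> R).
Hypotheses (mp : measurable_fun setT p) (p0 : forall x, 0 <= p x).
Hypothesis nup : forall A, measurable A -> nu A = (\int[mu]_(x in A) (p x)%:E)%E.
Local Open Scope ereal_scope.
Import HBNNSimple.

Lemma ge0_integral_density (g : T -> \bar R) : measurable_fun setT g -> (forall x, 0 <= g x) ->
  \int[nu]_x g x = \int[mu]_x (g x * (p x)%:E).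
Proof.
move=> mg g0; pose g_ := nnsfun_approx measurableT mg.
have g_g x : (g_ n x)%:E @[n --> \oo] --> g x by apply: cvg_nnsfun_approx.
have ndg x m n : (m <= n)%N -> (g_ m x <= g_ n x)%R by move=> mn; exact/lefP/nd_nnsfun_approx.
have mEp : measurable_fun setT (EFin \o p) by exact/measurable_EFinP.
transitivity (limn (fun n => \int[nu]_x (g_ n x)%:E)).
  rewrite -monotone_convergence//.
  - by apply: eq_integral => x _; apply/esym/cvg_lim => //; exact: g_g.
  - by move=> n; exact/measurable_EFinP/measurable_funP.
  - by move=> n x _; rewrite lee_fin.
  - by move=> x _ m n mn; rewrite lee_fin ndg.
transitivity (limn (fun n => \int[mu]_x ((g_ n x)%:E * (p x)%:E))); last first.
  rewrite -monotone_convergence//.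
  - apply: eq_integral => x _; apply/cvg_lim => //.
    by apply: cvgeZr => //; exact: g_g.
  - by move=> n; apply: emeasurable_funM => //; exact/measurable_EFinP/measurable_funP.
  - by move=> n x _; rewrite mule_ge0// lee_fin.
  - by move=> x _ m n mn; rewrite lee_wpmul2r// lee_fin// ndg.
congr (limn _); apply/funext => n.
have mA k : measurable (g_ n @^-1` [set k]) by rewrite -[X in measurable X]setTI; exact: measurable_funP.
under eq_integral do rewrite fimfunE -fsumEFin//.
rewrite ge0_integral_fsum//; last 2 first.
- by move=> y; exact/measurable_EFinP/measurable_funM.
- by move=> y x _; rewrite nnfun_muleindic_ge0.
transitivity (\int[mu]_x \sum_(k \in range (g_ n)) ((k * \1_(g_ n @^-1` [set k]) x)%:E * (p x)%:E)).
  rewrite ge0_integral_fsum//; last 2 first.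
  - move=> y; apply: emeasurable_funM => //.
    by apply/measurable_EFinP/measurable_funM.
  - by move=> y x _; rewrite mule_ge0 ?nnfun_muleindic_ge0 ?lee_fin.
  apply: eq_fsbigr => k /set_mem [w _ kw].
  have k0 : (0 <= k)%R by rewrite -kw.
  rewrite integralZl_indic_nnsfun// integral_indic// setIT nup//.
  rewrite [in LHS]integral_mkcond -ge0_integralZl//; last 2 first.
  - by apply/(measurable_restrictT _ _).1 => //; exact: measurable_funTS.
  - by move=> x _; rewrite patchE; case: ifP => // _; rewrite lee_fin.
  apply: eq_integral => x _; rewrite patchE indicE; case: ifPn => _ /=.
    by rewrite mulr1.
  by rewrite mulr0 mul0e mule0.
apply: eq_integral => x _; rewrite [in RHS]fimfunE -fsumEFin//.
rewrite !fsbig_finite//= ge0_sume_distrl// => k _; exact: nnfun_muleindic_ge0.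
Qed.

End Density.

Section LebesgueReflection.
Context {R : realType}.
Notation mu := (@lebesgue_measure R).
Local Open Scope ereal_scope.

(** Lebesgue measure is determined by the lengths of the intervals []a, b]]. Reflection turns such
    an interval into [[c - b, c - a[], which has the same length although the closed end has changed
    sides. *)
Lemma ge0_integral_reflect (g : R -> \bar R) (c : R) : measurable_fun setT g ->
  (forall x, 0 <= g x) -> \int[mu]_x g (c - x)%R = \int[mu]_x g x.
Proof.
move=> mg g0; have mphi : measurable_fun setT (fun x : R => (c - x)%R : measurableTypeR R).
  by apply: measurable_funB => //; exact: measurable_cst.
transitivity (\int[pushforward mu (fun x : R => (c - x)%R : measurableTypeR R)]_x g x).
  by rewrite ge0_integral_pushforward.
apply: eq_measure_integral => A mA _; apply/esym.
apply: lebesgue_measure_unique => // _ [[a b]] _ <-.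
transitivity (mu `[(c - b)%R, (c - a)%R[%classic).
  rewrite !lebesgue_measure_itv/= !lte_fin ltrD2l ltrN2; case: ifP => // _.
  by rewrite -!EFinB; congr EFin; lra.
rewrite -[RHS]/(mu ((fun x : R => (c - x)%R) @^-1` `]a, b]%classic)); congr (mu _).
by apply/seteqP; split => x /=; rewrite !in_itv/=; lra.
Qed.

(** A translation is the composition of two reflections. *)
Lemma ge0_integral_translate (g : R -> \bar R) (c : R) : measurable_fun setT g ->
  (forall x, 0 <= g x) -> \int[mu]_x g (x + c)%R = \int[mu]_x g x.
Proof.
move=> mg g0; rewrite -(@ge0_integral_reflect g c)//.
rewrite -(@ge0_integral_reflect (fun x => g (c - x)%R) 0%R)//.
- by apply: eq_integral => x _; congr g; ring.
- apply: measurableT_comp => //; apply: measurable_funB => //; exact: measurable_cst.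
Qed.

End LebesgueReflection.

(** * Gaussian shifts *)

Section NormalLaw.
Context {R : realType}.
Variable v : R.
Hypothesis v0 : 0 < v.
Local Notation N := (normal_prob 0 (Num.sqrt v)).
Local Open Scope ereal_scope.

(** The density of the normal law [N(a, v)] with respect to [N(0, v)]. *)
Definition gauss_density (a x : R) : R := expR (a * x / v - a ^+ 2 / (2 * v))%R.

Lemma measurable_gauss_density a : measurable_fun setT (gauss_density a).
Proof.
apply: measurableT_comp => //; apply: measurable_funB => //; apply: measurable_funM => //.
Qed.

Lemma normal_integralE (g : R -> \bar R) : measurable_fun setT g -> (forall x, 0 <= g x) ->
  \int[N]_x g x = \int[lebesgue_measure]_x (g x * (normal_pdf 0 (Num.sqrt v) x)%:E).
Proof.
move=> mg g0; apply: ge0_integral_density => //; first exact: measurable_normal_pdf.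
by move=> x; exact: normal_pdf_ge0.
Qed.

(** The Cameron-Martin formula in dimension one: translate the Lebesgue integral by [a], then
    complete the square in the exponent. *)
Lemma normal_shift (g : R -> \bar R) a : measurable_fun setT g -> (forall x, 0 <= g x) ->
  \int[N]_x g (x + a)%R = \int[N]_x (g x * (gauss_density a x)%:E).
Proof.
move=> mg g0; have ma : measurable_fun setT (fun x : R => x + a)%R by apply: measurable_funD.
have md := measurable_gauss_density a.
rewrite !normal_integralE//; last 3 first.
- by apply: emeasurable_funM => //; exact/measurable_EFinP.
- by move=> x; rewrite mule_ge0// lee_fin expR_ge0.
- exact: measurableT_comp.
rewrite -[RHS](@ge0_integral_translate _ _ a); last 2 first.
- apply: emeasurable_funM; last by apply/measurable_EFinP; exact: measurable_normal_pdf.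
  by apply: emeasurable_funM => //; exact/measurable_EFinP.
- by move=> x; rewrite !mule_ge0// lee_fin ?expR_ge0 ?normal_pdf_ge0.
apply: eq_integral => x _; rewrite -muleA -EFinM; congr (_ * _%:E)%E.
have s0 : (Num.sqrt v != 0)%R by rewrite sqrtr_eq0 -ltNge.
rewrite normal_pdfE// /normal_fun mulrCA; congr (_ * _)%R.
rewrite /gauss_density -expRD !sqr_sqrtr ?ltW// !subr0; congr expR.
by field; rewrite gt_eqF.
Qed.

Lemma normal_sym (g : R -> \bar R) : measurable_fun setT g -> (forall x, 0 <= g x) ->
  \int[N]_x g (- x)%R = \int[N]_x g x.
Proof.
move=> mg g0; rewrite !normal_integralE//; last exact: measurableT_comp.
rewrite -[RHS](@ge0_integral_reflect _ _ 0%R); last 2 first.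
- by apply: emeasurable_funM => //; apply/measurable_EFinP; exact: measurable_normal_pdf.
- by move=> x; rewrite mule_ge0// lee_fin normal_pdf_ge0.
apply: eq_integral => x _; rewrite sub0r; congr (_ * _%:E)%E.
have s0 : (Num.sqrt v != 0)%R by rewrite sqrtr_eq0 -ltNge.
by rewrite normal_pdfE// /normal_fun !subr0 sqrrN.
Qed.

Lemma normal_density1 a : \int[N]_x (gauss_density a x)%:E = 1.
Proof.
transitivity (\int[N]_x (cst 1 x * (gauss_density a x)%:E)).
  by apply: eq_integral => x _; rewrite mul1e.
rewrite -(@normal_shift (cst 1))//.
have -> : \int[N]_x cst 1 (x + a)%R = \int[N]_x cst 1 x by [].
by rewrite integral_cst// mul1e; exact: probability_setT.
Qed.

(** A crude substitute for the exact constant 1 in the second moment of [N(0, v)]. Its effect is to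
    weaken the Itô isometry to an upper bound. *)
Definition gauss_const : R := (8 * expR 2^-1)%R.

(* [t ^ 2 / 4 <= expR t + expR (- t)], and these exponentials are multiples of Gaussian densities. *)
Lemma normal_moment2 : \int[N]_x (x ^+ 2)%:E <= (gauss_const * v)%:E.
Proof.
set s := Num.sqrt v; have s2 : (s ^+ 2 = v)%R by rewrite sqr_sqrtr// ltW.
have s0 : (0 < s)%R by rewrite sqrtr_gt0.
pose c := (4 * v * expR 2^-1)%R.
have c0 : (0 <= c)%R by rewrite !mulr_ge0 ?expR_ge0// ltW.
have md a := measurable_gauss_density a.
apply: (@le_trans _ _ (\int[N]_x (c%:E * ((gauss_density s x)%:E + (gauss_density (- s) x)%:E)))).
  apply: ge0_le_integral => //=.
  - by move=> x _; rewrite lee_fin sqr_ge0.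
  - by apply/measurable_EFinP; exact: measurable_funX.
  - apply: emeasurable_funM; first exact: measurable_cst.
    by apply: emeasurable_funD; apply/measurable_EFinP; exact: md.
  move=> x _; rewrite lee_fin.
  have dE (b : R) : (b ^+ 2 = v)%R -> (expR 2^-1 * gauss_density b x = expR (b * x / v))%R.
    by move=> b2; rewrite /gauss_density -expRD b2; congr expR; field; rewrite gt_eqF.
  rewrite /c -!mulrA (mulrDr (expR _)) !dE ?sqrrN// mulrA.
  have key (t : R) : (t ^+ 2 <= 4 * (expR t + expR (- t)))%R.
    wlog t0 : t / (0 <= t)%R.
      move=> h; have [/h//|t0] := leP 0%R t.
      by have := h (- t)%R; rewrite sqrrN opprK addrC; apply; rewrite oppr_ge0 ltW.
    have h1 : (1 + t / 2 <= expR (t / 2))%R by exact: expR_ge1Dx.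
    have h2 : ((t / 2) ^+ 2 <= expR (t / 2) ^+ 2)%R.
      by rewrite ler_sqr ?nnegrE ?expR_ge0 ?divr_ge0//; lra.
    rewrite -expRM_natl in h2; have : expR (2 * (t / 2))%R = expR t by congr expR; field.
    have := expR_gt0 (- t)%R; move: h2; rewrite exprMn; move: (expR (- t)%R) => u; move=> + ? <-; lra.
  have := key (s * x / v)%R; have -> : ((s * x / v) ^+ 2 = x ^+ 2 / v)%R.
    by rewrite !exprMn s2; field; rewrite gt_eqF.
  rewrite ler_pdivrMr// => h; rewrite (le_trans h)// !mulNr.
  by rewrite mulrAC.
rewrite ge0_integralZl//; last 2 first.
- by apply: emeasurable_funD; apply/measurable_EFinP; exact: md.
- by move=> x _; rewrite adde_ge0// lee_fin expR_ge0.
rewrite ge0_integralD//; last 4 first.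
- by move=> x _; rewrite lee_fin expR_ge0.
- by apply/measurable_EFinP; exact: md.
- by move=> x _; rewrite lee_fin expR_ge0.
- by apply/measurable_EFinP; exact: md.
rewrite !normal_density1 -EFinD -EFinM lee_fin /c /gauss_const; lra.
Qed.

End NormalLaw.

Section ProbabilityIntegrals.
Context {R : realType} d (Omega : measurableType d) (P : probability Omega R).

Lemma integrable_bounded (f : Omega -> R) (C : R) : measurable_fun setT f ->
  (forall w, `|f w| <= C) -> P.-integrable setT (EFin \o f).
Proof.
move=> mf fC; apply: (@le_integrable _ _ _ _ _ measurableT _ (cst C%:E)).
- exact/measurable_EFinP.
- by move=> w _ /=; rewrite lee_fin (le_trans (fC w))// ler_norm.
- exact: finite_measure_integrable_cst.
Qed.

Lemma integrable_ge0 (f : Omega -> R) : measurable_fun setT f -> (forall w, 0 <= f w) ->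
  (\int[P]_w (f w)%:E < +oo)%E -> P.-integrable setT (EFin \o f).
Proof.
move=> mf f0 foo; apply/integrableP; split; first exact/measurable_EFinP.
by under eq_integral do rewrite /= ger0_norm//.
Qed.

Lemma Rint_cst (c : R) : \int[P]_w c = c.
Proof. by rewrite Rintegral_cst// [X in fine X](probability_setT P) mulr1. Qed.

Lemma Rint_le_bound (f : Omega -> R) (C : R) : measurable_fun setT f ->
  (forall w, `|f w| <= C) -> `|\int[P]_w f w| <= C.
Proof.
move=> mf fC; have ifn := integrable_bounded mf fC.
apply: le_trans (le_normr_Rintegral _ ifn) _ => //.
rewrite -[leRHS]Rint_cst; apply: le_Rintegral => //.
- by apply: (@integrable_bounded _ C) => [|w]; rewrite ?normr_id//; exact: measurableT_comp.
- exact: finite_measure_integrable_cst.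
Qed.

End ProbabilityIntegrals.

Section GaussianFamily.
Context {R : realType} d (Omega : measurableType d) (P : probability Omega R).
Context (I : choiceType) (xi : I -> Omega -> R) (v : I -> R).
Implicit Type L : seq I.

Definition gaussian_family L :=
  [/\ uniq L,
      forall i, i \in L -> measurable_fun setT (xi i),
      forall i, i \in L -> 0 < v i /\ forall C, measurable C ->
        P (xi i @^-1` C) = normal_prob 0 (Num.sqrt (v i)) C &
      forall C : I -> set R, (forall i, measurable (C i)) ->
        P [set w | forall i, i \in L -> C i (xi i w)] = (\prod_(i <- L) P (xi i @^-1` C i))%E].

(** These rectangles form a pi-system. The sample space with the sigma-algebra that they generate,
    [cylT L], plays the part of the space of values of the variables in [L], without any power of
    [R]. *)
Definition cylinders L : set (set Omega) :=
  [set A | exists C : I -> set R, (forall i, measurable (C i)) /\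
     A = [set w | forall i, i \in L -> C i (xi i w)]].

Local Notation cylT L := (g_sigma_algebraType (cylinders L)).

Lemma measurable_xi_cyl L i : i \in L -> measurable_fun setT (xi i : cylT L -> R).
Proof.
move=> iL _ B mB; rewrite setTI; apply: sub_sigma_algebra.
exists (fun j => if j == i then B else setT); split=> [j|]; first by case: ifP.
apply/seteqP; split => w /=; first by move=> h j _; case: eqP => // ->.
by move=> /(_ i iL); rewrite eqxx.
Qed.

Lemma gf_tail i L : gaussian_family (i :: L) -> gaussian_family L.
Proof.
move=> [/= /andP[iL uL] mx nx ind]; split => //.
- by move=> j jL; apply: mx; rewrite inE jL orbT.
- by move=> j jL; apply: nx; rewrite inE jL orbT.
move=> C mC; pose C' j := if j == i then setT else C j.
have mC' j : measurable (C' j) by rewrite /C'; case: ifP.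
have := ind C' mC'; rewrite big_cons {2}/C' eqxx preimage_setT probability_setT mul1e.
have C'E j : j \in L -> C' j = C j.
  by move=> jL; rewrite /C'; case: eqP => // ji; rewrite ji (negPf iL) in jL.
rewrite (eq_big_seq (fun j => P (xi j @^-1` C j))); last by move=> j /C'E ->.
move=> <-; congr (P _); apply/seteqP; split => w /= h j.
  by rewrite inE => /predU1P[->|jL]; [rewrite /C' eqxx|rewrite C'E//; exact: h].
by move=> jL; have := h j; rewrite inE jL orbT C'E//; exact.
Qed.

Lemma cylinders_measurable L : (forall i, i \in L -> measurable_fun setT (xi i)) ->
  cylinders L `<=` measurable.
Proof.
move=> mx A [C [mC ->]].
rewrite (_ : [set w | _] = \bigcap_(i in [set` L]) (xi i @^-1` C i)); last first.
  by apply/seteqP; split => w /= h i; exact: h.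
apply: fin_bigcap_measurable => // i iL.
by rewrite -[X in measurable X]setTI; exact: mx.
Qed.

(** The head variable is independent of the sigma-algebra of the tail, so it can be integrated
    separately against its normal law. The function [Phi] sees the tail through the sample point
    itself. *)
Lemma gf_fubini i L (Phi : R * cylT L -> \bar R) : gaussian_family (i :: L) ->
  measurable_fun [set: R * cylT L] Phi -> (forall z, 0 <= Phi z)%E ->
  measurable_fun setT (fun z : R => \int[P]_w Phi (z, w))%E /\
  (\int[P]_w Phi (xi i w, w) =
   \int[normal_prob 0 (Num.sqrt (v i))]_z \int[P]_w Phi (z, w))%E.
Proof.
move=> gf mPhi Phi0; have [/= /andP[iL uL] mx nx ind] := gf.
have mxi : measurable_fun setT (xi i) by apply: mx; rewrite inE eqxx.
have cylm : cylinders L `<=` measurable.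
  by apply: cylinders_measurable => j jL; apply: mx; rewrite inE jL orbT.
have mid : measurable_fun setT (id : Omega -> cylT L).
  move=> _ B mB; rewrite setTI preimage_id; move: B mB.
  by apply: smallest_sub => //; exact: sigma_algebra_measurable.
have mF : measurable_fun setT (fun z : R => \int[P]_w Phi (z, w))%E.
  pose Phi' : R * Omega -> \bar R := fun z => Phi (z.1, (z.2 : cylT L)).
  apply: (@measurable_fun_fubini_tonelli_F _ _ _ _ R P Phi') => //.
  apply: (measurableT_comp mPhi); apply: measurable_fun_pair => //.
    exact: (measurableT_comp mid measurable_snd).
  by move=> p; exact: Phi0.
split => //.
rewrite (@fubini_indep _ _ _ P _ _ _ (cylT L) (xi i) id Phi)//; last first.
  move=> A B mA mB; rewrite preimage_id setIC muleC.
  have ind2 : indep2 P (cylinders L) [set xi i @^-1` C | C in measurable].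
    move=> _ _ [C [mC ->]] [D mD <-].
    pose C' j := if j == i then D else C j.
    have C'E j : j \in L -> C' j = C j.
      by move=> jL; rewrite /C'; case: eqP => // ji; rewrite ji (negPf iL) in jL.
    have -> : [set w | forall i0, i0 \in L -> C i0 (xi i0 w)] `&` xi i @^-1` D =
        [set w | forall j, j \in i :: L -> C' j (xi j w)].
      apply/seteqP; split => w /=.
        move=> [h1 h2] j; rewrite inE => /predU1P[->|jL]; first by rewrite /C' eqxx.
        by rewrite C'E//; exact: h1.
      move=> h; split=> [j jL|]; first by have := h j; rewrite inE jL orbT C'E//; exact.
      by have := h i; rewrite inE eqxx /C' eqxx; exact.
    rewrite ind; last by move=> j; rewrite /C'; case: ifP.
    rewrite big_cons {1}/C' eqxx muleC; congr (_ * _)%E.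
    have [_ _ _ ->//] := gf_tail gf.
    by apply: eq_big_seq => j jL; rewrite C'E.
  apply: (@indep2_gen _ _ _ P _ _ _ _ _ ind2) => //; last by exists A.
    move=> _ _ [C [mC ->]] [D [mD ->]]; exists (fun j => C j `&` D j); split.
      by move=> j; exact: measurableI.
    apply/seteqP; split => w /=; first by move=> [h1 h2] j jL; split; [exact: h1|exact: h2].
    by move=> h; split => j /h[].
  by move=> _ [C mC <-]; rewrite -[X in measurable X]setTI; exact: mxi.
have mxi' : measurable_fun setT (xi i : Omega -> measurableTypeR R) := mxi.
pose X' : {mfun Omega >-> measurableTypeR R} := HB.pack (xi i : Omega -> measurableTypeR R) (isMeasurableFun.Build _ _ _ _ _ mxi').
pose F (z : measurableTypeR R) := (\int[P]_w' Phi (z, w'))%E.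
rewrite -[LHS]/(\int[P]_w (F \o X') w)%E.
rewrite -ge0_integral_distribution//; last by move=> z; apply: integral_ge0.
apply: eq_measure_integral => A mA _.
by have [_ hN] := nx i ltac:(by rewrite inE eqxx); exact: (hN A mA).
Qed.

Section sums.
Context {E : normedModType R} (sepE : separable_space E).
Variables (h : I -> E) (a : I -> R).

(** The Cameron-Martin density of the family shifted by [a]: by independence, a product of
    one-dimensional densities. *)
Definition gauss_weight L (w : Omega) : R := \prod_(i <- L) gauss_density (v i) (a i) (xi i w).

Lemma gauss_weight_ge0 L w : 0 <= gauss_weight L w.
Proof. by apply: prodr_ge0 => i _; exact: expR_ge0. Qed.

Lemma measurable_gauss_weight d' (T : measurableType d') (xi' : I -> T -> R) L :
  (forall i, i \in L -> measurable_fun setT (xi' i)) ->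
  measurable_fun setT (fun w => \prod_(i <- L) gauss_density (v i) (a i) (xi' i w)).
Proof.
elim: L => [|i L IH] mx; first by under eq_fun do rewrite big_nil; exact: measurable_cst.
under eq_fun do rewrite big_cons; apply: measurable_funM.
  apply: (measurableT_comp (measurable_gauss_density _ _)); apply: mx.
  by rewrite inE eqxx.
by apply: IH => j jL; apply: mx; rewrite inE jL orbT.
Qed.

Lemma borel_gauss_sum d' (T : measurableType d') (xi' : I -> T -> R) L :
  (forall i, i \in L -> measurable_fun setT (xi' i)) ->
  borel_on setT (fun w => \sum_(i <- L) xi' i w *: h i).
Proof.
move=> mx; under eq_fun do rewrite big_seq_cond.
by apply: borel_sum => // i /andP[iL _]; apply: borel_scale => //; exact: mx.
Qed.

(** The Cameron-Martin formula for finitely many variables, by induction on the list: [gf_fubini]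
    isolates the head and [normal_shift] treats it. The free offset [x] absorbs the contribution of
    the head when the induction hypothesis is applied to the tail. *)
Lemma gf_shift L (f : E -> R) x : gaussian_family L -> continuous f -> (forall y, 0 <= f y) ->
  (\int[P]_w (f (x + \sum_(i <- L) (xi i w + a i) *: h i))%:E =
   \int[P]_w (f (x + \sum_(i <- L) xi i w *: h i) * gauss_weight L w)%:E)%E.
Proof.
move=> + cf f0; elim: L x => [|i L IH] x gf.
  by apply: eq_integral => w _; rewrite /gauss_weight !big_nil mulr1.
have [_ mx nx _] := gf; have [vi _] := nx i ltac:(by rewrite inE eqxx).
have mxL : forall j, j \in L -> measurable_fun setT (xi j : cylT L -> R) by move=> j; exact: measurable_xi_cyl.
have mS c (k : R -> E) (hk : borel_on setT (fun p : R * cylT L => k (p.1))) :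
    measurable_fun [set: R * cylT L] (fun p : R * cylT L => f (k p.1 + \sum_(i <- L) (xi i p.2 + c i) *: h i)).
  apply: (@borel_continuous _ _ sepE _ _ _ measurableT (fun p : R * cylT L => _) f) => //.
  apply: borelD => //.
  apply: (@borel_gauss_sum _ (R * cylT L)%type (fun i p => xi i p.2 + c i) L) => j jL.
  apply: measurable_funD; last exact: measurable_cst.
  exact: (measurableT_comp (mxL j jL)).
have bk b : borel_on setT (fun p : R * cylT L => x + (p.1 + b) *: h i).
  apply: borelD => //; first exact: borel_cst.
  by apply: borel_scale => //; apply: measurable_funD => //; exact: measurable_cst.
pose Phi1 (p : R * cylT L) := (f ((x + (p.1 + a i) *: h i) + \sum_(i <- L) (xi i p.2 + a i) *: h i))%:E.
pose Psi (p : R * cylT L) := (f ((x + p.1 *: h i) + \sum_(i <- L) xi i p.2 *: h i) * gauss_weight L p.2)%:E.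
have mPhi1 : measurable_fun setT Phi1.
  by apply/measurable_EFinP; exact: (mS a (fun z => x + (z + a i) *: h i) (bk _)).
have mW : measurable_fun setT (fun p : R * cylT L => gauss_weight L p.2).
  by apply: (@measurable_gauss_weight _ (R * cylT L)%type (fun i p => xi i p.2) L) => j jL; exact: (measurableT_comp (mxL j jL)).
have mPsi : measurable_fun setT Psi.
  apply/measurable_EFinP; apply: measurable_funM => //.
  have := @mS (fun=> 0) (fun z => x + (z + 0) *: h i) (bk 0).
  congr measurable_fun; apply/funext => p /=; rewrite addr0; congr (f (_ + _)).
  by apply: eq_bigr => j _; rewrite addr0.
have Psi0 p : (0 <= Psi p)%E by rewrite lee_fin mulr_ge0// gauss_weight_ge0.
transitivity (\int[P]_w Phi1 (xi i w, w))%E.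
  by apply: eq_integral => w _; rewrite /Phi1/= big_cons addrA.
have Phi10 p : (0 <= Phi1 p)%E by rewrite lee_fin.
rewrite (gf_fubini gf mPhi1 Phi10).2.
pose F (z : R) := (\int[P]_w Psi (z, w))%E.
transitivity (\int[normal_prob 0 (Num.sqrt (v i))]_z F (z + a i)%R)%E.
  by apply: eq_integral => z _; rewrite /F /Phi1/= IH//; exact: gf_tail gf.
have [mF _] := gf_fubini gf mPsi Psi0.
rewrite (@normal_shift _ _ vi F)//; last by move=> z; apply: integral_ge0 => w _.
pose Psi2 (p : R * cylT L) := (Psi p * (gauss_density (v i) (a i) p.1)%:E)%E.
transitivity (\int[normal_prob 0 (Num.sqrt (v i))]_z \int[P]_w Psi2 (z, w))%E.
  apply: eq_integral => z _; rewrite /F /Psi2/= ge0_integralZr ?lee_fin ?expR_ge0//=.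
  apply/measurable_EFinP; apply: measurable_funM => //.
    apply: (@borel_continuous _ _ sepE _ _ _ measurableT (fun w => _) f) => //.
    rewrite /=; apply: borelD => //; first exact: borel_cst.
    by apply: borel_gauss_sum => j jL; apply: mx; rewrite inE jL orbT.
  by apply: measurable_gauss_weight => j jL; apply: mx; rewrite inE jL orbT.
have mPsi2 : measurable_fun setT Psi2.
  apply: emeasurable_funM => //; apply/measurable_EFinP.
  by apply: (measurableT_comp (measurable_gauss_density _ _)).
have Psi20 p : (0 <= Psi2 p)%E by rewrite mule_ge0// lee_fin expR_ge0.
rewrite -(gf_fubini gf mPsi2 Psi20).2.
apply: eq_integral => w _; rewrite /Psi2/= -EFinM /gauss_weight !big_cons addrA.
by congr (_%:E); rewrite -mulrA; congr (_ * _); rewrite mulrC.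
Qed.

Lemma integrable_gauss_weight L : gaussian_family L ->
  measurable_fun setT (gauss_weight L) /\ (\int[P]_w (gauss_weight L w)%:E = 1)%E.
Proof.
move=> gf; have [_ mx _ _] := gf; split; first exact: measurable_gauss_weight.
have := @gf_shift L (fun=> 1) 0 gf (fun=> cvg_cst _) (fun=> ler01).
rewrite [LHS](_ : _ = 1%E) => [->|]; first by apply: eq_integral => w _; rewrite mul1r.
by rewrite integral_cst// mul1e; exact: probability_setT.
Qed.

End sums.

(** Squaring doubles the shift, up to a deterministic factor. Since the weight for [2 * a] has mean
    1, that factor is the second moment of the weight for [a]. *)
Lemma gauss_weight_sqr (a : I -> R) L w : (forall i, i \in L -> 0 < v i) ->
  gauss_weight a L w ^+ 2 =
  gauss_weight (fun i => 2 * a i) L w * expR (\sum_(i <- L) a i ^+ 2 / v i).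
Proof.
move=> v0; rewrite /gauss_weight expr2 -big_split/= expR_sum -big_split/=.
apply: eq_big_seq => i /v0 vi; rewrite /gauss_density -!expRD; congr expR.
by field; rewrite gt_eqF.
Qed.

Section TotalVariation.
Context {E : normedModType R} (sepE : separable_space E).
Variables (h : I -> E) (a : I -> R).

(* The likelihood ratio [gauss_weight] has mean [1] and second moment [exp (\sum a ^ 2 / v)]. *)
Lemma gf_total_variation L (f : E -> R) (C s : R) : gaussian_family L -> continuous f ->
  (forall x, `|f x| <= C) -> 0 < s -> \sum_(i <- L) a i ^+ 2 / v i <= s ^+ 2 ->
  `|\int[P]_w f (\sum_(i <- L) (xi i w + a i) *: h i) - \int[P]_w f (\sum_(i <- L) xi i w *: h i)|
     <= 4 * C * s.
Proof.
move=> gf cf fC s0 as2; have C0 : 0 <= C by exact: le_trans (fC 0).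
have [_ mx nx _] := gf.
have mf1 : measurable_fun setT (fun w => f (\sum_(i <- L) (xi i w + a i) *: h i)).
  apply: (@borel_continuous _ _ sepE _ _ _ measurableT _ f) => //.
  apply: (@borel_gauss_sum _ sepE h _ _ (fun i w => xi i w + a i)) => i iL.
  by apply: measurable_funD; [exact: mx|exact: measurable_cst].
have mf2 : measurable_fun setT (fun w => f (\sum_(i <- L) xi i w *: h i)).
  apply: (@borel_continuous _ _ sepE _ _ _ measurableT _ f) => //.
  by apply: (@borel_gauss_sum _ sepE h).
have if1 := integrable_bounded P mf1 (fun w => fC _).
have if2 := integrable_bounded P mf2 (fun w => fC _).
(* For [s >= 1 / 2] the trivial bound [2 * C] is at most [4 * C * s]. Below 1/2, the exponential of
   [s^2] is at most [1 + 2 * s^2]. *)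
have [s2|s2] := leP 2^-1 s.
  apply: le_trans (ler_normB _ _) _.
  have h1 := Rint_le_bound P mf1 (fun w => fC _).
  have h2 := Rint_le_bound P mf2 (fun w => fC _).
  apply: le_trans (lerD h1 h2) _; rewrite -mulrA mulrCA.
  have : C * 2 <= C * (4 * s) by rewrite ler_wpM2l//; lra.
  by lra.
pose La := gauss_weight a L.
have [mW iW] := integrable_gauss_weight sepE h a gf.
have W0 w : 0 <= La w by exact: gauss_weight_ge0.
have iLa : P.-integrable setT (EFin \o La) by apply: integrable_ge0 => //; rewrite iW ltry.
have RLa : \int[P]_w La w = 1 by rewrite /Rintegral iW.
pose K := expR (\sum_(i <- L) a i ^+ 2 / v i).
have La2 w : La w ^+ 2 = gauss_weight (fun i => 2 * a i) L w * K.
  by apply: gauss_weight_sqr => i /nx[].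
have [mW2 iW2] := integrable_gauss_weight sepE h (fun i => 2 * a i) gf.
have iLa2 : P.-integrable setT (EFin \o (fun w => La w ^+ 2)).
  under [X in EFin \o X]eq_fun do rewrite La2.
  under [X in _.-integrable _ X]eq_fun do rewrite /= EFinM.
  apply: integrableZr => //; apply: integrable_ge0 => //; last by rewrite iW2 ltry.
  by move=> w; exact: gauss_weight_ge0.
have RLa2 : \int[P]_w La w ^+ 2 = K.
  under eq_Rintegral do rewrite La2.
  rewrite RintegralZr//; first by rewrite /Rintegral iW2 mul1r.
  by apply: integrable_ge0 => // [w|]; [exact: gauss_weight_ge0|rewrite iW2 ltry].
have K1 : K <= 1 + 2 * s ^+ 2.
  have s14 : s ^+ 2 <= 4^-1.
    have -> : 4^-1 = 2^-1 ^+ 2 :> R by field.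
    by rewrite ler_sqr ?nnegrE ?ltW.
  apply: (@le_trans _ _ (expR (s ^+ 2))); first by rewrite ler_expR.
  have h1 : 1 - s ^+ 2 <= expR (- s ^+ 2) by exact: expR_ge1Dx.
  rewrite -[leLHS]invrK -expRN; apply: (@le_trans _ _ (1 - s ^+ 2)^-1).
    by rewrite lef_pV2// posrE ?expR_gt0//; lra.
  rewrite invf_ple ?posrE; [|lra|]; last by have := sqr_ge0 s; lra.
  rewrite -[leLHS]mul1r ler_pdivrMr; last by have := sqr_ge0 s; lra.
  by have := sqr_ge0 s; nra.
have mfL : measurable_fun setT (fun w => f (\sum_(i <- L) xi i w *: h i) * La w) by exact: measurable_funM.
have ifL : P.-integrable setT (EFin \o (fun w => f (\sum_(i <- L) xi i w *: h i) * La w)).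
  apply: (@le_integrable _ _ _ _ _ measurableT _ (fun w => (C * La w)%:E)).
  - exact/measurable_EFinP.
  - move=> w _ /=; rewrite lee_fin normrM (ger0_norm (W0 w)) (ger0_norm (mulr_ge0 C0 (W0 w))).
    by rewrite ler_wpM2r.
  - by under [X in _.-integrable _ X]eq_fun do rewrite EFinM; exact: integrableZl.
have iCL : P.-integrable setT (EFin \o (fun w => C * La w)).
  by under [X in _.-integrable _ X]eq_fun do rewrite /= EFinM; exact: integrableZl.
(* The shift formula is for nonnegative functions: it is applied to [f + C], and the constant
   cancels because the weight has mean 1. *)
have main : \int[P]_w f (\sum_(i <- L) (xi i w + a i) *: h i) = \int[P]_w (f (\sum_(i <- L) xi i w *: h i) * La w).
  have := @gf_shift _ sepE h a L (fun x => f x + C) 0 gf.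
  have cfC : continuous (fun x => f x + C) by move=> x; apply: cvgD; [exact: cf|exact: cvg_cst].
  have fC0 y : 0 <= f y + C by have := fC y; rewrite ler_norml; lra.
  move=> /(_ cfC fC0)/(congr1 fine).
  under eq_integral do rewrite add0r.
  under [in X in _ = X -> _]eq_integral do rewrite add0r.
  rewrite -![fine _]/(Rintegral _ _ _) RintegralD//; last exact: finite_measure_integrable_cst.
  rewrite Rint_cst; under [in X in _ = X -> _]eq_Rintegral do rewrite mulrDl.
  rewrite RintegralD// RintegralZl// RLa mulr1.
  by move=> /addIr.
rewrite main -RintegralB//.
have iB : P.-integrable setT (EFin \o (fun w => f (\sum_(i <- L) xi i w *: h i) * La w - f (\sum_(i <- L) xi i w *: h i))).
  by under [X in _.-integrable _ X]eq_fun do rewrite /= EFinB; exact: integrableB.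
apply: le_trans (le_normr_Rintegral _ iB) _ => //.
(* By Young's inequality [C * |La w - 1|] is at most [C * ((La w - 1)^2 / s + s) / 2], which is
   [G w] expanded. With [K - 1 <= 2 * s^2] its mean is at most [3 / 2 * C * s]. *)
pose G w := C * 2^-1 * s^-1 * (La w ^+ 2) + (C * 2^-1 * s + C * 2^-1 * s^-1) - C * s^-1 * La w.
have i1 : P.-integrable setT (EFin \o (fun w => C * 2^-1 * s^-1 * (La w ^+ 2))).
  by under [X in _.-integrable _ X]eq_fun do rewrite /= EFinM; exact: integrableZl.
have i2 : P.-integrable setT (EFin \o (fun w => C * s^-1 * La w)).
  by under [X in _.-integrable _ X]eq_fun do rewrite /= EFinM; exact: integrableZl.
have i3 : P.-integrable setT (EFin \o (fun w : Omega => C * 2^-1 * s + C * 2^-1 * s^-1)).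
  exact: finite_measure_integrable_cst.
have i4 : P.-integrable setT (EFin \o (fun w => C * 2^-1 * s^-1 * (La w ^+ 2) + (C * 2^-1 * s + C * 2^-1 * s^-1))).
  by under [X in _.-integrable _ X]eq_fun do rewrite /= EFinD; exact: integrableD.
have iG : P.-integrable setT (EFin \o G).
  by under [X in _.-integrable _ X]eq_fun do rewrite /= EFinB; exact: integrableB.
apply: (@le_trans _ _ (\int[P]_w G w)).
  apply: le_Rintegral => //; first by apply: integrable_norm.
  move=> w _; rewrite -[X in _ - X]mulr1 -mulrBr normrM.
  apply: (@le_trans _ _ (C * `|La w - 1|)); first by rewrite ler_wpM2r.
  rewrite /G; have -> : C * 2^-1 * s^-1 * La w ^+ 2 + (C * 2^-1 * s + C * 2^-1 * s^-1) - C * s^-1 * La w =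
    C * (((La w - 1) ^+ 2 / s + s) / 2) by field; rewrite gt_eqF.
  rewrite ler_wpM2l// -(@real_normK _ (La w - 1)) ?num_real//.
  move: (`|La w - 1|) => t.
  have -> : (t ^+ 2 / s + s) / 2 = t + (t - s) ^+ 2 / (2 * s) by field; rewrite gt_eqF.
  by rewrite lerDl divr_ge0 ?sqr_ge0// mulr_ge0// ltW.
rewrite /G RintegralB// RintegralD// !RintegralZl// Rint_cst RLa RLa2.
have -> : C * 2^-1 * s^-1 * K + (C * 2^-1 * s + C * 2^-1 * s^-1) - C * s^-1 * 1 = C * (((K - 1) / s + s) / 2).
  by field; rewrite gt_eqF.
rewrite (mulrC 4) -mulrA ler_wpM2l//.
have : (K - 1) / s <= 2 * s by rewrite ler_pdivrMr// -mulrA -expr2; lra.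
by lra.
Qed.

End TotalVariation.

(** The law of the head is symmetric, so its integral can be averaged over [z] and [-z]. The cross
    term then cancels, and the squared norms add up along the list. *)
Lemma gf_second_moment (E : hilbertType R) (sepE : separable_space E) (h : I -> E) L :
  gaussian_family L ->
  (\int[P]_w (`|\sum_(i <- L) xi i w *: h i| ^+ 2)%:E <=
   (gauss_const * \sum_(i <- L) v i * `|h i| ^+ 2)%:E)%E.
Proof.
elim: L => [|i L IH] gf.
  rewrite big_nil mulr0 le_eqVlt; apply/orP; left; apply/eqP.
  by under eq_integral do rewrite big_nil normr0 expr0n; rewrite integral0.
have [_ mx nx _] := gf; have [vi _] := nx i ltac:(by rewrite inE eqxx).
have mxL : forall j, j \in L -> measurable_fun setT (xi j : cylT L -> R) by move=> j; exact: measurable_xi_cyl.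
have mxL' : forall j, j \in L -> measurable_fun setT (xi j) by move=> j jL; apply: mx; rewrite inE jL orbT.
have cn2 : continuous (fun x : E => `|x| ^+ 2).
  by move=> x; apply: (@continuous_comp _ _ _ (fun x : E => `|x|) (fun t => t ^+ 2));
    [exact: norm_continuous|exact: exprn_continuous].
pose Phi (p : R * cylT L) := (`|p.1 *: h i + \sum_(j <- L) xi j p.2 *: h j| ^+ 2)%:E.
have mPhi : measurable_fun setT Phi.
  apply/measurable_EFinP.
  apply: (@borel_continuous _ _ sepE _ _ _ measurableT (fun p : R * cylT L => _) _ cn2).
  apply: borelD => //; first exact: borel_scale.
  apply: (@borel_gauss_sum _ sepE h _ (R * cylT L)%type (fun i p => xi i p.2) L) => j jL.
  exact: (measurableT_comp (mxL j jL)).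
have Phi0 p : (0 <= Phi p)%E by rewrite lee_fin sqr_ge0.
have [mF eF] := gf_fubini gf mPhi Phi0.
rewrite [leLHS](_ : _ = \int[P]_w Phi (xi i w, w))%E; last first.
  by apply: eq_integral => w _; rewrite /Phi/= big_cons.
rewrite eF; pose N : {measure set (measurableTypeR R) -> \bar R} := normal_prob 0 (Num.sqrt (v i)).
pose F (z : R) := (\int[P]_w Phi (z, w))%E.
pose S2 := (\int[P]_w (`|\sum_(j <- L) xi j w *: h j| ^+ 2)%:E)%E.
have F0 z : (0 <= F z)%E by apply: integral_ge0.
have bS : borel_on setT (fun w => \sum_(j <- L) xi j w *: h j) by exact: (@borel_gauss_sum _ sepE h).
have mS2 : measurable_fun setT (fun w => (`|\sum_(j <- L) xi j w *: h j| ^+ 2)%:E).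
  by apply/measurable_EFinP; apply: (@borel_continuous _ _ sepE _ _ _ measurableT _ _ cn2).
have FE z : (F z + F (- z)%R = 2%:E * ((z ^+ 2 * `|h i| ^+ 2)%:E + S2))%E.
  have mz y : measurable_fun setT (fun w : Omega => Phi (y, w)).
    apply/measurable_EFinP; apply: (@borel_continuous _ _ sepE _ _ _ measurableT (fun w : Omega => _) _ cn2).
    by rewrite /=; apply: borelD => //; exact: borel_cst.
  have S20 : (0 <= S2)%E by apply: integral_ge0 => w _; rewrite lee_fin sqr_ge0.
  rewrite /F -ge0_integralD//.
  transitivity (\int[P]_w (2%:E * ((z ^+ 2 * `|h i| ^+ 2)%:E + (`|\sum_(j <- L) xi j w *: h j| ^+ 2)%:E)))%E.
    apply: eq_integral => w _; rewrite /Phi/= -!EFinD -EFinM; congr EFin.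
    rewrite scaleNr !normD_sqr normrN dotNl normrZ exprMn real_normK ?num_real//.
    ring.
  rewrite ge0_integralZl//; last 2 first.
  - by apply: emeasurable_funD => //; exact: measurable_cst.
  - by move=> w _; rewrite -EFinD lee_fin; apply: addr_ge0; rewrite ?sqr_ge0// mulr_ge0 ?sqr_ge0.
  congr (_ * _)%E; rewrite ge0_integralD//; try by move=> w _; rewrite lee_fin ?sqr_ge0//; apply: mulr_ge0; exact: sqr_ge0.
  congr (_ + _)%E; rewrite integral_cst//.
  by rewrite [X in (_ * X)%E](probability_setT P) mule1.
have S20 : (0 <= S2)%E by apply: integral_ge0 => w _; rewrite lee_fin sqr_ge0.
have IHL := IH (gf_tail gf).
suff : (2%:E * \int[N]_z F z <= 2%:E * (gauss_const * \sum_(j <- i :: L) v j * `|h j| ^+ 2)%:E)%E.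
  by rewrite lee_pmul2l// lte_fin.
have mFN : measurable_fun setT (fun z : R => F (- z)%R).
  apply: (measurableT_comp (f := F)); first exact: mF.
  by apply: continuous_measurable_fun; exact: opp_continuous.
have -> : (2%:E * \int[N]_z F z = \int[N]_z (F z + F (- z)%R))%E.
  rewrite [RHS](@ge0_integralD _ _ _ N setT measurableT F (fun z => F (- z)%R))//.
  by rewrite [X in (_ = _ + X)%E](@normal_sym _ _ vi F)// -mule2n mule_natl.
under eq_integral do rewrite FE.
have mz2 : measurable_fun setT (fun z : R => (z ^+ 2 * `|h i| ^+ 2)%:E).
  by apply/measurable_EFinP; apply: measurable_funM => //; exact: measurable_funX.
have z20 z : (0 <= (z ^+ 2 * `|h i| ^+ 2)%:E)%E by rewrite lee_fin; apply: mulr_ge0; exact: sqr_ge0.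
have mz2S : measurable_fun setT (fun z : R => (z ^+ 2 * `|h i| ^+ 2)%:E + S2)%E.
  by apply: emeasurable_funD => //; exact: measurable_cst.
rewrite ge0_integralZl//; try by move=> z _; rewrite adde_ge0.
rewrite lee_pmul2l ?lte_fin//.
rewrite ge0_integralD//.
rewrite big_cons mulrDr EFinD; apply: leeD.
  under eq_integral do rewrite EFinM.
  have mz : measurable_fun setT (fun z : R => (z ^+ 2)%:E) by apply/measurable_EFinP; exact: measurable_funX.
  rewrite ge0_integralZr//; try by rewrite ?lee_fin ?sqr_ge0.
    rewrite [leRHS](_ : _ = (gauss_const * v i)%:E * (`|h i| ^+ 2)%:E)%E; last by rewrite -EFinM mulrA.
    apply: lee_wpmul2r; first by rewrite lee_fin sqr_ge0.
    exact: normal_moment2.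
  by move=> z _; rewrite lee_fin sqr_ge0.
rewrite integral_cst//; apply: le_trans IHL.
by rewrite [X in (_ * X)%E](probability_setT N) mule1.
Qed.

End GaussianFamily.

(** * Elementary stochastic integrals *)

Section WienerCells.
Context {R : realType} d (Omega : measurableType d) (P : probability Omega R).
Context {U : hilbertType R} (F : R -> set (set Omega)) (W : cylindrical Omega U).
Hypothesis hW : cylindrical_wiener P F W.

Lemma sigma_of_measurable (I : Type) (D : set I) (Y : I -> Omega -> R) i : D i ->
  measurable_fun setT (Y i : g_sigma_algebraType
    [set A | exists i C, [/\ D i, measurable C & A = Y i @^-1` C]] -> R).
Proof. by move=> Di _ B mB; rewrite setTI; apply: sub_sigma_algebra; exists i, B. Qed.

Lemma wb_measurable j t : wI W j -> 0 <= t -> measurable_fun setT (wb W j t).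
Proof. by move=> Jj; have [_ /(_ j Jj)[h _ _ _ _] _ _ _] := hW; exact: h. Qed.

(* Cells are pairs (component of the noise, interval of the time grid [ts]). *)
Variable ts : seq R.
Hypothesis sts : sorted <%R ts.
Hypothesis ts0 : forall t, t \in ts -> 0 <= t.
Local Notation tm := (nth 0 ts).

Definition cell_incr (c : nat * nat) (w : Omega) : R := wb W c.1 (tm c.2.+1) w - wb W c.1 (tm c.2) w.
Definition cell_var (c : nat * nat) : R := tm c.2.+1 - tm c.2.
Definition cells (js : seq nat) : seq (nat * nat) :=
  [seq (j, i) | j <- js, i <- iota 0 (size ts).-1].

Lemma tm_ge0 i : 0 <= tm i.
Proof.
have [h|h] := ltnP i (size ts); first by apply: ts0; exact: mem_nth.
by rewrite nth_default.
Qed.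

Lemma tm_lt i k : (k < size ts)%N -> (i < k)%N -> tm i < tm k.
Proof.
by move=> h ik; rewrite lt_sorted_ltn_nth// inE// (ltn_trans ik).
Qed.

Lemma tm_le i k : (k < size ts)%N -> (i <= k)%N -> tm i <= tm k.
Proof. by move=> h; rewrite leq_eqVlt => /predU1P[->//|/(tm_lt h)/ltW]. Qed.

Lemma in_cells js c : c \in cells js -> c.1 \in js /\ (c.2.+1 < size ts)%N.
Proof.
move=> /allpairsP[[j i]/= [jjs]]; rewrite mem_iota add0n => /= ilt ->; split => //=.
by move: ilt; case: (size ts).
Qed.

Lemma cell_incr_measurable js c : {subset js <= wI W} -> c \in cells js ->
  measurable_fun setT (cell_incr c).
Proof.
move=> sJ /in_cells[/sJ/set_mem cJ _]; apply: measurable_funB; apply: wb_measurable => //; exact: tm_ge0.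
Qed.

Lemma EFin_prod (I : Type) (L : seq I) (f : I -> R) :
  (\prod_(i <- L) (f i)%:E)%E = (\prod_(i <- L) f i)%:E.
Proof. by elim/big_rec2: _ => // i _ x _ ->; rewrite EFinM. Qed.

(** The last increment is independent of the past of the same Brownian component, which determines
    the earlier increments; induction removes the increments one at a time. *)
Lemma column_indep j (C : nat -> set R) m : wI W j -> (m < size ts)%N ->
  (forall i, measurable (C i)) ->
  P [set w | forall i, (i < m)%N -> C i (cell_incr (j, i) w)] =
  (\prod_(i <- iota 0 m) fine (P (cell_incr (j, i) @^-1` C i)))%:E.
Proof.
move=> Jj; have [_ /(_ j Jj)[mb _ _ ind _] _ _ _] := hW.
have mci i : measurable_fun setT (cell_incr (j, i)).
  by apply: measurable_funB; apply: mb; exact: tm_ge0.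
elim: m => [|m IH] ms mC.
  rewrite big_nil -(probability_setT P); congr (P _); exact/seteqP.
rewrite -[in iota 0 _]addn1 iotaD big_cat/= big_seq1 add0n EFinM -IH//; last exact: ltn_trans ms.
rewrite fineK ?fin_num_measure//; last by rewrite -[X in measurable X]setTI; exact: mci.
rewrite -(ind (tm m) (tm_ge0 m)).
- congr (P _); apply/seteqP; split => w /=.
    by move=> h; split=> [i im|]; [apply: h; exact: ltn_trans im _|exact: h].
  by move=> [h1 h2] i; rewrite ltnS leq_eqVlt => /predU1P[->//|]; exact: h1.
- pose T' := g_sigma_algebraType [set A | exists i C, [/\ [set u | 0 <= u <= tm m] i, measurable C & A = wb W j i @^-1` C]].
  have mi i : (i < m)%N -> measurable_fun setT (cell_incr (j, i) : T' -> R).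
    move=> im; have mlt := ltn_trans (ltnSn m) ms.
    by apply: measurable_funB; apply: sigma_of_measurable => /=; rewrite tm_ge0/= tm_le// ltnW.
  rewrite (_ : [set w | _] = \bigcap_(i in [set i | (i < m)%N]) (cell_incr (j, i) @^-1` C i)); last first.
      by apply/seteqP; split => w /= h i; exact: h.
  have : measurable (\bigcap_(i in [set i | (i < m)%N]) (cell_incr (j, i) @^-1` C i) : set T').
    apply: bigcap_measurableType => i im.
    by rewrite -[X in measurable X]setTI; apply: (mi i im).
  by [].
- by apply: sub_sigma_algebra; exists (tm m.+1), (C m); split => //=; apply: tm_le.
Qed.

(** Distinct components are independent by assumption, and the increments of one component by
    [column_indep]. Together these factorize the probability over all cells. *)
Lemma wiener_gaussian_family js : uniq js -> {subset js <= wI W} ->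
  gaussian_family P cell_incr cell_var (cells js).
Proof.
move=> ujs sJ; split.
- apply: allpairs_uniq => //; first exact: iota_uniq.
  by move=> [? ?] [? ?].
- by move=> c; exact: cell_incr_measurable.
- move=> c /in_cells[/sJ/set_mem Jc ilt]; have lt12 : tm c.2 < tm c.2.+1 by exact: tm_lt.
  split=> [|C mC]; first by rewrite subr_gt0.
  have [_ /(_ _ Jc)[_ _ hN _ _] _ _ _] := hW.
  by rewrite -hN//; exact: tm_ge0.
- move=> C mC; pose n := (size ts).-1.
  have [ts1|ts1] := leqP (size ts) 0.
    have -> : cells js = [::].
      by rewrite /cells; move: ts1; rewrite leqn0 => /eqP ->; elim: (js).
    by rewrite big_nil -(probability_setT P); congr (P _); exact/seteqP.
  have nlt : (n < size ts)%N by rewrite prednK.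
  pose A j := [set w | forall i, (i < n)%N -> C (j, i) (cell_incr (j, i) w)].
  have -> : [set w | forall c, c \in cells js -> C c (cell_incr c w)] = \bigcap_(j in [set` js]) A j.
    apply/seteqP; split => w /=.
      by move=> h j jjs i ilt; apply: h; apply/allpairsP; exists (j, i); rewrite mem_iota add0n.
    move=> h c /allpairsP[[j i]/= [jjs]]; rewrite mem_iota add0n => /= ilt ->.
    exact: h.
  have [_ _ mind _ _] := hW.
  rewrite (mind js A ujs); last first.
    move=> j jjs; have Jj := set_mem (sJ _ jjs); split => //.
    pose T' := g_sigma_algebraType [set A | exists i C, [/\ [set t | 0 <= t] i, measurable C & A = wb W j i @^-1` C]].
    rewrite /A (_ : [set w | _] = \bigcap_(i in [set i | (i < n)%N]) (cell_incr (j, i) @^-1` C (j, i))); last first.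
      by apply/seteqP; split => w /= h i; exact: h.
    have : measurable (\bigcap_(i in [set i | (i < n)%N]) (cell_incr (j, i) @^-1` C (j, i)) : set T').
      apply: bigcap_measurableType => i im.
      have : measurable_fun setT (cell_incr (j, i) : T' -> R).
        by apply: measurable_funB; apply: sigma_of_measurable; exact: tm_ge0.
      by move=> mi; rewrite -[X in measurable X]setTI; apply: mi.
    by [].
  transitivity ((\prod_(c <- cells js) fine (P (cell_incr c @^-1` C c)))%:E); last first.
    rewrite -EFin_prod; apply: eq_big_seq => c cL; rewrite fineK// fin_num_measure//.
    by rewrite -[X in measurable X]setTI; exact: (cell_incr_measurable sJ cL).
  congr EFin; rewrite /cells big_allpairs; apply: eq_big_seq => j jjs.
  rewrite (@column_indep j (fun i => C (j, i)) n)//.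
  exact: set_mem (sJ _ jjs).
Qed.

Section elementary.
Context {H : hilbertType R}.
Variables (js : seq nat) (e : seq (nat * R * R * H)).
Hypothesis ujs : uniq js.
Hypothesis he : forall j a b h, (j, a, b, h) \in e -> [/\ j \in js, a \in ts, b \in ts & a <= b].

(** The value on a cell is read at its right end point, because the integrands are built from
    left-open intervals with end points in the grid. *)
Definition cell_val (c : nat * nat) : H := elem_val e (tm c.2.+1) c.1.

Lemma index_le a b : a \in ts -> b \in ts -> a <= b -> (index a ts <= index b ts)%N.
Proof.
move=> ats bts ab; rewrite leqNgt; apply/negP => /tm_lt; rewrite index_mem => /(_ ats).
by rewrite !nth_index// ltNge ab.
Qed.

Lemma tm_cell a b i : a \in ts -> b \in ts -> (i.+1 < size ts)%N ->
  (a < tm i.+1 <= b) = (index a ts <= i < index b ts)%N.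
Proof.
move=> ats bts ilt; have ha : (index a ts < size ts)%N by rewrite index_mem.
have hb : (index b ts < size ts)%N by rewrite index_mem.
rewrite -{1}(nth_index 0 ats) -{1}(nth_index 0 bts).
by rewrite lt_sorted_ltn_nth ?inE// lt_sorted_leq_nth ?inE// ltnS.
Qed.

Lemma elem_int_cells w :
  elem_int W e w = \sum_(c <- cells js) cell_incr c w *: cell_val c.
Proof.
rewrite /elem_int /cell_val /elem_val.
under [RHS]eq_bigr do rewrite scaler_sumr.
rewrite exchange_big/=; apply: eq_big_seq => -[[[j a] b] h] /he[jjs ats bts ab].
rewrite /cells big_allpairs/= (bigD1_seq j)//= [X in _ = _ + X]big1 ?addr0; last first.
  by move=> k /negPf kj; apply: big1 => i _; rewrite eq_sym kj scaler0.
have iab := index_le ats bts ab.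
have ibs : (index b ts <= (size ts).-1)%N by rewrite -ltnS prednK ?index_mem// (leq_ltn_trans _ (_ : index b ts < _)%N)// index_mem.
transitivity (\sum_(index a ts <= i < index b ts) (wb W j (tm i.+1) w - wb W j (tm i) w) *: h).
  by rewrite -scaler_suml (telescope_sumr (fun i => wb W j (tm i) w))// !nth_index.
rewrite (big_nat_widen _ _ _ _ _ ibs) (big_nat_widenl _ _ _ _ _ (leq0n (index a ts))) big_mkcond/=.
rewrite /index_iota subn0; apply: eq_big_seq => i; rewrite mem_iota add0n => /= ilt.
have ilt' : (i.+1 < size ts)%N by move: ilt; case: (size ts).
by rewrite eqxx/= (tm_cell ats bts ilt') andbC; case: ifP; rewrite ?scaler0.
Qed.

Lemma elem_val_cell s k i : (i.+1 < size ts)%N -> tm i < s <= tm i.+1 ->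
  elem_val e s k = elem_val e (tm i.+1) k.
Proof.
move=> ilt /andP[is1 is2]; apply: eq_big_seq => -[[[j a] b] h] /he[jjs ats bts ab].
congr (if _ && _ then _ else _); rewrite (tm_cell ats bts ilt).
have ha : (index a ts < size ts)%N by rewrite index_mem.
have hb : (index b ts < size ts)%N by rewrite index_mem.
apply/idP/idP => /andP[h1 h2]; apply/andP; split.
- rewrite leqNgt; apply/negP => h3; have : tm i.+1 <= a by rewrite -[leRHS](nth_index 0 ats) tm_le.
  by move/(le_trans is2); rewrite leNgt h1.
- rewrite ltnNge; apply/negP => h3; have : b <= tm i by rewrite -[leLHS](nth_index 0 bts) tm_le// ltnW.
  by move=> hb'; have := le_lt_trans (le_trans h2 hb') is1; rewrite ltxx.
- apply: le_lt_trans is1; rewrite -[leLHS](nth_index 0 ats); apply: tm_le => //; exact: ltnW.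
- by apply: (le_trans is2); rewrite -[leRHS](nth_index 0 bts) tm_le.
Qed.

Lemma elem_val_notin s k : (forall i, (i.+1 < size ts)%N -> ~~ (tm i < s <= tm i.+1)) ->
  elem_val e s k = 0.
Proof.
move=> hs; rewrite /elem_val big_seq big1// => -[[[j a] b] h] /he[jjs ats bts ab].
case: ifPn => // /andP[_ /andP[h1 h2]]; exfalso.
have [i0 hi0] : exists i, (i < size ts)%N && (s <= tm i).
  by exists (index b ts); rewrite index_mem bts nth_index.
have ex : exists i, (i < size ts)%N && (s <= tm i) by exists i0.
case: (ex_minnP ex) => m /andP[mlt sm] mmin.
have m0 : (0 < m)%N.
  rewrite lt0n; apply/eqP => m0; move: sm; rewrite m0 leNgt => /negP; apply.
  by apply: le_lt_trans h1; rewrite -[leRHS](nth_index 0 ats) tm_le ?index_mem.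
have := hs m.-1; rewrite prednK// => /(_ mlt); rewrite sm andbT -leNgt => h3.
have := mmin m.-1; rewrite h3 andbT (leq_ltn_trans (leq_pred m) mlt) => /(_ isT).
by rewrite leqNgt ltn_predL m0.
Qed.

Hypothesis sJ : {subset js <= wI W}.

Lemma elem_val_out s k : k \notin js -> elem_val e s k = 0.
Proof.
move=> kjs; rewrite /elem_val big_seq big1// => -[[[j a] b] h] /he[jjs _ _ _].
by case: eqP => // jk; rewrite -jk jjs in kjs.
Qed.

(** Applied with the squared norm for the isometry, and with [dot x y ^ 2] for the covariance form.
    The condition at 0 discards the times outside the grid and the components that do not occur in
    [e]. *)
Lemma integral_elem_val (psi : H -> R) (t : R) : (forall x, 0 <= psi x) -> psi 0 = 0 ->
  (forall s, s \in ts -> s <= t) ->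
  (\int[lebesgue_measure]_(s in `[0%R, t]) (\esum_(k in wI W) (psi (elem_val e s k))%:E) =
   (\sum_(c <- cells js) cell_var c * psi (cell_val c))%:E)%E.
Proof.
move=> psi0 psi00 tst.
pose I (c : nat * nat) := `]tm c.2, tm c.2.+1]%classic : set R.
transitivity (\int[lebesgue_measure]_(s in `[0%R, t])
   (\sum_(c <- cells js) (\1_(I c) s * psi (cell_val c))%:E))%E.
  apply: eq_integral => s _.
  transitivity (\sum_(j <- js) (psi (elem_val e s j))%:E)%E.
    rewrite (esumID [set` js])//; last by move=> k _; rewrite lee_fin.
    rewrite [X in (_ + X)%E]esum1 ?adde0; last first.
      by move=> k [_ /negP kjs]; rewrite elem_val_out// psi00.
    rewrite (_ : wI W `&` [set` js] = [set` js]); last first.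
      by apply/seteqP; split=> [k []//|k kjs]; split => //; exact: set_mem (sJ kjs).
    rewrite esum_fset; [by rewrite -fsbig_seq|exact: finite_seq|].
    by move=> k _; rewrite lee_fin.
  rewrite /cells big_allpairs; apply: eq_big_seq => j _.
  have [[i ilt hi]|no] := pselect (exists2 i, (i.+1 < size ts)%N & tm i < s <= tm i.+1).
    have iin : i \in iota 0 (size ts).-1 by rewrite mem_iota add0n/=; move: ilt; case: (size ts).
    rewrite (bigD1_seq i) ?iota_uniq//= /I/= big1_seq ?adde0; last first.
      move=> k /andP[ki]; rewrite mem_iota add0n => /= klt.
      rewrite indicE memNset ?mul0r//= in_itv/= => /andP[h1 h2].
      have klt' : (k.+1 < size ts)%N by move: klt; case: (size ts).
      move: hi => /andP[h3 h4]; have [h5|h5|h5] := ltngtP k i; last by rewrite h5 eqxx in ki.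
        have := tm_le (ltnW ilt) h5; have := lt_le_trans h3 h2; rewrite ltNge => /negP; exact.
      have := tm_le (ltnW klt') h5; have := lt_le_trans h1 h4; rewrite ltNge => /negP; exact.
    by rewrite indicE mem_set ?mul1r ?(elem_val_cell j ilt hi)//= in_itv.
  rewrite elem_val_notin ?psi00.
    rewrite big1_seq// => k /andP[_]; rewrite mem_iota add0n => /= klt.
    rewrite indicE memNset ?mul0r// /I/= in_itv/= => h; apply: no; exists k => //.
    by move: klt; case: (size ts).
  by move=> i ilt; apply/negP => h; apply: no; exists i.
rewrite ge0_integral_sum//; last 2 first.
- move=> c; apply/measurable_EFinP; apply: measurable_funM; last exact: measurable_cst.
  by apply: measurable_indic; exact: measurable_itv.
- by move=> c s _; rewrite lee_fin mulr_ge0.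
rewrite -sumEFin; apply: eq_big_seq => c /in_cells[_ clt].
under eq_integral do rewrite EFinM.
rewrite ge0_integralZr ?lee_fin//; last first.
  by apply/measurable_EFinP; apply: measurable_indic; exact: measurable_itv.
rewrite [RHS]EFinM; congr (_ * _)%E.
have mI : measurable (I c) by exact: measurable_itv.
transitivity (lebesgue_measure (I c `&` `[0, t])); first exact: integral_indic.
rewrite (_ : _ `&` _ = I c); last first.
  apply/seteqP; split=> [s []//|s Is]; split => //; move: Is; rewrite /I/= !in_itv/= => /andP[h1 h2].
  by rewrite (le_trans (tm_ge0 c.2) (ltW h1))/= (le_trans h2)// tst// mem_nth.
rewrite /I lebesgue_measure_itv/= lte_fin ifT ?EFinB//.
by apply: tm_lt.
Qed.

End elementary.
End WienerCells.

Section ElementaryIntegrals.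
Context {R : realType} d (Omega : measurableType d) (P : probability Omega R).
Context {U H : hilbertType R} (F : R -> set (set Omega)) (W : cylindrical Omega U).
Hypothesis hW : cylindrical_wiener P F W.
Hypothesis sepH : separable_space H.
Implicit Type e : seq (nat * R * R * H).

Definition elem_within (u t : R) e := forall j a b h, (j, a, b, h) \in e ->
  [/\ wI W j, u <= a, a <= b & b <= t].

Lemma elem_grid t e : elem_within 0 t e -> exists (ts : seq R) (js : seq nat),
  [/\ sorted <%R ts, forall x, x \in ts -> 0 <= x <= t, uniq js, {subset js <= wI W} &
   forall j a b h, (j, a, b, h) \in e -> [/\ j \in js, a \in ts, b \in ts & a <= b]].
Proof.
move=> ve; pose ts0 := [seq x.1.1.2 | x <- e] ++ [seq x.1.2 | x <- e].
exists (sort <=%R (undup ts0)), (undup [seq x.1.1.1 | x <- e]); split.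
- by rewrite lt_sorted_uniq_le sort_uniq undup_uniq sort_le_sorted.
- move=> x; rewrite mem_sort mem_undup mem_cat => /orP[] /mapP[[[[j a] b] h]] /ve[_ a0 ab bt] /= ->.
    by rewrite a0 (le_trans ab).
  by rewrite bt (le_trans a0).
- exact: undup_uniq.
- by move=> j; rewrite mem_undup => /mapP[[[[k a] b] h]] /ve[Jk _ _ _] /= ->; apply: mem_set.
- move=> j a b h xe; have [_ _ ab _] := ve _ _ _ _ xe.
  rewrite !mem_sort !mem_undup !mem_cat; split => //.
  + by apply/mapP; exists (j, a, b, h).
  + by apply/orP; left; apply/mapP; exists (j, a, b, h).
  + by apply/orP; right; apply/mapP; exists (j, a, b, h).
Qed.

(** The half of the Itô isometry on which all limits in mean square rest. *)
Lemma elem_second_moment t e : elem_within 0 t e ->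
  (\int[P]_w (`|elem_int W e w| ^+ 2)%:E <= gauss_const%:E *
   \int[lebesgue_measure]_(s in `[0%R, t]) (\esum_(k in wI W) (`|elem_val e s k| ^+ 2)%:E))%E.
Proof.
move=> /elem_grid[ts [js [sts tst ujs sJ he]]].
have ts0 x : x \in ts -> 0 <= x by move=> /tst/andP[].
have n0 (x : H) : 0 <= `|x| ^+ 2 by exact: sqr_ge0.
have n00 : `|0 : H| ^+ 2 = 0 by rewrite normr0 expr0n.
have tst' x : x \in ts -> x <= t by move=> /tst/andP[].
rewrite (integral_elem_val sts ts0 ujs he sJ n0 n00 tst').
have gf := wiener_gaussian_family hW sts ts0 ujs sJ.
apply: le_trans (gf_second_moment sepH (cell_val ts e) gf).
rewrite le_eqVlt; apply/orP; left; apply/eqP; apply: eq_integral => w _.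
by rewrite (elem_int_cells _ sts ujs he).
Qed.

(** Here [q] is the covariance form of the elementary integral and [m] its covariance operator, so
    [m y] is a Cameron-Martin direction of squared length [q y]: shifting each cell by
    [v c * dot (h c) y] costs [q y]. The operator is described by polarization of [q] so that
    convergence of the forms alone controls it in the limit. *)
Lemma elem_total_variation t e : elem_within 0 t e -> exists (q : H -> R) (m : H -> H),
  [/\ forall y, (\int[lebesgue_measure]_(s in `[0%R, t])
         (\esum_(k in wI W) (dot (elem_val e s k) y ^+ 2)%:E) = (q y)%:E)%E,
      forall y y', dot (m y) y' = (q (y + y') - q (y - y')) / 4 &
      forall y (f : H -> R) (C s : R), continuous f -> (forall x, `|f x| <= C) -> 0 < s ->
        q y <= s ^+ 2 ->
        `|\int[P]_w f (elem_int W e w + m y) - \int[P]_w f (elem_int W e w)| <= 4 * C * s].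
Proof.
move=> /elem_grid[ts [js [sts tst ujs sJ he]]].
have ts0 x : x \in ts -> 0 <= x by move=> /tst/andP[].
have gf := wiener_gaussian_family hW sts ts0 ujs sJ.
have [_ _ vgt _] := gf.
pose h := cell_val ts e; pose v := cell_var ts; pose L := cells ts js.
exists (fun y => \sum_(c <- L) v c * dot (h c) y ^+ 2), (fun y => \sum_(c <- L) (v c * dot (h c) y) *: h c).
split.
- move=> y; have n0 (x : H) : 0 <= dot x y ^+ 2 by exact: sqr_ge0.
  have n00 : dot 0 y ^+ 2 = 0 by rewrite dot0l expr0n.
  have tst' x : x \in ts -> x <= t by move=> /tst/andP[].
  by rewrite (integral_elem_val sts ts0 ujs he sJ n0 n00 tst').
- move=> y y'; rewrite dot_suml -sumrB mulr_suml; apply: eq_bigr => c _.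
  by rewrite dotZl dotDr dotBr; field.
- move=> y f C s cf fC s0 qs.
  have := @gf_total_variation _ _ _ P _ _ _ H sepH h (fun c => v c * dot (h c) y) L f C s gf cf fC s0.
  have -> : \sum_(c <- L) (v c * dot (h c) y) ^+ 2 / v c = \sum_(c <- L) v c * dot (h c) y ^+ 2.
    by apply: eq_big_seq => c /vgt[vc _]; field; rewrite gt_eqF.
  move=> /(_ qs); congr (`|_ - _| <= _).
    apply: eq_Rintegral => w _; rewrite (elem_int_cells _ sts ujs he) -big_split/=; congr (f _).
    by apply: eq_bigr => c _; rewrite scalerDl.
  by apply: eq_Rintegral => w _; rewrite (elem_int_cells _ sts ujs he).
Qed.

Lemma elem_int_borel d' (T : measurableType d') (X : nat -> R -> T -> R) e :
  (forall j a b h, (j, a, b, h) \in e -> measurable_fun setT (fun w => X j b w - X j a w)) ->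
  borel_on setT (fun w => \sum_(x <- e) let: (j, a, b, h) := x in (X j b w - X j a w) *: h : H).
Proof.
move=> mX; under eq_fun do rewrite big_seq_cond.
apply: borel_sum => // -[[[j a] b] h] /andP[xe _].
by apply: borel_scale => //; exact: mX xe.
Qed.

(** The generators of the sigma-algebra of future increments in the last clause of
    [cylindrical_wiener]. *)
Definition future_sets u : set (set Omega) := [set A | exists (q : nat * R) (C : set R),
  [/\ wI W q.1 /\ u <= q.2, measurable C & A = (fun w => wb W q.1 q.2 w - wb W q.1 u w) @^-1` C]].

Lemma elem_int_future u t e : elem_within u t e ->
  borel_on setT (elem_int W e : g_sigma_algebraType (future_sets u) -> H).
Proof.
move=> ve; apply: (@elem_int_borel _ (g_sigma_algebraType (future_sets u)) (wb W)) => j a b h /ve[Jj ua ab bt].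
rewrite (_ : (fun w => _) = (fun w => (wb W j b w - wb W j u w) - (wb W j a w - wb W j u w))); last first.
  by apply/funext => w; ring.
apply: measurable_funB.
  by apply: (@sigma_of_measurable _ _ Omega _ [set q : nat * R | wI W q.1 /\ u <= q.2]
    (fun q w => wb W q.1 q.2 w - wb W q.1 u w) (j, b)); split => //=; exact: le_trans ab.
by apply: (@sigma_of_measurable _ _ Omega _ [set q : nat * R | wI W q.1 /\ u <= q.2]
    (fun q w => wb W q.1 q.2 w - wb W q.1 u w) (j, a)).
Qed.

Lemma elem_int_measurable t e : elem_within 0 t e -> borel_on setT (elem_int W e).
Proof.
move=> ve; apply: (@elem_int_borel _ Omega (wb W)) => j a b h /ve[Jj a0 ab bt].
by apply: measurable_funB; apply: (wb_measurable hW) => //; exact: le_trans ab.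
Qed.

End ElementaryIntegrals.

(** * Uniform continuity and convergence in mean square *)

Lemma powR_quadratic {R : realType} (theta C eta : R) : 0 < theta < 1 -> 0 <= C -> 0 < eta ->
  exists2 c : R, 0 <= c & forall t, 0 <= t -> C * t `^ theta <= eta + c * t ^+ 2.
Proof.
(* Below the threshold [k] the power is absorbed by [eta], since [k^theta = eta / (C + 1)]; above
   it, [t^theta <= k^(theta - 2) * t^2]. *)
move=> /andP[th0 th1] C0 eta0; pose k := (eta / (C + 1)) `^ theta^-1.
have eC : 0 < eta / (C + 1) by rewrite divr_gt0// ltr_wpDl.
have k0 : 0 < k by exact: powR_gt0.
exists (C * k `^ (theta - 2)); first by rewrite mulr_ge0// powR_ge0.
move=> t t0.
have [tk|tk] := leP t k.
  rewrite -[leLHS]addr0 lerD//; last by rewrite !mulr_ge0 ?powR_ge0 ?sqr_ge0.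
  apply: (@le_trans _ _ (C * k `^ theta)).
    by rewrite ler_wpM2l// ge0_ler_powR ?nnegrE// ltW.
  rewrite /k -powRrM mulVf ?gt_eqF// powRr1 ?ltW//.
  by rewrite mulrCA gtr_pMr// ltr_pdivrMr ?ltr_wpDl// mul1r ltrDl.
rewrite -[leLHS]add0r; apply: lerD; first exact: ltW.
rewrite -mulrA; apply: ler_wpM2l => //.
have tp : 0 < t by exact: lt_trans tk.
have -> : t `^ theta = t `^ (theta - 2) * t ^+ 2.
  rewrite -[t ^+ 2]powR_mulrn// -powRD ?subrK//.
  by apply/implyP => /eqP; lra.
rewrite ler_wpM2r ?sqr_ge0//.
have e1 : theta - 2 = - (2 - theta) by rewrite opprB.
rewrite e1 !powRN lef_pV2 ?posrE ?powR_gt0//.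
by apply: ge0_ler_powR; rewrite ?nnegrE ?subr_ge0 ?(ltW k0) ?(ltW tk)//; lra.
Qed.

Section UniformContinuity.
Context {R : realType} {E : normedModType R}.

(* A form of uniform continuity which is preserved by taking expectations. *)
Definition ucont (f : E -> R) := forall eta : R, 0 < eta ->
  exists2 c : R, 0 <= c & forall x y, `|f x - f y| <= eta + c * `|x - y| ^+ 2.

Lemma ucont_continuous f : ucont f -> continuous f.
Proof.
move=> uf x; apply/cvgrPdist_lt => e e0.
have [c c0 hc] := uf (e / 2) ltac:(by rewrite divr_gt0).
near=> y; apply: le_lt_trans (hc _ _) _.
have : `|x - y| < Num.min 1 (e / (2 * (c + 1))).
  near: y; have k0 : 0 < Num.min 1 (e / (2 * (c + 1))).
    by rewrite lt_min ltr01 divr_gt0// mulr_gt0// ltr_wpDl.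
  by apply/nbhs_ballP; exists (Num.min 1 (e / (2 * (c + 1)))) => // y; rewrite -ball_normE.
rewrite lt_min => /andP[h1]; rewrite ltr_pdivlMr ?mulr_gt0 ?ltr_wpDl// => h2.
have : c * `|x - y| ^+ 2 <= c * `|x - y|.
  by rewrite ler_wpM2l// expr2 ler_piMl// ltW.
by have := normr_ge0 (x - y); nra.
Unshelve. all: by end_near. Qed.

Lemma holder_ucont (f : E -> R) (theta C : R) : 0 < theta < 1 -> 0 <= C ->
  (forall x y, `|f x - f y| <= C * `|x - y| `^ theta) -> ucont f.
Proof.
move=> th C0 hf eta eta0; have [c c0 hc] := powR_quadratic th C0 eta0.
by exists c => // x y; exact: le_trans (hf x y) (hc _ (normr_ge0 _)).
Qed.

Lemma lipschitz_ucont (f : E -> R) (C : R) : 0 <= C ->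
  (forall x y, `|f x - f y| <= C * `|x - y|) -> ucont f.
Proof.
move=> C0 hf eta eta0; exists (C ^+ 2 / (4 * eta)); first by rewrite divr_ge0 ?sqr_ge0// mulr_ge0// ltW.
move=> x y; apply: le_trans (hf x y) _; set t := `|x - y|.
have -> : C * t = eta + C ^+ 2 / (4 * eta) * t ^+ 2 - (C * t - 2 * eta) ^+ 2 / (4 * eta).
  by field; rewrite gt_eqF.
by rewrite gerBl divr_ge0 ?sqr_ge0// mulr_ge0// ltW.
Qed.

Lemma ucontD f g : ucont f -> ucont g -> ucont (fun x => f x + g x).
Proof.
move=> uf ug e e0; have e2 : 0 < e / 2 by rewrite divr_gt0.
have [c c0 hc] := uf _ e2; have [c' c'0 hc'] := ug _ e2.
exists (c + c'); first exact: addr_ge0.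
move=> x y; rewrite (_ : _ - _ = (f x - f y) + (g x - g y)); last by ring.
by apply: le_trans (ler_normD _ _) _; have := hc x y; have := hc' x y; rewrite mulrDl; lra.
Qed.

Lemma ucontN f : ucont f -> ucont (fun x => - f x).
Proof.
move=> uf e /uf[c c0 hc]; exists c => // x y.
by rewrite -opprD normrN.
Qed.

Lemma ucont_shift f a : ucont f -> ucont (fun x => f (a + x)).
Proof.
move=> uf e /uf[c c0 hc]; exists c => // x y; apply: le_trans (hc _ _) _.
by rewrite opprD addrACA subrr add0r.
Qed.

Lemma ucont_comp (g : E -> E) f (M : R) : 0 <= M ->
  (forall x y, `|g x - g y| <= M * `|x - y|) -> ucont f -> ucont (f \o g).
Proof.
move=> M0 hg uf e /uf[c c0 hc]; exists (c * M ^+ 2); first by rewrite mulr_ge0 ?sqr_ge0.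
move=> x y; apply: le_trans (hc _ _) _; rewrite lerD2l -mulrA ler_wpM2l// -exprMn.
by rewrite ler_sqr ?nnegrE ?mulr_ge0.
Qed.

End UniformContinuity.

Section MeanSquare.
Context {R : realType} {H : hilbertType R} (sepH : separable_space H).

Lemma continuous_norm2 : continuous (fun x : H => `|x| ^+ 2).
Proof.
by move=> x; apply: (@continuous_comp _ _ _ (fun x : H => `|x|) (fun t => t ^+ 2));
  [exact: norm_continuous|exact: exprn_continuous].
Qed.

Lemma sqr_normD_le (x y : H) : `|x + y| ^+ 2 <= 2 * `|x| ^+ 2 + 2 * `|y| ^+ 2.
Proof. by have := sqr_ge0 `|x - y|; rewrite normB_sqr normD_sqr; lra. Qed.

Context d (T : measurableType d) (mu : {measure set T -> \bar R}) (D : set T) (mD : measurable D).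
Implicit Types X Y : T -> H.

Lemma borel_norm2 X : borel_on D X -> measurable_fun D (fun w => (`|X w| ^+ 2)%:E).
Proof.
by move=> bX; apply/measurable_EFinP; exact: (borel_continuous sepH mD continuous_norm2 bX).
Qed.

End MeanSquare.

Section ExpectationLimits.
Context {R : realType} {H : hilbertType R} (sepH : separable_space H).
Context d (Omega : measurableType d) (P : probability Omega R).
Local Notation ms X := (\int[P]_w (`|X w| ^+ 2)%:E)%E.

Lemma integrable_ms (X : Omega -> H) : borel_on setT X -> (ms X < +oo)%E ->
  P.-integrable setT (EFin \o (fun w => `|X w| ^+ 2)).
Proof.
move=> bX Xoo; apply: integrable_ge0 => //.
exact: (borel_continuous sepH measurableT continuous_norm2 bX).
Qed.

Lemma ucont_expectation (f : Omega -> R) (g : Omega -> R) (X Y : Omega -> H) (eta c : R) :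
  P.-integrable setT (EFin \o f) -> P.-integrable setT (EFin \o g) ->
  borel_on setT X -> borel_on setT Y -> (ms (fun w => X w - Y w) < +oo)%E -> 0 <= c ->
  (forall w, `|f w - g w| <= eta + c * `|X w - Y w| ^+ 2) ->
  `|\int[P]_w f w - \int[P]_w g w| <= eta + c * fine (ms (fun w => X w - Y w)).
Proof.
move=> intf intg bX bY XYoo c0 hfg; rewrite -RintegralB//.
have iB : P.-integrable setT (EFin \o (fun w => f w - g w)).
  by under [X in _.-integrable _ X]eq_fun do rewrite /= EFinB; exact: integrableB.
apply: le_trans (le_normr_Rintegral _ iB) _ => //.
have bXY : borel_on setT (fun w => X w - Y w) by exact: borelB.
have i2 := integrable_ms bXY XYoo.
have i3 : P.-integrable setT (EFin \o (fun w => c * `|X w - Y w| ^+ 2)).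
  by under [X in _.-integrable _ X]eq_fun do rewrite /= EFinM; exact: integrableZl.
have i4 : P.-integrable setT (EFin \o (fun w : Omega => eta)).
  exact: finite_measure_integrable_cst.
have i5 : P.-integrable setT (EFin \o (fun w => eta + c * `|X w - Y w| ^+ 2)).
  by under [X in _.-integrable _ X]eq_fun do rewrite /= EFinD; exact: integrableD.
apply: (@le_trans _ _ (\int[P]_w (eta + c * `|X w - Y w| ^+ 2))).
  by apply: le_Rintegral => //; apply: integrable_norm.
by rewrite RintegralD// Rint_cst RintegralZl.
Qed.

End ExpectationLimits.

Section IntegralComparison.
Context {R : realType} d (T : measurableType d) (mu : {measure set T -> \bar R}).
Context (D : set T) (mD : measurable D).
Local Open Scope ereal_scope.

Lemma integral_le_comb (f g1 g2 : T -> \bar R) (c1 c2 : R) :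
  measurable_fun D f -> measurable_fun D g1 -> measurable_fun D g2 ->
  (0 <= c1)%R -> (0 <= c2)%R ->
  (forall x, D x -> 0 <= f x) -> (forall x, D x -> 0 <= g1 x) -> (forall x, D x -> 0 <= g2 x) ->
  (forall x, D x -> f x <= c1%:E * g1 x + c2%:E * g2 x) ->
  \int[mu]_(x in D) f x <= c1%:E * \int[mu]_(x in D) g1 x + c2%:E * \int[mu]_(x in D) g2 x.
Proof.
move=> mf mg1 mg2 c10 c20 f0 g10 g20 h.
rewrite -(ge0_integralZl mu mD mg1 g10)// -(ge0_integralZl mu mD mg2 g20)//.
have m1 : measurable_fun D (fun x => c1%:E * g1 x) by apply: emeasurable_funM => //; exact: measurable_cst.
have m2 : measurable_fun D (fun x => c2%:E * g2 x) by apply: emeasurable_funM => //; exact: measurable_cst.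
have p1 x : D x -> 0 <= c1%:E * g1 x by move=> Dx; rewrite mule_ge0// ?lee_fin// g10.
have p2 x : D x -> 0 <= c2%:E * g2 x by move=> Dx; rewrite mule_ge0// ?lee_fin// g20.
rewrite -(ge0_integralD mu mD p1 m1 p2 m2).
by apply: ge0_le_integral => //; exact: emeasurable_funD.
Qed.

Variable J : set nat.

Lemma esum_series (a : nat -> \bar R) : (forall k, J k -> 0 <= a k) ->
  \esum_(k in J) a k = \sum_(0 <= k <oo | k \in J) a k.
Proof.
move=> a0; rewrite nneseries_esum; last by move=> k /set_mem; exact: a0.
by rewrite (_ : [set x | x \in J] = J)//; apply/seteqP; split=> x /=; rewrite inE.
Qed.

Lemma measurable_esum (a : T -> nat -> \bar R) : (forall k, J k -> measurable_fun D (a^~ k)) ->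
  (forall x k, D x -> J k -> 0 <= a x k) -> measurable_fun D (fun x => \esum_(k in J) a x k).
Proof.
move=> ma a0.
apply: (@eq_measurable_fun _ _ _ _ _ (fun x => \sum_(0 <= k <oo | k \in J) a x k)).
  by move=> x /set_mem Dx; rewrite esum_series// => k; exact: a0.
by apply: ge0_emeasurable_sum => [k x Dx /set_mem|k /set_mem]; [exact: a0|exact: ma].
Qed.

Lemma esum_le_comb (f g1 g2 : nat -> R) (c1 c2 : R) : (0 <= c1)%R -> (0 <= c2)%R ->
  (forall k, J k -> (0 <= g1 k)%R) -> (forall k, J k -> (0 <= g2 k)%R) ->
  (forall k, J k -> (f k <= c1 * g1 k + c2 * g2 k)%R) ->
  \esum_(k in J) (f k)%:E <=
    c1%:E * (\esum_(k in J) (g1 k)%:E) + c2%:E * (\esum_(k in J) (g2 k)%:E).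
Proof.
move=> c10 c20 g10 g20 h.
rewrite (@esum_series (fun k => (g1 k)%:E))// (@esum_series (fun k => (g2 k)%:E))//.
rewrite -!nneseriesZl; try by move=> k /set_mem ?; rewrite lee_fin; auto.
have e1 k : J k -> 0 <= c1%:E * (g1 k)%:E by move=> Jk; rewrite -EFinM lee_fin mulr_ge0// g10.
have e2 k : J k -> 0 <= c2%:E * (g2 k)%:E by move=> Jk; rewrite -EFinM lee_fin mulr_ge0// g20.
rewrite -!esum_series// -esumD//; apply: le_esum => k Jk.
by rewrite -!EFinM -EFinD lee_fin h.
Qed.

Lemma integral_esum_le_comb (f g1 g2 : T -> nat -> R) (c1 c2 : R) :
  (forall k, J k -> measurable_fun D (f^~ k)) -> (forall k, J k -> measurable_fun D (g1^~ k)) ->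
  (forall k, J k -> measurable_fun D (g2^~ k)) -> (0 <= c1)%R -> (0 <= c2)%R ->
  (forall x k, (0 <= f x k)%R) -> (forall x k, (0 <= g1 x k)%R) -> (forall x k, (0 <= g2 x k)%R) ->
  (forall x k, D x -> J k -> (f x k <= c1 * g1 x k + c2 * g2 x k)%R) ->
  \int[mu]_(x in D) (\esum_(k in J) (f x k)%:E) <=
  c1%:E * \int[mu]_(x in D) (\esum_(k in J) (g1 x k)%:E) +
  c2%:E * \int[mu]_(x in D) (\esum_(k in J) (g2 x k)%:E).
Proof.
move=> mf mg1 mg2 c10 c20 f0 g10 g20 h.
have me (g : T -> nat -> R) : (forall k, J k -> measurable_fun D (g^~ k)) -> (forall x k, (0 <= g x k)%R) ->
    measurable_fun D (fun x => \esum_(k in J) (g x k)%:E).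
  move=> mg g0; apply: measurable_esum => [k Jk|x k _ _]; last by rewrite lee_fin.
  by apply/measurable_EFinP; exact: mg.
have ge (g : T -> nat -> R) : (forall x k, (0 <= g x k)%R) -> forall x, D x -> 0 <= \esum_(k in J) (g x k)%:E.
  by move=> g0 x _; apply: esum_ge0 => k _; rewrite lee_fin.
apply: integral_le_comb => //; try exact: me; try exact: ge.
by move=> x Dx; apply: esum_le_comb => // k Jk; exact: h.
Qed.

End IntegralComparison.

Section ElementaryOperations.
Context {R : realType} d (Omega : measurableType d) (P : probability Omega R).
Context {U H : hilbertType R} (W : cylindrical Omega U).
Implicit Type e : seq (nat * R * R * H).

Definition elem_map (O : H -> H) e : seq (nat * R * R * H) := [seq (x.1, O x.2) | x <- e].

Lemma elem_val_map O e s k : bounded_operator O -> elem_val (elem_map O e) s k = O (elem_val e s k).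
Proof.
move=> bO; rewrite /elem_val bop_sum// big_map; apply: eq_bigr => -[[[j a] b] h] _ /=.
by case: ifP => // _; rewrite bop0.
Qed.

Lemma elem_int_map O e w : bounded_operator O -> elem_int W (elem_map O e) w = O (elem_int W e w).
Proof.
move=> bO; rewrite /elem_int bop_sum// big_map; apply: eq_bigr => -[[[j a] b] h] _ /=.
by rewrite bopZ.
Qed.

Lemma elem_within_map u t O e : elem_within W u t e -> elem_within W u t (elem_map O e).
Proof. by move=> he j a b h /mapP[[[[j' a'] b'] h'] /he ? [-> -> -> _]]. Qed.

Lemma elem_val_cat e e' s k : elem_val (e ++ e') s k = elem_val e s k + elem_val e' s k.
Proof. by rewrite /elem_val big_cat. Qed.

Lemma elem_int_cat e e' w : elem_int W (e ++ e') w = elem_int W e w + elem_int W e' w.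
Proof. by rewrite /elem_int big_cat. Qed.

Lemma elem_within_cat u t e e' : elem_within W u t e -> elem_within W u t e' -> elem_within W u t (e ++ e').
Proof. by move=> he he' j a b h; rewrite mem_cat => /orP[/he|/he']. Qed.

Definition elem_sub e e' := e ++ elem_map -%R e'.

Lemma bop_opp : bounded_operator (-%R : H -> H).
Proof. by split; [move=> a x y; hring|exact: opp_continuous]. Qed.

Lemma elem_val_sub e e' s k : elem_val (elem_sub e e') s k = elem_val e s k - elem_val e' s k.
Proof. by rewrite elem_val_cat elem_val_map//; exact: bop_opp. Qed.

Lemma elem_int_sub e e' w : elem_int W (elem_sub e e') w = elem_int W e w - elem_int W e' w.
Proof. by rewrite elem_int_cat elem_int_map//; exact: bop_opp. Qed.

Lemma elem_within_sub u t e e' : elem_within W u t e -> elem_within W u t e' -> elem_within W u t (elem_sub e e').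
Proof. by move=> he he'; apply: elem_within_cat => //; exact: elem_within_map. Qed.

(** Truncation at time [u] clamps both end points. A term on the wrong side of [u] becomes an empty
    interval whose increment vanishes, so no case distinction on the list is needed. *)
Definition elem_lo (u : R) e : seq (nat * R * R * H) :=
  [seq (x.1.1.1, Num.min x.1.1.2 u, Num.min x.1.2 u, x.2) | x <- e].
Definition elem_hi (u : R) e : seq (nat * R * R * H) :=
  [seq (x.1.1.1, Num.max x.1.1.2 u, Num.max x.1.2 u, x.2) | x <- e].

Lemma elem_int_split u e w : elem_int W e w = elem_int W (elem_lo u e) w + elem_int W (elem_hi u e) w.
Proof.
rewrite /elem_int /elem_lo /elem_hi !big_map -big_split; apply: eq_bigr => -[[[j a] b] h] _ /=.
rewrite -scalerDl; congr (_ *: _).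
by case: (leP a u); case: (leP b u) => _ _; ring.
Qed.

Lemma elem_val_lo u e s k : s <= u -> elem_val (elem_lo u e) s k = elem_val e s k.
Proof.
move=> su; rewrite /elem_val big_map; apply: eq_bigr => -[[[j a] b] h] _ /=.
congr (if _ && _ then _ else _); rewrite le_min su andbT gt_min.
by have [ua|ua] := ltP u s; [rewrite ltNge su in ua|rewrite orbF].
Qed.

Lemma elem_val_hi u e s k : u < s -> elem_val (elem_hi u e) s k = elem_val e s k.
Proof.
move=> us; rewrite /elem_val big_map; apply: eq_bigr => -[[[j a] b] h] _ /=.
congr (if _ && _ then _ else _); rewrite gt_max us andbT le_max.
by rewrite (leNgt s u) us orbF.
Qed.

Lemma elem_within_lo (u t : R) e : 0 <= u -> elem_within W 0 t e -> elem_within W 0 u (elem_lo u e).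
Proof.
move=> u0 he j a b h /mapP[[[[j' a'] b'] h']] /he[? ? ? ?] /= [-> -> -> _].
by case: (leP a' u) => ?; case: (leP b' u) => ?; split => //; lra.
Qed.

Lemma elem_within_hi (u t : R) e : u <= t -> elem_within W 0 t e -> elem_within W u t (elem_hi u e).
Proof.
move=> ut he j a b h /mapP[[[[j' a'] b'] h']] /he[? ? ? ?] /= [-> -> -> _].
by case: (leP a' u) => ?; case: (leP b' u) => ?; split => //; lra.
Qed.

Lemma elem_val_within u t e s k : elem_within W u t e -> ~~ (u < s <= t) -> elem_val e s k = 0.
Proof.
move=> he /negP st; rewrite /elem_val big_seq big1// => -[[[j a] b] h] /he[_ ua _ bt].
case: ifPn => // /andP[_ /andP[as_ sb]]; exfalso; apply: st.
by rewrite (le_lt_trans ua)// (le_trans sb).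
Qed.

Lemma elem_val_borel (D : set (measurableTypeR R)) e k : separable_space H -> measurable D ->
  borel_on D (fun s : measurableTypeR R => elem_val e s k).
Proof.
move=> sepH mD; rewrite /elem_val; apply: borel_sum => // -[[[j a] b] h] _.
pose A : set (measurableTypeR R) := if j == k then `]a, b]%classic else set0.
rewrite (_ : (fun s => _) = (fun s => (\1_A s : R) *: h)).
  apply: borel_scale => //; apply: measurable_indic; rewrite /A.
  by case: ifP => // _; exact: measurable_itv.
apply/funext => s; rewrite indicE /A; case: (j == k) => /=; last by rewrite in_set0 scale0r.
by rewrite mem_setE in_itv/=; case: ifP => _; rewrite ?scale1r ?scale0r.
Qed.

End ElementaryOperations.

(** * Stochastic integrals and their laws *)

Section StochasticIntegrals.
Context {R : realType} d (Omega : measurableType d) (P : probability Omega R).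
Context {U H : hilbertType R} (F : R -> set (set Omega)) (W : cylindrical Omega U).
Hypothesis hW : cylindrical_wiener P F W.
Hypothesis sepH : separable_space H.
Local Notation mu := (@lebesgue_measure R).
Local Notation ms X := (\int[P]_w (`|X w| ^+ 2)%:E)%E.
Local Notation hs u t Phi :=
  (\int[mu]_(s in `]u, t]) (\esum_(k in wI W) (`|Phi s k| ^+ 2)%:E))%E.
Implicit Types (Phi Psi : R -> nat -> H) (e : seq (nat * R * R * H)).

Definition integrand (u t : R) Phi := forall k, wI W k ->
  borel_on (`]u, t] : set (measurableTypeR R)) (fun s : measurableTypeR R => Phi s k).

(* [Z] is a version of the integral of [Phi] over ]u, t]. *)
Definition sint (u t : R) Phi (Z : Omega -> H) :=
  [/\ borel_on setT Z, integrand u t Phi & forall eps : R, 0 < eps -> exists e,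
    [/\ elem_within W u t e, (hs u t (fun s k => (Phi s k - elem_val e s k)%R) <= eps%:E)%E &
        (ms (fun w => (Z w - elem_int W e w)%R) <= eps%:E)%E]].

Let mI (u t : R) : measurable (`]u, t]%classic : set (measurableTypeR R)).
Proof. exact: measurable_itv. Qed.

Lemma integrand_elem u t e : integrand u t (elem_val e).
Proof. by move=> k _; exact: elem_val_borel. Qed.

Lemma integrandB u t Phi Psi : integrand u t Phi -> integrand u t Psi ->
  integrand u t (fun s k => Phi s k - Psi s k).
Proof. by move=> h1 h2 k Jk; apply: borelB => //; [exact: h1|exact: h2]. Qed.

Lemma integrand_map u t Phi (O : H -> H) : bounded_operator O -> integrand u t Phi ->
  integrand u t (fun s k => O (Phi s k)).
Proof. by move=> bO h1 k Jk; apply: (borel_comp bO.2); exact: h1. Qed.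

Lemma sub_integrand u t u' t' Phi : u <= u' -> t' <= t -> integrand u t Phi -> integrand u' t' Phi.
Proof.
move=> uu' tt' h k Jk O oO.
rewrite (_ : _ `&` _ = (`]u', t'] : set (measurableTypeR R)) `&` (`]u, t] `&` (fun s => Phi s k) @^-1` O)).
  by apply: measurableI => //; exact: h.
apply/seteqP; split=> [s [h1 h2]|s [h1 [_ h2]]]; split => //; split => //.
by move: h1; rewrite /= !in_itv/= => /andP[a b]; rewrite (le_lt_trans uu')// (le_trans b).
Qed.

Lemma hs_le_comb u t Phi Psi1 Psi2 (c1 c2 : R) : integrand u t Phi -> integrand u t Psi1 ->
  integrand u t Psi2 -> 0 <= c1 -> 0 <= c2 ->
  (forall s k, u < s <= t -> wI W k ->
     `|Phi s k| ^+ 2 <= c1 * `|Psi1 s k| ^+ 2 + c2 * `|Psi2 s k| ^+ 2) ->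
  (hs u t Phi <= c1%:E * hs u t Psi1 + c2%:E * hs u t Psi2)%E.
Proof.
move=> h h1 h2 c10 c20 hc.
have mb Xi : integrand u t Xi -> forall k, wI W k ->
    measurable_fun (`]u, t] : set (measurableTypeR R)) (fun s : measurableTypeR R => `|Xi s k| ^+ 2).
  by move=> hXi k Jk; apply: (borel_continuous sepH _ continuous_norm2 (hXi k Jk)).
apply: integral_esum_le_comb => //; try (by move=> k; exact: mb).
Qed.

Lemma ms_le_comb (X Y1 Y2 : Omega -> H) (c1 c2 : R) : borel_on setT X -> borel_on setT Y1 ->
  borel_on setT Y2 -> 0 <= c1 -> 0 <= c2 ->
  (forall w, `|X w| ^+ 2 <= c1 * `|Y1 w| ^+ 2 + c2 * `|Y2 w| ^+ 2) ->
  (ms X <= c1%:E * ms Y1 + c2%:E * ms Y2)%E.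
Proof.
move=> bX b1 b2 c10 c20 h.
apply: integral_le_comb => //; try exact: borel_norm2.
by move=> w _; rewrite -!EFinM -EFinD lee_fin.
Qed.

Lemma hs_ge0 u t Phi : (0 <= hs u t Phi)%E.
Proof. by apply: integral_ge0 => s _; apply: esum_ge0 => k _; rewrite lee_fin sqr_ge0. Qed.

Lemma elem_isometry u t e : 0 <= u -> elem_within W u t e ->
  (ms (elem_int W e) <= gauss_const%:E * hs u t (elem_val e))%E.
Proof.
move=> u0 he; have he0 : elem_within W 0 t e.
  by move=> j a b h /he[? ? ? ?]; split => //; exact: le_trans u0 _.
apply: le_trans (elem_second_moment hW sepH he0) _.
rewrite le_eqVlt; apply/orP; left; apply/eqP; congr (_ * _)%E.
rewrite integral_mkcond [RHS]integral_mkcond; apply: eq_integral => s _; rewrite !patchE.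
have [us|us] := boolP (u < s <= t).
  rewrite !ifT// !inE/= in_itv//=; move: us => /andP[us ->].
  by rewrite (le_trans u0 (ltW us)).
rewrite [RHS]ifF; last by apply/negbTE; rewrite notin_setE/= in_itv/=; exact/negP.
by case: ifP => // _; apply: esum1 => k _; rewrite (elem_val_within k he us) normr0 expr0n.
Qed.

(** Lets the isometry be proved without knowing beforehand that the energy [x] of the integrand is
    finite: when it is infinite the bound is trivial. *)
Lemma ereal_le_eps (a x : \bar R) (c K : R) : 0 < c -> 0 <= K -> (0 <= x)%E ->
  (forall eps : R, 0 < eps -> (a <= c%:E * x + (K * eps)%:E)%E) -> (a <= c%:E * x)%E.
Proof.
move=> c0 K0; case: x => [x _ h| _ _|//]; last by rewrite gt0_muley ?leey ?lte_fin.
apply/lee_addgt0Pr => e e0; apply: le_trans (h (e / (K + 1)) _) _.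
  by rewrite divr_gt0// ltr_wpDl.
rewrite leeD2l// lee_fin mulrA ler_pdivrMr ?ltr_wpDl//.
by rewrite mulrC ler_pM2l// lerDl.
Qed.

Lemma gauss_const_gt0 : 0 < gauss_const :> R.
Proof. by rewrite mulr_gt0// expR_gt0. Qed.

(** The isometry passes to the limit. The factor 4 comes from splitting squares twice, once for [Z]
    and once for the integrand. *)
Lemma sint_ms u t Phi Z : 0 <= u -> sint u t Phi Z ->
  (ms Z <= (4 * gauss_const)%:E * hs u t Phi)%E.
Proof.
move=> u0 [bZ mPhi hZ]; have g0 := gauss_const_gt0.
apply: (@ereal_le_eps _ _ _ (2 + 4 * gauss_const)).
- by rewrite mulr_gt0.
- by rewrite addr_ge0// mulr_ge0// ltW.
- exact: hs_ge0.
move=> eps /hZ[e [he h1 h2]].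
have be : borel_on setT (elem_int W e).
  by apply: (elem_int_measurable hW sepH (t := t)) => j a b h /he[? ? ? ?]; split => //; exact: le_trans u0 _.
have h3 : (ms Z <= 2%:E * ms (fun w => (Z w - elem_int W e w)%R) + 2%:E * ms (elem_int W e))%E.
  apply: ms_le_comb => //; first exact: borelB.
  by move=> w; rewrite -{1}(subrK (elem_int W e w) (Z w)); exact: sqr_normD_le.
have h4 : (hs u t (elem_val e) <= 2%:E * hs u t Phi + 2%:E * hs u t (fun s k => (Phi s k - elem_val e s k)%R))%E.
  apply: hs_le_comb => //; [exact: integrand_elem|by apply: integrandB => //; exact: integrand_elem|].
  move=> s k _ _; have := sqr_normD_le (Phi s k) (elem_val e s k - Phi s k).
  by rewrite addrC subrK (distrC (Phi s k)).
have h5 := elem_isometry u0 he.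
have := hs_ge0 u t Phi; move: (hs u t Phi) h4 => x h4 x0.
have h6 : (ms (elem_int W e) <= gauss_const%:E * (2%:E * x + (2 * eps)%:E))%E.
  apply: le_trans h5 _; rewrite lee_pmul2l ?lte_fin//; apply: le_trans h4 _; rewrite leeD2l// EFinM.
  by rewrite lee_pmul2l ?lte_fin.
have h7 : (ms Z <= (2 * eps)%:E + 2%:E * (gauss_const%:E * (2%:E * x + (2 * eps)%:E)))%E.
  apply: le_trans h3 _; apply: leeD; first by rewrite EFinM lee_pmul2l ?lte_fin.
  by rewrite lee_pmul2l ?lte_fin.
apply: le_trans h7 _; case: x x0 {h4 h6} => [x x0| _|//].
  by rewrite -!EFinM -!EFinD -?EFinM -?EFinD lee_fin; lra.
by rewrite [X in (_ <= X + _)%E]gt0_muley ?lte_fin ?mulr_gt0// addye// leey.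
Qed.

Lemma sintB u t Phi Psi Z Z' : 0 <= u -> sint u t Phi Z -> sint u t Psi Z' ->
  sint u t (fun s k => Phi s k - Psi s k) (fun w => Z w - Z' w).
Proof.
move=> u0 [bZ mPhi hZ] [bZ' mPsi hZ']; split; [exact: borelB|exact: integrandB|].
move=> eps e0; have e4 : 0 < eps / 4 by rewrite divr_gt0.
have [e [he h1 h2]] := hZ _ e4; have [e' [he' h1' h2']] := hZ' _ e4.
have be e1 : elem_within W u t e1 -> borel_on setT (elem_int W e1).
  by move=> h; apply: (elem_int_measurable hW sepH (t := t)) => j a b x /h[? ? ? ?]; split => //; exact: le_trans u0 _.
have E4 : (eps%:E = 2%:E * (eps / 4)%:E + 2%:E * (eps / 4)%:E)%E.
  by rewrite -EFinM -EFinD; congr EFin; field.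
have bnd (x y z : H) : `|x - z| ^+ 2 <= 2 * `|x - y| ^+ 2 + 2 * `|z - y| ^+ 2.
  by have := sqr_normD_le (x - y) (y - z); rewrite addrA subrK (distrC y z).
exists (elem_sub e e'); split; first exact: elem_within_sub.
- apply: (@le_trans _ _ (2%:E * hs u t (fun s k => (Phi s k - elem_val e s k)%R) +
     2%:E * hs u t (fun s k => (Psi s k - elem_val e' s k)%R))%E); last first.
    by rewrite [X in (_ <= X)%E]E4 leeD// lee_pmul2l ?lte_fin.
  apply: hs_le_comb => //; do ?[exact: integrand_elem|apply: integrandB => //].
  move=> s k _ _; rewrite elem_val_sub.
  rewrite (_ : _ - _ = (Phi s k - elem_val e s k) - (Psi s k - elem_val e' s k)); last by hring.
  by have := bnd (Phi s k - elem_val e s k) 0 (Psi s k - elem_val e' s k); rewrite !subr0.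
- apply: (@le_trans _ _ (2%:E * ms (fun w => (Z w - elem_int W e w)%R) +
     2%:E * ms (fun w => (Z' w - elem_int W e' w)%R))%E); last first.
    by rewrite [X in (_ <= X)%E]E4 leeD// lee_pmul2l ?lte_fin.
  have bs : borel_on setT (elem_int W (elem_sub e e')) by apply: be; exact: elem_within_sub.
  apply: ms_le_comb => //; do ?[exact: be|apply: borelB => //].
  move=> w; rewrite elem_int_sub.
  rewrite (_ : _ - _ = (Z w - elem_int W e w) - (Z' w - elem_int W e' w)); last by hring.
  by have := bnd (Z w - elem_int W e w) 0 (Z' w - elem_int W e' w); rewrite !subr0.
Qed.

Lemma sint_map u t Phi Z (O : H -> H) : 0 <= u -> bounded_operator O -> sint u t Phi Z ->
  sint u t (fun s k => O (Phi s k)) (O \o Z).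
Proof.
move=> u0 bO [bZ mPhi hZ]; split; [exact: (borel_comp bO.2)|exact: integrand_map|].
have [C C0 hC] := bop_bound bO.
have hC2 x : `|O x| ^+ 2 <= C ^+ 2 * `|x| ^+ 2 + 0 * `|x| ^+ 2.
  by rewrite mul0r addr0 -exprMn ler_sqr ?nnegrE ?mulr_ge0.
move=> eps e0; have e4 : 0 < eps / (C ^+ 2 + 1) by rewrite divr_gt0// ltr_wpDl ?sqr_ge0.
have [e [he h1 h2]] := hZ _ e4.
have be e1 : elem_within W u t e1 -> borel_on setT (elem_int W e1).
  by move=> h; apply: (elem_int_measurable hW sepH (t := t)) => j a b x /h[? ? ? ?]; split => //; exact: le_trans u0 _.
have E4 : ((C ^+ 2)%:E * (eps / (C ^+ 2 + 1))%:E <= eps%:E)%E.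
  rewrite -EFinM lee_fin mulrA ler_pdivrMr ?ltr_wpDl ?sqr_ge0//.
  by rewrite mulrC ler_pM2l// lerDl.
exists (elem_map O e); split; first exact: elem_within_map.
- apply: le_trans E4; apply: (@le_trans _ _ ((C ^+ 2)%:E * hs u t (fun s k => (Phi s k - elem_val e s k)%R) +
     0%:E * hs u t (fun s k => (Phi s k - elem_val e s k)%R))%E); last first.
    by rewrite mul0e adde0 lee_wpmul2l// lee_fin sqr_ge0.
  apply: hs_le_comb; rewrite ?sqr_ge0//; do ?[exact: integrand_elem|exact: integrand_map|apply: integrandB => //].
  by move=> s k _ _; rewrite elem_val_map// -(bopB bO).
- apply: le_trans E4; apply: (@le_trans _ _ ((C ^+ 2)%:E * ms (fun w => (Z w - elem_int W e w)%R) +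
     0%:E * ms (fun w => (Z w - elem_int W e w)%R))%E); last first.
    by rewrite mul0e adde0 lee_wpmul2l// lee_fin sqr_ge0.
  have bs : borel_on setT (elem_int W (elem_map O e)) by apply: be; exact: elem_within_map.
  apply: ms_le_comb; rewrite ?sqr_ge0//; do ?[exact: be|exact: (borel_comp bO.2)|apply: borelB => //].
  by move=> w; rewrite elem_int_map// -(bopB bO).
Qed.

Lemma ms_eq0 (X : Omega -> H) : borel_on setT X -> (ms X <= 0)%E -> {ae P, forall w, X w = 0}.
Proof.
move=> bX X0; have mX := borel_norm2 sepH measurableT bX.
have /(ae_eq_integral_abs P measurableT mX) : (\int[P]_w `|(`|X w| ^+ 2)%:E| = 0)%E.
  apply/eqP; rewrite eq_le integral_ge0// andbT; apply: le_trans X0.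
  by rewrite le_eqVlt; apply/orP; left; apply/eqP; apply: eq_integral => w _; rewrite gee0_abs// lee_fin sqr_ge0.
apply: filterS => w /(_ I) /= [] /eqP; rewrite sqrf_eq0 normr_eq0 => /eqP. exact.
Qed.

(** The difference is an integral of zero. This allows two solutions to be written with one common
    stochastic convolution. *)
Lemma sint_uniq u t Phi Z Z' : 0 <= u -> sint u t Phi Z -> sint u t Phi Z' ->
  {ae P, forall w, Z w = Z' w}.
Proof.
move=> u0 hZ hZ'; have hB := sintB u0 hZ hZ'.
have : {ae P, forall w, Z w - Z' w = 0}.
  have [bB _ _] := hB; apply: (ms_eq0 bB); apply: le_trans (sint_ms u0 hB) _.
  rewrite [X in (_ * X)%E]integral0_eq ?mule0// => s _; apply: esum1 => k _.
  by rewrite subrr normr0 expr0n.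
by apply: filterS => w /eqP; rewrite subr_eq0 => /eqP.
Qed.

Lemma hs_le_itv u t u' t' Phi : u <= u' -> t' <= t -> integrand u t Phi -> (hs u' t' Phi <= hs u t Phi)%E.
Proof.
move=> uu' tt' hPhi; apply: ge0_subset_integral => //.
- apply: measurable_esum => [k Jk|s k _ _]; last by rewrite lee_fin sqr_ge0.
  by apply/measurable_EFinP; apply: (borel_continuous sepH _ continuous_norm2 (hPhi k Jk)).
- by move=> s _; apply: esum_ge0 => k _; rewrite lee_fin sqr_ge0.
- by move=> s; rewrite /= !in_itv/= => /andP[a b]; rewrite (le_lt_trans uu')// (le_trans b).
Qed.

(** The part before [u] of an approximation of [Z] also approximates [Z'], by [sint_ms] applied to
    their difference; what remains is the part after [u]. The constant [K] collects [2] for [Z] and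
    [2 * 4 * gauss_const] for [Z']. *)
Lemma sint_increment u t Phi Z Z' : 0 <= u -> u <= t -> sint 0 t Phi Z -> sint 0 u Phi Z' ->
  sint u t Phi (fun w => Z w - Z' w).
Proof.
move=> u0 ut [bZ mPhi hZ] [bZ' mPhi' hZ']; split; [exact: borelB|exact: sub_integrand mPhi|].
move=> eps e0; pose K := 2 + 8 * gauss_const : R.
have g0 := gauss_const_gt0.
have K0 : 0 < K by rewrite addr_gt0// mulr_gt0.
have [e [he h1 h2]] := hZ _ (divr_gt0 e0 K0); set eps' := eps / K in h1 h2.
have e'0 : 0 < eps' by exact: divr_gt0.
have be t1 e1 : elem_within W 0 t1 e1 -> borel_on setT (elem_int W e1).
  by move=> h; exact: (elem_int_measurable hW sepH h).
exists (elem_hi u e); split; first exact: elem_within_hi.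
- apply: (@le_trans _ _ (hs u t (fun s k => (Phi s k - elem_val e s k)%R))%E).
    rewrite le_eqVlt; apply/orP; left; apply/eqP; apply: eq_integral => s.
    rewrite inE/= in_itv/= => /andP[us st]; apply: eq_esum => k _; by rewrite elem_val_hi.
  apply: le_trans (hs_le_itv u0 (lexx t) _) _; first by apply: integrandB => //; exact: integrand_elem.
  apply: le_trans h1 _; rewrite lee_fin ler_pdivrMr// ler_peMr ?ltW//.
  by rewrite /K; lra.
have hlo := elem_within_lo u0 he.
have sZ' : sint 0 u Phi Z' by [].
have sE : sint 0 u (elem_val (elem_lo u e)) (elem_int W (elem_lo u e)).
  split; [exact: be hlo|exact: integrand_elem|].
  move=> eta eta0; exists (elem_lo u e); split => //.
    rewrite integral0_eq ?lee_fin ?ltW// => s _; apply: esum1 => k _.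
    by rewrite subrr normr0 expr0n.
  rewrite integral0_eq ?lee_fin ?ltW// => w _.
  by rewrite subrr normr0 expr0n.
have sB := sintB (lexx 0) sZ' sE.
have h3 : (ms (fun w => (Z' w - elem_int W (elem_lo u e) w)%R) <= (4 * gauss_const)%:E * eps'%:E)%E.
  apply: le_trans (sint_ms (lexx 0) sB) _; apply: lee_wpmul2l.
    by rewrite lee_fin mulr_ge0// ltW.
  have -> : (hs 0%R u (fun s k => (Phi s k - elem_val (elem_lo u e) s k)%R) =
      hs 0%R u (fun s k => (Phi s k - elem_val e s k)%R))%E.
    apply: eq_integral => s.
    by rewrite inE/= in_itv/= => /andP[us st]; apply: eq_esum => k _; rewrite elem_val_lo.
  by apply: le_trans h1; apply: hs_le_itv => //; apply: integrandB => //; exact: integrand_elem.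
apply: (@le_trans _ _ (2%:E * ms (fun w => (Z w - elem_int W e w)%R) +
     2%:E * ms (fun w => (Z' w - elem_int W (elem_lo u e) w)%R))%E).
  have b1 := be _ _ he; have b2 := be _ _ hlo.
  have b3 : borel_on setT (elem_int W (elem_hi u e)).
    apply: (be t) => j a b h hin.
    by have [? ? ? ?] := elem_within_hi ut he hin; split => //; exact: le_trans u0 _.
  apply: ms_le_comb => //; do ?[apply: borelB => //].
  move=> w; have := sqr_normD_le (Z w - elem_int W e w) (elem_int W (elem_lo u e) w - Z' w).
  rewrite (distrC _ (Z' w)); congr (`|_| ^+ 2 <= _).
  by rewrite (elem_int_split W u e w); hring.
apply: (@le_trans _ _ (2%:E * eps'%:E + 2%:E * ((4 * gauss_const)%:E * eps'%:E))%E).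
  by apply: leeD; rewrite lee_pmul2l ?lte_fin.
rewrite -!EFinM -EFinD lee_fin.
have -> : 2 * eps' + 2 * (4 * gauss_const * eps') = eps' * K by rewrite /K; ring.
by rewrite /eps' mulfVK ?gt_eqF.
Qed.

Lemma cvge0_le (x : nat -> \bar R) (eps : R) : x n @[n --> \oo] --> 0%E -> (forall n, 0 <= x n)%E -> 0 < eps ->
  \forall n \near \oo, (x n <= eps%:E)%E.
Proof.
move=> /fine_cvgP[fx] /cvgrPdist_le/(_ eps) h x0 e0; near=> n.
have fn : x n \is a fin_num by near: n.
have : `|0 - fine (x n)| <= eps by near: n; exact: h.
by rewrite sub0r normrN ger0_norm ?fine_ge0// -lee_fin fineK.
Unshelve. all: by end_near. Qed.

Lemma stoch_integral_sint t (Phi : R -> U -> H) Z : (forall k, wI W k ->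
    borel_on (`[0, t] : set (measurableTypeR R)) (fun s : measurableTypeR R => Phi s (wg W k))) ->
  stoch_integral P W t Phi Z -> sint 0 t (fun s k => Phi s (wg W k)) Z.
Proof.
move=> mPhi [bZ [e [he h1 h2]]].
have mPhi' : integrand 0 t (fun s k => Phi s (wg W k)).
  move=> k Jk O oO.
  rewrite (_ : _ `&` _ = (`]0, t] : set (measurableTypeR R)) `&` (`[0, t] `&` (fun s => Phi s (wg W k)) @^-1` O)).
    by apply: measurableI => //; exact: mPhi.
  apply/seteqP; split=> [s [s1 s2]|s [s1 [_ s2]]]; split => //; split => //.
  by move: s1; rewrite /= !in_itv/= => /andP[/ltW -> ->].
split => //; first by move=> O oO; rewrite setTI; exact: bZ.
move=> eps e0.
have a1 n : (0 <= \int[mu]_(s in `[0%R, t]) (\esum_(k in wI W) (`|Phi s (wg W k) - elem_val (e n) s k| ^+ 2)%:E))%E.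
  by apply: integral_ge0 => s _; apply: esum_ge0 => k _; rewrite lee_fin sqr_ge0.
have a2 n : (0 <= 'E_P[fun w => (`|Z w - elem_int W (e n) w| ^+ 2)%R])%E.
  by rewrite unlock; apply: integral_ge0 => w _; rewrite lee_fin sqr_ge0.
have [n _ /(_ n (leqnn n))[n1 n2]] := filterI (cvge0_le h1 a1 e0) (cvge0_le h2 a2 e0).
have hen : elem_within W 0 t (e n) by move=> j a b h /he.
exists (e n); split => //; last by rewrite unlock in n2.
apply: le_trans n1; apply: ge0_subset_integral => //; last 2 first.
- by move=> s _; apply: esum_ge0 => k _; rewrite lee_fin sqr_ge0.
- by move=> s; rewrite /= !in_itv/= => /andP[/ltW -> ->].
have mI' : measurable (`[0, t]%classic : set (measurableTypeR R)) by exact: measurable_itv.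
apply: measurable_esum => [k Jk|s k _ _]; last by rewrite lee_fin sqr_ge0.
apply/measurable_EFinP; apply: (borel_continuous sepH _ continuous_norm2) => //.
by apply: borelB => //; [exact: mPhi|exact: elem_val_borel].
Qed.

End StochasticIntegrals.

Section IndependentMean.
Context {R : realType} d (Omega : measurableType d) (P : probability Omega R).
Context {E : normedModType R} (sepE : separable_space E).

Lemma borel_pullback d1 d2 (T1 : measurableType d1) (T2 : measurableType d2) (p : T1 -> T2) (X : T2 -> E) :
  measurable_fun setT p -> borel_on setT X -> borel_on setT (X \o p).
Proof.
by move=> mp bX O oO; have := mp measurableT _ (bX O oO); rewrite !setTI.
Qed.

Lemma EFin_Rintegral (f : Omega -> R) (C : R) : measurable_fun setT f -> (forall w, `|f w| <= C) ->
  (\int[P]_w (f w)%:E)%E = (\int[P]_w f w)%:E.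
Proof.
move=> mf fC; rewrite /Rintegral fineK//.
exact: (integrable_fin_num measurableT (integrable_bounded P mf fC)).
Qed.

(** Freezing of the variable that is known: [Omega] is used twice as a measurable space, once with
    each of the two independent sigma-algebras. Adding [C] to [f] makes Tonelli's theorem
    applicable. *)
Lemma fubini_mean (S1 S2 : set (set Omega)) (A : set Omega) (V Y : Omega -> E) (f : E -> R) (C : R) :
  S1 `<=` measurable -> S2 `<=` measurable -> indep2 P <<s S1 >> <<s S2 >> -> <<s S1 >> A ->
  borel_on setT (V : g_sigma_algebraType S1 -> E) ->
  borel_on setT (Y : g_sigma_algebraType S2 -> E) ->
  continuous f -> (forall x, `|f x| <= C) ->
  \int[P]_w (\1_A w * f (V w + Y w)) = \int[P]_w (\1_A w * \int[P]_w' f (V w + Y w')).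
Proof.
move=> S1m S2m ind SA bV bY cf fC.
pose T1 := g_sigma_algebraType S1; pose T2 := g_sigma_algebraType S2.
have s1 : <<s S1 >> `<=` measurable by apply: smallest_sub => //; exact: sigma_algebra_measurable.
have s2 : <<s S2 >> `<=` measurable by apply: smallest_sub => //; exact: sigma_algebra_measurable.
have C0 : 0 <= C by apply: le_trans (fC 0).
have mid1 : measurable_fun setT (id : Omega -> T1) by move=> _ B mB; rewrite setTI; exact: s1.
have mid2 : measurable_fun setT (id : Omega -> T2) by move=> _ B mB; rewrite setTI; exact: s2.
pose Phi (z : T1 * T2) : \bar R := (\1_A z.1 * (f (V z.1 + Y z.2) + C))%:E.
have bV' : borel_on setT (fun z : T1 * T2 => V z.1) by exact: (borel_pullback measurable_fst bV).
have bY' : borel_on setT (fun z : T1 * T2 => Y z.2) by exact: (borel_pullback measurable_snd bY).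
have mA : measurable A by exact: s1.
have mPhi : measurable_fun setT Phi.
  apply/measurable_EFinP; apply: measurable_funM.
    apply: (measurableT_comp _ measurable_fst); apply: measurable_indic.
    exact: SA.
  apply: measurable_funD; last exact: measurable_cst.
  exact: (borel_continuous sepE measurableT cf (borelD sepE measurableT bV' bY')).
have fD x : 0 <= f x + C by have := fC x; rewrite ler_norml; lra.
have Phi0 z : (0 <= Phi z)%E by rewrite lee_fin mulr_ge0.
have := @fubini_indep R d Omega P _ _ T1 T2 id id Phi mid1 mid2 ind mPhi Phi0.
rewrite /Phi /=.
have bVO : borel_on setT V by move=> O oO; exact: s1 (bV O oO).
have bYO : borel_on setT Y by move=> O oO; exact: s2 (bY O oO).
have mf x : measurable_fun setT (fun w => f (x + Y w)).
  by apply: (borel_continuous sepE measurableT cf); apply: borelD => //; exact: borel_cst.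
have m1 : measurable_fun setT (\1_A : Omega -> R) by exact: measurable_indic.
have mfV : measurable_fun setT (fun w => f (V w + Y w)).
  by apply: (borel_continuous sepE measurableT cf); exact: borelD.
have i1 w : `|\1_A w : R| <= 1 by rewrite indicE; case: (_ \in _); rewrite ?normr0 ?normr1.
pose g x := \int[P]_w' f (x + Y w').
have gC x : `|g x| <= C by apply: Rint_le_bound => // w; exact: fC.
have mfC x : measurable_fun setT (fun w => f (x + Y w) + C).
  by apply: measurable_funD => //; exact: measurable_cst.
have fC2 x w : `|f (x + Y w) + C| <= 2 * C.
  by apply: le_trans (ler_normD _ _) _; rewrite (ger0_norm C0); have := fC (x + Y w); lra.
have RC x : \int[P]_w (f (x + Y w) + C) = g x + C.
  rewrite RintegralD ?Rint_cst//.
  - exact: (@integrable_bounded _ _ _ P _ C).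
  - by apply: (@integrable_bounded _ _ _ P _ C) => [|w']; [exact: measurable_cst|rewrite ger0_norm].
have inner w : (\int[P]_w' (\1_A w * (f (V w + Y w') + C))%:E = (\1_A w * (g (V w) + C))%:E)%E.
  rewrite (@EFin_Rintegral _ (2 * C)); last 2 first.
  - by apply: measurable_funM => //; exact: measurable_cst.
  - by move=> w'; rewrite normrM -[2 * C]mul1r; apply: ler_pM.
  congr EFin; rewrite RintegralZl ?RC//.
  exact: (@integrable_bounded _ _ _ P _ (2 * C)).
under [in RHS]eq_integral do rewrite inner.
have mgV : measurable_fun setT (fun w => \1_A w * (g (V w) + C)).
  have mF := @measurable_fun_fubini_tonelli_F _ _ T1 Omega R P
    (fun z : T1 * Omega => (f (V z.1 + Y z.2) + C)%:E).
  have : measurable_fun setT (fun w : T1 => \int[P]_w' (f (V w + Y w') + C)%:E)%E.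
    apply: mF => [|z]; last by rewrite lee_fin.
    have bV2 : borel_on setT (fun z : T1 * Omega => V z.1) by exact: (borel_pullback measurable_fst bV).
    have bY2 : borel_on setT (fun z : T1 * Omega => Y z.2) by exact: (borel_pullback measurable_snd bYO).
    apply/measurable_EFinP; apply: measurable_funD; last exact: measurable_cst.
    exact: (borel_continuous sepE measurableT cf (borelD sepE measurableT bV2 bY2)).
  rewrite (_ : (fun w => _) = EFin \o (fun w => g (V w) + C)); last first.
    by apply/funext => w /=; rewrite (@EFin_Rintegral _ (2 * C))// RC.
  move=> /measurable_EFinP mg; apply: measurable_funM => // _ B mB.
  by rewrite setTI; apply: s1; rewrite -[X in <<s _ >> X]setTI; exact: mg.
have gD w : `|g (V w) + C| <= 2 * C.
  by apply: le_trans (ler_normD _ _) _; rewrite (ger0_norm C0); have := gC (V w); lra.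
have fD2 w : `|f (V w + Y w) + C| <= 2 * C.
  by apply: le_trans (ler_normD _ _) _; rewrite (ger0_norm C0); have := fC (V w + Y w); lra.
rewrite (@EFin_Rintegral _ (2 * C)); last 2 first.
- by apply: measurable_funM => //; apply: measurable_funD => //; exact: measurable_cst.
- by move=> w; rewrite normrM -[2 * C]mul1r; apply: ler_pM.
rewrite (@EFin_Rintegral _ (2 * C)); last 2 first.
- by [].
- by move=> w; rewrite normrM -[2 * C]mul1r; apply: ler_pM.
move=> [].
have iC : P.-integrable setT (EFin \o (fun w => \1_A w * C)).
  apply: (@integrable_bounded _ _ _ P _ C) => [|w]; first by apply: measurable_funM => //; exact: measurable_cst.
  by rewrite normrM (ger0_norm C0) -[leRHS]mul1r; apply: ler_pM.
have mgV' : measurable_fun setT (fun w => \1_A w * g (V w)).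
  rewrite (_ : (fun w => _) = (fun w => \1_A w * (g (V w) + C) - \1_A w * C)); last by apply/funext => w; ring.
  by apply: measurable_funB => //; apply: measurable_funM => //; exact: measurable_cst.
under eq_Rintegral do rewrite mulrDr.
under [in RHS]eq_Rintegral do rewrite mulrDr.
rewrite RintegralD//; last first.
  apply: (@integrable_bounded _ _ _ P _ C) => [|w]; first exact: measurable_funM.
  by rewrite normrM -[leRHS]mul1r; apply: ler_pM.
rewrite RintegralD//; last first.
  apply: (@integrable_bounded _ _ _ P _ C) => [|w]; first by [].
  by rewrite normrM -[leRHS]mul1r; apply: ler_pM.
by move/addIr.
Qed.

End IndependentMean.

Section LawOfStochasticIntegrals.
Context {R : realType} d (Omega : measurableType d) (P : probability Omega R).
Context {U H : hilbertType R} (F : R -> set (set Omega)) (W : cylindrical Omega U).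
Hypothesis hN : normal_filtration P F.
Hypothesis hW : cylindrical_wiener P F W.
Hypothesis sepH : separable_space H.
Local Notation mu := (@lebesgue_measure R).
Local Notation ms X := (\int[P]_w (`|X w| ^+ 2)%:E)%E.
Local Notation hs u t Phi :=
  (\int[mu]_(s in `]u, t]) (\esum_(k in wI W) (`|Phi s k| ^+ 2)%:E))%E.
Local Notation qs u t Phi y :=
  (\int[mu]_(s in `]u, t]) (\esum_(k in wI W) (dot (Phi s k) y ^+ 2)%:E))%E.
Implicit Types (Phi Psi : R -> nat -> H) (e : seq (nat * R * R * H)).

Lemma ucont_measurable (f : H -> R) (X : Omega -> H) : ucont f -> borel_on setT X ->
  measurable_fun setT (f \o X).
Proof. by move=> /ucont_continuous cf; exact: (borel_continuous sepH measurableT cf). Qed.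

Lemma ucont_mean (f : H -> R) (C : R) (Z : Omega -> H) : ucont f -> (forall x, `|f x| <= C) ->
  borel_on setT Z -> ucont (fun x => \int[P]_w f (x + Z w)).
Proof.
move=> uf fC bZ eta /uf[c c0 hc]; exists c => // x y.
have m z : measurable_fun setT (fun w => f (z + Z w)).
  by apply: (ucont_measurable uf); apply: borelD => //; exact: borel_cst.
rewrite -RintegralB//; try exact: (@integrable_bounded _ _ _ P _ C).
apply: Rint_le_bound => [|w]; first exact: measurable_funB.
by apply: le_trans (hc _ _) _; rewrite opprD addrACA subrr addr0.
Qed.

Lemma elem_int_borel_within u t e : 0 <= u -> elem_within W u t e -> borel_on setT (elem_int W e).
Proof.
move=> u0 he; apply: (elem_int_measurable hW sepH (t := t)) => j a b h /he[? ? ? ?].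
by split => //; exact: le_trans u0 _.
Qed.

Lemma filtration_measurable u : 0 <= u -> F u `<=` measurable /\ <<s F u >> = F u.
Proof.
by have [/(_ u) h _ _ _] := hN; move=> /h[sF Fm]; split => //; exact: sigma_algebra_id.
Qed.

(* Conditionally on the past of [u], an integral over ]u, t] is averaged out. *)
Lemma sint_mean u t Phi Z (A : set Omega) (V : Omega -> H) (f : H -> R) (C : R) :
  0 <= u -> sint P W u t Phi Z -> F u A -> borel_on setT (V : g_sigma_algebraType (F u) -> H) ->
  ucont f -> (forall x, `|f x| <= C) ->
  \int[P]_w (\1_A w * f (V w + Z w)) = \int[P]_w (\1_A w * \int[P]_w' f (V w + Z w')).
Proof.
move=> u0 [bZ _ hZ] FA bV uf fC; apply/eqP; rewrite -subr_eq0 -normr_eq0 eq_le normr_ge0 andbT.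
apply/ler_addgt0Pr => eta eta0; rewrite add0r.
have [Fm sF] := filtration_measurable u0.
have [c c0 hc] := uf (eta / 4) ltac:(by rewrite divr_gt0).
have e0 : 0 < eta / (4 * (c + 1)) by rewrite divr_gt0// mulr_gt0// ltr_wpDl.
have [e [he _ hms]] := hZ _ e0; set eps := eta / _ in e0 hms.
have ceps : c * eps <= eta / 4.
  rewrite /eps mulrA ler_pdivrMr ?mulr_gt0// ?ltr_wpDl//.
  by rewrite [leRHS](_ : _ = eta * c + eta); [rewrite mulrC lerDl ltW|field].
have be := elem_int_borel_within u0 he.
have mA : measurable A by exact: Fm.
have m1 : measurable_fun setT (\1_A : Omega -> R) by exact: measurable_indic.
have i1 w : `|\1_A w : R| <= 1 by rewrite indicE; case: (_ \in _); rewrite ?normr0 ?normr1.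
have bV' : borel_on setT V by move=> O oO; apply: Fm; rewrite -sF; exact: bV.
have fS : future_sets W u `<=` measurable.
  move=> B [q [D [[Jq uq] mD ->]]]; rewrite -[X in measurable X]setTI.
  by apply: measurable_funB => //; apply: (wb_measurable hW) => //; exact: le_trans uq.
have [_ _ _ _ /(_ u u0) ind] := hW.
have ind' : indep2 P <<s F u >> <<s future_sets W u >> by rewrite sF; exact: ind.
have Am : <<s F u >> A by rewrite sF.
have := fubini_mean sepH Fm fS ind' Am bV (elem_int_future sepH he) (ucont_continuous uf) fC.
have im (k : Omega -> R) : measurable_fun setT k -> (forall w, `|k w| <= C) ->
    P.-integrable setT (EFin \o (fun w => \1_A w * k w)).
  move=> mk kC; apply: (@integrable_bounded _ _ _ P _ C) => [|w]; first exact: measurable_funM.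
  by rewrite normrM -[leRHS]mul1r; apply: ler_pM.
have bd (Y : Omega -> H) : borel_on setT Y -> forall x, `|\int[P]_w f (x + Y w)| <= C.
  move=> bY x; apply: Rint_le_bound => //.
  by apply: (ucont_measurable uf); apply: borelD => //; exact: borel_cst.
have msfin : (ms (fun w => (Z w - elem_int W e w)%R) < +oo)%E by exact: le_lt_trans hms (ltry _).
have msle : fine (ms (fun w => (Z w - elem_int W e w)%R)) <= eps.
  by rewrite -lee_fin fineK// ge0_fin_numE// integral_ge0// => w _; rewrite lee_fin sqr_ge0.
have fin (a : R) : a <= eta / 4 + c * fine (ms (fun w => (Z w - elem_int W e w)%R)) -> a <= eta / 2.
  move/le_trans; apply; have : c * fine (ms (fun w => (Z w - elem_int W e w)%R)) <= c * eps by exact: ler_wpM2l.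
  by move: ceps; move: (c * eps) (c * _) => a1 a2; lra.
have h1 : `|\int[P]_w (\1_A w * f (V w + Z w)) - \int[P]_w (\1_A w * f (V w + elem_int W e w))| <= eta / 2.
  apply: fin; apply: ucont_expectation => //.
  - by apply: im => //; apply: (ucont_measurable uf); exact: borelD.
  - by apply: im => //; apply: (ucont_measurable uf); exact: borelD.
  move=> w; rewrite -mulrBr normrM; apply: (@le_trans _ _ (1 * `|f (V w + Z w) - f (V w + elem_int W e w)|)).
    exact: ler_wpM2r.
  by rewrite mul1r; apply: le_trans (hc _ _) _; rewrite opprD addrACA subrr add0r.
have h2 x : `|\int[P]_w f (x + Z w) - \int[P]_w f (x + elem_int W e w)| <= eta / 2.
  have bx : borel_on setT (fun _ : Omega => x) by exact: borel_cst.
  apply: fin; apply: ucont_expectation => //.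
  - by apply: (@integrable_bounded _ _ _ P _ C) => [|w]//; apply: (ucont_measurable uf); exact: borelD.
  - by apply: (@integrable_bounded _ _ _ P _ C) => [|w]//; apply: (ucont_measurable uf); exact: borelD.
  by move=> w; apply: le_trans (hc _ _) _; rewrite opprD addrACA subrr add0r.
have mg Y : borel_on setT Y -> measurable_fun setT (fun w => \int[P]_w' f (V w + Y w')).
  by move=> bY; apply: (ucont_measurable (ucont_mean uf fC bY) bV').
have h3 : `|\int[P]_w (\1_A w * \int[P]_w' f (V w + Z w')) -
            \int[P]_w (\1_A w * \int[P]_w' f (V w + elem_int W e w'))| <= eta / 2.
  rewrite -RintegralB//; [|by apply: im => [|w]; [exact: mg|exact: bd]|by apply: im => [|w]; [exact: mg|exact: bd]].
  apply: Rint_le_bound => [|w].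
    by apply: measurable_funB; apply: measurable_funM => //; exact: mg.
  by rewrite -mulrBr normrM -[leRHS]mul1r; apply: ler_pM.
move: h1 h3; move: (\int[P]_w _) (\int[P]_w _) (\int[P]_w _) (\int[P]_w _) => a1 a2 a3 a4 h1 h3 h.
move: h1 h3; rewrite h => h1 h3.
rewrite (_ : a4 - a2 = (a4 - a1) - (a2 - a1)); last by ring.
by apply: le_trans (ler_normB _ _) _; lra.
Qed.

Lemma small_factor (a b : R) : 0 < a -> 0 <= b -> exists2 eps : R, 0 < eps <= 1 & eps * b <= a.
Proof.
move=> a0 b0; have b1 : 0 < b + 1 by rewrite ltr_wpDl.
exists (Num.min 1 (a / (b + 1))); first by rewrite lt_min ltr01 divr_gt0// ge_min lexx.
apply: (@le_trans _ _ (a / (b + 1) * b)); first by rewrite ler_wpM2r// ge_min lexx orbT.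
by rewrite mulrAC ler_pdivrMr// ler_pM2l// lerDl.
Qed.

Lemma sqr_close (a b eps : R) : 0 < eps ->
  b ^+ 2 <= (1 + eps) * a ^+ 2 + (1 + eps^-1) * (b - a) ^+ 2.
Proof.
move=> e0; rewrite -subr_ge0.
have -> : (1 + eps) * a ^+ 2 + (1 + eps^-1) * (b - a) ^+ 2 - b ^+ 2 = (eps * a - (b - a)) ^+ 2 / eps.
  by field; rewrite gt_eqF.
by rewrite divr_ge0 ?sqr_ge0// ltW.
Qed.

(** The weight [eps] in [sqr_close] costs a factor [1 + 1 / eps]. A Hilbert-Schmidt distance of
    order [eps^2] leaves the error [eps^2 + eps], which still tends to zero. *)
Lemma qs_close u t Phi Psi y (eps : R) : integrand W u t Phi -> integrand W u t Psi -> 0 < eps ->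
  (hs u t (fun s k => (Phi s k - Psi s k)%R) <= (eps ^+ 2)%:E)%E ->
  (qs u t Psi y <= (1 + eps)%:E * qs u t Phi y + ((eps ^+ 2 + eps) * `|y| ^+ 2)%:E)%E.
Proof.
move=> mPhi mPsi e0 h; pose c2 := (1 + eps^-1) * `|y| ^+ 2.
have c20 : 0 <= c2 by rewrite mulr_ge0 ?sqr_ge0// addr_ge0// invr_ge0 ltW.
have cd : continuous (fun x : H => dot x y ^+ 2).
  by move=> x; apply: (@continuous_comp _ _ _ (fun x => dot x y) (fun t => t ^+ 2));
    [exact: continuous_dotl|exact: exprn_continuous].
have mI : measurable (`]u, t]%classic : set (measurableTypeR R)) by exact: measurable_itv.
apply: (@le_trans _ _ ((1 + eps)%:E * qs u t Phi y + c2%:E * hs u t (fun s k => (Phi s k - Psi s k)%R))%E).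
  apply: integral_esum_le_comb => //.
  - by move=> k Jk; apply: (borel_continuous sepH mI cd); exact: mPsi.
  - by move=> k Jk; apply: (borel_continuous sepH mI cd); exact: mPhi.
  - move=> k Jk; apply: (borel_continuous sepH mI continuous_norm2).
    by apply: (integrandB sepH mPhi mPsi).
  - by rewrite addr_ge0// ltW.
  - by move=> s k; exact: sqr_ge0.
  - by move=> s k; exact: sqr_ge0.
  move=> s k _ _; apply: le_trans (sqr_close (dot (Phi s k) y) _ e0) _.
  rewrite lerD2l /c2 -mulrA; apply: ler_wpM2l; first by rewrite addr_ge0// invr_ge0 ltW.
  by rewrite -dotBl (le_trans (dot_sqr_le _ _))// mulrC distrC.
apply: leeD => //; apply: (@le_trans _ _ (c2%:E * (eps ^+ 2)%:E)%E).
  by apply: lee_wpmul2l => //; rewrite lee_fin.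
rewrite -EFinM lee_fin le_eqVlt; apply/orP; left; apply/eqP; rewrite /c2; field.
by rewrite gt_eqF.
Qed.

(** The bound for elementary integrals passes to the limit: the covariance forms converge, hence by
    polarization so do the shift directions [m y] to [Q y]. The strict inequality between
    [dot (Q y) y] and [s^2] leaves room for the error in the forms. *)
Lemma sint_total_variation u t Phi Z (Q : H -> H) (K : R) : 0 <= u -> sint P W u t Phi Z ->
  bounded_operator Q -> (forall x y, dot (Q x) y = dot x (Q y)) ->
  (forall y, qs u t Phi y = (dot (Q y) y)%:E) -> 0 <= K -> (forall y, dot (Q y) y <= K * `|y| ^+ 2) ->
  forall y (f : H -> R) (C s : R), ucont f -> (forall x, `|f x| <= C) -> 0 < s ->
  dot (Q y) y < s ^+ 2 ->
  `|\int[P]_w f (Z w + Q y) - \int[P]_w f (Z w)| <= 4 * C * s.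
Proof.
move=> u0 [bZ mPhi hZ] bQ sQ hQ K0 hK y f C s uf fC s0 qs.
apply/ler_addgt0Pr => eta eta0.
have [c c0 hc] := uf (eta / 4) ltac:(by rewrite divr_gt0).
pose K' := 2 * K + 4; have K'0 : 0 <= K' by rewrite addr_ge0// mulr_ge0.
have y20 : 0 <= `|y| ^+ 2 by exact: sqr_ge0.
(* The choice of [e1] keeps the approximate form [q y] below [s^2]; [e2] makes the errors of both
   expectations smaller than [eta / 2]. *)
have [e1 /andP[e10 e11] he1] := @small_factor (s ^+ 2 - dot (Q y) y) ((K + 2) * `|y| ^+ 2)
  ltac:(by rewrite subr_gt0) ltac:(by rewrite mulr_ge0// addr_ge0).
have [e2 /andP[e20 e21] he2] := @small_factor (eta / 4) (c * (2 + 2 * K' ^+ 2 * `|y| ^+ 2))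
  ltac:(by rewrite divr_gt0) ltac:(by rewrite mulr_ge0// addr_ge0// mulr_ge0// mulr_ge0// sqr_ge0).
pose eps := Num.min e1 e2.
have eps0 : 0 < eps by rewrite lt_min e10.
have eps1 : eps <= 1 by rewrite ge_min e11.
have epse1 : eps <= e1 by rewrite ge_min lexx.
have epse2 : eps <= e2 by rewrite ge_min lexx orbT.
have eps2 : eps ^+ 2 <= eps by rewrite expr2 ler_piMl// ltW.
have [e [he hhs hms]] := hZ _ (exprn_gt0 2 eps0).
have he0 : elem_within W 0 t e by move=> j a b h /he[? ? ? ?]; split => //; exact: le_trans u0 _.
have [q [m [hq hm htv]]] := elem_total_variation hW sepH he0.
have hq' y' : (\int[mu]_(r in `]u, t]) (\esum_(k in wI W) (dot (elem_val e r k) y' ^+ 2)%:E) = (q y')%:E)%E.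
  rewrite -hq integral_mkcond [RHS]integral_mkcond; apply: eq_integral => r _; rewrite !patchE.
  have [us|us] := boolP (u < r <= t).
    rewrite !ifT// !inE/= in_itv//=; move: us => /andP[us ->].
    by rewrite (le_trans u0 (ltW us)).
  rewrite ifF; last by apply/negbTE; rewrite notin_setE/= in_itv/=; exact/negP.
  by case: ifP => // _; rewrite esum1// => k _; rewrite (elem_val_within k he us) dot0l expr0n.
have mE : integrand W u t (elem_val e) by exact: integrand_elem.
have hhs' : (hs u t (fun r k => (elem_val e r k - Phi r k)%R) <= (eps ^+ 2)%:E)%E.
  apply: le_trans hhs; rewrite le_eqVlt; apply/orP; left; apply/eqP.
  by apply: eq_integral => r _; apply: eq_esum => k _; rewrite distrC.
have qle y' : q y' <= (1 + eps) * dot (Q y') y' + (eps ^+ 2 + eps) * `|y'| ^+ 2.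
  by have := qs_close y' mPhi mE eps0 hhs; rewrite hq' hQ -EFinM -EFinD lee_fin.
have leq_ y' : dot (Q y') y' <= (1 + eps) * q y' + (eps ^+ 2 + eps) * `|y'| ^+ 2.
  by have := qs_close y' mE mPhi eps0 hhs'; rewrite hQ hq' -EFinM -EFinD lee_fin.
have Qpos y' : 0 <= dot (Q y') y'.
  by rewrite -lee_fin -hQ; apply: integral_ge0 => r _; apply: esum_ge0 => k _; rewrite lee_fin sqr_ge0.
have up y' : q y' <= dot (Q y') y' + eps * ((K + 2) * `|y'| ^+ 2).
  have := qle y'; have := hK y'; have := sqr_ge0 `|y'|; move: (`|y'| ^+ 2) (q y') (dot _ _) => n a b n0 h1 h2.
  apply: le_trans h2 _; have : eps * b <= eps * (K * n) by rewrite ler_pM2l.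
  have : eps ^+ 2 * n <= eps * n by rewrite ler_wpM2r.
  by rewrite !(mulrDl, mulrDr) mul1r; lra.
have lo y' : dot (Q y') y' <= q y' + eps * (K' * `|y'| ^+ 2).
  have := leq_ y'; have := up y'; have := hK y'; have := sqr_ge0 `|y'|.
  rewrite /K'; move: (`|y'| ^+ 2) (q y') (dot _ _) => n a b n0 h1 h2 h3.
  apply: le_trans h3 _; have h4 : a <= (2 * K + 2) * n.
    apply: le_trans h2 _; have : eps * ((K + 2) * n) <= 1 * ((K + 2) * n) by rewrite ler_wpM2r// mulr_ge0// addr_ge0.
    by rewrite !(mulrDl, mulrDr) mul1r; lra.
  have : eps * a <= eps * ((2 * K + 2) * n) by rewrite ler_pM2l.
  have : eps ^+ 2 * n <= eps * n by rewrite ler_wpM2r.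
  by rewrite !(mulrDl, mulrDr) mul1r; lra.
have dq y' : `|q y' - dot (Q y') y'| <= eps * K' * `|y'| ^+ 2.
  rewrite -mulrA ler_norml; apply/andP; split; first by have := lo y'; lra.
  have := up y'; have : eps * ((K + 2) * `|y'| ^+ 2) <= eps * (K' * `|y'| ^+ 2).
    by rewrite ler_pM2l// ler_wpM2r ?sqr_ge0// /K'; lra.
  lra.
have pol x x' : dot (Q x) x' = (dot (Q (x + x')) (x + x') - dot (Q (x - x')) (x - x')) / 4.
  rewrite (bopD bQ) (bopB bQ) !dotDl !dotNl !dotDr !dotNr (sQ x' x) (dotC x' (Q x)).
  by field.
pose w := m y - Q y.
(* With [k = eps * K'], polarization bounds [dot w y'] by [k / 2 * (|y|^2 + |y'|^2)]. The choice
   [y' = w / k] turns this into [|w| <= k * |y|]. *)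
have wle : `|w| ^+ 2 <= (eps * K') ^+ 2 * `|y| ^+ 2.
  have [K'00|K'n0] := eqVneq (eps * K') 0.
    have h y' : dot w y' = 0.
      rewrite /w dotBl hm pol; have := dq (y + y'); have := dq (y - y').
      by rewrite K'00 !mul0r !normr_le0 !subr_eq0 => /eqP -> /eqP ->; rewrite subrr.
    by rewrite K'00 expr0n/= mul0r -dotxx h.
  have k0 : 0 < eps * K' by rewrite lt_def K'n0 mulr_ge0// ltW.
  move: (eps * K' : R) k0 dq {K'n0} => k k0 dq.
  have h1 : dot w (k^-1 *: w) <= k / 2 * (`|y| ^+ 2 + k^-1 ^+ 2 * `|w| ^+ 2).
    rewrite {1}/w dotBl hm pol; set y' := k^-1 *: w.
    have ny' : k^-1 ^+ 2 * `|w| ^+ 2 = `|y'| ^+ 2 by rewrite /y' normrZ exprMn real_normK ?num_real.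
    have := dq (y + y'); have := dq (y - y'); rewrite ny' (normB_sqr y y') (normD_sqr y y') !ler_norml.
    move: (`|y| ^+ 2 : R) (`|y'| ^+ 2 : R) (dot y y') => n n' b.
    move: (q _) (q _) (dot _ _) (dot _ _) => a1 a2 a3 a4.
    by move=> /andP[? ?] /andP[? ?]; lra.
  rewrite dotZr dotxx in h1.
  have : 0 <= k * (k / 2 * (`|y| ^+ 2 + k^-1 ^+ 2 * `|w| ^+ 2) - k^-1 * `|w| ^+ 2).
    by rewrite mulr_ge0 ?subr_ge0// ltW.
  have -> : k * (k / 2 * (`|y| ^+ 2 + k^-1 ^+ 2 * `|w| ^+ 2) - k^-1 * `|w| ^+ 2) =
     (k ^+ 2 * `|y| ^+ 2 - `|w| ^+ 2) / 2 by field; rewrite gt_eqF.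
  lra.
have be := elem_int_borel_within u0 he.
have qes : q y <= s ^+ 2.
  apply: le_trans (up y) _; have : eps * ((K + 2) * `|y| ^+ 2) <= e1 * ((K + 2) * `|y| ^+ 2).
    by apply: ler_wpM2r => //; rewrite mulr_ge0// addr_ge0.
  by move: he1; lra.
have hTV := htv y f C s (ucont_continuous uf) fC s0 qes.
have bQy (z : H) : borel_on setT (fun _ : Omega => z) by exact: borel_cst.
have b1 : borel_on setT (fun w => Z w + Q y) by exact: borelD.
have b2 : borel_on setT (fun w => elem_int W e w + m y) by exact: borelD.
have ib (X : Omega -> H) : borel_on setT X -> P.-integrable setT (EFin \o (fun w => f (X w))).
  by move=> bX; apply: (@integrable_bounded _ _ _ P _ C) => //; exact: (ucont_measurable uf).
have ms0 (X : Omega -> H) : (0 <= ms X)%E by apply: integral_ge0 => z _; rewrite lee_fin sqr_ge0.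
have cfin (X : Omega -> H) : (ms X <= (eps * (2 + 2 * K' ^+ 2 * `|y| ^+ 2))%:E)%E ->
    eta / 4 + c * fine (ms X) <= eta / 2.
  move=> h; have fX : ms X \is a fin_num by rewrite ge0_fin_numE// (le_lt_trans h)// ltry.
  have : c * fine (ms X) <= c * (eps * (2 + 2 * K' ^+ 2 * `|y| ^+ 2)).
    by rewrite ler_wpM2l// -lee_fin fineK.
  have : c * (eps * (2 + 2 * K' ^+ 2 * `|y| ^+ 2)) <= e2 * (c * (2 + 2 * K' ^+ 2 * `|y| ^+ 2)).
    by rewrite mulrCA ler_wpM2r// mulr_ge0// addr_ge0// mulr_ge0// mulr_ge0// sqr_ge0.
  move: he2; lra.
have lty (X : Omega -> H) (a : R) : (ms X <= a%:E)%E -> (ms X < +oo)%E by move/le_lt_trans; apply; exact: ltry.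
have n0 : 0 <= K' ^+ 2 * `|y| ^+ 2 by rewrite mulr_ge0// sqr_ge0.
have hZe : (ms (fun w => (Z w - elem_int W e w)%R) <= (eps * (2 + 2 * K' ^+ 2 * `|y| ^+ 2))%:E)%E.
  apply: le_trans hms _; rewrite lee_fin; apply: le_trans eps2 _.
  by rewrite ler_peMr ?ltW//; lra.
have h1 : `|\int[P]_w f (Z w) - \int[P]_w f (elem_int W e w)| <= eta / 2.
  by apply: le_trans (ucont_expectation sepH (ib _ bZ) (ib _ be) bZ be (lty _ _ hZe) c0 _) (cfin _ hZe) => z.
have hZe2 : (ms (fun w => (Z w + Q y - (elem_int W e w + m y))%R) <= (eps * (2 + 2 * K' ^+ 2 * `|y| ^+ 2))%:E)%E.
  apply: (@le_trans _ _ (2%:E * ms (fun w => (Z w - elem_int W e w)%R) + 2%:E * ms (fun _ : Omega => w))%E).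
    apply: ms_le_comb => //; [exact: borelB|exact: borelB|].
    move=> z; have := sqr_normD_le (Z z - elem_int W e z) (- w); rewrite normrN.
    by congr (`|_| ^+ 2 <= _); rewrite /w; hring.
  have -> : (ms (fun _ : Omega => w) = (`|w| ^+ 2)%:E)%E.
    by rewrite integral_cst// [X in (_ * X)%E](@probability_setT _ _ _ P) mule1.
  apply: (@le_trans _ _ (2%:E * (eps ^+ 2)%:E + 2%:E * (`|w| ^+ 2)%:E)%E).
    by apply: leeD => //; apply: lee_wpmul2l => //; rewrite lee_fin.
  rewrite -!EFinM -EFinD lee_fin.
  have : `|w| ^+ 2 <= eps ^+ 2 * (K' ^+ 2 * `|y| ^+ 2) by rewrite mulrA -exprMn.
  have : eps ^+ 2 * (K' ^+ 2 * `|y| ^+ 2) <= eps * (K' ^+ 2 * `|y| ^+ 2) by rewrite ler_wpM2r.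
  rewrite -[2 * K' ^+ 2 * _]mulrA mulrDr [eps * (2 * (_ * _))]mulrCA.
  have aux (r1 r2 r3 r4 r5 : R) : r4 <= r5 -> r1 <= r2 -> r3 <= r1 -> 2 * r4 + 2 * r3 <= r5 * 2 + 2 * r2.
    by lra.
  by move=> p1 p2; exact: aux eps2 p1 p2.
have h2 : `|\int[P]_w f (Z w + Q y) - \int[P]_w f (elem_int W e w + m y)| <= eta / 2.
  by apply: le_trans (ucont_expectation sepH (ib _ b1) (ib _ b2) b1 b2 (lty _ _ hZe2) c0 _) (cfin _ hZe2) => z.
move: hTV h1 h2; move: (\int[P]_w _) (\int[P]_w _) (\int[P]_w _) (\int[P]_w _) => a1 a2 a3 a4.
move=> h0 h1 h2.
have -> : a1 - a2 = (a1 - a4) + (a4 - a3) - (a2 - a3) by ring.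
apply: le_trans (ler_normB _ _) _; have := ler_normD (a1 - a4) (a4 - a3).
move: (4 * C * s) (`|_|) (`|_|) (`|_|) (`|_|) h0 h1 h2 => r b1' b2' b3' b4'.
by move: (eta : R) => ?; lra.
Qed.

End LawOfStochasticIntegrals.

(** * Bochner integrals and semigroups *)

Section Bochner.
Context {R : realType} {E : hilbertType R} (sepE : separable_space E).
Local Notation mu := (@lebesgue_measure R).
Context (D : set (measurableTypeR R)) (mD : measurable D) (Dfin : (mu D < +oo)%E).
Implicit Types (f : measurableTypeR R -> E) (C : R).

Lemma integrable_cst_on C : mu.-integrable D (EFin \o cst C).
Proof.
apply/integrableP; split; first exact/measurable_EFinP/measurable_cst.
by rewrite /= integral_cst//= lte_mul_pinfty.
Qed.

Lemma integrable_bounded_on (h : measurableTypeR R -> R) C : measurable_fun D h ->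
  (forall s, D s -> `|h s| <= C) -> mu.-integrable D (EFin \o h).
Proof.
move=> mh hC; apply: (@le_integrable _ _ _ mu D mD _ (cst C%:E)).
- exact/measurable_EFinP.
- by move=> s Ds /=; rewrite lee_fin (le_trans (hC s Ds))// ler_norm.
- exact: integrable_cst_on.
Qed.

Lemma borel_dot f y : borel_on D f -> measurable_fun D (fun s => dot (f s) y).
Proof. exact: (borel_continuous sepE mD (@continuous_dotl _ E y)). Qed.

Lemma integrable_dot f C y : borel_on D f -> (forall s, D s -> `|f s| <= C) ->
  mu.-integrable D (EFin \o (fun s => dot (f s) y)).
Proof.
move=> bf fC; apply: (@integrable_bounded_on _ (C * `|y|)); first exact: borel_dot.
by move=> s Ds; apply: le_trans (dot_le _ _) _; rewrite ler_wpM2r// fC.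
Qed.

Section simple.
Variables (m : nat) (A : nat -> set R) (v : nat -> E).
Hypothesis mA : forall i, measurable (A i : set (measurableTypeR R)).
Let phi (s : R) : E := \sum_(i < m) \1_(A i) s *: v i.
Let I0 : E := \sum_(i < m) fine (mu (D `&` A i)) *: v i.

Lemma simple_dot y : mu.-integrable D (EFin \o (fun s => dot (phi s) y)) /\
  \int[mu]_(s in D) dot (phi s) y = dot I0 y.
Proof.
have ii (i : nat) : mu.-integrable D (fun s => (\1_(A i) s * dot (v i) y)%:E).
  apply: (@integrable_bounded_on (fun s => \1_(A i) s * dot (v i) y) `|dot (v i) y|).
    by apply: measurable_funM => //; apply: measurable_indic.
  by move=> s _; rewrite normrM -[leRHS]mul1r ler_wpM2r// indicE; case: (_ \in _); rewrite ?normr0 ?normr1.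
have e1 : EFin \o (fun s => dot (phi s) y) = (fun s => \sum_(i <- index_enum 'I_m) (\1_(A i) s * dot (v i) y)%:E)%E.
  by apply/funext => s /=; rewrite /phi dot_suml sumEFin; congr EFin; apply: eq_bigr => i _; rewrite dotZl.
split; first by rewrite e1; apply: integrable_sum.
rewrite /Rintegral (_ : (fun x => _) = EFin \o (fun s => dot (phi s) y))// e1 integral_sum//.
have ei (i : nat) : (\int[mu]_(s in D) (\1_(A i) s * dot (v i) y)%:E = (fine (mu (D `&` A i)) * dot (v i) y)%:E)%E.
  under eq_integral do rewrite mulrC EFinM.
  rewrite integralZl//; last first.
    by apply: (@integrable_bounded_on _ 1) => [|s _]; [exact: measurable_indic|rewrite indicE; case: (_ \in _); rewrite ?normr0 ?normr1].
  have -> : (\int[mu]_(s in D) (\1_(A i) s)%:E = mu (A i `&` D))%E by exact: integral_indic.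
  rewrite mulrC EFinM setIC fineK//.
  rewrite ge0_fin_numE//; apply: le_lt_trans Dfin; apply: le_measure; rewrite ?inE//; exact: measurableI.
under eq_bigr do rewrite ei.
by rewrite sumEFin dot_suml; apply: eq_bigr => i _; rewrite dotZl.
Qed.

Lemma simple_close f C (eps : R) y : borel_on D f -> (forall s, D s -> `|f s| <= C) ->
  measurable_fun D (fun s => `|f s - phi s|) ->
  (\int[mu]_(s in D) `|f s - phi s|%:E <= eps%:E)%E ->
  `|dot I0 y - \int[mu]_(s in D) dot (f s) y| <= eps * `|y|.
Proof.
move=> bf fC mfp hfp; have [ip <-] := simple_dot y; have if_ := integrable_dot y bf fC.
have ifp : mu.-integrable D (EFin \o (fun s => `|f s - phi s|)).
  apply/integrableP; split; first exact/measurable_EFinP.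
  apply: (@le_lt_trans _ _ eps%:E); last exact: ltry.
  by under eq_integral do rewrite /= normr_id.
rewrite -RintegralB//.
have id_ : mu.-integrable D (EFin \o (fun s => dot (phi s) y - dot (f s) y)).
  by under [X in _.-integrable _ X]eq_fun do rewrite /= EFinB; exact: integrableB.
apply: le_trans (le_normr_Rintegral mD id_) _.
apply: (@le_trans _ _ (\int[mu]_(s in D) (`|y| * `|f s - phi s|))).
  apply: le_Rintegral => //.
  - exact: integrable_norm.
  - by under [X in _.-integrable _ X]eq_fun do rewrite /= EFinM; exact: integrableZl.
  by move=> s Ds; rewrite -dotBl distrC mulrC; exact: dot_le.
rewrite RintegralZl// mulrC ler_wpM2r//.
by rewrite -lee_fin /Rintegral fineK//; exact: (integrable_fin_num mD ifp).
Qed.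

End simple.

(** Bounded Borel functions thus have at most one Bochner integral, and identities between integrals
    are checked on scalar products. *)
Lemma has_bochner_dot f C I : borel_on D f -> (forall s, D s -> `|f s| <= C) ->
  has_bochner D f I -> forall y, dot I y = \int[mu]_(s in D) dot (f s) y.
Proof.
move=> bf fC [m [A [v [mA mf h1 h2]]]] y.
apply/eqP; rewrite -subr_eq0 -normr_eq0 eq_le normr_ge0 andbT.
apply/ler_addgt0Pr => eta eta0; rewrite add0r.
have e0 : 0 < eta / (2 * (`|y| + 1)) by rewrite divr_gt0// mulr_gt0// ltr_wpDl.
have n0 n : (0 <= \int[mu]_(s in D) `|f s - \sum_(i < m n) \1_(A n i) s *: v n i|%:E)%E.
  exact: integral_ge0.
have [n _ /(_ n (leqnn n))[hn1 hn2]] := filterI (cvge0_le h1 n0 e0) ((cvgrPdist_le _ _).1 h2 _ e0).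
have := simple_close (mA n) y bf fC (mf n) hn1.
rewrite /= in hn2; set I0 := \sum_(i < m n) _ in hn2 * => h3.
have := le_trans (dot_le (I - I0) y) (ler_wpM2r (normr_ge0 y) hn2); rewrite dotBl => h4.
rewrite (_ : _ - _ = (dot I y - dot I0 y) + (dot I0 y - \int[mu]_(s in D) dot (f s) y)); last by ring.
apply: le_trans (ler_normD _ _) _; apply: le_trans (lerD h4 h3) _.
rewrite [leRHS](_ : _ = eta / (2 * (`|y| + 1)) * `|y| + eta / (2 * (`|y| + 1)) * `|y| + 2 * (eta / (2 * (`|y| + 1)))).
  by rewrite lerDl mulr_ge0// ltW.
by field; rewrite gt_eqF// ltr_wpDl.
Qed.

Lemma riesz_integral f C : borel_on D f -> (forall s, D s -> `|f s| <= C) ->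
  exists I, forall y, dot I y = \int[mu]_(s in D) dot (f s) y.
Proof.
move=> bf fC; have id_ y := integrable_dot y bf fC.
have [|I hI] := @riesz R E (fun y => \int[mu]_(s in D) dot (f s) y); last by exists I => y; rewrite hI dotC.
apply: (@bopP _ _ _ _ (`|C| * fine (mu D))) => [a x y|y].
  rewrite /GRing.scale/= -RintegralZl// -RintegralD//; last first.
    exact: (integrableZl mD a (id_ x)).
  by apply: eq_Rintegral => s _; rewrite dotDr dotZr.
apply: le_trans (le_normr_Rintegral mD (id_ y)) _.
apply: (@le_trans _ _ (\int[mu]_(s in D) (`|C| * `|y|))).
  apply: le_Rintegral => //; [exact: integrable_norm|exact: integrable_cst_on|].
  move=> s Ds; apply: le_trans (dot_le _ _) _; rewrite ler_wpM2r//.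
  by apply: le_trans (fC s Ds) _; exact: ler_norm.
by rewrite Rintegral_cst// mulrAC.
Qed.

(** Guarantees that [bochner] is not its default value 0. The candidate is the weak integral given
    by Riesz; the simple functions are the approximations of [borel_code], cut off at an index
    beyond which little mass is left. *)
Lemma has_bochner_exists f C : borel_on D f -> (forall s, D s -> `|f s| <= C) ->
  exists I, has_bochner D f I.
Proof.
move=> bf fC; have [I hI] := riesz_integral bf fC; exists I.
have [q [c [hc hm]]] := borel_code sepE (D := D).
have mlt n j : measurable (D `&` [set s | (j <= c n (f s))%N]).
  rewrite (_ : _ `&` _ = D `\` \bigcup_(i in [set i | (i < j)%N]) (D `&` [set s | c n (f s) = i])).
    by apply: measurableD => //; apply: bigcup_measurable => i _; exact: hm.
  apply/seteqP; split=> s /=; first by move=> [Ds h]; split=> // -[i /= ij [_ e]]; rewrite -e ltnNge h in ij.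
  by move=> [Ds nb]; split => //; rewrite leqNgt; apply/negP => h; apply: nb; exists (c n (f s)).
(* For fixed [n] the sets where the code is at least [j] decrease to the empty set, and [D] has
   finite measure. The index found here becomes the cut-off [m n]. *)
have small n : exists j, (mu (D `&` [set s | (j <= c n (f s))%N]) <= (n.+1%:R^-1)%:E)%E.
  have cv := @nonincreasing_cvg_mu _ _ _ mu (fun j => D `&` [set s | (j <= c n (f s))%N]).
  have {cv} : mu (D `&` [set s | (j <= c n (f s))%N]) @[j --> \oo] --> 0%E.
    rewrite -(measure0 mu) (_ : set0 = \bigcap_j (D `&` [set s | (j <= c n (f s))%N])).
      apply: cv => //.
      - by apply: le_lt_trans Dfin; apply: le_measure; rewrite ?inE// => s [].
      - exact: bigcap_measurable.
      - by move=> i j ij; apply/subsetPset => s [Ds h]; split => //=; exact: leq_trans h.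
    by apply/esym/seteqP; split=> // s h; have [_ /=] := h (c n (f s)).+1 Logic.I; rewrite ltnn.
  have n0 : 0 < n.+1%:R^-1 :> R by rewrite invr_gt0.
  move=> /cvge0_le h; have [//|j _ /(_ j (leqnn j)) hj] := h _ _ n0.
  by exists j.
have {small}[m hmm] := choice small.
pose A n i : set R := D `&` [set s | c n (f s) = i].
have mA n i : measurable (A n i : set (measurableTypeR R)) by exact: hm.
pose phi n s := \sum_(i < m n) \1_(A n i) s *: q i.
have bphi n : borel_on D (phi n : measurableTypeR R -> E).
  apply: borel_sum => // i _; apply: borel_scale => //; exact: measurable_indic.
have mfp n : measurable_fun D (fun s => `|f s - phi n s|).
  by have /(borel_normP sepE mD)/(_ 0) := borelB sepE mD bf (bphi n); under eq_fun do rewrite subr0.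
have phiE n s : D s -> phi n s = if (c n (f s) < m n)%N then q (c n (f s)) else 0.
  move=> Ds; rewrite /phi; case: ifPn => [lt|ge].
    rewrite (bigD1 (Ordinal lt))//= big1 ?addr0 ?indicE ?mem_set ?scale1r//.
    by move=> i ne; rewrite indicE memNset ?scale0r// => -[_ /= e]; case/eqP: ne; apply: val_inj => /=.
  apply: big1 => i _; rewrite indicE memNset ?scale0r// => -[_ /= e].
  by rewrite e ltn_ord in ge.
have dist n s : D s -> `|f s - phi n s| <= n.+1%:R^-1 + `|C| * \1_(D `&` [set s | (m n <= c n (f s))%N]) s.
  move=> Ds; rewrite phiE//; case: ifPn => [lt|].
    by apply: (le_trans (ltW (hc n (f s)))); rewrite lerDl mulr_ge0.
  rewrite -leqNgt => ge; rewrite subr0 indicE mem_set// mulr1.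
  by apply: (le_trans (fC s Ds)); rewrite (le_trans (ler_norm _))// lerDr.
pose K : R := fine (mu D) + `|C|.
have bnd n : (\int[mu]_(s in D) `|f s - phi n s|%:E <= (n.+1%:R^-1 * K)%:E)%E.
  have mB := mlt n (m n); set B := D `&` _ in mB.
  apply: (@le_trans _ _ (\int[mu]_(s in D) (n.+1%:R^-1%:E + `|C|%:E * (\1_B s)%:E))%E).
    apply: ge0_le_integral => //.
    - exact/measurable_EFinP.
    - apply: emeasurable_funD => //; apply: emeasurable_funM => //.
      by apply/measurable_EFinP; exact: measurable_indic.
    by move=> s Ds; rewrite -EFinM -EFinD lee_fin dist.
  rewrite ge0_integralD//; last first.
    by apply: emeasurable_funM => //; apply/measurable_EFinP; exact: measurable_indic.
  rewrite integral_cst// ge0_integralZl//; last by apply/measurable_EFinP; exact: measurable_indic.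
  have -> : (\int[mu]_(s in D) (\1_B s)%:E = mu (B `&` D))%E by exact: integral_indic.
  have -> : B `&` D = B by apply/seteqP; split => s [] //; case.
  rewrite /K mulrDr EFinD; apply: leeD; first by rewrite EFinM fineK// ge0_fin_numE.
  by rewrite mulrC EFinM; apply: lee_wpmul2l => //; exact: hmm.
have K0 : 0 <= K by rewrite addr_ge0// fine_ge0.
have cvK : (n.+1%:R^-1 * K)%R @[n --> \oo] --> 0.
  by rewrite -[X in _ --> X](mul0r K); apply: cvgMl; exact: cvg_harmonic.
exists m, A, (fun _ => q); split => //.
- apply: (@squeeze_cvge _ _ _ _ (cst 0%E) _ (fun n => (n.+1%:R^-1 * K)%:E)).
  + by apply: nearW => n /=; rewrite integral_ge0//= bnd.
  + exact: cvg_cst.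
  + by apply: cvg_EFin => //; exact: nearW.
- apply/cvgrPdist_le => e e0; near=> n.
  apply: (@le_trans _ _ (n.+1%:R^-1 * K)); last first.
    rewrite -[leLHS]ger0_norm ?mulr_ge0// -normrN -[- _]add0r.
    by near: n; move/cvgrPdist_le : cvK => /(_ e e0).
  set I0 := \sum_(i < m n) _.
  apply: norm_le_dot; first by rewrite mulr_ge0.
  have := simple_close (mA n) (I - I0) bf fC (mfp n) (bnd n).
  rewrite -hI -/I0 => h; rewrite {1}(_ : I - I0 = - (I0 - I)); last by rewrite opprB.
  by apply: le_trans h; rewrite dotNl dotBl -normrN; exact: ler_norm.
Unshelve. all: by end_near. Qed.

End Bochner.

Section Semigroup.
Context {R : realType} {H : hilbertType R} (S : R -> H -> H).
Hypothesis hS : C0_semigroup S.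

Lemma sg_bop t : 0 <= t -> bounded_operator (S t).
Proof. by have [h _ _ _] := hS; exact: h. Qed.

Lemma sg_right x (e : R) : 0 < e -> exists2 del : R, 0 < del & forall t, 0 <= t -> t <= del -> `|S t x - x| <= e.
Proof.
move=> e0; have [_ S0 _ /(_ x)] := hS.
move=> /cvgrPdist_le/(_ e e0)/nbhs_ballP[del /= del0 hd].
exists (del / 2); first by rewrite divr_gt0.
move=> t t0 td; have [->|tn0] := eqVneq t 0; first by rewrite S0 subrr normr0 ltW.
have tp : 0 < t by rewrite lt_def tn0.
rewrite distrC; apply: hd => //; rewrite -ball_normE /ball_/= sub0r normrN ger0_norm//.
by apply: (le_lt_trans td); rewrite ltr_pdivrMr// ltr_pMr// ltr1n.
Qed.

(** Otherwise there are times [p n] tending to 0 at which the operator norm exceeds [n + 1]. Strong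
    continuity at 0 makes these operators pointwise bounded, against the Banach-Steinhaus
    theorem. *)
Lemma sg_bound_near0 : exists2 del : R, 0 < del &
  exists2 M : R, 1 <= M & forall t x, 0 <= t <= del -> `|S t x| <= M * `|x|.
Proof.
apply: contrapT => no.
have ex (n : nat) : exists p : R * H, 0 <= p.1 <= n.+1%:R^-1 /\ n.+1%:R * `|p.2| < `|S p.1 p.2|.
  apply: contrapT => no'; apply: no; exists n.+1%:R^-1; first by rewrite invr_gt0.
  exists n.+1%:R; first by rewrite ler1n.
  move=> t x ht; rewrite leNgt; apply/negP => h; apply: no'; exists (t, x) => //.
have [p hp] := choice ex.
have p0 n : 0 <= (p n).1 by have [/andP[]] := hp n.
pose Fam : set (H -> H) := [set S (p n).1 | n in [set: nat]].
have [||M hM] := @Banach_Steinhauss R H H Fam _ _ 1.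
- move=> f [n _ <-]; have bS := sg_bop (p0 n); split; last exact: bS.1.
  have [C C0 hC] := bop_bound bS; move=> r; exists (C * r) => x xr.
  by apply: le_trans (hC x) _; rewrite ler_wpM2l.
- move=> x; have [del del0 hd] := sg_right x ltr01.
  have [N hN] : exists N : nat, forall n, (N <= n)%N -> n.+1%:R^-1 <= del.
    exists (Num.truncn del^-1) => n nN; rewrite -[leRHS]invrK lef_pV2 ?posrE ?invr_gt0//.
    by apply: (le_trans (ltW (truncnS_gt _))); rewrite ler_nat ltnS.
  exists (\sum_(n < N) `|S (p n).1 x| + (1 + `|x|)) => f [n _ <-].
  have [nN|Nn] := ltnP n N.
    rewrite (bigD1 (Ordinal nN))//= -addrA lerDl addr_ge0 ?sumr_ge0// addr_ge0//.
  rewrite -[leLHS]add0r lerD ?sumr_ge0// -{1}(subrK x (S _ x)); apply: le_trans (ler_normD _ _) _.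
  rewrite lerD2r; apply: hd => //; have [/andP[_ h] _] := hp n; apply: (le_trans h); exact: hN.
have [_ h] := hp (Num.truncn M).
set n := Num.truncn M in h; have nM : M < n.+1%:R by exact: truncnS_gt.
have xn0 : 0 < `|(p n).2|.
  rewrite lt_def normr_ge0 andbT; apply/eqP => e; move: h; rewrite e mulr0.
  by move/eqP : e; rewrite normr_eq0 => /eqP ->; rewrite (bop0 (sg_bop (p0 n))) normr0 ltxx.
have := hM (S (p n).1) (ex_intro2 _ _ n Logic.I erefl) (`|(p n).2|^-1 *: (p n).2).
rewrite normrZ normfV normr_id mulVf ?gt_eqF// lexx => /(_ isT).
rewrite (bopZ (sg_bop (p0 n))) normrZ normfV normr_id ler_pdivrMl// leNgt => /negP; apply.
by apply: le_lt_trans h; rewrite mulrC ler_wpM2r// ltW.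
Qed.

Lemma sg_bound (T : R) : exists2 M : R, 1 <= M & forall t x, 0 <= t <= T -> `|S t x| <= M * `|x|.
Proof.
have [del del0 [M M1 hM]] := sg_bound_near0; have [_ _ Sadd _] := hS.
have M0 : 0 <= M by apply: le_trans M1.
have step (n : nat) : forall t x, 0 <= t <= n%:R * del -> `|S t x| <= M ^+ n.+1 * `|x|.
  elim: n => [|n IH] t x /andP[t0 tn].
    by apply: hM; rewrite t0/=; apply: (le_trans tn); rewrite mul0r ltW.
  have [td|td] := leP t del.
    apply: (le_trans (hM t x _)); first by rewrite t0.
    by rewrite ler_wpM2r// exprS ler_peMr// exprn_ege1.
  have -> : S t x = S del (S (t - del) x).
    by rewrite -Sadd ?subr_ge0; [rewrite addrC subrK|exact: ltW|exact: ltW].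
  apply: (le_trans (hM _ _ _)); first by rewrite lexx andbT ltW.
  rewrite exprS -mulrA ler_wpM2l//; apply: IH; rewrite subr_ge0 ltW//=.
  by move: tn; rewrite -natr1 mulrDl mul1r lerBlDr.
exists (M ^+ (Num.truncn (T / del)).+2); first exact: exprn_ege1.
move=> t x /andP[t0 tT]; apply: step; rewrite t0/=; apply: (le_trans tT).
by rewrite -ler_pdivrMr// ltW// truncnS_gt.
Qed.

Lemma sg_ucont (T : R) x (e : R) : 0 < e -> exists2 del : R, 0 < del &
  forall s t, 0 <= s <= T -> 0 <= t <= T -> `|s - t| <= del -> `|S s x - S t x| <= e.
Proof.
have [_ _ Sadd _] := hS.
move=> e0; have [M M1 hM] := sg_bound T; have M0 : 0 < M by apply: lt_le_trans M1.
have [del del0 hd] := sg_right x (divr_gt0 e0 M0); exists del => //.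
have main s t : 0 <= s <= T -> s <= t -> `|s - t| <= del -> `|S s x - S t x| <= e.
  move=> /andP[s0 sT] st; rewrite distrC ger0_norm ?subr_ge0// => td.
  have ts0 : 0 <= t - s by rewrite subr_ge0.
  have -> : S t x = S s (S (t - s) x) by rewrite -Sadd// addrC subrK.
  rewrite -(bopB (sg_bop s0)).
  apply: (le_trans (hM _ _ _)); first by rewrite s0.
  by rewrite mulrC -ler_pdivlMr// distrC; exact: hd.
move=> s t hs ht; have [st|/ltW ts] := leP s t; first exact: main.
by rewrite distrC => h; rewrite distrC; apply: main.
Qed.

(** Extending the semigroup by the identity to negative times makes the orbits continuous on the
    whole line, so that their measurability needs no discussion of end points. *)
Definition sgx (t : R) : H -> H := S (Num.max t 0).

Lemma sgx_bop t : bounded_operator (sgx t).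
Proof. by apply: sg_bop; rewrite le_max lexx orbT. Qed.

Lemma sgxE t : 0 <= t -> sgx t = S t.
Proof. by move=> t0; rewrite /sgx max_l. Qed.

Lemma sgx_continuous x : continuous (fun t => sgx t x).
Proof.
move=> t; apply/cvgrPdist_le => e e0.
have [del del0 hd] := sg_ucont (Num.max t 0 + 1) x e0.
near=> s.
have st : `|t - s| < Num.min 1 del.
  near: s; apply/nbhs_ballP; exists (Num.min 1 del : R); last by move=> s.
  by rewrite /= lt_min ltr01.
move: st; rewrite lt_min => /andP[st1 st2].
have mx : `|Num.max t 0 - Num.max s 0| <= `|t - s|.
  rewrite ler_norml; case: (leP t 0) => ?; case: (leP s 0) => ?; have := ler_norm (t - s);
    have := ler_norm (s - t); rewrite (distrC s); have := normr_ge0 (t - s); lra.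
apply: hd.
- by rewrite le_max lexx orbT/= lerDl.
- rewrite le_max lexx orbT/=; move: (le_lt_trans mx st1); rewrite ltr_norml; lra.
- by apply: (le_trans mx); exact: ltW.
Unshelve. all: by end_near. Qed.

End Semigroup.

(** * Orthonormal expansions, weak measurability and nonnegative forms *)

Section Parseval.
Context {R : realType} {E : hilbertType R} (J : set nat) (g : nat -> E).
Hypothesis hg : orthonormal_basis J g.

Lemma bessel_identity (s : seq nat) (u : E) : uniq s -> {subset s <= J} ->
  `|u - \sum_(k <- s) dot (g k) u *: g k| ^+ 2 = `|u| ^+ 2 - \sum_(k <- s) dot (g k) u ^+ 2.
Proof.
move=> us sJ; have [go _] := hg.
have e1 : dot u (\sum_(k <- s) dot (g k) u *: g k) = \sum_(k <- s) dot (g k) u ^+ 2.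
  by rewrite dot_sumr; apply: eq_bigr => k _; rewrite dotZr dotC expr2.
have e2 : `|\sum_(k <- s) dot (g k) u *: g k| ^+ 2 = \sum_(k <- s) dot (g k) u ^+ 2.
  rewrite -dotxx dot_suml; apply: eq_big_seq => k ks; rewrite dotZl dot_sumr.
  rewrite (bigD1_seq k)//= dotZr go ?eqxx ?mulr1; try exact: set_mem (sJ _ ks).
  rewrite big1_seq ?addr0 ?expr2// => j /andP[jk js].
  by rewrite dotZr go; [rewrite eq_sym (negPf jk) mulr0|exact: set_mem (sJ _ ks)|exact: set_mem (sJ _ js)].
by rewrite normB_sqr e1 e2; ring.
Qed.

Lemma bessel_span (s : seq nat) (c : nat -> R) (u : E) : uniq s -> {subset s <= J} ->
  `|u| ^+ 2 - \sum_(k <- s) dot (g k) u ^+ 2 <= `|u - \sum_(k <- s) c k *: g k| ^+ 2.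
Proof.
move=> us sJ; rewrite -bessel_identity//; have [go _] := hg.
set p := \sum_(k <- s) dot _ _ *: _; set x := \sum_(k <- s) _.
have orth : dot (u - p) (p - x) = 0.
  rewrite /p /x -sumrB dot_sumr big1_seq// => k /= ks.
  rewrite -scalerBl dotZr dotBl dot_suml (bigD1_seq k)//= dotZl go ?eqxx ?mulr1; try exact: set_mem (sJ _ ks).
  rewrite big1_seq ?addr0 ?(dotC u) ?subrr ?mulr0// => j /andP[jk js].
  by rewrite dotZl go; [rewrite (negPf jk) mulr0|exact: set_mem (sJ _ js)|exact: set_mem (sJ _ ks)].
rewrite [X in _ <= `|X| ^+ 2](_ : u - x = (u - p) + (p - x)); last by rewrite addrA subrK.
by rewrite [leRHS]normD_sqr orth mulr0 addr0 lerDl sqr_ge0.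
Qed.

(** Bessel's inequality bounds every finite partial sum. Conversely a combination of basis vectors
    close to [u] is no closer than the projection on their span, so some partial sum is nearly
    [|u|^2]. *)
Lemma parseval u : (\esum_(k in J) (dot (g k) u ^+ 2)%:E = (`|u| ^+ 2)%:E)%E.
Proof.
have [go gd] := hg; apply/eqP; rewrite eq_le; apply/andP; split.
  apply: ge_ereal_sup => _ [X [finX XJ] <-].
  have [s us Xs] : exists2 s : seq nat, uniq s & X = [set` s].
    have /finite_seqP[s Xs] := finX; exists (undup s); first exact: undup_uniq.
    by rewrite Xs; apply/seteqP; split=> k /=; rewrite mem_undup.
  rewrite Xs -fsbig_seq// sumEFin lee_fin -subr_ge0 -bessel_identity ?sqr_ge0//.
  by move=> k ks; apply: mem_set; apply: XJ; rewrite Xs.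
apply/lee_addgt0Pr => e e0.
have : closure [set x | exists (s : seq nat) (c : nat -> R), (forall k, k \in s -> J k) /\ x = \sum_(k <- s) c k *: g k] u.
  by rewrite gd.
move=> /(_ _ (nbhsx_ballx u (Num.min 1 e) _))[|x [[s [c [sJ xs]]]]]; first by rewrite lt_min ltr01.
rewrite -ball_normE /ball_/= => ux.
(* The list in [orthonormal_basis] may repeat indices; their coefficients are collected. *)
have [c' xs'] : exists c' : nat -> R, x = \sum_(k <- undup s) c' k *: g k.
  exists (fun k => \sum_(j <- s | j == k) c k); rewrite xs.
  under [RHS]eq_bigr do rewrite scaler_suml.
  rewrite (exchange_big_dep xpredT)//=; apply: eq_big_seq => k ks.
  rewrite -big_filter (_ : [seq i <- undup s | k == i] = [:: k]) ?big_seq1//.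
  by rewrite (eq_filter (a2 := pred1 k)) ?filter_pred1_uniq ?undup_uniq ?mem_undup// => i; rewrite eq_sym.
have usJ : {subset undup s <= J} by move=> k; rewrite mem_undup => /sJ; exact: mem_set.
have h1 := bessel_span c' u (undup_uniq s) usJ; rewrite -xs' in h1.
have h2 : `|u - x| ^+ 2 <= e.
  move: ux; rewrite lt_min => /andP[u1 ue]; rewrite expr2.
  apply: le_trans (ltW ue); rewrite ler_piMr// ltW//.
apply: (@le_trans _ _ ((\sum_(k <- undup s) dot (g k) u ^+ 2)%:E + e%:E)%E).
  by rewrite -EFinD lee_fin; move: (le_trans h1 h2); rewrite lerBlDl addrC.
apply: leeD => //; rewrite -sumEFin fsbig_seq ?undup_uniq//.
apply: ereal_sup_ubound; exists [set` undup s] => //; split; first exact: finite_seq.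
by move=> k /= /usJ/set_mem.
Qed.

End Parseval.

(** For [r >= 0], [|z| > r] holds exactly when [dot z (q n) > r * |q n|] for some point of a dense
    sequence, a point close enough to [z] being a witness. Distances are thus countable suprema of
    scalar tests. *)
Lemma borel_weak {R : realType} {E : hilbertType R} (sepE : separable_space E) d (T : measurableType d)
    (D : set T) (mD : measurable D) (f : T -> E) :
  (forall y, measurable_fun D (fun s => dot (f s) y)) -> borel_on D f.
Proof.
move=> mf; apply/(borel_normP sepE mD) => x; have [q hq] := dense_seq sepE.
apply: (measurability (@RGenOInfty.G R)) => [|/= _ [_] [r] -> <-]; first exact: RGenOInfty.measurableE.
have [r0|r0] := ltP r 0.
  rewrite (_ : _ `&` _ = D)//; apply/seteqP; split=> [s []//|s Ds]; split => //=.
  by rewrite in_itv/= andbT (lt_le_trans r0).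
rewrite (_ : _ `&` _ = \bigcup_n (D `&` (fun s => dot (f s) (q n) - dot x (q n)) @^-1` `]r * `|q n|, +oo[)).
  by apply: bigcup_measurable => n _; apply: measurable_funB => //; exact: measurable_cst.
apply/seteqP; split=> s /=; rewrite in_itv/= andbT; last first.
  move=> [n _ [Ds]]; rewrite /= in_itv/= andbT -dotBl => h; split => //.
  have qn0 : 0 < `|q n|.
    rewrite lt_def normr_ge0 andbT normr_eq0; apply/eqP => q0.
    by rewrite q0 normr0 mulr0 dot0r ltxx in h.
  by rewrite -(ltr_pM2r qn0); apply: lt_le_trans h _; exact: dot_ler.
move=> [Ds rz]; set z := f s - x in rz *; have z0 : 0 < `|z| by exact: le_lt_trans rz.
pose e := (`|z| - r) * `|z| / (`|z| + r + 1).
have den : 0 < `|z| + r + 1 by rewrite ltr_wpDl// addr_ge0// ltW.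
have e0 : 0 < e by rewrite divr_gt0// mulr_gt0// subr_gt0.
have [n hn] := hq z e e0; exists n => //; split => //; rewrite /= in_itv/= andbT -dotBl -/z.
have h1 : dot z (z - q n) <= `|z| * `|z - q n| by exact: dot_ler.
rewrite dotBr dotxx in h1.
have h2 : r * `|q n| <= r * (`|z| + `|z - q n|).
  by rewrite ler_wpM2l// -{1}(subKr z (q n)); exact: ler_normB.
apply: le_lt_trans h2 _; apply: lt_le_trans (_ : `|z| ^+ 2 - `|z| * `|z - q n| <= _); last by move: h1; lra.
have : `|z - q n| * (`|z| + r) < e * (`|z| + r + 1).
  apply: (@le_lt_trans _ _ (`|z - q n| * (`|z| + r + 1))); first by rewrite ler_wpM2l// lerDl.
  by rewrite ltr_pM2r.
rewrite /e mulfVK ?gt_eqF// expr2; move: `|z - q n| => a; nra.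
Qed.

(** Rescale the test vector to length [|x|]: positivity of the form on [x - y'] gives [2 * dot (Q x)
    y' <= dot (Q x) x + dot (Q y') y'], hence the operator bound from the diagonal one. *)
Lemma nonneg_form_bound {R : realType} {H : hilbertType R} (Q : H -> H) (K : R) : 0 <= K ->
  (forall a x y, Q (a *: x + y) = a *: Q x + Q y) -> (forall x y, dot (Q x) y = dot x (Q y)) ->
  (forall y, 0 <= dot (Q y) y) -> (forall y, dot (Q y) y <= K * `|y| ^+ 2) ->
  forall x, `|Q x| <= K * `|x|.
Proof.
move=> K0 lin sQ Qpos hK.
have LD x y : Q (x + y) = Q x + Q y by have := lin 1 x y; rewrite !scale1r.
have L0 : Q 0 = 0.
  by have := LD 0 0; rewrite addr0 => /eqP; rewrite -subr_eq0 opprD addrA subrr sub0r oppr_eq0 => /eqP.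
have LZ a x : Q (a *: x) = a *: Q x by have := lin a x 0; rewrite L0 !addr0.
move=> x; have [->|xn] := eqVneq x 0; first by rewrite L0 !normr0 mulr0.
have cs y : dot (Q x) y <= K * `|x| * `|y|.
  have [->|yn] := eqVneq y 0; first by rewrite dot0r normr0 mulr0.
  have nx : 0 < `|x| by rewrite normr_gt0.
  have ny : 0 < `|y| by rewrite normr_gt0.
  pose y' := (`|x| / `|y|) *: y.
  have ny' : `|y'| = `|x| by rewrite normrZ ger0_norm ?divr_ge0// divfK ?gt_eqF.
  have h1 := Qpos (x - y'); have h2 := hK x; have h3 := hK y'.
  have Qy' : Q (x - y') = Q x - Q y'.
    by rewrite -scaleN1r LD LZ scaleN1r.
  rewrite Qy' dotBl !dotBr (sQ y' x) (dotC y') in h1; rewrite ny' in h3.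
  have h4 : dot (Q x) y' <= K * `|x| ^+ 2 by lra.
  have xy0 : 0 <= `|y| / `|x| by rewrite divr_ge0.
  have -> : dot (Q x) y = `|y| / `|x| * dot (Q x) y' by rewrite dotZr; field; rewrite !gt_eqF.
  apply: (le_trans (ler_wpM2l xy0 h4)); rewrite le_eqVlt; apply/orP; left; apply/eqP.
  by field; rewrite gt_eqF.
by apply: norm_le_dot; [rewrite mulr_ge0|exact: cs].
Qed.

(** * The covariance operators and their pseudo-inverses *)

Section Covariance.
Context {R : realType} {H U : hilbertType R} (S : R -> H -> H) (G : U -> H).
Hypotheses (sepH : separable_space H) (hS : C0_semigroup S) (bG : bounded_operator G).
Context (J : set nat) (g : nat -> U).
Hypothesis hg : orthonormal_basis J g.
Local Notation mu := (@lebesgue_measure R).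

(** The adjoint of [sgx S s \o G]. The covariance integrand is the composition of this adjoint with
    the operator itself, so its quadratic form is [|dual s y|^2]. *)
Definition dual (s : R) (y : H) : U := adjoint G (adjoint (sgx S s) y).

Lemma dualP s u y : dot (sgx S s (G u)) y = dot u (dual s y).
Proof. by rewrite (adjointP (sgx_bop hS s)) (adjointP bG). Qed.

Lemma dualD s x y : dual s (x + y) = dual s x + dual s y.
Proof. by apply: dot_ext => u; rewrite dotDl ![dot (dual _ _) u]dotC -!dualP dotDr. Qed.

Lemma dualZ s a y : dual s (a *: y) = a *: dual s y.
Proof. by apply: dot_ext => u; rewrite dotZl ![dot (dual _ _) u]dotC -!dualP dotZr. Qed.

Lemma dual_bound (T : R) : exists2 C : R, 0 <= C & forall s y, s <= T -> `|dual s y| <= C * `|y|.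
Proof.
have [M M1 hM] := sg_bound hS (Num.max T 0); have [C C0 hC] := bop_bound bG.
have M0 : 0 <= M by apply: le_trans M1.
exists (C * M) => [|s y sT]; first exact: mulr_ge0.
apply: (le_trans (adjoint_le bG C0 hC _)); rewrite -mulrA ler_wpM2l//.
apply: (adjoint_le (sgx_bop hS s) M0) => x; apply: hM.
by rewrite le_max lexx orbT/= ge_max !le_max sT lexx orbT.
Qed.

(** Expanding along the basis exhibits [|dual s y|^2] as a countable sum of squares of continuous
    functions of [s]; its measurability follows, and that of scalar products by polarization. *)
Lemma dual_norm2 s y : ((`|dual s y| ^+ 2)%:E = \esum_(k in J) (dot (sgx S s (G (g k))) y ^+ 2)%:E)%E.
Proof. by rewrite -(parseval hg); apply: eq_esum => k _; rewrite dualP. Qed.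

Lemma measurable_orbit (D : set (measurableTypeR R)) x y : measurable D ->
  measurable_fun D (fun s : measurableTypeR R => dot (sgx S s x) y).
Proof.
move=> mD; have c : continuous (fun s : R => dot (sgx S s x) y).
  move=> s; apply: (@continuous_comp _ _ _ (fun s => sgx S s x) (fun z => dot z y)).
    exact: sgx_continuous.
  exact: continuous_dotl.
have m : measurable_fun [set: measurableTypeR R] (fun s : measurableTypeR R => dot (sgx S s x) y).
  exact: continuous_measurable_fun.
exact: measurable_funTS.
Qed.

Lemma measurable_dual2 (D : set (measurableTypeR R)) y : measurable D ->
  measurable_fun D (fun s : measurableTypeR R => `|dual s y| ^+ 2).
Proof.
move=> mD; apply/measurable_EFinP; rewrite (_ : _ \o _ = (fun s => \esum_(k in J) (dot (sgx S s (G (g k))) y ^+ 2)%:E)%E); last first.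
  by apply/funext => s /=; rewrite dual_norm2.
apply: measurable_esum => [k Jk|s k _ _]; last by rewrite lee_fin sqr_ge0.
by apply/measurable_EFinP; apply: measurable_funX; exact: measurable_orbit.
Qed.

Lemma measurable_dual (D : set (measurableTypeR R)) x y : measurable D ->
  measurable_fun D (fun s : measurableTypeR R => dot (dual s x) (dual s y)).
Proof.
move=> mD; rewrite (_ : (fun s => _) = (fun s => (`|dual s (x + y)| ^+ 2 - `|dual s x| ^+ 2 - `|dual s y| ^+ 2) / 2)).
  apply: measurable_funM; last exact: measurable_cst.
  by apply: measurable_funB; [apply: measurable_funB|]; exact: measurable_dual2.
by apply/funext => s; rewrite dualD normD_sqr; field.
Qed.

Let mI (t : R) : measurable (`[0, t]%classic : set (measurableTypeR R)).
Proof. exact: measurable_itv. Qed.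

Let finI (t : R) : (mu `[0%R, t] < +oo)%E.
Proof. by rewrite lebesgue_measure_itv/=; case: ifP => _; rewrite ?ltry// -EFinB ltry. Qed.

Lemma cov_dot s h y : 0 <= s -> dot (cov_integrand S G s h) y = dot (dual s h) (dual s y).
Proof. by move=> s0; rewrite /cov_integrand -(sgxE _ s0) dualP. Qed.

Lemma cov_borel t h : borel_on (`[0, t]%classic : set (measurableTypeR R))
  (fun s : measurableTypeR R => cov_integrand S G s h).
Proof.
apply: (borel_weak sepH (mI t)) => y.
apply: (@eq_measurable_fun _ _ _ _ _ (fun s => dot (dual s h) (dual s y))); last exact: measurable_dual.
by move=> s; rewrite inE/= in_itv/= => /andP[s0 _]; rewrite cov_dot.
Qed.

Lemma cov_bound t : exists2 C : R, 0 <= C & forall h s, `[0, t]%classic s -> `|cov_integrand S G s h| <= C * `|h|.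
Proof.
have [C C0 hC] := dual_bound t; exists (C ^+ 2) => [|h s]; first exact: sqr_ge0.
rewrite /= in_itv/= => /andP[s0 st]; apply: norm_le_dot; first by rewrite mulr_ge0 ?sqr_ge0.
rewrite cov_dot//; apply: (le_trans (dot_ler _ _)).
apply: le_trans (ler_pM (normr_ge0 _) (normr_ge0 _) (hC _ _ st) (hC _ _ st)) _.
by rewrite mulrACA -expr2 mulrA.
Qed.

(** Converts the operator-valued Bochner integral into a scalar integral, from which symmetry,
    positivity and boundedness are read off. *)
Lemma Q_dot t h y : dot (Qop S G t h) y = \int[mu]_(s in `[0, t]) dot (dual s h) (dual s y).
Proof.
have [C C0 hC] := cov_bound t.
have [I hI] := has_bochner_exists sepH (mI t) (finI t) (@cov_borel t h) (hC h).
have hQ : has_bochner `[0, t] (fun s => cov_integrand S G s h) (Qop S G t h).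
  by rewrite /Qop /bochner; case: xgetP => [z _ //|/(_ I)].
rewrite (has_bochner_dot sepH (mI t) (finI t) (@cov_borel t h) (hC h) hQ).
by apply: eq_Rintegral => s; rewrite inE/= in_itv/= => /andP[s0 _]; rewrite cov_dot.
Qed.

Lemma Q_sym t x y : dot (Qop S G t x) y = dot x (Qop S G t y).
Proof. rewrite [RHS]dotC; apply: (eq_trans (Q_dot t x y)); apply: (eq_trans _ (esym (Q_dot t y x))).
by apply: eq_Rintegral => s _; exact: dotC. Qed.

Let intd t x y : mu.-integrable `[0, t] (EFin \o (fun s => dot (dual s x) (dual s y))).
Proof.
have [C C0 hC] := dual_bound t.
apply: (@integrable_bounded_on R `[0, t] (mI t) (finI t) _ (C * `|x| * (C * `|y|))).
  exact: measurable_dual.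
move=> s; rewrite /= in_itv/= => /andP[s0 st]; apply: (le_trans (dot_le _ _)).
by apply: ler_pM => //; exact: hC.
Qed.

Lemma Q_quad t y : (\int[mu]_(s in `[0%R, t]) (`|dual s y| ^+ 2)%:E = (dot (Qop S G t y) y)%:E)%E.
Proof.
rewrite Q_dot /Rintegral; under [in RHS]eq_integral do rewrite dotxx.
rewrite fineK//; apply: (integrable_fin_num (mI t)).
by have := @intd t y y; congr (_.-integrable _ _); apply/funext => s /=; rewrite dotxx.
Qed.

Lemma Q_bound t : exists2 C : R, 0 <= C & forall y, dot (Qop S G t y) y <= C * `|y| ^+ 2.
Proof.
have [C C0 hC] := dual_bound t; exists (C ^+ 2 * fine (mu `[0%R, t])).
  by rewrite mulr_ge0 ?sqr_ge0 ?fine_ge0.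
move=> y; rewrite -lee_fin -Q_quad.
apply: (@le_trans _ _ (\int[mu]_(s in `[0%R, t]) (C ^+ 2 * `|y| ^+ 2)%:E)%E).
  apply: ge0_le_integral => //.
  - by apply/measurable_EFinP; apply: measurable_dual2.
  move=> s; rewrite /= in_itv/= => /andP[s0 st]; rewrite lee_fin -exprMn.
  by rewrite ler_sqr ?nnegrE ?mulr_ge0// hC.
rewrite integral_cst//.
rewrite [leRHS](_ : _ = ((C ^+ 2 * `|y| ^+ 2) * fine (mu `[0%R, t]))%:E); last by rewrite mulrAC.
by rewrite [leRHS]EFinM fineK// ge0_fin_numE.
Qed.

Lemma Q_bop t : bounded_operator (Qop S G t).
Proof.
have [C C0 hC] := dual_bound t; have [K K0 hK] := Q_bound t.
have lin a x y : Qop S G t (a *: x + y) = a *: Qop S G t x + Qop S G t y.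
  apply: dot_ext => z; rewrite dotDl dotZl; apply: (eq_trans (Q_dot t _ z)).
  apply: (eq_trans _ (congr2 (fun p q => a * p + q) (esym (Q_dot t x z)) (esym (Q_dot t y z)))).
  rewrite -RintegralZl//.
  rewrite -RintegralD//; last exact: (integrableZl (mI t) a (@intd t x z)).
  by apply: eq_Rintegral => s _; rewrite dualD dualZ dotDl dotZl.
have Qpos y : 0 <= dot (Qop S G t y) y.
  by rewrite -lee_fin -Q_quad; apply: integral_ge0 => s _; rewrite lee_fin sqr_ge0.
apply: (@bopP _ _ _ _ K) => // x.
by apply: (nonneg_form_bound K0 lin (Q_sym t) Qpos hK).
Qed.

(** The substitution of [r - s] for [s] identifies the covariance of the stochastic convolution over
    []u, r]] as [Q_(r - u)]. *)
Lemma Q_quad_reflect u r y : u <= r ->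
  (\int[mu]_(s in `]u, r]) (\esum_(k in J) (dot (S (r - s) (G (g k))) y ^+ 2)%:E) =
   (dot (Qop S G (r - u) y) y)%:E)%E.
Proof.
move=> ur; rewrite -Q_quad.
pose h (s : R) : \bar R := ((fun s => (`|dual s y| ^+ 2)%:E) \_ `[0%R, r - u[) s.
have mD : measurable (`[0, r - u[%classic : set (measurableTypeR R)) by exact: measurable_itv.
have mh : measurable_fun setT (h : measurableTypeR R -> \bar R).
  by apply/(measurable_restrictT _ mD)/measurable_EFinP; exact: measurable_dual2.
have h0 s : (0 <= h s)%E by apply: erestrict_ge0 => ? _; rewrite lee_fin sqr_ge0.
transitivity (\int[mu]_s h (r - s)%R)%E.
  rewrite integral_mkcond; apply: eq_integral => s _; rewrite /h !patchE.
  have -> : (r - s \in `[0, r - u[%classic) = (s \in `]u, r]%classic).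
    by rewrite !mem_setE !in_itv/= subr_ge0 ltrD2l ltrN2 andbC.
  case: ifPn => //; rewrite mem_setE in_itv/= => /andP[_ sr].
  rewrite dual_norm2; apply: eq_esum => k _; rewrite sgxE// subr_ge0//.
rewrite ge0_integral_reflect// /h -integral_mkcond integral_itv_bndo_bndc//.
by apply/measurable_EFinP; exact: measurable_dual2.
Qed.

Lemma dual_adjoint s t y : 0 <= s -> 0 <= t -> dual s (adjoint (S t) y) = dual (t + s) y.
Proof.
move=> s0 t0; have [_ _ Sadd _] := hS; apply: dot_ext => u.
rewrite ![dot (dual _ _) u]dotC -!dualP -(adjointP (sg_bop hS t0)) !sgxE ?addr_ge0//.
by rewrite Sadd.
Qed.

(** The left side is the part over [[t - s, t]] of the integral that defines the right side. This
    gives the monotonicity of [Gamma] in time. *)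
Lemma Q_mono_adjoint s t y : 0 <= s -> s <= t ->
  dot (Qop S G s (adjoint (S (t - s)) y)) (adjoint (S (t - s)) y) <= dot (Qop S G t y) y.
Proof.
move=> s0 st; have ts0 : 0 <= t - s by rewrite subr_ge0.
rewrite -lee_fin -!Q_quad.
pose h (r : R) : \bar R := ((fun s => (`|dual s y| ^+ 2)%:E) \_ `[t - s, t]) r.
have mD : measurable (`[t - s, t]%classic : set (measurableTypeR R)) by exact: measurable_itv.
have mh : measurable_fun setT (h : measurableTypeR R -> \bar R).
  by apply/(measurable_restrictT _ mD)/measurable_EFinP; exact: measurable_dual2.
have h0 r : (0 <= h r)%E by apply: erestrict_ge0 => ? _; rewrite lee_fin sqr_ge0.
have -> : (\int[mu]_(r in `[0%R, s]) (`|dual r (adjoint (S (t - s)) y)| ^+ 2)%:E = \int[mu]_r h (r + (t - s))%R)%E.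
  rewrite integral_mkcond; apply: eq_integral => r _; rewrite /h !patchE.
  have -> : (r + (t - s) \in `[t - s, t]%classic) = (r \in `[0, s]%classic).
    by rewrite !mem_setE !in_itv/= lerDr -lerBrDr; congr (_ && (_ <= _)); ring.
  case: ifPn => //; rewrite mem_setE in_itv/= => /andP[r0 _].
  by rewrite dual_adjoint// addrC.
rewrite ge0_integral_translate// /h -integral_mkcond; apply: ge0_subset_integral => //.
- by apply/measurable_EFinP; exact: measurable_dual2.
- by move=> r; rewrite /= !in_itv/= => /andP[a ->]; rewrite (le_trans ts0).
Qed.

End Covariance.

Section OperatorNorm.
Context {R : realType} {E F : normedModType R}.
Implicit Type f : E -> F.

Lemma opnorm_ge0 f : 0 <= opnorm f.
Proof.
rewrite /opnorm /opnorm_on; have [hs|/sup_out -> //] := pselect (has_sup [set `|f x| | x in setT `&` [set x | `|x| <= 1]]).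
have [[z [x xin _]] _] := hs; apply: (le_trans (normr_ge0 (f x))).
by apply: ub_le_sup; [exact: hs.2|exists x].
Qed.

(** The supremum of an unbounded set is 0 by convention, so positivity of [opnorm f] certifies that
    [f] is bounded on the unit ball. *)
Lemma opnorm_ub f x : 0 < opnorm f -> `|x| <= 1 -> `|f x| <= opnorm f.
Proof.
rewrite /opnorm /opnorm_on => f0 x1; set A := [set _ | _ in _] in f0 *.
have hs : has_sup A by apply: contrapT => /sup_out h; rewrite h ltxx in f0.
by apply: ub_le_sup; [exact: hs.2|exists x].
Qed.

Lemma opnorm_lub f C : (forall x, `|x| <= 1 -> `|f x| <= C) -> opnorm f <= C.
Proof.
move=> h; apply: ge_sup => [|_ [x [_ x1] <-]]; last exact: h.
by exists `|f 0|, 0 => //; split => //=; rewrite normr0 ler01.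
Qed.

End OperatorNorm.

Section Gamma.
Context {R : realType} {H U : hilbertType R} (S : R -> H -> H) (G Gt : U -> H).
Hypotheses (sepH : separable_space H) (hS : C0_semigroup S).
Hypotheses (bG : bounded_operator G) (bGt : bounded_operator Gt).
Context (J : set nat) (g : nat -> U).
Hypothesis hg : orthonormal_basis J g.
Variable theta : R.
Hypothesis theta1 : theta < 1.
Hypothesis hrange : forall t, 0 < t -> range (S t) `<=` range (sqrt_operator (Qop S G t)).
Hypothesis hlow : forall t, 0 < t -> exists c : R, 0 < c /\ forall s, 0 < s < t ->
  c <= opnorm (Gamma_op S G s) `^ (1 - theta) /\ c <= opnorm (Gamma_op S G s \o Gt).
Local Notation Q := (Qop S G).
Local Notation Gam := (Gamma_op S G).
Local Notation sqrtQ t := (sqrt_operator (Qop S G t)).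

(** The assumed lower bounds exclude the value 0, in particular the conventional one: by [opnorm_ub]
    both operators are bounded on the unit ball. *)
Lemma Gamma_norm_gt0 t : 0 < t -> 0 < opnorm (Gam t) /\ 0 < opnorm (Gam t \o Gt).
Proof.
move=> t0; have t1 : 0 < t + 1 by rewrite addr_gt0.
have [c [c0 /(_ t)]] := hlow t1; rewrite t0 ltrDl ltr01 => /(_ isT)[h1 h2]; split; last exact: lt_le_trans h2.
rewrite lt_def opnorm_ge0 andbT; apply/eqP => e; move: h1; rewrite e powR0 ?gt_eqF ?subr_gt0// => /(lt_le_trans c0).
by rewrite ltxx.
Qed.

(** If no square root existed, [sqrt_operator] would be its default 0; the range inclusion would
    force [S t = 0], hence [Gam t = 0], contradicting the positivity of its norm. The existence of
    the root is thus extracted from the hypotheses. *)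
Lemma sqrtQ_spec t : 0 < t -> [/\ bounded_operator (sqrtQ t),
  forall x y, dot (sqrtQ t x) y = dot x (sqrtQ t y) & forall x, sqrtQ t (sqrtQ t x) = Q t x].
Proof.
move=> t0; rewrite {1}/sqrt_operator; case: xgetP => [f -> [h1 h2 _ h3] //|no].
have e0 : sqrtQ t = fun=> 0.
  by rewrite /sqrt_operator; case: xgetP => // f _ h; case: (no f h).
have S0 x : S t x = 0.
  by have [y _] := hrange t0 (ex_intro2 _ _ x Logic.I erefl); rewrite e0 => ->.
have G0 x : Gam t x = 0.
  rewrite /Gamma_op S0 e0 /pseudo_inverse; case: xgetP => // y _ [_ h].
  by apply/eqP; rewrite -normr_eq0 -sqrf_eq0 -dotxx h.
have [+ _] := Gamma_norm_gt0 t0; suff -> : opnorm (Gam t) = 0 by rewrite ltxx.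
apply/eqP; rewrite eq_le opnorm_ge0 andbT; apply: opnorm_lub => x _.
by rewrite G0 normr0.
Qed.

Lemma Gamma_spec t h : 0 < t -> sqrtQ t (Gam t h) = S t h /\
  forall z, sqrtQ t z = 0 -> dot (Gam t h) z = 0.
Proof.
move=> t0; have [b _ _] := sqrtQ_spec t0.
by apply: (pseudo_inverseP b); apply: (hrange t0); exists h.
Qed.

Lemma sqrtQ_norm2 t y : 0 < t -> `|sqrtQ t y| ^+ 2 = dot (Q t y) y.
Proof. by move=> t0; have [_ s e] := sqrtQ_spec t0; rewrite -dotxx -(e y) (s (sqrtQ t y) y). Qed.

Lemma Gamma_approx t h e : 0 < t -> 0 < e -> exists y, `|sqrtQ t y - Gam t h| < e.
Proof.
move=> t0 e0; have [b s _] := sqrtQ_spec t0; have [_ k] := Gamma_spec h t0.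
exact: orth_ker_closure_range.
Qed.

Lemma Gamma_dot t h y : 0 < t -> dot (S t h) y ^+ 2 <= `|Gam t h| ^+ 2 * dot (Q t y) y.
Proof.
move=> t0; have [_ s _] := sqrtQ_spec t0; have [<- _] := Gamma_spec h t0.
by rewrite s -sqrtQ_norm2//; exact: dot_sqr_le.
Qed.

(** The converse of [Gamma_dot]. The vector [Gam t h] is orthogonal to the kernel of the square
    root, hence a limit of vectors [sqrtQ t y], and can almost be tested against itself. Bounds on
    [Gamma] are thereby reduced to inequalities between forms. *)
Lemma Gamma_le t h (c : R) : 0 < t -> 0 <= c ->
  (forall y, dot (S t h) y ^+ 2 <= c ^+ 2 * dot (Q t y) y) -> `|Gam t h| <= c.
Proof.
move=> t0 c0 hc; have [_ s _] := sqrtQ_spec t0; have [e _] := Gamma_spec h t0.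
set z := Gam t h in e *; rewrite leNgt; apply/negP => cz.
have z0 : 0 < `|z| by exact: le_lt_trans cz.
(* Chosen so that [d * (|z| + c + 1)] is half of [(|z| - c) * |z|], which contradicts the inequality
   obtained by testing. *)
pose d := (`|z| - c) / 2 * (`|z| / (`|z| + c + 1)).
have den : 0 < `|z| + c + 1 by rewrite ltr_wpDl// addr_ge0.
have d0 : 0 < d by rewrite !mulr_gt0 ?invr_gt0// subr_gt0.
have [y] := Gamma_approx h t0 d0; rewrite -/z; set p := sqrtQ t y => py.
have := hc y; rewrite -e s -/p -sqrtQ_norm2// -/p -exprMn.
rewrite -ler_sqrt ?sqr_ge0// !sqrtr_sqr normrM normr_id (ger0_norm c0) => h1.
have h2 : `|z| * (`|z| - `|z - p|) <= `|dot z p|.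
  apply: le_trans (ler_norm _); have := dot_ler z (z - p); rewrite dotBr dotxx mulrBr -expr2; lra.
have h3 : `|p| <= `|z| + `|z - p| by rewrite -{1}(subKr z p); exact: ler_normB.
have h4 := le_trans (le_trans h2 h1) (ler_wpM2l c0 h3).
rewrite distrC in h4; move: py h4; move: `|p - z| => a ad h4.
have h5 : (`|z| - c) * `|z| <= a * (`|z| + c + 1).
  have [a0|a0] := leP 0 a; last by nra.
  by nra.
have : a * (`|z| + c + 1) < d * (`|z| + c + 1) by rewrite ltr_pM2r.
rewrite /d -mulrA divfK ?gt_eqF// => h6.
have := mulr_gt0 (_ : 0 < `|z| - c) z0; rewrite subr_gt0 => /(_ cz) h7.
by move: h5 h6 h7; rewrite mulrAC; lra.
Qed.

Lemma Gamma_mono s t h : 0 < s -> s <= t -> `|Gam t h| <= `|Gam s h|.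
Proof.
move=> s0 st; have t0 : 0 < t by exact: lt_le_trans st.
have [_ _ Sadd _] := hS; have ts0 : 0 <= t - s by rewrite subr_ge0.
apply: Gamma_le => // y.
have -> : S t h = S (t - s) (S s h) by rewrite -Sadd ?subrK// ltW.
rewrite (adjointP (sg_bop hS ts0)); apply: (le_trans (Gamma_dot _ _ s0)).
by rewrite ler_wpM2l ?sqr_ge0//; apply: (Q_mono_adjoint sepH hS bG hg _ (ltW s0) st).
Qed.

(** The homogeneity that is used is derived from the form inequalities, without any linearity of the
    pseudo-inverse. *)
Lemma Gamma_scale t h (c : R) : 0 < t -> h != 0 -> 0 <= c ->
  `|Gam t (`|h|^-1 *: h)| <= c -> `|Gam t h| <= c * `|h|.
Proof.
move=> t0 hn c0 hc; apply: Gamma_le => //; first by rewrite mulr_ge0.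
move=> y; have h0 : 0 < `|h| by rewrite normr_gt0.
have -> : h = `|h| *: (`|h|^-1 *: h) by rewrite scalerA mulfV ?gt_eqF// scale1r.
rewrite (bopZ (sg_bop hS (ltW t0))) dotZl exprMn normrZ normr_id normrZ normfV normr_id mulVf ?gt_eqF// mulr1.
rewrite [leRHS](_ : _ = `|h| ^+ 2 * (c ^+ 2 * dot (Q t y) y)); last by ring.
apply: ler_wpM2l; first exact: sqr_ge0.
apply: (le_trans (Gamma_dot _ _ t0)); apply: ler_wpM2r.
  by rewrite -sqrtQ_norm2// sqr_ge0.
by rewrite ler_sqr ?nnegrE.
Qed.

Lemma Gamma_opnorm t h : 0 < t -> `|Gam t h| <= opnorm (Gam t) * `|h|.
Proof.
move=> t0; have [p _] := Gamma_norm_gt0 t0; have [->|hn] := eqVneq h 0.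
  rewrite normr0 mulr0; apply: Gamma_le => // y.
  by rewrite (bop0 (sg_bop hS (ltW t0))) dot0l expr0n/= mul0r.
apply: Gamma_scale => //; first exact: opnorm_ge0.
by apply: opnorm_ub => //; rewrite normrZ normfV normr_id mulVf// normr_eq0.
Qed.

Lemma Gamma_opnorm_comp t u : 0 < t -> `|Gam t (Gt u)| <= opnorm (Gam t \o Gt) * `|u|.
Proof.
move=> t0; have [_ p] := Gamma_norm_gt0 t0; have [->|un] := eqVneq u 0.
  rewrite normr0 mulr0 (bop0 bGt); apply: Gamma_le => // y.
  by rewrite (bop0 (sg_bop hS (ltW t0))) dot0l expr0n/= mul0r.
have u0 : 0 < `|u| by rewrite normr_gt0.
apply: Gamma_le => //; first by rewrite mulr_ge0// opnorm_ge0.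
move=> y; have {1}-> : u = `|u| *: (`|u|^-1 *: u) by rewrite scalerA mulfV ?gt_eqF// scale1r.
rewrite (bopZ bGt) (bopZ (sg_bop hS (ltW t0))) dotZl !exprMn.
rewrite [X in _ <= X]mulrAC mulrC ler_wpM2r ?sqr_ge0//.
apply: (le_trans (Gamma_dot _ _ t0)); rewrite ler_wpM2r//.
  by rewrite -sqrtQ_norm2// sqr_ge0.
rewrite ler_sqr ?nnegrE ?opnorm_ge0//.
apply: (opnorm_ub (f := Gam t \o Gt)) => //.
by rewrite normrZ normfV normr_id mulVf ?gt_eqF.
Qed.

Lemma opnorm_Gamma_mono s t : 0 < s -> s <= t -> opnorm (Gam t) <= opnorm (Gam s) /\
  opnorm (Gam t \o Gt) <= opnorm (Gam s \o Gt).
Proof.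
move=> s0 st; have [p q] := Gamma_norm_gt0 s0; split; apply: opnorm_lub => x x1.
  by apply: (le_trans (Gamma_mono _ s0 st)); exact: opnorm_ub.
by apply: (le_trans (Gamma_mono _ s0 st)); exact: (opnorm_ub (f := Gam s \o Gt)).
Qed.

(** Since [Q_s] is at most of order [s], [Gamma_dot] with [y = S s v] gives
    [|S s v| <= |Gam s v| * C * sqrt s], while [|S s v| >= |v| / 2] for small [s] by strong
    continuity. Away from 0 the assumed lower bound suffices. This singularity makes [a(s) / sqrt s]
    integrable. *)
Lemma opnorm_Gamma_lower T : 0 < T -> exists2 c : R, 0 < c & forall s, 0 < s -> s < T ->
  c <= opnorm (Gam s \o Gt) * Num.sqrt s.
Proof.
move=> T0; have [C C0 hC] := dual_bound hS bG T.
have [u0 Gu0] : exists u, Gt u != 0.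
  apply: contrapT => /forallNP no; have [_] := Gamma_norm_gt0 T0.
  suff -> : opnorm (Gam T \o Gt) = 0 by rewrite ltxx.
  apply/eqP; rewrite eq_le opnorm_ge0 andbT; apply: opnorm_lub => x _ /=.
  have /negP/negPn/eqP -> := no x; apply: Gamma_le => // y.
  by rewrite (bop0 (sg_bop hS (ltW T0))) dot0l expr0n/= mul0r.
set v := Gt u0 in Gu0; have v0 : 0 < `|v| by rewrite normr_gt0.
have [del del0 hd] := sg_right hS v (divr_gt0 v0 (ltr0Sn R 1)).
have [c1 [c10 hc1]] := hlow T0.
have un0 : u0 != 0 by apply: contra Gu0 => /eqP e; rewrite /v e (bop0 bGt).
have nu0 : 0 < `|u0| by rewrite normr_gt0.
have C1 : 0 < C + 1 by rewrite ltr_wpDl.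
pose c2 := `|v| / 2 / (`|u0| * (C + 1)).
have c20 : 0 < c2 by rewrite !divr_gt0// mulr_gt0.
exists (Num.min c2 (c1 * Num.sqrt del)); first by rewrite lt_min c20 mulr_gt0// sqrtr_gt0.
move=> s s0 sT; set k := opnorm _; have k0 : 0 <= k by exact: opnorm_ge0.
have [sd|ds] := leP s del; last first.
  apply: (@le_trans _ _ (c1 * Num.sqrt del)); first by rewrite ge_min lexx orbT.
  apply: ler_pM => //; [exact: ltW|by have [] := hc1 s ltac:(by rewrite s0 sT)|].
  by rewrite ler_sqrt ltW.
apply: (@le_trans _ _ c2); first by rewrite ge_min lexx.
have Qs y : dot (Q s y) y <= s * (C ^+ 2 * `|y| ^+ 2).
  rewrite -lee_fin -(Q_quad sepH hS bG hg).
  apply: (@le_trans _ _ (\int[lebesgue_measure]_(r in `[0%R, s]) (C ^+ 2 * `|y| ^+ 2)%:E)%E).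
    apply: ge0_le_integral => //.
    - by apply/measurable_EFinP; apply: (measurable_dual2 hS bG hg).
    move=> r; rewrite /= in_itv/= => /andP[r0 rs]; rewrite lee_fin -exprMn.
    by rewrite ler_sqr ?nnegrE ?mulr_ge0// hC// (le_trans rs)// ltW.
  rewrite integral_cst//= lebesgue_measure_itv/= lte_fin s0 -EFinB subr0 -EFinM.
  by rewrite lee_fin mulrC.
have h1 : `|S s v| <= k * `|u0| * (Num.sqrt s * C).
  have := Gamma_dot v (S s v) s0; rewrite dotxx => h.
  have h2 : `|Gam s v| ^+ 2 <= (k * `|u0|) ^+ 2.
    by rewrite ler_sqr ?nnegrE ?mulr_ge0//; exact: Gamma_opnorm_comp.
  have h3 : (`|S s v| ^+ 2) ^+ 2 <= (k * `|u0| * (Num.sqrt s * C)) ^+ 2 * `|S s v| ^+ 2.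
    have q0 : 0 <= dot (Q s (S s v)) (S s v) by rewrite -sqrtQ_norm2// sqr_ge0.
    apply: (le_trans h); apply: (le_trans (ler_pM (sqr_ge0 _) q0 h2 (Qs _))).
    by rewrite !exprMn (sqr_sqrtr (ltW s0)) le_eqVlt; apply/orP; left; apply/eqP; ring.
  have [->|Sn] := eqVneq `|S s v| 0; first by rewrite !mulr_ge0 ?sqrtr_ge0.
  have S0 : 0 < `|S s v| by rewrite lt_def Sn normr_ge0.
  have S20 : 0 < `|S s v| ^+ 2 by rewrite exprn_gt0.
  move: h3; rewrite {1}expr2 ler_pM2r// ler_sqr ?nnegrE//.
  by rewrite !mulr_ge0 ?sqrtr_ge0.
have h2 : `|v| / 2 <= `|S s v|.
  have := hd s (ltW s0) sd; rewrite distrC => h; have := ler_normB v (v - S s v); rewrite subKr.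
  by have := ler_normD (v - S s v) (S s v); rewrite subrK; lra.
rewrite /c2 ler_pdivrMr ?mulr_gt0//; apply: (le_trans h2); apply: (le_trans h1).
rewrite -!mulrA ler_wpM2l// mulrCA ler_wpM2l ?sqrtr_ge0//.
by rewrite ler_wpM2l// lerDl.
Qed.

End Gamma.

(** * Smoothing by the stochastic convolution *)

Section UnitHolder.
Context {R : realType} {E : normedModType R} (theta : R).
Hypothesis theta01 : 0 < theta < 1.

(** The unit ball for the maximum of the supremum norm and the Hölder seminorm. *)
Definition unit_holder (f : E -> R) := (forall x, `|f x| <= 1) /\
  (forall x y, `|f x - f y| <= `|x - y| `^ theta).

Lemma unit_holder_ucont f : unit_holder f -> ucont f.
Proof. by move=> [_ h]; apply: (holder_ucont theta01 ler01) => x y; rewrite mul1r. Qed.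

(** The first term dominates when [t] exceeds [1 / alpha], the second one otherwise. *)
Lemma powR_young (alpha t : R) : 0 < alpha -> 0 <= t ->
  t `^ theta <= alpha `^ (1 - theta) * t + alpha `^ (- theta).
Proof.
move=> a0 t0; have /andP[th0 th1] := theta01.
have p0 (x y : R) : 0 <= x `^ y by exact: powR_ge0.
have [ta|ta] := leP t alpha^-1.
  rewrite -[leLHS]add0r lerD ?mulr_ge0//.
  apply: (@le_trans _ _ (alpha^-1 `^ theta)).
    by apply: ge0_ler_powR; rewrite ?nnegrE ?(ltW th0) ?invr_ge0 ?(ltW a0).
  by rewrite -powR_inv1 ?(ltW a0)// -powRrM mulN1r.
have tp : 0 < t by apply: lt_trans ta; rewrite invr_gt0.
rewrite -[leLHS]addr0 lerD//.
have -> : t `^ theta = t^-1 `^ (1 - theta) * t.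
  rewrite -{3}(powRr1 t0) -powR_inv1// -powRrM -powRD; first by congr (_ `^ _); ring.
  by apply/implyP => _; rewrite gt_eqF.
rewrite ler_pM2r//; apply: ge0_ler_powR; rewrite ?nnegrE ?subr_ge0 ?(ltW th1) ?invr_ge0// ?(ltW a0)//.
by rewrite -[leRHS]invrK lef_pV2 ?posrE ?invr_gt0// ltW.
Qed.

(** The Lipschitz regularization [inf_z (f (x - z) + lam * |z|)] with [lam = alpha^(1 - theta)].
    Being built from translates, it inherits the Hölder bound of [f]; [powR_young] measures its
    distance to [f]. *)
Lemma inf_convolution f (alpha : R) : unit_holder f -> 0 < alpha -> exists h,
  [/\ unit_holder h, forall x y, `|h x - h y| <= alpha `^ (1 - theta) * `|x - y| &
      forall x, `|f x - h x| <= alpha `^ (- theta)].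
Proof.
move=> [f1 fh] a0; pose lam := alpha `^ (1 - theta); have l0 : 0 <= lam by exact: powR_ge0.
pose V x := [set f (x - z) + lam * `|z| | z in [set: E]].
pose h x := inf (V x).
have lb x z : -1 <= f (x - z) + lam * `|z|.
  by have := f1 (x - z); rewrite ler_norml => /andP[? _]; rewrite -[leLHS]addr0 lerD// mulr_ge0.
have hle x z : h x <= f (x - z) + lam * `|z|.
  by apply: ge_inf; [exists (-1) => _ [y _ <-]|exists z].
have geh x c : (forall z, c <= f (x - z) + lam * `|z|) -> c <= h x.
  by move=> hc; apply: lb_le_inf; [exists (f (x - 0) + lam * `|0 : E|), 0|move=> _ [z _ <-]].
have hf x : h x <= f x by have := hle x 0; rewrite subr0 normr0 mulr0 addr0.
exists h; split.
- split=> [x|].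
    rewrite ler_norml geh ?lb//=; apply: (le_trans (hf x)); exact: le_trans (ler_norm _) (f1 x).
  have main x y : h x - h y <= `|x - y| `^ theta.
    rewrite lerBlDr -lerBlDl; apply: geh => z; rewrite lerBlDl; apply: (le_trans (hle x z)).
    rewrite addrA lerD2r -lerBlDr; apply: (le_trans (ler_norm _)).
    apply: (le_trans (fh _ _)); rewrite le_eqVlt; apply/orP; left; apply/eqP; congr (`|_| `^ _).
    by rewrite opprB addrA subrK.
  by move=> x y; rewrite ler_norml main andbT lerNl opprB distrC main.
- have main x y : h x - h y <= lam * `|x - y|.
    rewrite lerBlDr -lerBlDl; apply: geh => z; rewrite lerBlDl; apply: (le_trans (hle x (z + (x - y)))).
    rewrite (_ : x - (z + (x - y)) = y - z); last by rewrite opprD opprB addrCA [x + _]addrC subrK addrC.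
    rewrite [leRHS]addrCA lerD2l -mulrDr ler_wpM2l// addrC; exact: ler_normD.
  by move=> x y; rewrite ler_norml main andbT lerNl opprB distrC main.
- move=> x; rewrite ger0_norm ?subr_ge0// lerBlDr -lerBlDl; apply: geh => z; rewrite lerBlDl.
  have := fh x (x - z); rewrite subKr => h1; have := powR_young a0 (normr_ge0 z) => h2.
  have := le_trans (ler_norm _) h1; rewrite /lam; move: h2; lra.
Qed.

End UnitHolder.

Section SmoothingEstimates.
Context {R : realType} d (Omega : measurableType d) (P : probability Omega R).
Context {U H : hilbertType R} (F : R -> set (set Omega)) (W : cylindrical Omega U).
Hypothesis hW : cylindrical_wiener P F W.
Hypothesis sepH : separable_space H.
Context (S : R -> H -> H) (G Gt : U -> H).
Hypothesis hS : C0_semigroup S.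
Hypotheses (bG : bounded_operator G) (bGt : bounded_operator Gt).
Variable theta : R.
Hypothesis theta01 : 0 < theta < 1.
Hypothesis hrange : forall t, 0 < t -> range (S t) `<=` range (sqrt_operator (Qop S G t)).
Hypothesis hlow : forall t, 0 < t -> exists c : R, 0 < c /\ forall s, 0 < s < t ->
  c <= opnorm (Gamma_op S G s) `^ (1 - theta) /\ c <= opnorm (Gamma_op S G s \o Gt).
Local Notation Q := (Qop S G).
Local Notation Gam := (Gamma_op S G).
Local Notation sqrtQ t := (sqrt_operator (Qop S G t)).

Let theta1 : theta < 1. Proof. by have /andP[] := theta01. Qed.
Let hg : orthonormal_basis (wI W) (wg W). Proof. by have [] := hW. Qed.

Definition conv_kernel (r : R) (s : R) (k : nat) : H := S (r - s) (G (wg W k)).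

Section one_interval.
Variables (u r : R) (Z : Omega -> H).
Hypotheses (u0 : 0 <= u) (ur : u < r).
Hypothesis hZ : sint P W u r (conv_kernel r) Z.
Local Notation tau := (r - u).

Let tau0 : 0 < tau. Proof. by rewrite subr_gt0. Qed.
Let bZ : borel_on setT Z. Proof. by have [] := hZ. Qed.

(** With [z = Gam tau h] one has [S tau h = sqrtQ tau z]. Approximating [z] by [sqrtQ tau y] makes
    [Q tau y] close to [S tau h], and [Q tau y] is a Cameron-Martin direction whose squared length
    [|sqrtQ tau y|^2] is close to [|z|^2]. *)
Lemma shift_total_variation (f : H -> R) (C : R) h : ucont f -> (forall x, `|f x| <= C) ->
  `|\int[P]_w f (S tau h + Z w) - \int[P]_w f (Z w)| <= 4 * C * `|Gam tau h|.
Proof.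
move=> uf fC; have C0 : 0 <= C by apply: le_trans (fC 0).
apply/ler_addgt0Pr => eta eta0; pose e := eta / (8 * C + 2).
have e0 : 0 < e by rewrite divr_gt0// ltr_wpDl// mulr_ge0.
have [bq sq qq] := sqrtQ_spec theta1 hrange hlow tau0.
have [Gs Gk] := Gamma_spec theta1 hrange hlow h tau0.
have [K K0 hK] := bop_bound bq.
have [c c0 hc] := uf e e0.
have [del /andP[del0 del1] hdel] := small_factor e0 (mulr_ge0 c0 (sqr_ge0 K)).
have md : 0 < Num.min e del by rewrite lt_min e0.
have [y] := Gamma_approx theta1 hrange hlow h tau0 md; rewrite lt_min => /andP[y1 y2].
set z := Gam tau h in Gs Gk y1 y2 *; set p := sqrtQ tau y in y1 y2.
have Qy : Q tau y = sqrtQ tau p by rewrite qq.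
have QS : `|Q tau y - S tau h| <= K * del.
  rewrite Qy -Gs -(bopB bq); apply: (le_trans (hK _)); rewrite ler_wpM2l//; exact: ltW.
have [KQ KQ0 hKQ] := Q_bound sepH hS bG hg tau.
have s0 : 0 < `|z| + e by rewrite ltr_wpDl.
have hq : dot (Q tau y) y < (`|z| + e) ^+ 2.
  rewrite -(sqrtQ_norm2 theta1 hrange hlow)// ltr_sqr ?nnegrE ?(ltW s0)//.
  by rewrite -/p -{1}(subrK z p) addrC (le_lt_trans (ler_normD _ _))// ltrD2l.
have hquad y' : (\int[lebesgue_measure]_(s in `]u, r]) (\esum_(k in wI W) (dot (conv_kernel r s k) y' ^+ 2)%:E) =
    (dot (Q tau y') y')%:E)%E by apply: (Q_quad_reflect sepH hS bG hg y' (ltW ur)).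
have tv := sint_total_variation hW sepH u0 hZ (Q_bop sepH hS bG hg tau)
  (Q_sym sepH hS bG hg tau) hquad KQ0 hKQ uf fC s0 hq.
have bc (x : H) : borel_on setT (fun _ : Omega => x) by exact: borel_cst.
have ib (X : Omega -> H) : borel_on setT X -> P.-integrable setT (EFin \o (fun w => f (X w))).
  by move=> bX; apply: (@integrable_bounded _ _ _ P _ C) => //; exact: (ucont_measurable sepH uf).
have b1 : borel_on setT (fun w => S tau h + Z w) by exact: borelD.
have b2 : borel_on setT (fun w => Z w + Q tau y) by exact: borelD.
have cl : `|\int[P]_w f (S tau h + Z w) - \int[P]_w f (Z w + Q tau y)| <= 2 * e.
  rewrite -RintegralB//; [|exact: ib|exact: ib].
  apply: Rint_le_bound => [|w].
    by apply: measurable_funB; apply: (ucont_measurable sepH uf).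
  apply: (le_trans (hc _ _)); rewrite mulr2n mulrDl mul1r lerD2l.
  rewrite (_ : _ - _ = S tau h - Q tau y); last by hring.
  apply: (@le_trans _ _ (c * (K * del) ^+ 2)).
    rewrite ler_wpM2l// ler_sqr ?nnegrE ?mulr_ge0 ?(ltW del0)//.
    by rewrite distrC.
  apply: le_trans hdel; rewrite exprMn mulrA mulrC ler_wpM2r ?mulr_ge0 ?sqr_ge0//.
  by rewrite expr2 ler_piMl// ltW.
move: tv cl; move: (\int[P]_w _) (\int[P]_w _) (\int[P]_w _) => a1 a2 a3 tv cl.
rewrite (_ : a1 - a2 = (a1 - a3) + (a3 - a2)); last by ring.
apply: (le_trans (ler_normD _ _)); apply: (le_trans (lerD cl tv)).
rewrite mulrDr addrCA lerD2l -mulrDl [X in _ <= X](_ : _ = (8 * C + 2) * e); last first.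
  by rewrite /e; field; rewrite gt_eqF// ltr_wpDl// mulr_ge0.
by rewrite ler_wpM2r ?(ltW e0)//; lra.
Qed.

(** The transition operator over []u, r]] of the equation without drift, when [Z] is its stochastic
    convolution: an Ornstein-Uhlenbeck semigroup. *)
Definition smoothed (f : H -> R) (x : H) : R := \int[P]_w f (S tau x + Z w).

Let borel_shift x : borel_on setT (fun w => x + Z w).
Proof. by apply: borelD => //; exact: borel_cst. Qed.

Let intf (f : H -> R) (C : R) x : ucont f -> (forall x, `|f x| <= C) ->
  P.-integrable setT (EFin \o (fun w => f (x + Z w))).
Proof.
move=> uf fC; apply: (@integrable_bounded _ _ _ P _ C) => //.
exact: (ucont_measurable sepH uf (borel_shift x)).
Qed.

Lemma smoothed_shift (f : H -> R) (C : R) x h : ucont f -> (forall x, `|f x| <= C) ->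
  `|smoothed f (x + h) - smoothed f x| <= 4 * C * `|Gam tau h|.
Proof.
move=> uf fC; rewrite /smoothed (bopD (sg_bop hS (ltW tau0))).
have uf' := ucont_shift (S tau x) uf.
have := @shift_total_variation (fun z => f (S tau x + z)) C h uf' (fun z => fC _).
by under eq_Rintegral do rewrite addrA.
Qed.

Variable M : R.
Hypothesis M1 : 1 <= M.
Hypothesis hM : forall x, `|S tau x| <= M * `|x|.

(** Interpolation at the scale [alpha = opnorm (Gam tau)]: the regularized part is Lipschitz with
    constant [M * alpha^(1 - theta)], while the remainder, of size [alpha^(- theta)], costs at most
    [4 * alpha^(- theta) * alpha] by total variation. *)
Lemma smoothed_lipschitz (f : H -> R) x y : unit_holder theta f ->
  `|smoothed f x - smoothed f y| <= (M + 4) * opnorm (Gam tau) `^ (1 - theta) * `|x - y|.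
Proof.
move=> uhf; have [al0 _] := Gamma_norm_gt0 theta1 hlow tau0; set al := opnorm _ in al0 *.
have [h [uhh hl hd]] := inf_convolution theta01 uhf al0.
have uf := unit_holder_ucont theta01 uhf; have uh := unit_holder_ucont theta01 uhh.
have ud : ucont (fun x => f x - h x) by apply: ucontD => //; exact: ucontN.
have e z : smoothed f z = smoothed h z + smoothed (fun x => f x - h x) z.
  rewrite /smoothed -RintegralD//; [|exact: (intf _ uh uhh.1)|exact: (intf _ ud hd)].
  by apply: eq_Rintegral => w _; rewrite [RHS]addrC subrK.
rewrite !e (_ : _ - _ = (smoothed h x - smoothed h y) +
  (smoothed (fun x => f x - h x) x - smoothed (fun x => f x - h x) y)); last by ring.
apply: (le_trans (ler_normD _ _)); rewrite mulrDl mulrDl; apply: lerD.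
  rewrite /smoothed -RintegralB//; [|exact: (intf _ uh uhh.1)|exact: (intf _ uh uhh.1)].
  apply: Rint_le_bound => [|w].
    by apply: measurable_funB; apply: (ucont_measurable sepH uh).
  apply: (le_trans (hl _ _)); rewrite opprD addrACA subrr addr0 -(bopB (sg_bop hS (ltW tau0))).
  by rewrite mulrC mulrAC ler_wpM2r ?powR_ge0//.
have exy : y + (x - y) = x by rewrite addrC subrK.
have := smoothed_shift y (x - y) ud hd; rewrite exy => /le_trans; apply.
rewrite -!mulrA ler_wpM2l//; have := Gamma_opnorm hS theta1 hrange hlow (x - y) tau0.
rewrite -/al => /(ler_wpM2l (powR_ge0 al (- theta)))/le_trans; apply.
rewrite mulrA -{2}(powRr1 (ltW al0)) -powRD ?(gt_eqF al0) ?implybT// addrC//.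
Qed.

Variables (L B : H -> H) (K : U -> U) (Bt : H -> U) (CB CK : R).
Hypotheses (bK : bounded_operator K) (CK0 : 0 <= CK) (hCK : forall v, `|K v| <= CK * `|v|).
Hypotheses (hLK : forall x, L (B x) = Gt (K (Bt x))) (CB0 : 0 <= CB).
Hypotheses (hB1 : forall x, `|Bt x| <= CB) (hB2 : forall x y, `|Bt x - Bt y| <= CB * `|x - y| `^ theta).

(** The drift lies in the range of [Gt], so a shift along it costs [opnorm (Gam tau \o Gt)]. For the
    Hölder bound, changing [x] into [y] affects the direction of the shift, controlled by the Hölder
    norm of [Bt], and the base point. *)
Lemma smoothed_drift (f : H -> R) (eps : R) : unit_holder theta f -> 0 <= eps ->
  let k := 8 * M * CK * CB * opnorm (Gam tau \o Gt) in
  let h x := smoothed f (x + eps *: L (B x)) - smoothed f x in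
  (forall x, `|h x| <= eps * k) /\ (forall x y, `|h x - h y| <= eps * k * `|x - y| `^ theta).
Proof.
move=> uhf eps0 k h; have uf := unit_holder_ucont theta01 uhf.
pose ka := opnorm (Gam tau \o Gt).
have ka0 : 0 <= ka by exact: opnorm_ge0.
have M0 : 0 <= M by apply: le_trans M1.
have Gv v : `|Gam tau (eps *: Gt (K v))| <= eps * ka * CK * `|v|.
  have := Gamma_opnorm_comp hS bGt theta1 hrange hlow (eps *: K v) tau0.
  rewrite (bopZ bGt) => /le_trans; apply; rewrite -/ka normrZ (ger0_norm eps0) mulrCA -!mulrA ler_wpM2l// ler_wpM2l//; exact: hCK.
have kk : eps * k = 8 * M * (eps * ka * CK * CB) by rewrite /k /ka; ring.
have c0 : 0 <= eps * ka * CK * CB by rewrite !mulr_ge0.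
have GvB x : `|Gam tau (eps *: L (B x))| <= eps * ka * CK * CB.
  by rewrite hLK; apply: (le_trans (Gv _)); rewrite ler_wpM2l ?mulr_ge0.
split=> [x|x y].
  apply: (le_trans (smoothed_shift x _ uf uhf.1)); rewrite kk mulr1.
  apply: (@le_trans _ _ (4 * (eps * ka * CK * CB))); first by rewrite ler_wpM2l// GvB.
  by rewrite ler_wpM2r//; move: M1; lra.
set hx := eps *: L (B x); set hy := eps *: L (B y).
have -> : h x - h y = (smoothed f (x + hy + (hx - hy)) - smoothed f (x + hy)) +
    ((smoothed f (x + hy) - smoothed f x) - (smoothed f (y + hy) - smoothed f y)).
  rewrite (_ : x + hy + (hx - hy) = x + hx); last by hring.
  by rewrite /h -/hx -/hy; ring.
have n0 : 0 <= `|x - y| `^ theta by exact: powR_ge0.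
apply: (le_trans (ler_normD _ _)).
have h1 : `|smoothed f (x + hy + (hx - hy)) - smoothed f (x + hy)| <= 4 * (eps * ka * CK * CB) * `|x - y| `^ theta.
  apply: (le_trans (smoothed_shift _ _ uf uhf.1)); rewrite mulr1 -mulrA ler_wpM2l//.
  rewrite /hx /hy -scalerBr !hLK -(bopB bGt) -(bopB bK); apply: (le_trans (Gv _)).
  by rewrite -[leRHS]mulrA ler_wpM2l ?mulr_ge0.
have h2 : `|(smoothed f (x + hy) - smoothed f x) - (smoothed f (y + hy) - smoothed f y)| <=
    4 * M * (eps * ka * CK * CB) * `|x - y| `^ theta.
  (* Moving the base point is written as smoothing the difference [ft], whose supremum is at most
     [M * |x - y|^theta]. The Hölder regularity of [f] is spent before smoothing, and the total
     variation bound only sees this supremum. *)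
  pose ft z := f (S tau (x - y) + z) - f z.
  have uft : ucont ft by apply: ucontD; [exact: ucont_shift|exact: ucontN].
  have ftC z : `|ft z| <= M * `|x - y| `^ theta.
    apply: (le_trans (uhf.2 _ _)); rewrite addrK.
    have /andP[th0 _] := theta01.
    apply: (@le_trans _ _ ((M * `|x - y|) `^ theta)).
      by apply: ge0_ler_powR; rewrite ?nnegrE ?mulr_ge0 ?(ltW th0).
    rewrite powRM// ler_wpM2r// -[leRHS](powRr1 M0).
    by apply: ler_powR => //; exact: ltW.
  have e z : smoothed ft (y + z) = smoothed f (x + z) - smoothed f (y + z).
    rewrite /smoothed /ft -RintegralB//; [|exact: (intf _ uf uhf.1)|exact: (intf _ uf uhf.1)].
    apply: eq_Rintegral => w _; congr (f _ - _).
    by rewrite addrA -(bopD (sg_bop hS (ltW tau0))); congr (S _ _ + _); hring.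
  have := smoothed_shift y hy uft ftC; rewrite e -{2}(addr0 y) e !addr0.
  rewrite (_ : _ - _ - _ = smoothed f (x + hy) - smoothed f x - (smoothed f (y + hy) - smoothed f y)); last by ring.
  move=> /le_trans; apply; apply: (le_trans (ler_wpM2l _ (GvB y))); first by rewrite !mulr_ge0.
  by rewrite le_eqVlt; apply/orP; left; apply/eqP; ring.
apply: (le_trans (lerD h1 h2)); rewrite kk -mulrDl ler_wpM2r// -mulrDl ler_wpM2r//; move: M1; lra.
Qed.

End one_interval.

End SmoothingEstimates.

(** * Mild solutions *)

Section SmallIntegrals.
Context {R : realType}.
Local Notation mu := (@lebesgue_measure R).

Lemma inv_nat_le (del : R) : 0 < del -> exists N : nat, forall n, (N <= n)%N -> n.+1%:R^-1 <= del.
Proof.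
move=> d0; exists (Num.truncn del^-1) => n nN; rewrite -[leRHS]invrK lef_pV2 ?posrE ?invr_gt0//.
by apply: (le_trans (ltW (truncnS_gt _))); rewrite ler_nat ltnS.
Qed.

Lemma integral_near0 (T : R) (f : measurableTypeR R -> \bar R) : 0 < T ->
  measurable_fun (`]0, T] : set (measurableTypeR R)) f -> (forall s, `]0, T]%classic s -> (0 <= f s)%E) ->
  (\int[mu]_(s in `]0%R, T]) f s < +oo)%E ->
  forall e : R, 0 < e -> exists2 del : R, 0 < del <= T & (\int[mu]_(s in `]0%R, del]) f s <= e%:E)%E.
Proof.
move=> T0 mf f0 foo e e0.
have mT : measurable (`]0, T]%classic : set (measurableTypeR R)) by exact: measurable_itv.
pose fn n (s : measurableTypeR R) := (f \_ (`]0, n.+1%:R^-1]%classic : set R)) s.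
have mn n : measurable (`]0, n.+1%:R^-1]%classic : set (measurableTypeR R)) by exact: measurable_itv.
have intf : mu.-integrable `]0, T] f.
  apply/integrableP; split => //; rewrite (eq_integral f)// => s sin.
  by rewrite gee0_abs// f0//; exact: set_mem.
have cvgf s : (`]0, T]%classic : set R) s -> fn n s @[n --> \oo] --> 0%E.
  rewrite /= in_itv/= => /andP[s0 sT].
  have [N hN] := @inv_nat_le (s / 2) ltac:(by rewrite divr_gt0).
  apply: cvg_near_cst; exists N => // n /= /hN h; rewrite /fn patchE ifF//.
  apply/negbTE; rewrite mem_setE in_itv/= negb_and -!leNgt; apply/orP; right.
  by rewrite -ltNge (le_lt_trans h)// ltr_pdivrMr// ltr_pMr// ltr1n.
have [| | |_ _] := @dominated_convergence _ _ _ mu `]0%R, T] mT fn (cst 0%E) f _ (measurable_cst _) _ intf.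
- move=> n; apply/(measurable_restrict _ (mn n) mT).
  by apply: (measurable_funS mT _ mf); exact: subIsetl.
- by apply: aeW => s; exact: cvgf.
- apply: aeW => s n sT; rewrite /fn patchE; case: ifP => _; last by rewrite abse0 f0.
  by rewrite gee0_abs// f0.
rewrite integral0 => /cvge0_le h.
have [n1 [_ hn1] hh] : exists2 n : nat, True /\ n.+1%:R^-1 <= T & (\int[mu]_(x in `]0%R, T]) fn n x <= e%:E)%E.
  have [||n _ hn] := h e.
  - by move=> n; apply: integral_ge0 => s sT; rewrite /fn patchE; case: ifP => // _; exact: f0.
  - by [].
  have [N hN] := inv_nat_le T0.
  exists (maxn n N); first by split => //; apply: hN; rewrite leq_maxr.
  by apply: hn => /=; rewrite leq_maxl.
exists n1.+1%:R^-1; first by rewrite hn1 andbT invr_gt0.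
apply: le_trans hh; rewrite /fn -integral_mkcondr le_eqVlt; apply/orP; left; apply/eqP.
congr (integral _ _ _); apply/seteqP; split=> s /=; rewrite !in_itv/=.
  by move=> /andP[a b]; split; rewrite ?in_itv/= a// (le_trans b).
by move=> [].
Qed.

End SmallIntegrals.

Section StochasticConvolution.
Context {R : realType} d (Omega : measurableType d) (P : probability Omega R).
Context {U H : hilbertType R} (F : R -> set (set Omega)) (W : cylindrical Omega U).
Hypothesis hW : cylindrical_wiener P F W.
Hypothesis sepH : separable_space H.
Context (S : R -> H -> H) (G : U -> H).
Hypothesis hS : C0_semigroup S.
Local Notation mu := (@lebesgue_measure R).
Local Notation ms X := (\int[P]_w (`|X w| ^+ 2)%:E)%E.
Local Notation hs u t Phi :=
  (\int[mu]_(s in `]u, t]) (\esum_(k in wI W) (`|Phi s k| ^+ 2)%:E))%E.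
Local Notation Phi := (conv_kernel W S G).

Lemma borel_orbit (D : set (measurableTypeR R)) (r : R) (x : H) : measurable D ->
  (forall s, D s -> s <= r) -> borel_on D (fun s : measurableTypeR R => S (r - s) x).
Proof.
move=> mD Dr O oO.
rewrite (_ : _ `&` _ = D `&` (fun s => sgx S (r - s) x) @^-1` O); last first.
  by apply/seteqP; split=> s /= [Ds]; rewrite sgxE ?subr_ge0 ?Dr.
apply: measurableI => //; have : open ((fun s : R => sgx S (r - s) x) @^-1` O).
  apply: open_comp => // s _.
  apply: (@continuous_comp _ _ _ (fun s => r - s) (fun t => sgx S t x)).
    by apply: cvgB; [exact: cvg_cst|exact: cvg_id].
  exact: sgx_continuous.
exact: open_measurable.
Qed.

Lemma integrand_conv u r t : t <= r -> integrand W u t (Phi r).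
Proof.
move=> tr k _; apply: borel_orbit; first exact: measurable_itv.
by move=> s; rewrite /= in_itv/= => /andP[_ h]; exact: le_trans tr.
Qed.

Lemma stoch_integral_conv t Z : stoch_integral P W t (fun s u => S (t - s) (G u)) Z ->
  sint P W 0 t (Phi t) Z.
Proof.
apply: (stoch_integral_sint sepH (Phi := fun s u => S (t - s) (G u))) => k _; apply: borel_orbit; first exact: measurable_itv.
by move=> s; rewrite /= in_itv/= => /andP[].
Qed.

Variable T : R.
Hypothesis T0 : 0 < T.
Variable Z : R -> Omega -> H.
Hypothesis hZ : forall t, 0 <= t <= T -> sint P W 0 t (Phi t) (Z t).

(** The part of the convolution produced after time [u]: a version of the integral of [S (v - s) G]
    over []u, v]]. *)
Definition Zinc (u v : R) (w : Omega) : H := Z v w - S (v - u) (Z u w).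

Lemma sint_Zinc u v : 0 <= u -> u <= v -> v <= T -> sint P W u v (Phi v) (Zinc u v).
Proof.
move=> u0 uv vT; have [_ _ Sadd _] := hS; have vu0 : 0 <= v - u by rewrite subr_ge0.
have h1 : sint P W 0 v (Phi v) (Z v) by apply: hZ; rewrite (le_trans u0).
have uT : 0 <= u <= T by rewrite u0 (le_trans uv).
have h2 := sint_map hW sepH (lexx 0) (sg_bop hS vu0) (hZ uT).
apply: (sint_increment hW sepH u0 uv h1); have [b1 b2 b3] := h2; split => //.
  exact: integrand_conv.
move=> eps /b3[e [he h3 h4]]; exists e; split => //; apply: le_trans h3.
rewrite le_eqVlt; apply/orP; left; apply/eqP; apply: eq_integral => s.
rewrite inE/= in_itv/= => /andP[s0 su]; apply: eq_esum => k _.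
by rewrite /conv_kernel -Sadd ?subr_ge0// addrA subrK.
Qed.

Lemma borel_Zinc u v : 0 <= u -> u <= v -> v <= T -> borel_on setT (Zinc u v).
Proof. by move=> u0 uv vT; have [] := sint_Zinc u0 uv vT. Qed.

Lemma hs_elem_finite t (e : seq (nat * R * R * H)) : elem_within W 0 t e -> (hs 0%R t (elem_val e) < +oo)%E.
Proof.
move=> he; have [ts [js [sts tst ujs sJ hej]]] := elem_grid he.
have ts0 x : x \in ts -> 0 <= x by move=> /tst/andP[].
have tst' x : x \in ts -> x <= t by move=> /tst/andP[].
have n0 (x : H) : 0 <= `|x| ^+ 2 by exact: sqr_ge0.
have n00 : `|0 : H| ^+ 2 = 0 by rewrite normr0 expr0n.
apply: (@le_lt_trans _ _ (\int[mu]_(s in `[0%R, t]) (\esum_(k in wI W) (`|elem_val e s k| ^+ 2)%:E))%E).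
  have mI : measurable (`[0, t]%classic : set (measurableTypeR R)) by exact: measurable_itv.
  apply: ge0_subset_integral => //.
  - apply: measurable_esum => [k Jk|s k _ _]; last by rewrite lee_fin.
    apply/measurable_EFinP; apply: (borel_continuous sepH mI continuous_norm2).
    exact: elem_val_borel.
  - by move=> s _; apply: esum_ge0 => k _; rewrite lee_fin.
  - by move=> s; rewrite /= !in_itv/= => /andP[/ltW -> ->].
by rewrite (integral_elem_val sts ts0 ujs hej sJ n0 n00 tst') ltry.
Qed.

(** An elementary integrand has finite energy, and one of them lies within 1 of the kernel. *)
Lemma hs_conv_finite : (hs 0%R T (Phi T) < +oo)%E.
Proof.
have TT : 0 <= T <= T by rewrite lexx ltW.
have [bZ mPhi h] := hZ TT.
have [e [he h1 _]] := h 1 ltr01.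
apply: (@le_lt_trans _ _ (2%:E * hs 0%R T (fun s k => (Phi T s k - elem_val e s k)%R) + 2%:E * hs 0%R T (elem_val e))%E).
  apply: hs_le_comb => //; [by apply: integrandB => //; exact: integrand_elem|exact: integrand_elem|].
  by move=> s k _ _; have := sqr_normD_le (Phi T s k - elem_val e s k) (elem_val e s k); rewrite subrK.
apply: lte_add_pinfty; apply: lte_mul_pinfty => //.
- by apply: le_lt_trans h1 _; exact: ltry.
- exact: hs_elem_finite.
Qed.

Let energy (s : R) : \bar R := (\esum_(k in wI W) (`|sgx S s (G (wg W k))| ^+ 2)%:E)%E.

Let measurable_energy (D : set (measurableTypeR R)) : measurable D ->
  measurable_fun D (energy : measurableTypeR R -> \bar R).
Proof.
move=> mD; apply: measurable_esum => [k Jk|s k _ _]; last by rewrite lee_fin sqr_ge0.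
apply/measurable_EFinP; apply: (borel_continuous sepH mD continuous_norm2) => O oO.
apply: measurableI => //; apply: open_measurable; apply: open_comp => // s _.
exact: sgx_continuous.
Qed.

Let energy_ge0 s : (0 <= energy s)%E.
Proof. by apply: esum_ge0 => k _; rewrite lee_fin sqr_ge0. Qed.

Lemma hs_conv_reflect u v : 0 <= u -> u <= v ->
  (hs u v (Phi v) = \int[mu]_(s in `]0%R, (v - u)%R]) energy s)%E.
Proof.
move=> u0 uv.
pose h (s : R) : \bar R := (energy \_ `[0%R, v - u[) s.
have mD : measurable (`[0, v - u[%classic : set (measurableTypeR R)) by exact: measurable_itv.
have mD' : measurable (`]0, v - u]%classic : set (measurableTypeR R)) by exact: measurable_itv.
have mh : measurable_fun setT (h : measurableTypeR R -> \bar R).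
  by apply/(measurable_restrictT _ mD); exact: measurable_energy.
have h0 s : (0 <= h s)%E by apply: erestrict_ge0.
transitivity (\int[mu]_s h (v - s)%R)%E.
  rewrite integral_mkcond; apply: eq_integral => s _; rewrite /h !patchE.
  have -> : (v - s \in `[0, v - u[%classic) = (s \in `]u, v]%classic).
    by rewrite !mem_setE !in_itv/= subr_ge0 ltrD2l ltrN2 andbC.
  case: ifPn => //; rewrite mem_setE in_itv/= => /andP[_ sv].
  by apply: eq_esum => k _; rewrite sgxE// subr_ge0.
rewrite ge0_integral_reflect// /h -integral_mkcond integral_itv_bndo_bndc//; last exact: measurable_energy.
by rewrite -integral_itv_obnd_cbnd//; exact: measurable_energy.
Qed.

(** After reflection the energy over []u, v]] is an integral over []0, v - u]], so the smallness
    depends on the length of the interval alone. *)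
Lemma ms_Zinc_small (e : R) : 0 < e -> exists2 del : R, 0 < del & forall u v, 0 <= u -> u <= v -> v <= T ->
  v - u <= del -> (ms (Zinc u v) <= e%:E)%E.
Proof.
move=> e0; have g0 := @gauss_const_gt0 R.
have mT : measurable (`]0, T]%classic : set (measurableTypeR R)) by exact: measurable_itv.
have fin : (\int[mu]_(s in `]0%R, T]) energy s < +oo)%E.
  by have := hs_conv_finite; rewrite (hs_conv_reflect (lexx 0) (ltW T0)) subr0.
have e'0 : 0 < e / (4 * gauss_const) by rewrite divr_gt0// mulr_gt0.
have [del /andP[del0 delT] hdel] := integral_near0 T0 (measurable_energy mT) (fun s _ => energy_ge0 s) fin e'0.
exists del => // u v u0 uv vT vud; have sZ := sint_Zinc u0 uv vT.
apply: (le_trans (sint_ms hW sepH u0 sZ)); rewrite hs_conv_reflect//.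
apply: (@le_trans _ _ ((4 * gauss_const)%:E * (e / (4 * gauss_const))%:E)%E).
  apply: lee_wpmul2l; first by rewrite lee_fin mulr_ge0 ?ltW.
  apply: le_trans hdel; apply: ge0_subset_integral => //.
  - by apply: measurable_energy; exact: measurable_itv.
  - by move=> s; rewrite /= !in_itv/= => /andP[-> h]; exact: le_trans vud.
by rewrite -EFinM mulrCA divff ?mulr1// mulf_neq0// gt_eqF.
Qed.

Lemma ms_conv_finite t : 0 <= t <= T -> (ms (Z t) < +oo)%E.
Proof.
move=> tin; have st := hZ tin; have /andP[t0 tT] := tin.
apply: (le_lt_trans (sint_ms hW sepH (lexx 0) st)); apply: lte_mul_pinfty.
- by rewrite lee_fin mulr_ge0// ltW// gauss_const_gt0.
- by [].
rewrite hs_conv_reflect// subr0.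
have := hs_conv_finite; rewrite (hs_conv_reflect (lexx 0) (ltW T0)) subr0; apply: le_lt_trans.
have mI r : measurable (`]0, r]%classic : set (measurableTypeR R)) by exact: measurable_itv.
apply: ge0_subset_integral; [exact: mI|exact: mI|exact: measurable_energy|by move=> s _|].
by move=> s; rewrite /= !in_itv/= => /andP[-> h]; exact: le_trans tT.
Qed.

End StochasticConvolution.

(** * Continuity in mean square and consistency of the Euler step *)

Section MeanSquareContinuity.
Context {R : realType} {H : hilbertType R} (sepH : separable_space H).
Context d (Omega : measurableType d) (P : probability Omega R).
Context (S : R -> H -> H) (hS : C0_semigroup S).
Local Notation ms X := (\int[P]_w (`|X w| ^+ 2)%:E)%E.

Lemma borel_sg t (X : Omega -> H) : 0 <= t -> borel_on setT X -> borel_on setT (fun w => S t (X w)).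
Proof. by move=> t0 bX; exact: (borel_comp (sg_bop hS t0).2 bX). Qed.

(** Dominated convergence along a hypothetical sequence of times tending to 0. *)
Lemma ms_sg_small (X : Omega -> H) (e : R) : borel_on setT X -> (ms X < +oo)%E -> 0 < e ->
  exists2 del : R, 0 < del & forall r, 0 <= r -> r <= del -> (ms (fun w => (S r (X w) - X w)%R) <= e%:E)%E.
Proof.
move=> bX fX e0; apply: contrapT => no.
have ex (n : nat) : exists r : R, [/\ 0 <= r, r <= n.+1%:R^-1 & ~ (ms (fun w => (S r (X w) - X w)%R) <= e%:E)%E].
  apply: contrapT => no'; apply: no; exists n.+1%:R^-1; first by rewrite invr_gt0.
  by move=> r r0 rn; apply: contrapT => h; apply: no'; exists r.
have [r hr] := choice ex.
have r0 n : 0 <= r n by have [] := hr n.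
have [M M1 hM] := sg_bound hS 1; have M0 : 0 <= M by apply: le_trans M1.
have rn n : r n <= n.+1%:R^-1 by have [] := hr n.
have bB n : borel_on setT (fun w => S (r n) (X w) - X w) by apply: borelB => //; exact: borel_sg.
pose f n w := (`|S (r n) (X w) - X w| ^+ 2)%:E.
have intg : P.-integrable setT (fun w => ((M + 1) ^+ 2)%:E * (`|X w| ^+ 2)%:E)%E.
  by apply: integrableZl => //; exact: (integrable_ms sepH bX fX).
have [| | |_ _] := @dominated_convergence _ _ _ P setT measurableT f (cst 0%E) _ _ (measurable_cst _) _ intg.
- by move=> n; exact: (borel_norm2 sepH measurableT (bB n)).
- apply: aeW => w _; rewrite /f; apply: cvg_EFin; first exact: nearW.
  apply/cvgrPdist_le => eta eta0.
  have m0 : 0 < Num.min 1 eta by rewrite lt_min ltr01.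
  have [del del0 hd] := sg_right hS (X w) m0.
  have [N hN] := inv_nat_le del0.
  exists N => // n /= /hN h.
  have := hd (r n) (r0 n) (le_trans (rn n) h); rewrite le_min => /andP[h1 h2].
  rewrite sub0r normrN ger0_norm ?sqr_ge0// expr2.
  by apply: (le_trans _ h2); rewrite ler_piMr.
- apply: aeW => w n _; have p : (0 <= f n w)%E by rewrite lee_fin sqr_ge0.
  rewrite gee0_abs// /f -EFinM lee_fin -exprMn.
  rewrite ler_sqr ?nnegrE ?mulr_ge0 ?addr_ge0//; apply: (le_trans (ler_normB _ _)).
  rewrite mulrDl mul1r lerD2r; apply: hM; rewrite r0/=; apply: (le_trans (rn n)).
  by rewrite invf_le1// ler1n.
under eq_cvg do rewrite /=; rewrite integral0 => /cvge0_le h.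
have [||n _ /(_ n (leqnn n))] := h e; [|by []|].
  by move=> n; apply: integral_ge0 => w _; rewrite lee_fin sqr_ge0.
by have [] := hr n.
Qed.

End MeanSquareContinuity.

Section Solution.
Context {R : realType} {H : hilbertType R} (sepH : separable_space H).
Context d (Omega : measurableType d) (P : probability Omega R) (F : R -> set (set Omega)).
Hypothesis hN : normal_filtration P F.
Context (S : R -> H -> H) (hS : C0_semigroup S).
Context (b : H -> H) (Cb theta : R).
Hypotheses (theta01 : 0 < theta < 1) (Cb0 : 0 <= Cb) (hb1 : forall x, `|b x| <= Cb).
Hypothesis hb2 : forall x y, `|b x - b y| <= Cb * `|x - y| `^ theta.
Context (T : R).
Local Notation mu := (@lebesgue_measure R).
Local Notation ms X := (\int[P]_w (`|X w| ^+ 2)%:E)%E.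
Context (Z : R -> Omega -> H).
Hypothesis bZ : forall t, 0 <= t <= T -> borel_on setT (Z t).
Context (x0 : H) (X : R -> Omega -> H).

(** The stochastic convolution [Z] is a parameter, so that the two solutions to be compared share it
    and it cancels in their difference. *)
Record mild_solution : Prop := MildSolution {
  mild_adapted : forall t (O : set H), 0 <= t <= T -> open O -> F t (X t @^-1` O) ;
  mild_measurable : forall O : set H, open O ->
    measurable [set p : R * Omega | 0 <= p.1 <= T /\ O (X p.1 p.2)] ;
  mild_eq : forall t, 0 <= t <= T -> {ae P, forall w, exists I : H,
    has_bochner `[0, t] (fun s => S (t - s) (b (X s w))) I /\ X t w = S t x0 + I + Z t w} }.

Hypothesis hX : mild_solution.

Let M := xget 1 [set M : R | 1 <= M /\ forall t x, 0 <= t <= T -> `|S t x| <= M * `|x|].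

Lemma sgM : 1 <= M /\ forall t x, 0 <= t <= T -> `|S t x| <= M * `|x|.
Proof.
rewrite /M; case: xgetP => [m _ //|no].
by have [m m1 hm] := sg_bound hS T; case: (no m).
Qed.

Let M0 : 0 <= M. Proof. by have [h _] := sgM; apply: le_trans h. Qed.

Lemma continuous_drift : continuous b.
Proof.
move=> x; apply/cvgrPdist_le => e e0.
have uf : ucont (fun y => `|b x - b y|).
  apply: (holder_ucont theta01 Cb0) => y z; apply: (le_trans (ler_dist_dist _ _)).
  by rewrite opprB addrC addrA subrK distrC.
have /cvgrPdist_le/(_ e e0) := ucont_continuous uf (x := x).
by apply: filterS => y; rewrite subrr normr0 sub0r normrN normr_id.
Qed.

Lemma mild_borel_past t : 0 <= t <= T -> borel_on setT (X t : g_sigma_algebraType (F t) -> H).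
Proof. by move=> ht O oO; rewrite setTI; apply: sub_sigma_algebra; exact: mild_adapted. Qed.

Lemma mild_borel t : 0 <= t <= T -> borel_on setT (X t).
Proof.
move=> ht O oO; rewrite setTI; have [/(_ t) h _ _ _] := hN.
by have /andP[t0 _] := ht; have [_] := h t0; apply; exact: mild_adapted.
Qed.

(** Stands for the integral of [S (v - s) (b (X s w))] over [[u, v]], which is only known to
    represent the equation almost surely. Defining it by subtraction makes it everywhere defined and
    measurable. *)
Definition drift_inc (u v : R) (w : Omega) : H := X v w - S (v - u) (X u w) - Zinc S Z u v w.

Lemma borel_drift_inc u v : 0 <= u -> u <= v -> v <= T -> borel_on setT (drift_inc u v).
Proof.
move=> u0 uv vT; have vu0 : 0 <= v - u by rewrite subr_ge0.
have hu : 0 <= u <= T by rewrite u0 (le_trans uv).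
have hv : 0 <= v <= T by rewrite (le_trans u0).
have bS Y : borel_on setT Y -> borel_on setT (fun w : Omega => S (v - u) (Y w)) by exact: borel_sg.
apply: borelB => //; apply: borelB => //; try (by exact: mild_borel); try exact: bZ.
- by apply: bS; exact: mild_borel.
- by apply: bS; exact: bZ.
Qed.

Lemma borel_path w v : v <= T -> borel_on (`[0, v]%classic : set (measurableTypeR R)) (fun s : measurableTypeR R => X s w).
Proof.
move=> vT O oO.
have := @pair2_measurable _ _ R Omega w measurableT _ (mild_measurable hX oO).
rewrite setTI => h.
rewrite (_ : _ `&` _ = (`[0, v]%classic : set (measurableTypeR R)) `&` ((fun s : R => (s, w)) @^-1` [set p | 0 <= p.1 <= T /\ O (X p.1 p.2)])).
  by apply: measurableI; [exact: measurable_itv|exact: h].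
apply/seteqP; split=> s [] /=; rewrite in_itv/= => /andP[s0 sv]; last by move=> [_ h']; rewrite s0.
by move=> h'; rewrite s0 sv (le_trans sv).
Qed.

Lemma borel_path_sg w v : v <= T ->
  borel_on (`[0, v]%classic : set (measurableTypeR R)) (fun s : measurableTypeR R => S (v - s) (b (X s w))).
Proof.
move=> vT; have mD : measurable (`[0, v]%classic : set (measurableTypeR R)) by exact: measurable_itv.
apply/(borel_normP sepH mD) => x.
apply: (@eq_measurable_fun _ _ _ _ _ (fun s : measurableTypeR R => `|sgx S (v - s) (b (X s w)) - x|)).
  by move=> s; rewrite inE/= in_itv/= => /andP[_ sv]; rewrite sgxE// subr_ge0.
have bbX := borel_comp continuous_drift (borel_path w vT).
apply: (measurable_caratheodory sepH mD (Psi := fun (s : measurableTypeR R) y => `|sgx S (v - s) y - x|) bbX).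
- move=> y; apply: measurable_funTS; apply: continuous_measurable_fun => s.
  apply: cvg_norm; apply: cvgB; last exact: cvg_cst.
  apply: (@continuous_comp _ _ _ (fun s => v - s) (fun t => sgx S t y)).
    by apply: cvgB; [exact: cvg_cst|exact: cvg_id].
  exact: sgx_continuous.
- move=> s _ y; apply: cvg_norm; apply: cvgB; last exact: cvg_cst.
  exact: (sgx_bop hS (v - s)).2.
Qed.

(** The vector [z] is quantified inside the almost sure event, so that it may later depend on the
    sample point. *)
Lemma drift_inc_le u v : 0 <= u -> u <= v -> v <= T -> {ae P, forall w, forall z : H,
  (`|drift_inc u v w - (v - u) *: z|%:E <=
   \int[mu]_(s in `[u, v]) `|S (v - s) (b (X s w)) - z|%:E)%E}.
Proof.
move=> u0 uv vT; have [_ _ Sadd _] := hS.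
have vu0 : 0 <= v - u by rewrite subr_ge0.
have v0 : 0 <= v by exact: le_trans uv.
have uT : u <= T by exact: le_trans uv vT.
have hu : 0 <= u <= T by rewrite u0.
have hv : 0 <= v <= T by rewrite v0.
apply: filterS2 (mild_eq hX hu) (mild_eq hX hv) => w [Iu [hIu Xu]] [Iv [hIv Xv]] z.
have mI (t : R) : measurable (`[0, t]%classic : set (measurableTypeR R)) by exact: measurable_itv.
have mIuv : measurable (`[u, v]%classic : set (measurableTypeR R)) by exact: measurable_itv.
have fin (a t : R) : (mu `[a, t] < +oo)%E.
  by rewrite lebesgue_measure_itv/=; case: ifP => _; rewrite ?ltry// -EFinB ltry.
have bnd r s : r <= T -> (`[0, r]%classic : set R) s -> `|S (r - s) (b (X s w))| <= M * Cb.
  rewrite /= in_itv/= => rT /andP[s0 sr]; have [_ hM] := sgM.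
  apply: (le_trans (hM _ _ _)); first by rewrite subr_ge0 sr/=; lra.
  by rewrite ler_wpM2l.
have bv := borel_path_sg w vT; have bu := borel_path_sg w uT.
pose f s := S (v - s) (b (X s w)).
have if_ y : mu.-integrable `[0, v] (EFin \o (fun s => dot (f s) y)).
  exact: (integrable_dot sepH (mI v) (fin 0 v) y bv (fun s => bnd v s vT)).
have dE y : dot (drift_inc u v w) y = \int[mu]_(s in `[u, v]) dot (f s) y.
  have -> : drift_inc u v w = Iv - S (v - u) Iu.
    have SvE : S v x0 = S (v - u) (S u x0) by rewrite -Sadd// subrK.
    rewrite /drift_inc /Zinc Xu Xv SvE !(bopD (sg_bop hS vu0)); hring.
  rewrite dotBl (adjointP (sg_bop hS vu0)).
  rewrite (has_bochner_dot sepH (mI v) (fin 0 v) bv (fun s => bnd v s vT) hIv).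
  rewrite (has_bochner_dot sepH (mI u) (fin 0 u) bu (fun s => bnd u s uT) hIu).
  have -> : \int[mu]_(s in `[0, u]) dot (S (u - s) (b (X s w))) (adjoint (S (v - u)) y) = \int[mu]_(s in `[0, u]) dot (f s) y.
    apply: eq_Rintegral => s; rewrite inE/= in_itv/= => /andP[s0 su].
    by rewrite -(adjointP (sg_bop hS vu0)) /f -Sadd ?subr_ge0// addrA subrK.
  rewrite Rintegral_itvB//=.
  rewrite Rintegral_itv_obnd_cbnd//.
  apply: (integrableS (mI v) _ _ (if_ y)); first exact: measurable_itv.
  by move=> s; rewrite /= !in_itv/= => /andP[/ltW us ->]; rewrite (le_trans u0).
set D := drift_inc u v w in dE *; set y := D - (v - u) *: z.
have buv : borel_on (`[u, v]%classic : set (measurableTypeR R)) (f : measurableTypeR R -> H).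
  move=> O oO; rewrite (_ : _ `&` _ = `[u, v] `&` (`[0, v] `&` f @^-1` O)).
    by apply: measurableI => //; exact: bv.
  apply/seteqP; split=> [s [h1 h2]|s [h1 [_ h2]]]; split => //; split => //.
  by move: h1; rewrite /= !in_itv/= => /andP[us ->]; rewrite (le_trans u0).
have bfz : borel_on (`[u, v]%classic : set (measurableTypeR R)) (fun s : measurableTypeR R => f s - z).
  by apply: borelB => //; exact: borel_cst.
have mfz : measurable_fun (`[u, v]%classic : set (measurableTypeR R)) (fun s : measurableTypeR R => `|f s - z|).
  exact: ((borel_normP sepH mIuv _).1 buv z).
have fzb s : (`[u, v]%classic : set R) s -> `|f s - z| <= M * Cb + `|z|.
  move=> hs; apply: (le_trans (ler_normB _ _)); rewrite lerD2r; apply: (bnd v s vT).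
  by move: hs; rewrite /= !in_itv/= => /andP[us ->]; rewrite (le_trans u0).
have ifz := integrable_dot sepH mIuv (fin u v) y bfz fzb.
have inz : mu.-integrable `[u, v] (EFin \o (fun s => `|f s - z|)).
  by apply: (integrable_bounded_on mIuv (fin u v) mfz (C := M * Cb + `|z|)) => s /fzb; rewrite normr_id.
have -> : (\int[mu]_(s in `[u, v]) `|f s - z|%:E = (\int[mu]_(s in `[u, v]) `|f s - z|)%:E)%E.
  by rewrite /Rintegral fineK//; exact: (integrable_fin_num mIuv inz).
rewrite lee_fin; apply: norm_le_dot; first exact: Rintegral_ge0.
have -> : dot y y = \int[mu]_(s in `[u, v]) dot (f s - z) y.
  rewrite {1}/y dotBl dE dotZl.
  have -> : (v - u) * dot z y = \int[mu]_(s in `[u, v]) (dot z y).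
    rewrite Rintegral_cst//= lebesgue_measure_itv/= lte_fin.
    case: ltP => [_|vu]; first by rewrite -EFinB/= mulrC.
    have e0 : v - u = 0 by apply/eqP; rewrite subr_eq0 eq_le vu uv.
    by rewrite e0 mul0r mulr0.
  rewrite -RintegralB//.
  - by apply: eq_Rintegral => s _; rewrite dotBl.
  - apply: (integrableS (mI v) _ _ (if_ y)) => //.
    by move=> s; rewrite /= !in_itv/= => /andP[us ->]; rewrite (le_trans u0).
  - exact: (integrable_cst_on mIuv (fin u v)).
apply: (@le_trans _ _ (\int[mu]_(s in `[u, v]) (`|y| * `|f s - z|))).
  apply: le_Rintegral => //; first exact: (integrableZl mIuv `|y| inz).
  by move=> s _; rewrite mulrC; exact: dot_ler.
by rewrite RintegralZl// mulrC.
Qed.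

End Solution.

Section AlmostSureComparison.
Context {R : realType} {H : hilbertType R} (sepH : separable_space H).
Context d (Omega : measurableType d) (P : probability Omega R).
Local Notation ms X := (\int[P]_w (`|X w| ^+ 2)%:E)%E.

Lemma ms_le_ae (X Y1 Y2 : Omega -> H) (c1 c2 c3 e1 e2 : R) : borel_on setT X -> borel_on setT Y1 ->
  borel_on setT Y2 -> 0 <= c1 -> 0 <= c2 -> 0 <= c3 ->
  {ae P, forall w, `|X w| ^+ 2 <= c1 * `|Y1 w| ^+ 2 + c2 * `|Y2 w| ^+ 2 + c3} ->
  (ms Y1 <= e1%:E)%E -> (ms Y2 <= e2%:E)%E -> (ms X <= (c1 * e1 + c2 * e2 + c3)%:E)%E.
Proof.
move=> bX b1 b2 c10 c20 c30 h he1 he2.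
have mX := borel_norm2 sepH measurableT bX.
have m1 := borel_norm2 sepH measurableT b1; have m2 := borel_norm2 sepH measurableT b2.
have s0 (Y : Omega -> H) w : (0 <= (`|Y w| ^+ 2)%:E)%E by rewrite lee_fin sqr_ge0.
have mc (Y : Omega -> H) (c : R) : measurable_fun setT (fun w => (`|Y w| ^+ 2)%:E) ->
    measurable_fun setT (fun w => (c%:E * (`|Y w| ^+ 2)%:E)%E).
  by move=> m; apply: emeasurable_funM => //; exact: measurable_cst.
have p0 (Y : Omega -> H) (c : R) w : 0 <= c -> (0 <= c%:E * (`|Y w| ^+ 2)%:E)%E by move=> c0; rewrite mule_ge0// lee_fin.
apply: (@le_trans _ _ (\int[P]_w (c1%:E * (`|Y1 w| ^+ 2)%:E + c2%:E * (`|Y2 w| ^+ 2)%:E + c3%:E))%E).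
  apply: ae_ge0_le_integral => //.
  - by move=> w _; rewrite !adde_ge0 ?p0// lee_fin.
  - by apply: emeasurable_funD; [apply: emeasurable_funD; exact: mc|exact: measurable_cst].
  - by apply: filterS h => w hw _; rewrite -!EFinM -!EFinD lee_fin.
rewrite ge0_integralD//; last 2 first.
- by move=> w _; rewrite adde_ge0// p0.
- by apply: emeasurable_funD; exact: mc.
rewrite integral_cst// [X in (_ * X)%E](@probability_setT _ _ _ P) mule1 EFinD; apply: leeD => //.
rewrite ge0_integralD//; try exact: mc; try by move=> w _; exact: p0.
rewrite EFinD !EFinM !ge0_integralZl//; apply: leeD; by apply: lee_wpmul2l.
Qed.

Lemma finite_del_min (N : nat) (Q : nat -> R -> Prop) :
  (forall i, exists2 del : R, 0 < del & forall r, 0 <= r -> r <= del -> Q i r) ->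
  exists2 del : R, 0 < del & forall i, (i < N)%N -> forall r, 0 <= r -> r <= del -> Q i r.
Proof.
move=> h; elim: N => [|N [del d0 hd]]; first by exists 1.
have [del' d'0 hd'] := h N; exists (Num.min del del'); first by rewrite lt_min d0.
move=> i; rewrite ltnS leq_eqVlt => /predU1P[->|iN] r r0; rewrite le_min => /andP[h1 h2]; first exact: hd'.
exact: hd.
Qed.

(** Takes the place of the compactness of [[0, T]]: estimates at finitely many grid times are
    propagated to the times that follow them. *)
Lemma grid_below (T eta : R) : 0 < T -> 0 < eta -> exists (N : nat) (g : nat -> R), forall u, 0 <= u <= T ->
  exists2 i, (i < N)%N & [/\ 0 <= g i, g i <= u & u - g i <= eta].
Proof.
move=> T0 eta0; exists (Num.truncn (T / eta)).+1, (fun i => i%:R * eta) => u /andP[u0 uT].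
have ue0 : 0 <= u / eta by rewrite divr_ge0// ltW.
exists (Num.truncn (u / eta)).
  by rewrite ltnS; apply: le_truncn; rewrite ler_pM2r ?invr_gt0.
split; first by rewrite mulr_ge0// ltW.
  by rewrite -ler_pdivlMr// truncn_le.
rewrite lerBlDr; have := truncnS_gt (u / eta); rewrite ltr_pdivrMr// -natr1 mulrDl mul1r addrC => /ltW.
exact.
Qed.

End AlmostSureComparison.

Section SolutionContinuity.
Context {R : realType} {H : hilbertType R} (sepH : separable_space H).
Context d (Omega : measurableType d) (P : probability Omega R) (F : R -> set (set Omega)).
Hypothesis hN : normal_filtration P F.
Context (S : R -> H -> H) (hS : C0_semigroup S).
Context (b : H -> H) (Cb theta : R).
Hypotheses (theta01 : 0 < theta < 1) (Cb0 : 0 <= Cb) (hb1 : forall x, `|b x| <= Cb).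
Hypothesis hb2 : forall x y, `|b x - b y| <= Cb * `|x - y| `^ theta.
Context (T : R) (T0 : 0 < T).
Local Notation mu := (@lebesgue_measure R).
Local Notation ms X := (\int[P]_w (`|X w| ^+ 2)%:E)%E.
Context (Z : R -> Omega -> H).
Hypothesis bZ : forall t, 0 <= t <= T -> borel_on setT (Z t).
Hypothesis fZ : forall t, 0 <= t <= T -> (ms (Z t) < +oo)%E.
Hypothesis bZi : forall u v, 0 <= u -> u <= v -> v <= T -> borel_on setT (Zinc S Z u v).
Hypothesis sZ : forall e : R, 0 < e -> exists2 del : R, 0 < del & forall u v, 0 <= u -> u <= v -> v <= T ->
  v - u <= del -> (ms (Zinc S Z u v) <= e%:E)%E.
Context (x0 : H) (X : R -> Omega -> H).
Hypothesis hX : mild_solution P F S b T Z x0 X.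
Variable M : R.
Hypotheses (M1 : 1 <= M) (hM : forall t x, 0 <= t <= T -> `|S t x| <= M * `|x|).

Let M0 : 0 <= M. Proof. exact: le_trans M1. Qed.
Let bX t : 0 <= t <= T -> borel_on setT (X t).
Proof. by move=> ht; exact: (mild_borel hN hX ht). Qed.

Let cb : continuous b. Proof. exact: (continuous_drift theta01 Cb0 hb2). Qed.

Let K := M * Cb.
Let K0 : 0 <= K. Proof. by rewrite mulr_ge0. Qed.

Let finms (Y : Omega -> H) : (ms Y < +oo)%E -> exists2 e : R, 0 <= e & (ms Y <= e%:E)%E.
Proof.
move=> h; have p : (0 <= ms Y)%E by apply: integral_ge0 => w _; rewrite lee_fin sqr_ge0.
by exists (fine (ms Y)); rewrite ?fine_ge0// fineK// ge0_fin_numE.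
Qed.

Lemma drift_inc_K u v : 0 <= u -> u <= v -> v <= T -> {ae P, forall w, `|drift_inc S Z X u v w| <= K * (v - u)}.
Proof.
move=> u0 uv vT; have vu0 : 0 <= v - u by rewrite subr_ge0.
apply: filterS (drift_inc_le sepH hS theta01 Cb0 hb1 hb2 hX u0 uv vT) => w /(_ 0); rewrite scaler0 subr0 => h.
rewrite -lee_fin; apply: (le_trans h).
have mIuv : measurable (`[u, v]%classic : set (measurableTypeR R)) by exact: measurable_itv.
apply: (@le_trans _ _ (\int[mu]_(s in `[u, v]) K%:E)%E).
  have buv : borel_on (`[u, v]%classic : set (measurableTypeR R)) (fun s : measurableTypeR R => S (v - s) (b (X s w))).
    move=> O oO; rewrite (_ : _ `&` _ = `[u, v] `&` (`[0, v] `&` (fun s => S (v - s) (b (X s w))) @^-1` O)).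
      by apply: measurableI => //; exact: (borel_path_sg sepH hS theta01 Cb0 hb2 hX w vT).
    apply/seteqP; split=> [s [h1 h2]|s [h1 [_ h2]]]; split => //; split => //.
    by move: h1; rewrite /= !in_itv/= => /andP[us ->]; rewrite (le_trans u0).
  apply: ge0_le_integral => //.
  - apply/measurable_EFinP; exact: (borel_normP sepH mIuv _).1 buv 0.
  - move=> s; rewrite /= in_itv/= => /andP[us sv]; rewrite lee_fin subr0.
    apply: (le_trans (hM _ _)); first by rewrite subr_ge0 sv/=; lra.
    by rewrite ler_wpM2l.
rewrite integral_cst//= lebesgue_measure_itv/= lte_fin; case: ltP => [_|vu].
  by rewrite -EFinB -EFinM.
by rewrite mule0 lee_fin mulr_ge0.
Qed.

Lemma mild_step u v w : 0 <= u -> u <= v -> X v w = S (v - u) (X u w) + drift_inc S Z X u v w + Zinc S Z u v w.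
Proof. by move=> u0 uv; rewrite /drift_inc; hring. Qed.

(** The variable [Z 0] is kept as it stands: it is common to both solutions and cancels in their
    difference. *)
Lemma mild_initial : {ae P, forall w, X 0 w = x0 + Z 0 w}.
Proof.
have T00 : 0 <= (0 : R) <= T by rewrite lexx ltW.
have [_ S0 _ _] := hS.
have mI : measurable (`[0, 0]%classic : set (measurableTypeR R)) by exact: measurable_itv.
have fin : (mu `[0%R, 0%R] < +oo)%E by rewrite lebesgue_measure_itv/= ltxx.
apply: filterS (mild_eq hX T00) => w [I [hI ->]].
suff -> : I = 0 by rewrite S0 addr0.
have bnd s : (`[0, 0]%classic : set R) s -> `|S (0 - s) (b (X s w))| <= K.
  rewrite /= in_itv/= => h; have s0 : s = 0 by apply: le_anti; rewrite andbC.
  rewrite s0 subr0; apply: (le_trans (hM _ T00)).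
  by rewrite ler_wpM2l.
have bp := borel_path_sg sepH hS theta01 Cb0 hb2 hX w (ltW T0).
apply: dot_ext => y; rewrite dot0l (has_bochner_dot sepH mI fin bp bnd hI).
by rewrite set_itv1 Rintegral_set1.
Qed.

Lemma mild_ms_finite t : 0 <= t <= T -> (ms (X t) < +oo)%E.
Proof.
move=> ht; have /andP[t0 tT] := ht; have T00 : 0 <= (0 : R) <= T by rewrite lexx ltW.
have [e1 e10 h1] := finms (fZ T00); have [e2 e20 h2] := finms (fZ ht).
have bc (x : H) : borel_on setT (fun _ : Omega => x) by exact: borel_cst.
have h3 : (ms (X 0%R) <= (2 * e1 + 0 * e1 + 2 * `|x0| ^+ 2)%:E)%E.
  apply: (ms_le_ae sepH (bX T00) (bZ T00) (bZ T00) _ _ _ _ h1 h1) => //.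
  apply: filterS mild_initial => w ->; rewrite mul0r addr0 addrC; exact: sqr_normD_le.
have t00 : 0 <= t - 0 by rewrite subr0.
pose Y w := S t (Z 0 w).
have bY : borel_on setT Y by apply: borel_sg => //; exact: bZ.
apply: (@le_lt_trans _ _ (4 * M ^+ 2 * (2 * e1 + 0 * e1 + 2 * `|x0| ^+ 2) + 8 * (2 * e2 + 2 * (M ^+ 2 * e1)) + 4 * (K * t) ^+ 2)%:E); last exact: ltry.
have h4 : (ms (Zinc S Z 0%R t) <= (2 * e2 + 2 * (M ^+ 2 * e1) + 0)%:E)%E.
  have hY : (ms Y <= (M ^+ 2 * e1 + 0 * e1 + 0)%:E)%E.
    apply: (ms_le_ae sepH bY (bZ T00) (bZ T00) _ _ _ _ h1 h1) => //; first exact: sqr_ge0.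
    apply: aeW => w; rewrite mul0r !addr0 -exprMn ler_sqr ?nnegrE ?mulr_ge0//; exact: hM.
  rewrite mul0r !addr0 in hY.
  apply: (ms_le_ae sepH (bZi (lexx 0) t0 tT) (bZ ht) bY _ _ _ _ h2 hY) => //.
  by apply: aeW => w; rewrite addr0 /Zinc subr0 -(normrN (Y w)); exact: sqr_normD_le.
rewrite addr0 in h4.
apply: (ms_le_ae sepH (bX ht) (bX T00) (bZi (lexx 0) t0 tT) _ _ _ _ h3 h4) => //.
- by rewrite mulr_ge0// sqr_ge0.
- by rewrite mulr_ge0// sqr_ge0.
apply: filterS (drift_inc_K (lexx 0) t0 tT) => w; rewrite subr0 => hd.
rewrite (mild_step w (lexx 0) t0) subr0.
set a := S t _; set b1 := drift_inc _ _ _ _ _ _; set c := Zinc _ _ _ _ _.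
have ha : `|a| ^+ 2 <= M ^+ 2 * `|X 0 w| ^+ 2 by rewrite -exprMn ler_sqr ?nnegrE ?mulr_ge0//; exact: hM.
have hb : `|b1| ^+ 2 <= (K * t) ^+ 2 by rewrite ler_sqr ?nnegrE ?mulr_ge0.
have := sqr_normD_le (a + b1) c; have := sqr_normD_le a b1; move: ha hb; have := sqr_ge0 `|c|; lra.
Qed.

Let sgB r x : 0 <= r <= T -> `|S r x - x| ^+ 2 <= (M + 1) ^+ 2 * `|x| ^+ 2.
Proof.
move=> hr; rewrite -exprMn ler_sqr ?nnegrE ?mulr_ge0 ?addr_ge0//.
by apply: (le_trans (ler_normB _ _)); rewrite mulrDl mul1r lerD2r hM.
Qed.

(** From the grid time before [u], the solution evolves by [S (u - g i)], which commutes with [S r],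
    up to a small drift and a small noise. Uniformity in [u] is thus reduced to finitely many times,
    where [ms_sg_small] applies. *)
Lemma mild_sg_small (e : R) : 0 < e -> exists2 del : R, 0 < del & forall r u, 0 <= r -> r <= del -> 0 <= u <= T ->
  (ms (fun w => (S r (X u w) - X u w)%R) <= e%:E)%E.
Proof.
move=> e0; have [_ _ Sadd _] := hS.
have A0 : 0 < e / 3 by rewrite divr_gt0.
have M20 : 0 <= 2 * M ^+ 2 by rewrite mulr_ge0// sqr_ge0.
have M40 : 0 <= 4 * (M + 1) ^+ 2 by rewrite mulr_ge0// sqr_ge0.
have [e1 /andP[e10 _] he1] := small_factor A0 M20.
have [e2 /andP[e20 _] he2] := small_factor A0 M40.
have [d1 d10 hd1] := sZ e20.
have [d2 /andP[d20 d21] hd2] := small_factor A0 (mulr_ge0 M40 (sqr_ge0 K)).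
have dd0 : 0 < Num.min d1 d2 by rewrite lt_min d10.
have [N [g hg]] := grid_below T0 dd0.
have hQ i : exists2 del : R, 0 < del & forall r, 0 <= r -> r <= del ->
    0 <= g i <= T -> (ms (fun w => (S r (X (g i) w) - X (g i) w)%R) <= e1%:E)%E.
  have [gi|ngi] := pselect (0 <= g i <= T); last by exists 1.
  have [del del0 h] := ms_sg_small sepH hS (bX gi) (mild_ms_finite gi) e10.
  by exists del => // r r0 rd _; exact: h.
have [d3 d30 hd3] := finite_del_min N hQ.
exists (Num.min d3 T); first by rewrite lt_min d30.
move=> r u r0; rewrite le_min => /andP[rd3 rT] hu.
have [i iN [gi0 giu]] := hg u hu; rewrite le_min => /andP[ug1 ug2].
have /andP[u0 uT] := hu.
have hgi : 0 <= g i <= T by rewrite gi0 (le_trans giu).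
have h1 := hd3 i iN r r0 rd3 hgi.
have h2 := hd1 _ _ gi0 giu uT ug1.
have ugi0 : 0 <= u - g i by rewrite subr_ge0.
have ugT : 0 <= u - g i <= T by rewrite ugi0/=; lra.
have hr : 0 <= r <= T by rewrite r0.
have b1 : borel_on setT (fun w => S r (X u w) - X u w) by apply: borelB => //; [apply: borel_sg|]; rewrite ?r0//; exact: bX.
have b2 : borel_on setT (fun w => S r (X (g i) w) - X (g i) w) by apply: borelB => //; [apply: borel_sg|]; rewrite ?r0//; exact: bX.
apply: (@le_trans _ _ (2 * M ^+ 2 * e1 + 4 * (M + 1) ^+ 2 * e2 + 4 * (M + 1) ^+ 2 * (K * (u - g i)) ^+ 2)%:E); last first.
  rewrite lee_fin; have : 4 * (M + 1) ^+ 2 * (K * (u - g i)) ^+ 2 <= e / 3.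
    apply: le_trans hd2; rewrite exprMn mulrA mulrC ler_wpM2r ?(mulr_ge0 M40 (sqr_ge0 K))//.
    apply: (@le_trans _ _ (d2 ^+ 2)); first by rewrite ler_sqr ?nnegrE// ltW.
    by rewrite expr2 ler_piMl// ltW.
  have aux (p q z : R) : p <= e / 3 -> q <= e / 3 -> z <= e / 3 -> p + q + z <= e by lra.
  by apply: aux; rewrite mulrC.
apply: (ms_le_ae sepH b1 b2 (bZi gi0 giu uT) _ _ _ _ h1 h2) => //; first by rewrite mulr_ge0// sqr_ge0.
apply: filterS (drift_inc_K gi0 giu uT) => w hd.
rewrite (mild_step w gi0 giu); set a := S (u - g i) _; set b' := drift_inc _ _ _ _ _ _; set c := Zinc _ _ _ _ _.
have ea : S r (a + b' + c) - (a + b' + c) = S (u - g i) (S r (X (g i) w) - X (g i) w) + (S r (b' + c) - (b' + c)).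
  rewrite -addrA (bopD (sg_bop hS r0) a) /a (bopB (sg_bop hS ugi0)) -!Sadd// (addrC r).
  by hring.
rewrite ea; apply: (le_trans (sqr_normD_le _ _)).
have h3 : `|S (u - g i) (S r (X (g i) w) - X (g i) w)| ^+ 2 <= M ^+ 2 * `|S r (X (g i) w) - X (g i) w| ^+ 2.
  by rewrite -exprMn ler_sqr ?nnegrE ?mulr_ge0//; exact: hM.
have h4 := sgB (b' + c) hr.
have h5 := sqr_normD_le b' c.
have h6 : `|b'| ^+ 2 <= (K * (u - g i)) ^+ 2 by rewrite ler_sqr ?nnegrE ?mulr_ge0.
have h7 : (M + 1) ^+ 2 * `|b' + c| ^+ 2 <= (M + 1) ^+ 2 * (2 * (K * (u - g i)) ^+ 2 + 2 * `|c| ^+ 2).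
  by rewrite ler_wpM2l ?sqr_ge0//; lra.
move: h3 (le_trans h4 h7); rewrite !mulrDr; lra.
Qed.

Lemma mild_ms_continuous (e : R) : 0 < e -> exists2 del : R, 0 < del & forall u v, 0 <= u -> u <= v -> v <= T ->
  v - u <= del -> (ms (fun w => (X v w - X u w)%R) <= e%:E)%E.
Proof.
move=> e0; have e60 : 0 < e / 12 by rewrite divr_gt0.
have [d1 d10 hd1] := mild_sg_small e60; have [d2 d20 hd2] := sZ e60.
have [d3 /andP[d30 d31] hd3] := small_factor e60 (sqr_ge0 K).
exists (Num.min d1 (Num.min d2 d3)); first by rewrite !lt_min d10 d20.
move=> u v u0 uv vT; rewrite !le_min => /and3P[h1 h2 h3].
have vu0 : 0 <= v - u by rewrite subr_ge0.
have hu : 0 <= u <= T by rewrite u0 (le_trans uv).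
have hv : 0 <= v <= T by rewrite (le_trans u0).
have b1 : borel_on setT (fun w => X v w - X u w) by apply: borelB => //; exact: bX.
have b2 : borel_on setT (fun w => S (v - u) (X u w) - X u w).
  by apply: borelB => //; [apply: borel_sg => //; exact: bX|exact: bX].
apply: (@le_trans _ _ (4 * (e / 12) + 2 * (e / 12) + 4 * (K * (v - u)) ^+ 2)%:E); last first.
  rewrite lee_fin; have : (K * (v - u)) ^+ 2 <= e / 12.
    apply: le_trans hd3; rewrite exprMn mulrC ler_wpM2r ?sqr_ge0//.
    apply: (@le_trans _ _ (d3 ^+ 2)); first by rewrite ler_sqr ?nnegrE// ltW.
    by rewrite expr2 ler_piMl// ltW.
  lra.
apply: (ms_le_ae sepH b1 b2 (bZi u0 uv vT) _ _ _ _ (hd1 _ _ vu0 h1 hu) (hd2 _ _ u0 uv vT h2)) => //.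
  by rewrite mulr_ge0// sqr_ge0.
apply: filterS (drift_inc_K u0 uv vT) => w hd.
rewrite (mild_step w u0 uv); set a := S (v - u) _; set b' := drift_inc _ _ _ _ _ _; set c := Zinc _ _ _ _ _.
have -> : a + b' + c - X u w = (a - X u w + b') + c by hring.
have h6 : `|b'| ^+ 2 <= (K * (v - u)) ^+ 2 by rewrite ler_sqr ?nnegrE ?mulr_ge0.
have := sqr_normD_le (a - X u w + b') c; have := sqr_normD_le (a - X u w) b'; lra.
Qed.

Lemma drift_sqr (eta : R) : 0 < eta -> exists2 c : R, 0 <= c & forall x y, `|b x - b y| ^+ 2 <= eta + c * `|x - y| ^+ 2.
Proof.
move=> eta0; have C20 : 0 <= 2 * Cb * Cb by rewrite !mulr_ge0.
have [c c0 hc] := powR_quadratic theta01 C20 eta0; exists c => // x y.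
apply: le_trans (hc _ (normr_ge0 _)); rewrite expr2 -mulrA; apply: ler_pM => //.
by apply: (le_trans (ler_normB _ _)); have := hb1 x; have := hb1 y; lra.
Qed.

(** The same grid argument for [b (X u)]; its proximity to the value at the grid time comes from
    [mild_ms_continuous] through [drift_sqr]. *)
Lemma drift_sg_small (e : R) : 0 < e -> exists2 del : R, 0 < del & forall r u, 0 <= r -> r <= del -> 0 <= u <= T ->
  (ms (fun w => (S r (b (X u w)) - b (X u w))%R) <= e%:E)%E.
Proof.
move=> e0; have A0 : 0 < e / 3 by rewrite divr_gt0.
have M40 : 0 <= 2 * (M + 1) ^+ 2 by rewrite mulr_ge0// sqr_ge0.
have [eta /andP[eta0 _] heta] := small_factor A0 M40.
have [c c0 hc] := drift_sqr eta0.
have [e2 /andP[e20 _] he2] := small_factor A0 (mulr_ge0 M40 c0).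
have [d1 d10 hd1] := mild_ms_continuous e20.
have [N [g hg]] := grid_below T0 d10.
have e60 : 0 < e / 6 by rewrite divr_gt0.
have bbX t : 0 <= t <= T -> borel_on setT (fun w => b (X t w)).
  by move=> ht; exact: (borel_comp cb (bX ht)).
have fbX t : 0 <= t <= T -> (ms (fun w => b (X t w)) < +oo)%E.
  move=> ht; apply: (@le_lt_trans _ _ (\int[P]_w (Cb ^+ 2)%:E)%E).
    apply: ge0_le_integral => //.
    - by apply: (borel_norm2 sepH measurableT); exact: bbX.
    - by move=> w _; rewrite lee_fin ler_sqr ?nnegrE.
  by rewrite integral_cst//= [X in (_ * X)%E](@probability_setT _ _ _ P) mule1 ltry.
have hQ i : exists2 del : R, 0 < del & forall r, 0 <= r -> r <= del ->
    0 <= g i <= T -> (ms (fun w => (S r (b (X (g i) w)) - b (X (g i) w))%R) <= (e / 6)%:E)%E.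
  have [gi|ngi] := pselect (0 <= g i <= T); last by exists 1.
  have [del del0 h] := ms_sg_small sepH hS (bbX _ gi) (fbX _ gi) e60.
  by exists del => // r r0 rd _; exact: h.
have [d3 d30 hd3] := finite_del_min N hQ.
exists (Num.min d3 T); first by rewrite lt_min d30.
move=> r u r0; rewrite le_min => /andP[rd3 rT] hu.
have [i iN [gi0 giu ug]] := hg u hu; have /andP[u0 uT] := hu.
have hgi : 0 <= g i <= T by rewrite gi0 (le_trans giu).
have hr : 0 <= r <= T by rewrite r0.
have b1 t : 0 <= t <= T -> borel_on setT (fun w => S r (b (X t w)) - b (X t w)).
  by move=> ht; apply: borelB => //; [apply: borel_sg => //; exact: bbX|exact: bbX].
have b2 : borel_on setT (fun w => X u w - X (g i) w) by apply: borelB => //; exact: bX.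
apply: (@le_trans _ _ (2 * (e / 6) + 2 * (M + 1) ^+ 2 * c * e2 + 2 * (M + 1) ^+ 2 * eta)%:E); last first.
  by rewrite lee_fin; move: he2 heta; rewrite (mulrC e2) (mulrC eta); lra.
apply: (ms_le_ae sepH (b1 _ hu) (b1 _ hgi) b2 _ _ _ _ (hd3 i iN r r0 rd3 hgi) (hd1 _ _ gi0 giu uT ug)) => //.
- by rewrite mulr_ge0.
- by rewrite mulr_ge0// ltW.
apply: aeW => w; set x := b (X u w); set y := b (X (g i) w).
have -> : S r x - x = (S r y - y) + (S r (x - y) - (x - y)).
  by rewrite (bopB (sg_bop hS r0)); hring.
have hxy : (M + 1) ^+ 2 * `|x - y| ^+ 2 <= (M + 1) ^+ 2 * (eta + c * `|X u w - X (g i) w| ^+ 2).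
  by rewrite ler_wpM2l ?sqr_ge0//; exact: hc.
have := sqr_normD_le (S r y - y) (S r (x - y) - (x - y)); have := sgB (x - y) hr; move: hxy; rewrite mulrDr; lra.
Qed.

Let bbX t : 0 <= t <= T -> borel_on setT (fun w => b (X t w)).
Proof. by move=> ht; exact: (borel_comp cb (bX ht)). Qed.

Let D u v : set (measurableTypeR R * Omega) := [set p | u <= p.1 <= v].

Let mD u v : measurable (D u v).
Proof.
rewrite (_ : D u v = `[u, v]%classic `*` setT).
  by apply: measurableX => //; exact: measurable_itv.
by apply/seteqP; split=> [p h|p [h _]]; [split=> //; rewrite /= in_itv|move: h; rewrite /= in_itv].
Qed.

Let borel_snd u v (Y : Omega -> H) : borel_on setT Y -> borel_on (D u v) (fun p => Y p.2).
Proof.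
move=> bY; have h : borel_on (setT : set (measurableTypeR R * Omega)) (Y \o snd) := borel_pullback measurable_snd bY.
move=> O oO; apply: measurableI; [exact: mD|have := h O oO; rewrite setTI; exact].
Qed.

Let borel_joint u v : 0 <= u -> v <= T -> borel_on (D u v) (fun p => X p.1 p.2).
Proof.
move=> u0 vT O oO; have h := mild_measurable hX oO.
rewrite (_ : _ `&` _ = D u v `&` [set p : measurableTypeR R * Omega | 0 <= p.1 <= T /\ O (X p.1 p.2)]).
  by apply: measurableI; [exact: mD|exact: h].
apply/seteqP; split=> p [/= hp]; first by move/andP: hp => [up pv] h'; split; rewrite /D/= ?up ?pv// (le_trans u0)// (le_trans pv).
by move=> [_ h'].
Qed.

Let borel_orbit_snd u v (Y : Omega -> H) : borel_on setT Y ->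
  borel_on (D u v) (fun p => sgx S (p.1 - u) (Y p.2)).
Proof.
move=> bY; apply/(borel_normP sepH (mD u v)) => x.
apply: (measurable_caratheodory sepH (mD u v) (X := fun p => Y p.2)
  (Psi := fun (p : measurableTypeR R * Omega) (y : H) => `|sgx S (p.1 - u) y - x|) (borel_snd u v bY)).
- move=> y; apply: measurable_funTS.
  apply: (@measurableT_comp _ _ _ _ _ _ (fun s : measurableTypeR R => `|sgx S (s - u) y - x|)); last exact: measurable_fst.
  apply: continuous_measurable_fun => s.
  apply: cvg_norm; apply: cvgB; last exact: cvg_cst.
  apply: (@continuous_comp _ _ _ (fun s => s - u) (fun t => sgx S t y)).
    by apply: cvgB; [exact: cvg_id|exact: cvg_cst].
  exact: sgx_continuous.
- move=> p _ y; apply: cvg_norm; apply: cvgB; last exact: cvg_cst.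
  exact: (sgx_bop hS (p.1 - u)).2.
Qed.

(* Tonelli turns an almost sure bound by a time integral into a bound by the
   largest mean square in the interval. *)
Lemma mean_time_integral (Y : Omega -> R) (A0 B0 C0 e1 e2 u v : R) : 0 <= u -> u <= v -> v <= T ->
  measurable_fun setT Y -> 0 <= A0 -> 0 <= B0 -> 0 <= C0 ->
  {ae P, forall w, (`|Y w|%:E <= \int[mu]_(s in `[u, v])
    (A0 + B0 * `|X s w - X u w| ^+ 2 + C0 * `|sgx S (s - u) (b (X u w)) - b (X u w)| ^+ 2)%:E)%E} ->
  (forall s, u <= s -> s <= v -> (ms (fun w => (X s w - X u w)%R) <= e1%:E)%E) ->
  (forall s, u <= s -> s <= v -> (ms (fun w => (S (s - u) (b (X u w)) - b (X u w))%R) <= e2%:E)%E) ->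
  (\int[P]_w `|Y w|%:E <= ((A0 + B0 * e1 + C0 * e2) * (v - u))%:E)%E.
Proof.
move=> u0 uv vT mY A00 B00 C00 hY h1 h2.
have hu : 0 <= u <= T by rewrite u0 (le_trans uv).
pose g (p : measurableTypeR R * Omega) : R := A0 + B0 * `|X p.1 p.2 - X u p.2| ^+ 2
  + C0 * `|sgx S (p.1 - u) (b (X u p.2)) - b (X u p.2)| ^+ 2.
have g0 p : 0 <= g p by rewrite !addr_ge0 ?mulr_ge0 ?sqr_ge0.
pose f := (EFin \o g) \_ (D u v).
have n2 (W : measurableTypeR R * Omega -> H) : borel_on (D u v) W -> measurable_fun (D u v) (fun p => `|W p| ^+ 2).
  by move=> bW; apply/measurable_EFinP; exact: (borel_norm2 sepH (mD u v) bW).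
have mf : measurable_fun setT f.
  apply/(measurable_restrictT _ (mD u v)); apply/measurable_EFinP.
  apply: measurable_funD; first apply: measurable_funD; first exact: measurable_cst.
  - apply: measurable_funM; first exact: measurable_cst.
    apply: n2; apply: (borelB sepH (mD u v)); first exact: borel_joint.
    by exact: (borel_snd u v (bX hu)).
  - apply: measurable_funM; first exact: measurable_cst.
    apply: n2; apply: (borelB sepH (mD u v)); first exact: (borel_orbit_snd u v (bbX hu)).
    exact: (borel_snd u v (bbX hu)).
have f0 p : (0 <= f p)%E by rewrite /f patchE; case: ifP => // _; rewrite lee_fin.
have fE s w : f (s, w) = ((fun s => (g (s, w))%:E) \_ `[u, v]) s.
  by rewrite /f !patchE (_ : (s, w) \in D u v = (s \in `[u, v]%classic)).
apply: (@le_trans _ _ (\int[P]_w \int[mu]_s f (s, w))%E).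
  apply: ae_ge0_le_integral => //.
  - by apply/measurable_EFinP; exact: measurableT_comp.
  - by move=> w _; exact: integral_ge0.
  - exact: (measurable_fun_fubini_tonelli_G (m1 := mu)).
  - apply: filterS hY => w hw _; apply: (le_trans hw); rewrite integral_mkcond.
    by under eq_integral do rewrite -fE.
rewrite -(@fubini_tonelli _ _ _ _ R mu P f mf f0).
apply: (@le_trans _ _ (\int[mu]_(s in `[u, v]) (A0 + B0 * e1 + C0 * e2)%:E)%E); last first.
  rewrite integral_cst//= lebesgue_measure_itv/= lte_fin; case: ltP => [_|vu].
    by rewrite -EFinB -EFinM.
  have -> : v - u = 0 by apply/eqP; rewrite subr_eq0 eq_le vu uv.
  by rewrite mule0 mulr0.
have mIuv : measurable (`[u, v]%classic : set (measurableTypeR R)) by exact: measurable_itv.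
have mcst : measurable_fun setT ((fun _ : measurableTypeR R => (A0 + B0 * e1 + C0 * e2)%:E) \_ `[u, v]).
  by apply/(measurable_restrictT _ mIuv); exact: measurable_cst.
rewrite [leRHS]integral_mkcond; apply: ge0_le_integral => //.
- by move=> s _; exact: integral_ge0.
- exact: (measurable_fun_fubini_tonelli_F (m2 := P)).
move=> s _; have [suv|suv] := boolP (s \in (`[u, v]%classic : set R)); last first.
  rewrite patchE (negbTE suv); under eq_integral do rewrite fE patchE (negbTE suv).
  by rewrite integral0.
rewrite patchE suv; under eq_integral do rewrite fE patchE suv.
move: suv; rewrite inE/= in_itv/= => /andP[us sv].
have su0 : 0 <= s - u by rewrite subr_ge0.
have hs : 0 <= s <= T by rewrite (le_trans u0)// (le_trans sv).
have p1 w : (0 <= B0%:E * (`|X s w - X u w| ^+ 2)%:E)%E by rewrite mule_ge0// lee_fin// sqr_ge0.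
have p2 w : (0 <= C0%:E * (`|S (s - u) (b (X u w)) - b (X u w)| ^+ 2)%:E)%E by rewrite mule_ge0// lee_fin// sqr_ge0.
have b1 : borel_on setT (fun w => X s w - X u w) by apply: borelB => //; exact: bX.
have b2 : borel_on setT (fun w => S (s - u) (b (X u w)) - b (X u w)).
  by apply: borelB => //; [apply: borel_sg => //|]; exact: bbX.
have m1 := borel_norm2 sepH measurableT b1; have m2 := borel_norm2 sepH measurableT b2.
have -> : (\int[P]_w (g (s, w))%:E = \int[P]_w (A0%:E + B0%:E * (`|X s w - X u w| ^+ 2)%:E
    + C0%:E * (`|S (s - u) (b (X u w)) - b (X u w)| ^+ 2)%:E))%E.
  by apply: eq_integral => w _; rewrite /g/= sgxE// -!EFinM -!EFinD.
have mc (c : R) (h : Omega -> \bar R) : measurable_fun setT h -> measurable_fun setT (fun w => (c%:E * h w)%E).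
  by move=> m; apply: emeasurable_funM => //; exact: measurable_cst.
rewrite ge0_integralD//; last 3 first.
- by move=> w _; rewrite adde_ge0.
- by apply: emeasurable_funD; [exact: measurable_cst|exact: mc].
- exact: mc.
rewrite ge0_integralD//; last exact: mc.
rewrite integral_cst// [X in (_ * X)%E](@probability_setT _ _ _ P) mule1.
have s2 (W : Omega -> H) w : (0 <= (`|W w| ^+ 2)%:E)%E by rewrite lee_fin sqr_ge0.
rewrite !ge0_integralZl//; try by move=> w _; exact: s2.
rewrite !EFinD !EFinM; apply: leeD; first apply: leeD => //; apply: lee_wpmul2l => //.
- exact: h1.
- exact: h2.
Qed.

(** Replacing the drift by its value at the left end of the interval costs less than any multiple of
    the length, uniformly in time. Summed over a grid of small mesh, these errors disappear. *)
Lemma drift_consistency (e : R) : 0 < e -> exists2 del : R, 0 < del & forall u v, 0 <= u -> u <= v -> v <= T ->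
  v - u <= del ->
  (\int[P]_w `|drift_inc S Z X u v w - (v - u) *: S (v - u) (b (X u w))|%:E <= (e * (v - u))%:E)%E.
Proof.
move=> e0; have e40 : 0 < e / 4 by rewrite divr_gt0.
(* A norm is bounded through [t <= kap + t^2 / kap], because the available bounds are in mean
   square. Hence the order of the choices: [kap], then [eta] depending on [kap], then [e1] depending
   on the constant [c] of [eta], and [e2]. *)
have [kap /andP[kap0 _] hkap] := small_factor e40 (mulr_ge0 (ler0n _ 2) M0).
have Mk0 : 0 <= M / kap by rewrite divr_ge0// ltW.
have [eta /andP[eta0 _] heta] := small_factor e40 Mk0.
have [c c0 hc] := drift_sqr eta0.
have Mkc0 : 0 <= M / kap * c by rewrite mulr_ge0.
have [e1 /andP[e10 _] he1] := small_factor e40 Mkc0.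
have [e2 /andP[e20 _] he2] := small_factor e40 Mk0.
have [d1 d10 hd1] := mild_ms_continuous e10.
have [d2 d20 hd2] := drift_sg_small e20.
exists (Num.min d1 d2); first by rewrite lt_min d10.
move=> u v u0 uv vT; rewrite le_min => /andP[vd1 vd2].
have hu : 0 <= u <= T by rewrite u0 (le_trans uv).
have vu0 : 0 <= v - u by rewrite subr_ge0.
have [_ _ Sadd _] := hS.
pose A0 := M * (2 * kap) + M / kap * eta.
have A00 : 0 <= A0 by rewrite addr_ge0// mulr_ge0// ?mulr_ge0 ?ltW.
have mY : measurable_fun setT (fun w => `|drift_inc S Z X u v w - (v - u) *: S (v - u) (b (X u w))|).
  have b1 : borel_on setT (fun w => drift_inc S Z X u v w - (v - u) *: S (v - u) (b (X u w))).
    apply: borelB => //; first exact: (borel_drift_inc sepH hN hS bZ hX).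
    apply: (borel_comp (f := fun x : H => (v - u) *: x)).
      by move=> x; apply: cvgZ; [exact: cvg_cst|exact: cvg_id].
    by apply: borel_sg => //; exact: bbX.
  have /(_ 0) := (borel_normP sepH measurableT _).1 b1.
  by apply: eq_measurable_fun => w _; rewrite subr0.
apply: (@le_trans _ _ ((A0 + M / kap * c * e1 + M / kap * e2) * (v - u))%:E); last first.
  rewrite lee_fin ler_wpM2r//.
  have aux (p q r z : R) : p <= e / 4 -> q <= e / 4 -> r <= e / 4 -> z <= e / 4 -> p + q + r + z <= e by lra.
  rewrite /A0; apply: aux; try by rewrite mulrC.
  by have -> : M * (2 * kap) = kap * (2 * M) by ring.
have -> : (\int[P]_w `|drift_inc S Z X u v w - (v - u) *: S (v - u) (b (X u w))|%:E =
    \int[P]_w `|(`|drift_inc S Z X u v w - (v - u) *: S (v - u) (b (X u w))|)|%:E)%E.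
  by apply: eq_integral => w _; rewrite normr_id.
apply: mean_time_integral => //; last 2 first.
- by move=> s us sv; apply: hd1 => //; [exact: le_trans vT|apply: le_trans vd1; rewrite lerD2r].
- by move=> s us sv; apply: hd2 => //; rewrite ?subr_ge0//; apply: le_trans vd2; rewrite lerD2r.
apply: filterS (drift_inc_le sepH hS theta01 Cb0 hb1 hb2 hX u0 uv vT) => w /(_ (S (v - u) (b (X u w)))) h.
rewrite normr_id; apply: (le_trans h).
have mIuv : measurable (`[u, v]%classic : set (measurableTypeR R)) by exact: measurable_itv.
have sub : (`[u, v]%classic : set R) `<=` `[0, v] by move=> s; rewrite /= !in_itv/= => /andP[us ->]; rewrite (le_trans u0).
have bXuv : borel_on (`[u, v]%classic : set (measurableTypeR R)) (fun s : measurableTypeR R => X s w).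
  move=> O oO; rewrite (_ : _ `&` _ = `[u, v] `&` (`[0, v] `&` (fun s => X s w) @^-1` O)).
    by apply: measurableI => //; exact: (borel_path hX w vT).
  by apply/seteqP; split=> [s [h1 h2]|s [h1 [_ h2]]]; split => //; split => //; exact: sub.
have buv : borel_on (`[u, v]%classic : set (measurableTypeR R)) (fun s : measurableTypeR R => S (v - s) (b (X s w))).
  move=> O oO; rewrite (_ : _ `&` _ = `[u, v] `&` (`[0, v] `&` (fun s => S (v - s) (b (X s w))) @^-1` O)).
    by apply: measurableI => //; exact: (borel_path_sg sepH hS theta01 Cb0 hb2 hX w vT).
  by apply/seteqP; split=> [s [h1 h2]|s [h1 [_ h2]]]; split => //; split => //; exact: sub.
have borb : borel_on (`[u, v]%classic : set (measurableTypeR R)) (fun s : measurableTypeR R => sgx S (s - u) (b (X u w))).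
  move=> O oO; apply: measurableI => //; apply: open_measurable; apply: open_comp => // s _.
  apply: (@continuous_comp _ _ _ (fun s => s - u) (fun t => sgx S t (b (X u w)))).
    by apply: cvgB; [exact: cvg_id|exact: cvg_cst].
  exact: sgx_continuous.
have n2 (W : measurableTypeR R -> H) : borel_on (`[u, v]%classic : set (measurableTypeR R)) W ->
    measurable_fun (`[u, v]%classic : set (measurableTypeR R)) (fun p : measurableTypeR R => `|W p| ^+ 2).
  by move=> bW; apply/measurable_EFinP; exact: (borel_norm2 sepH mIuv bW).
have bcst (x : H) : borel_on (`[u, v]%classic : set (measurableTypeR R)) (fun _ : measurableTypeR R => x) by exact: borel_cst.
apply: ge0_le_integral => //.
- by apply/measurable_EFinP; exact: (borel_normP sepH mIuv _).1 buv _.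
- apply/measurable_EFinP; apply: measurable_funD; first apply: measurable_funD; first exact: measurable_cst.
  + apply: measurable_funM; first exact: measurable_cst.
    by apply: n2; apply: (borelB sepH mIuv).
  + apply: measurable_funM; first exact: measurable_cst.
    by apply: n2; apply: (borelB sepH mIuv).
move=> s; rewrite /= in_itv/= => /andP[us sv]; rewrite lee_fin.
have su0 : 0 <= s - u by rewrite subr_ge0.
have vs0 : 0 <= v - s by rewrite subr_ge0.
rewrite sgxE//; set x := b (X u w); set y := b (X s w).
have -> : S (v - s) y - S (v - u) x = S (v - s) ((y - x) - (S (s - u) x - x)).
  have -> : v - u = (v - s) + (s - u) by ring.
  by rewrite (Sadd _ _ _ vs0 su0) !(bopB (sg_bop hS vs0)); hring.
apply: (le_trans (hM _ _)); first by rewrite vs0/=; lra.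
have young (t : R) : t <= kap + t ^+ 2 / kap.
  have kk : kap * kap^-1 = 1 by rewrite divff// gt_eqF.
  have : 0 <= (t - kap) ^+ 2 / kap by rewrite divr_ge0 ?sqr_ge0// ltW.
  have -> : (t - kap) ^+ 2 / kap = t ^+ 2 / kap - 2 * t * (kap * kap^-1) + kap * (kap * kap^-1) by ring.
  rewrite kk; have := ltW kap0; have : 0 <= t ^+ 2 / kap by rewrite divr_ge0 ?sqr_ge0// ltW.
  lra.
have nle : `|(y - x) - (S (s - u) x - x)| <= 2 * kap + (eta + c * `|X s w - X u w| ^+ 2) / kap + `|S (s - u) x - x| ^+ 2 / kap.
  apply: (le_trans (ler_normB _ _)).
  have := young `|y - x|; have := young `|S (s - u) x - x|.
  have : `|y - x| ^+ 2 / kap <= (eta + c * `|X s w - X u w| ^+ 2) / kap by rewrite ler_wpM2r ?invr_ge0 ?(ltW kap0)//; exact: hc.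
  lra.
apply: (le_trans (ler_wpM2l M0 nle)); rewrite le_eqVlt; apply/orP; left; apply/eqP; rewrite /A0; ring.
Qed.

End SolutionContinuity.

(** * Singular kernels *)

Section MonotoneKernels.
Context {R : realType}.
Local Notation mu := (@lebesgue_measure R).
Implicit Types (f : R -> R) (T : R).

(** Nothing is required at 0, where the kernels may be singular. *)
Definition decreasing_kernel T f := (forall s, 0 < s -> s <= T -> 0 <= f s) /\
  (forall s t, 0 < s -> s <= t -> t <= T -> f t <= f s).

(** Superlevel sets of a decreasing function are intervals. *)
Lemma kernel_measurable T f : decreasing_kernel T f ->
  measurable_fun (`]0, T] : set (measurableTypeR R)) (f : measurableTypeR R -> R).
Proof.
move=> [_ fd]; apply: (measurability (@RGenCInfty.G R)) => [|/= _ [_] [r] -> <-].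
  exact: RGenCInfty.measurableE.
apply: is_interval_measurable => s t/=; rewrite !in_itv/= !andbT.
move=> [/andP[s0 sT] fs] [/andP[t0 tT] ft] u /andP[su ut]; split.
  by rewrite in_itv/= (lt_le_trans s0)// (le_trans ut).
by rewrite in_itv/= andbT (le_trans ft)// fd// (lt_le_trans s0).
Qed.

(** Right end points avoid the singularity at 0, and by monotonicity these sums stay below the
    integral. Grid sums are therefore bounded uniformly in the mesh. *)
Lemma kernel_riemann T f (eps : R) n : decreasing_kernel T f -> 0 < eps -> n%:R * eps <= T ->
  ((\sum_(i < n) eps * f (i.+1%:R * eps))%:E <= \int[mu]_(s in `]0%R, (n%:R * eps)%R]) (f s)%:E)%E.
Proof.
move=> hf eps0; have [f0 fd] := hf; elim: n => [|n IH] nT; first by rewrite big_ord0; apply: integral_ge0 => s; rewrite /= in_itv/= mul0r => /andP[h1 h2]; have := lt_le_trans h1 h2; rewrite ltxx.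
have ne0 : 0 <= n%:R * eps by rewrite mulr_ge0// ltW.
have nn : n%:R * eps <= n.+1%:R * eps by rewrite ler_pM2r// ler_nat.
have nn1 : n%:R * eps < n.+1%:R * eps by rewrite ltr_pM2r// ltr_nat.
have mf a b : 0 <= a -> b <= T -> measurable_fun (`]a, b] : set (measurableTypeR R)) (fun s : measurableTypeR R => (f s)%:E).
  move=> a0 bT; apply/measurable_EFinP.
  apply: (measurable_funS _ _ (kernel_measurable hf)); first exact: measurable_itv.
  by move=> s; rewrite /= !in_itv/= => /andP[h1 h2]; rewrite (le_lt_trans a0)// (le_trans h2).
rewrite big_ord_recr/= EFinD.
have -> : (`]0, (n.+1%:R * eps)]%classic : set R) = (`]0, (n%:R * eps)] `|` `](n%:R * eps), (n.+1%:R * eps)])%classic.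
  by rewrite -itv_bndbnd_setU// ?bnd_simp.
rewrite ge0_integral_setU//=; last 3 first.
- by rewrite -itv_bndbnd_setU// ?bnd_simp//; exact: mf.
- move=> s [] /=; rewrite in_itv/= => /andP[h1 h2]; rewrite lee_fin f0//; try lra.
- by apply/disj_setPS => s [/=]; rewrite !in_itv/= => /andP[_ h1] /andP[h2]; lra.
apply: leeD; first by apply: IH; lra.
apply: (@le_trans _ _ (\int[mu]_(s in `](n%:R * eps)%R, (n.+1%:R * eps)%R]) (f (n.+1%:R * eps))%:E)%E).
  rewrite integral_cst//= lebesgue_measure_itv/= lte_fin nn1 -EFinB -EFinM lee_fin.
  have -> : n.+1%:R * eps - n%:R * eps = eps by rewrite -natr1; ring.
  by rewrite mulrC.
apply: ge0_le_integral => //.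
- by move=> s; rewrite /= in_itv/= => /andP[h1 h2]; rewrite lee_fin f0//; lra.
- exact: mf.
- move=> s; rewrite /= in_itv/= => /andP[h1 h2]; rewrite lee_fin fd//; lra.
Qed.

(** The three lower bounds turn the integrability of [a * k] into that of [k], of [a] and of
    [a / sqrt s]; these yield respectively the smallness of the sums of [k], the modulus [omega],
    and the finiteness and smallness of [V]. *)
Lemma kernel_estimates T (a k : R -> R) (c : R) : 0 < T -> 0 < c ->
  decreasing_kernel T a -> decreasing_kernel T k ->
  (forall s, 0 < s -> s <= T -> [/\ c <= a s, c <= k s & c <= k s * Num.sqrt s]) ->
  (\int[mu]_(s in `]0%R, T]) (a s * k s)%:E < +oo)%E ->
  (forall e : R, 0 < e -> exists2 tau : R, 0 < tau <= T & forall (eps : R) n, 0 < eps -> n%:R * eps <= tau ->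
     \sum_(i < n) eps * k (i.+1%:R * eps) <= e) /\
  exists omega V : R -> R,
    [/\ forall (eps : R) n, 0 < eps -> n%:R * eps <= T -> \sum_(i < n) eps * a (i.+1%:R * eps) <= omega (n%:R * eps),
        forall tau, 0 <= tau -> tau <= T -> 0 <= omega tau /\ 0 <= V tau,
        forall tau, 0 < tau -> tau <= T -> Num.sqrt 2 * V (tau / 2) + omega (tau / 2) <= V tau &
        forall e : R, 0 < e -> exists2 tau0 : R, 0 < tau0 <= T & forall tau, 0 < tau -> tau <= tau0 -> V tau <= e].
Proof.
move=> T0 c0 ha hk hc foo; have [a0 ad] := ha; have [k0 kd] := hk.
have mI (x : R) : measurable (`]0, x]%classic : set (measurableTypeR R)) by exact: measurable_itv.
have ma : measurable_fun (`]0, T] : set (measurableTypeR R)) (a : measurableTypeR R -> R) by exact: kernel_measurable.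
have mk : measurable_fun (`]0, T] : set (measurableTypeR R)) (k : measurableTypeR R -> R) by exact: kernel_measurable.
have mak : measurable_fun (`]0, T] : set (measurableTypeR R)) (fun s : measurableTypeR R => (a s * k s)%:E).
  by apply/measurable_EFinP; exact: measurable_funM.
have inT (s : R) : (`]0, T]%classic : set R) s -> 0 < s /\ s <= T by rewrite /= in_itv/= => /andP[].
have dom (g : R -> R) (C : R) : 0 <= C -> measurable_fun (`]0, T] : set (measurableTypeR R)) (g : measurableTypeR R -> R) ->
    (forall s, 0 < s -> s <= T -> 0 <= g s) -> (forall s, 0 < s -> s <= T -> g s <= C * (a s * k s)) ->
    (\int[mu]_(s in `]0%R, T]) (g s)%:E < +oo)%E.
  move=> C0 mg g0 gle; apply: (@le_lt_trans _ _ (C%:E * \int[mu]_(s in `]0%R, T]) (a s * k s)%:E)%E); last first.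
    by apply: lte_mul_pinfty => //; apply: integral_ge0 => s /inT[s0 sT]; rewrite lee_fin mulr_ge0 ?a0 ?k0.
  rewrite -ge0_integralZl//; last by move=> s /inT[s0 sT]; rewrite lee_fin mulr_ge0 ?a0 ?k0.
  apply: ge0_le_integral => //.
  - by move=> s /inT[s0 sT]; rewrite lee_fin g0.
  - exact/measurable_EFinP.
  - by apply: emeasurable_funM => //; exact: measurable_cst.
  - by move=> s /inT[s0 sT]; rewrite -EFinM lee_fin gle.
have mono (g : R -> R) (x : R) : x <= T -> measurable_fun (`]0, T] : set (measurableTypeR R)) (g : measurableTypeR R -> R) ->
    (forall s, 0 < s -> s <= T -> 0 <= g s) -> (\int[mu]_(s in `]0%R, x]) (g s)%:E <= \int[mu]_(s in `]0%R, T]) (g s)%:E)%E.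
  move=> xT mg g0; apply: ge0_subset_integral => //.
  - exact/measurable_EFinP.
  - by move=> s /inT[s0 sT]; rewrite lee_fin g0.
  - by move=> s; rewrite /= !in_itv/= => /andP[-> h]; exact: le_trans xT.
split.
  have fk : (\int[mu]_(s in `]0%R, T]) (k s)%:E < +oo)%E.
    apply: (dom k c^-1) => //; first by rewrite invr_ge0 ltW.
    move=> s s0 sT; rewrite ler_pdivlMl// ler_wpM2r ?k0//.
    by have [] := hc s s0 sT.
  move=> e e0; have mEk : measurable_fun (`]0, T] : set (measurableTypeR R)) (fun s : measurableTypeR R => (k s)%:E) by exact/measurable_EFinP.
  have [|tau /andP[tau0 tauT] htau] := integral_near0 T0 mEk _ fk e0.
    by move=> s /inT[s0 sT]; rewrite lee_fin k0.
  exists tau; first by rewrite tau0.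
  move=> eps n eps0 nt; have hk' : decreasing_kernel tau k.
    by split=> [s s0 st|s t s0 st tt]; [apply: k0 => //; exact: le_trans tauT|apply: kd => //; exact: le_trans tauT].
  rewrite -lee_fin; apply: (le_trans (kernel_riemann hk' eps0 nt)); apply: le_trans htau.
  apply: ge0_subset_integral => //.
  - by apply: (measurable_funS (mI T) _ mEk) => s; rewrite /= !in_itv/= => /andP[-> h]; exact: le_trans tauT.
  - by move=> s; rewrite /= in_itv/= => /andP[s0 st]; rewrite lee_fin k0// (le_trans st).
  - by move=> s; rewrite /= !in_itv/= => /andP[-> h]; exact: le_trans nt.
pose A (s : R) := a s / Num.sqrt s.
have ms' : measurable_fun (`]0, T] : set (measurableTypeR R)) (fun s : measurableTypeR R => (Num.sqrt s)^-1).
  have hsq : decreasing_kernel T (fun s : R => (Num.sqrt s)^-1).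
    split=> [s _ _|s t s0 st _]; first by rewrite invr_ge0 sqrtr_ge0.
    by rewrite lef_pV2 ?posrE ?sqrtr_gt0// ?(lt_le_trans s0)// ler_sqrt// ltW// (lt_le_trans s0).
  exact: kernel_measurable.
have mA : measurable_fun (`]0, T] : set (measurableTypeR R)) (A : measurableTypeR R -> R) by exact: measurable_funM.
have A0 s : 0 < s -> s <= T -> 0 <= A s by move=> s0 sT; rewrite divr_ge0 ?a0 ?sqrtr_ge0.
have fA : (\int[mu]_(s in `]0%R, T]) (A s)%:E < +oo)%E.
  apply: (dom A c^-1) => //; first by rewrite invr_ge0 ltW.
  move=> s s0 sT; rewrite ler_pdivlMl// mulrC -mulrA ler_wpM2l ?a0//.
  by rewrite ler_pdivrMl ?sqrtr_gt0// mulrC; have [] := hc s s0 sT.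
have fa : (\int[mu]_(s in `]0%R, T]) (a s)%:E < +oo)%E.
  apply: (dom a c^-1) => //; first by rewrite invr_ge0 ltW.
  move=> s s0 sT; rewrite ler_pdivlMl// mulrC ler_wpM2l ?a0//.
  by have [] := hc s s0 sT.
(* [V] dominates the sum over [j] of [sqrt 2 ^ j * omega (tau / 2 ^ j.+1)]. *)
pose v (tau s : R) := 3 * a s * (Num.sqrt tau / Num.sqrt s - 1).
pose omega (tau : R) := fine (\int[mu]_(s in `]0%R, tau]) (a s)%:E)%E.
pose V (tau : R) := fine (\int[mu]_(s in `]0%R, tau]) (v tau s)%:E)%E.
have v0 tau s : 0 < s -> s <= tau -> tau <= T -> 0 <= v tau s.
  move=> s0 st tT; rewrite mulr_ge0 ?mulr_ge0 ?a0 ?(le_trans st)// subr_ge0.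
  by rewrite ler_pdivlMr ?sqrtr_gt0// mul1r ler_sqrt// (le_trans (ltW s0)).
have sub (x : R) : x <= T -> (`]0, x]%classic : set R) `<=` `]0, T].
  by move=> xT s; rewrite /= !in_itv/= => /andP[-> h]; exact: le_trans xT.
have mv tau x : x <= T -> measurable_fun (`]0, x] : set (measurableTypeR R)) (v tau : measurableTypeR R -> R).
  move=> xT; apply: (measurable_funS (mI T) (sub _ xT)).
  apply: measurable_funM; first by apply: measurable_funM => //; exact: measurable_cst.
  apply: measurable_funB; last exact: measurable_cst.
  by apply: measurable_funM => //; exact: measurable_cst.
have vA tau s : 0 < s -> s <= tau -> tau <= T -> v tau s <= 3 * Num.sqrt tau * A s.
  move=> s0 st tT; rewrite /v /A.
  have -> : 3 * Num.sqrt tau * (a s / Num.sqrt s) = 3 * a s * (Num.sqrt tau / Num.sqrt s) by ring.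
  by rewrite ler_wpM2l ?gerBl// mulr_ge0// a0// (le_trans st).
have Vle tau : tau <= T -> (\int[mu]_(s in `]0%R, tau]) (v tau s)%:E <= (3 * Num.sqrt tau)%:E * \int[mu]_(s in `]0%R, T]) (A s)%:E)%E.
  move=> tT; have s30 : 0 <= 3 * Num.sqrt tau by rewrite mulr_ge0// sqrtr_ge0.
  apply: (@le_trans _ _ ((3 * Num.sqrt tau)%:E * \int[mu]_(s in `]0%R, tau]) (A s)%:E)%E); last first.
    by apply: lee_wpmul2l => //; exact: mono.
  have mA' : measurable_fun (`]0, tau] : set (measurableTypeR R)) (fun s : measurableTypeR R => (A s)%:E).
    by apply/measurable_EFinP; exact: (measurable_funS (mI T) (sub _ tT)).
  have pA s : (`]0, tau]%classic : set R) s -> (0 <= (A s)%:E)%E.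
    by move=> /(sub _ tT)/inT[s0 sT]; rewrite lee_fin A0.
  rewrite -(ge0_integralZl mu (mI tau) mA' pA)//.
  apply: ge0_le_integral => //.
  - by move=> s; rewrite /= in_itv/= => /andP[s0 st]; rewrite lee_fin v0.
  - by apply/measurable_EFinP; exact: mv.
  - by apply: emeasurable_funM => //; exact: measurable_cst.
  - by move=> s; rewrite /= in_itv/= => /andP[s0 st]; rewrite -EFinM lee_fin vA.
have fV tau : tau <= T -> (\int[mu]_(s in `]0%R, tau]) (v tau s)%:E)%E \is a fin_num.
  move=> tT; rewrite ge0_fin_numE; last first.
    by apply: integral_ge0 => s; rewrite /= in_itv/= => /andP[s0 st]; rewrite lee_fin v0.
  by apply: (le_lt_trans (Vle tau tT)); apply: lte_mul_pinfty => //; rewrite lee_fin mulr_ge0// sqrtr_ge0.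
have fom tau : tau <= T -> (\int[mu]_(s in `]0%R, tau]) (a s)%:E)%E \is a fin_num.
  move=> tT; rewrite ge0_fin_numE; last first.
    by apply: integral_ge0 => s /(sub _ tT)/inT[s0 sT]; rewrite lee_fin a0.
  by apply: le_lt_trans fa; exact: mono.
exists omega, V; split.
- move=> eps n eps0 nT; rewrite -lee_fin fineK ?fom//; exact: (kernel_riemann ha).
- move=> tau _ tT; split; apply: fine_ge0; apply: integral_ge0 => s.
    by move=> /(sub _ tT)/inT[s0 sT]; rewrite lee_fin a0.
  by rewrite /= in_itv/= => /andP[s0 st]; rewrite lee_fin v0.
- move=> tau tau0 tT; have hlf (x : R) : 0 < x -> x / 2 <= x by lra.
  have t2 : tau / 2 <= tau by exact: hlf.
  have t2T : tau / 2 <= T by exact: le_trans tT.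
  rewrite -lee_fin EFinD EFinM !fineK ?fV ?fom//.
  have s20 : 0 <= Num.sqrt 2 :> R by exact: sqrtr_ge0.
  have s22 : Num.sqrt 2 * Num.sqrt 2 = 2 :> R by rewrite -expr2 sqr_sqrtr.
  apply: (@le_trans _ _ (\int[mu]_(s in `]0%R, (tau / 2)%R]) (v tau s)%:E)%E); last first.
    apply: ge0_subset_integral => //.
    + by apply/measurable_EFinP; exact: mv.
    + by move=> s; rewrite /= in_itv/= => /andP[s0 st]; rewrite lee_fin v0.
    + by move=> s; rewrite /= !in_itv/= => /andP[-> h]; exact: le_trans t2.
  have mv2 : measurable_fun (`]0, tau / 2] : set (measurableTypeR R)) (fun s : measurableTypeR R => (v (tau / 2) s)%:E).
    by apply/measurable_EFinP; exact: mv.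
  have ma2 : measurable_fun (`]0, tau / 2] : set (measurableTypeR R)) (fun s : measurableTypeR R => (a s)%:E).
    by apply/measurable_EFinP; exact: (measurable_funS (mI T) (sub _ t2T)).
  have pv s : (`]0, tau / 2]%classic : set R) s -> (0 <= (v (tau / 2) s)%:E)%E.
    by rewrite /= in_itv/= => /andP[s0 st]; rewrite lee_fin v0.
  have pa s : (`]0, tau / 2]%classic : set R) s -> (0 <= (a s)%:E)%E.
    by move=> /(sub _ t2T)/inT[s0 sT]; rewrite lee_fin a0.
  rewrite -(ge0_integralZl mu (mI _) mv2 pv)// -(ge0_integralD mu (mI _) _ _ pa ma2); last 2 first.
  + by move=> s hs; rewrite mule_ge0 ?lee_fin// -lee_fin pv.
  + by apply: emeasurable_funM => //; exact: measurable_cst.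
  apply: ge0_le_integral => //.
  + by move=> s hs; rewrite adde_ge0 ?pa// mule_ge0 ?lee_fin// -lee_fin pv.
  + by apply: emeasurable_funD => //; apply: emeasurable_funM => //; exact: measurable_cst.
  + by apply/measurable_EFinP; exact: mv.
  move=> s; rewrite /= in_itv/= => /andP[s0 st]; rewrite -EFinM -EFinD lee_fin /v.
  have as0 : 0 <= a s by apply: a0 => //; exact: le_trans t2T.
  have sq : Num.sqrt 2 * Num.sqrt (tau / 2) = Num.sqrt tau.
    by rewrite -sqrtrM//; congr Num.sqrt; field.
  (* This fixes the factor 3 in [v]: the recursion holds under the integral sign as soon as
     [3 * (sqrt 2 - 1) >= 1]. *)
  have s2l : 4 / 3 <= Num.sqrt 2 :> R.
    by move: s20 s22; set q := Num.sqrt _; nra.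
  have e1 : Num.sqrt 2 * (3 * a s * (Num.sqrt (tau / 2) / Num.sqrt s - 1)) =
      3 * a s * (Num.sqrt tau / Num.sqrt s - Num.sqrt 2) by rewrite -sq; ring.
  rewrite e1; have : a s * (4 / 3) <= a s * Num.sqrt 2 by exact: ler_wpM2l.
  rewrite !mulrBr; lra.
- move=> e e0; set IA := (\int[mu]_(s in `]0%R, T]) (A s)%:E)%E in fA Vle.
  have IA0 : (0 <= IA)%E by apply: integral_ge0 => s /inT[s0 sT]; rewrite lee_fin A0.
  have fIA : IA \is a fin_num by rewrite ge0_fin_numE.
  have [x /andP[x0 x1] hx] := small_factor e0 (mulr_ge0 (ler0n R 3) (fine_ge0 IA0)).
  exists (Num.min T (x ^+ 2)); first by rewrite lt_min T0 exprn_gt0//= ge_min lexx.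
  move=> tau tau0; rewrite le_min => /andP[tT tx].
  rewrite -lee_fin fineK ?fV//; apply: (le_trans (Vle tau tT)).
  rewrite -(fineK fIA) -EFinM lee_fin; apply: le_trans hx.
  rewrite mulrAC [leRHS]mulrC ler_wpM2l ?mulr_ge0 ?fine_ge0//.
  by rewrite -[leRHS]ger0_norm ?(ltW x0)// -sqrtr_sqr ler_sqrt// sqr_ge0.
Qed.

End MonotoneKernels.

(** * Comparison of two solutions *)

Section MeanSquareSpace.
Context {R : realType} {H : hilbertType R} (sepH : separable_space H).
Context d (Omega : measurableType d) (P : probability Omega R).
Local Notation ms X := (\int[P]_w (`|X w| ^+ 2)%:E)%E.
Local Notation intb f := (P.-integrable setT (EFin \o f)).

Lemma integrable_dom (f g : Omega -> R) : measurable_fun setT f -> intb g -> (forall w, `|f w| <= g w) -> intb f.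
Proof.
move=> mf ig fg; apply: (le_integrable measurableT _ _ ig); first exact/measurable_EFinP.
by move=> w _; rewrite /= lee_fin; apply: (le_trans (fg w)); exact: ler_norm.
Qed.

Lemma integrable_add (f g : Omega -> R) : intb f -> intb g -> intb (fun w => f w + g w).
Proof. by move=> h1 h2; have := integrableD measurableT h1 h2. Qed.

Lemma integrable_sub (f g : Omega -> R) : intb f -> intb g -> intb (fun w => f w - g w).
Proof. by move=> h1 h2; have := integrableB measurableT h1 h2. Qed.

Lemma integrable_scale (c : R) (f : Omega -> R) : intb f -> intb (fun w => c * f w).
Proof. by move=> h1; have := integrableZl measurableT c h1. Qed.

Lemma integrable_indic_mul (A : set Omega) (f : Omega -> R) : measurable A -> intb f -> intb (fun w => \1_A w * f w).
Proof.
move=> mA hf; have [mf _] := integrableP _ _ _ hf.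
apply: (le_integrable measurableT _ _ hf).
  by apply/measurable_EFinP; apply: measurable_funM; [exact: measurable_indic|exact/measurable_EFinP].
move=> w _; rewrite /= lee_fin normrM indicE; case: (w \in A); first by rewrite normr1 mul1r.
by rewrite normr0 mul0r.
Qed.

(** With [A] ranging over the events of the past, these means replace conditional expectations. *)
Definition mean_on (A : set Omega) (f : Omega -> R) := \int[P]_w (\1_A w * f w).

Lemma mean_onD A f g : measurable A -> intb f -> intb g ->
  mean_on A (fun w => f w + g w) = mean_on A f + mean_on A g.
Proof.
move=> mA hf hg; rewrite /mean_on -RintegralD//; try exact: integrable_indic_mul.
by apply: eq_Rintegral => w _; rewrite mulrDr.
Qed.

Lemma mean_onB A f g : measurable A -> intb f -> intb g ->
  mean_on A (fun w => f w - g w) = mean_on A f - mean_on A g.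
Proof.
move=> mA hf hg; rewrite /mean_on -RintegralB//; try exact: integrable_indic_mul.
by apply: eq_Rintegral => w _; rewrite mulrBr.
Qed.

Lemma mean_onZ A (c : R) f : measurable A -> intb f -> mean_on A (fun w => c * f w) = c * mean_on A f.
Proof.
move=> mA hf; rewrite /mean_on -RintegralZl//; last exact: integrable_indic_mul.
by apply: eq_Rintegral => w _; rewrite mulrCA.
Qed.

Lemma mean_on_norm A f : measurable A -> intb f -> `|mean_on A f| <= \int[P]_w `|f w|.
Proof.
move=> mA hf; apply: (le_trans (le_normr_Rintegral _ _)) => //; first exact: integrable_indic_mul.
apply: le_Rintegral => //.
- by have := integrable_norm (integrable_indic_mul mA hf).
- by have := integrable_norm hf.
by move=> w _; rewrite normrM indicE ler_piMl//; case: (w \in A); rewrite ?normr1 ?normr0.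
Qed.

Lemma mean_on_ge0 A f : (forall w, 0 <= f w) -> 0 <= mean_on A f.
Proof. by move=> f0; apply: Rintegral_ge0 => w _; rewrite mulr_ge0// indicE. Qed.

Definition l2 (X : Omega -> H) := borel_on setT X /\ (ms X < +oo)%E.

Lemma l2_finite X : l2 X -> exists2 e : R, 0 <= e & (ms X <= e%:E)%E.
Proof.
move=> [_ h]; have p : (0 <= ms X)%E by apply: integral_ge0 => w _; rewrite lee_fin sqr_ge0.
by exists (fine (ms X)); rewrite ?fine_ge0// fineK// ge0_fin_numE.
Qed.

Lemma l2_measurable X : l2 X -> measurable_fun setT (fun w => `|X w|).
Proof.
move=> [bX _]; have /(_ 0) := (borel_normP sepH measurableT _).1 bX.
by apply: eq_measurable_fun => w _; rewrite subr0.
Qed.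

Lemma l2_sqr X : l2 X -> intb (fun w => `|X w| ^+ 2).
Proof. by move=> [bX fX]; exact: (integrable_ms sepH bX fX). Qed.

Lemma l2_normM X Y : l2 X -> l2 Y -> intb (fun w => `|X w| * `|Y w|).
Proof.
move=> hX hY; apply: (integrable_dom _ (integrable_add (l2_sqr hX) (l2_sqr hY))).
  by apply: measurable_funM; exact: l2_measurable.
move=> w; rewrite ger0_norm ?mulr_ge0//; have := sqr_ge0 (`|X w| - `|Y w|).
have := mulr_ge0 (normr_ge0 (X w)) (normr_ge0 (Y w)); rewrite sqrrB; move: `|X w| `|Y w| => x y.
by rewrite mulr2n; lra.
Qed.

Lemma l2_cst (x : H) : l2 (fun=> x).
Proof.
split; first exact: borel_cst.
by rewrite integral_cst// [X in (_ * X)%E](@probability_setT _ _ _ P) mule1 ltry.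
Qed.

Lemma l2_le_ae (X Y1 Y2 : Omega -> H) (c1 c2 c3 : R) : borel_on setT X -> l2 Y1 -> l2 Y2 ->
  0 <= c1 -> 0 <= c2 -> 0 <= c3 ->
  {ae P, forall w, `|X w| ^+ 2 <= c1 * `|Y1 w| ^+ 2 + c2 * `|Y2 w| ^+ 2 + c3} -> l2 X.
Proof.
move=> bX h1 h2 c10 c20 c30 h; split => //.
have [e1 _ he1] := l2_finite h1; have [e2 _ he2] := l2_finite h2.
apply: (le_lt_trans (ms_le_ae sepH bX h1.1 h2.1 c10 c20 c30 h he1 he2)); exact: ltry.
Qed.

Lemma l2D X Y : l2 X -> l2 Y -> l2 (fun w => X w + Y w).
Proof.
move=> hX hY; apply: (l2_le_ae _ hX hY (c1 := 2) (c2 := 2) (c3 := 0)) => //.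
  by apply: borelD => //; [exact: hX.1|exact: hY.1].
by apply: aeW => w; rewrite addr0; exact: sqr_normD_le.
Qed.

Lemma l2B X Y : l2 X -> l2 Y -> l2 (fun w => X w - Y w).
Proof.
move=> hX hY; apply: (l2_le_ae _ hX hY (c1 := 2) (c2 := 2) (c3 := 0)) => //.
  by apply: borelB => //; [exact: hX.1|exact: hY.1].
by apply: aeW => w; rewrite addr0 -(normrN (Y w)); exact: sqr_normD_le.
Qed.

Lemma l2_bound X (c : R) : borel_on setT X -> 0 <= c -> {ae P, forall w, `|X w| <= c} ->
  l2 X /\ \int[P]_w (`|X w| ^+ 2) <= c ^+ 2.
Proof.
move=> bX c0 h;
have h0 := l2_cst 0.
have ms0 : (ms (fun _ : Omega => (0%R : H)) <= 0%:E)%E.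
  rewrite (_ : (\int[P]_w _)%E = 0%E)// (eq_integral (cst 0%E)) ?integral0// => w _.
  by rewrite normr0 expr0n.
have h3 : {ae P, forall w, `|X w| ^+ 2 <= 0 * `|(0 : H)| ^+ 2 + 0 * `|(0 : H)| ^+ 2 + c ^+ 2}.
  by apply: filterS h => w h; rewrite !mul0r !add0r ler_sqr ?nnegrE.
have := ms_le_ae sepH bX h0.1 h0.1 (lexx 0) (lexx 0) (sqr_ge0 c) h3 ms0 ms0.
rewrite !mul0r !add0r => le; have hX : l2 X by split=> //; apply: (le_lt_trans le); exact: ltry.
split=> //; rewrite -lee_fin /Rintegral fineK//; exact: (integrable_fin_num measurableT (l2_sqr hX)).
Qed.

Lemma l2_le X Y (c : R) : borel_on setT X -> l2 Y -> 0 <= c -> (forall w, `|X w| <= c * `|Y w|) ->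
  l2 X /\ \int[P]_w (`|X w| ^+ 2) <= c ^+ 2 * \int[P]_w (`|Y w| ^+ 2).
Proof.
move=> bX hY c0 h; have h2 w : `|X w| ^+ 2 <= c ^+ 2 * `|Y w| ^+ 2 by rewrite -exprMn ler_sqr ?nnegrE ?mulr_ge0.
have hX : l2 X.
  apply: (l2_le_ae bX hY hY (sqr_ge0 c) (lexx 0) (lexx 0)).
  by apply: aeW => w; rewrite mul0r !addr0.
split=> //; rewrite -RintegralZl//; last exact: l2_sqr.
by apply: le_Rintegral => //; [exact: l2_sqr|have := integrable_scale (c ^+ 2) (l2_sqr hY)].
Qed.

Lemma l2_norm X : l2 X -> intb (fun w => `|X w|).
Proof.
move=> hX; have i1 : intb (fun _ : Omega => 1 : R).
  by apply: (@integrable_bounded _ _ _ P _ 1) => // w; rewrite normr1.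
apply: (integrable_dom (l2_measurable hX) (integrable_add i1 (l2_sqr hX))) => w.
rewrite normr_id; have := sqr_ge0 (`|X w| - 1); rewrite sqrrB1; move: (normr_ge0 (X w)) => h.
by rewrite mulr2n; lra.
Qed.

Lemma dot_polar (x y : H) : dot x y = 2^-1 * (`|x + y| ^+ 2 - `|x| ^+ 2 - `|y| ^+ 2).
Proof. by rewrite -!dotxx !dotDl !dotDr (dotC y x); field. Qed.

Lemma l2_dot X Y : l2 X -> l2 Y -> intb (fun w => dot (X w) (Y w)).
Proof.
move=> hX hY; have := integrable_scale 2^-1 (integrable_sub (integrable_sub (l2_sqr (l2D hX hY)) (l2_sqr hX)) (l2_sqr hY)).
by apply: eq_integrable => // w _; rewrite /= dot_polar.
Qed.

(** The optimal weight [q / p] is approximated by [(q + x) / (p + x)], which remains meaningful when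
    [p] or [q] vanishes. *)
Lemma quadratic_mean_bound (y p q : R) : 0 <= p -> 0 <= q ->
  (forall x, 0 < x -> y <= (x * p ^+ 2 + q ^+ 2 / x) / 2) -> y <= p * q.
Proof.
move=> p0 q0 h; apply/ler_addgt0Pr => e e0.
have [x /andP[x0 x1] hx] := small_factor e0 (addr_ge0 p0 q0).
have px : 0 < p + x by rewrite ltr_wpDl.
have qx : 0 < q + x by rewrite ltr_wpDl.
have := h _ (divr_gt0 qx px); rewrite invf_div.
have le1 : (q + x) / (p + x) * p ^+ 2 <= (q + x) * p.
  rewrite mulrAC ler_pdivrMr// -!mulrA ler_wpM2l ?(ltW qx)// expr2 ler_wpM2l//.
  by rewrite lerDl ltW.
have le2 : q ^+ 2 * ((p + x) / (q + x)) <= (p + x) * q.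
  rewrite mulrA ler_pdivrMr// mulrC -!mulrA ler_wpM2l ?(ltW px)// expr2 ler_wpM2l//.
  by rewrite lerDl ltW.
have : (q + x) * p + (p + x) * q = 2 * (p * q) + x * (p + q) by ring.
by move: hx le1 le2; lra.
Qed.

Lemma l2_cauchy X Y (p q : R) : l2 X -> l2 Y -> 0 <= p -> 0 <= q ->
  \int[P]_w (`|X w| ^+ 2) <= p ^+ 2 -> \int[P]_w (`|Y w| ^+ 2) <= q ^+ 2 -> \int[P]_w (`|X w| * `|Y w|) <= p * q.
Proof.
move=> hX hY p0 q0 hp hq; apply: quadratic_mean_bound => // x x0.
apply: (@le_trans _ _ (\int[P]_w (2^-1 * (x * `|X w| ^+ 2 + x^-1 * `|Y w| ^+ 2)))).
  apply: le_Rintegral => //; first exact: l2_normM.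
    by apply: integrable_scale; apply: integrable_add; apply: integrable_scale; exact: l2_sqr.
  move=> w _; move: (`|X w|) (`|Y w|) => a b.
  have xx : x * x^-1 = 1 by rewrite divff// gt_eqF.
  have : 0 <= x^-1 * (x * a - b) ^+ 2 by rewrite mulr_ge0 ?sqr_ge0// invr_ge0 ltW.
  have -> : x^-1 * (x * a - b) ^+ 2 = (x * x^-1) * (x * a ^+ 2) - 2 * (x * x^-1) * (a * b) + x^-1 * b ^+ 2 by ring.
  by rewrite xx; lra.
rewrite RintegralZl//; last by apply: integrable_add; apply: integrable_scale; exact: l2_sqr.
rewrite RintegralD//; try by apply: integrable_scale; exact: l2_sqr.
rewrite !RintegralZl//; try exact: l2_sqr.
rewrite mulrC ler_wpM2r// ?invr_ge0//; apply: lerD; first by rewrite ler_wpM2l// ltW.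
by rewrite mulrC ler_wpM2r// invr_ge0 ltW.
Qed.

Lemma l2_expand X Y : l2 X -> l2 Y -> \int[P]_w (`|X w + Y w| ^+ 2) =
  \int[P]_w (`|X w| ^+ 2) + \int[P]_w (`|Y w| ^+ 2) + 2 * \int[P]_w dot (X w) (Y w).
Proof.
move=> hX hY; have iX := l2_sqr hX; have iY := l2_sqr hY; have iD := l2_dot hX hY.
rewrite -RintegralZl// -!RintegralD//.
- by apply: eq_Rintegral => w _; rewrite dot_polar; field.
- exact: integrable_add.
- exact: integrable_scale.
Qed.

Lemma l2_triangle X Y (p q : R) : l2 X -> l2 Y -> 0 <= p -> 0 <= q ->
  \int[P]_w (`|X w| ^+ 2) <= p ^+ 2 -> \int[P]_w (`|Y w| ^+ 2) <= q ^+ 2 ->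
  \int[P]_w (`|X w + Y w| ^+ 2) <= (p + q) ^+ 2.
Proof.
move=> hX hY p0 q0 hp hq; rewrite l2_expand//.
have : \int[P]_w dot (X w) (Y w) <= p * q.
  apply: le_trans (l2_cauchy hX hY p0 q0 hp hq); apply: le_Rintegral => //.
  - exact: l2_dot.
  - exact: l2_normM.
  - by move=> w _; exact: dot_ler.
by rewrite sqrrD mulr2n; lra.
Qed.

(* The bound for deterministic directions extends to random ones by approximating
   [xi] with maps of countable range. *)
Lemma mean_dot_random (G : set (set Omega)) (K xi D : Omega -> H) (C : R) : <<s G >> `<=` measurable ->
  l2 K -> l2 xi -> l2 D -> 0 <= C -> borel_on setT (xi : g_sigma_algebraType G -> H) ->
  (forall A v, <<s G >> A -> mean_on A (fun w => dot (K w) v) <= C * `|v| * mean_on A (fun w => `|D w|)) ->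
  \int[P]_w dot (K w) (xi w) <= C * \int[P]_w (`|xi w| * `|D w|).
Proof.
move=> sG hK hxi hD C0 bxi h.
have iK := l2_norm hK; have iD := l2_norm hD; have iKx := l2_dot hK hxi; have ixD := l2_normM hxi hD.
have key (eta : R) : 0 < eta -> eta <= 1 -> 0 <= \int[P]_w (C * (`|xi w| * `|D w|) - dot (K w) (xi w) + eta * (C * `|D w| + `|K w|)).
  move=> eta0 eta1.
  have [N hN] := inv_nat_le eta0.
  have [q [c [hc mc]]] := @borel_code R H sepH _ (g_sigma_algebraType G) setT.
  pose A i := [set w | c N (xi w) = i].
  have sA i : <<s G >> (A i) by have := mc _ bxi N i; rewrite setTI.
  have mA i : measurable (A i) by apply: sG.
  set phi := fun w => _.
  have iphi : intb phi.
    apply: integrable_add; first by apply: integrable_sub => //; exact: integrable_scale.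
    by apply: integrable_scale; apply: integrable_add => //; exact: integrable_scale.
  have hA i : 0 <= mean_on (A i) phi.
    have -> : mean_on (A i) phi = mean_on (A i) (fun w => (C * (`|xi w| * `|D w|) + eta * (C * `|D w|)) - (dot (K w) (xi w) - eta * `|K w|)).
      by apply: eq_Rintegral => w _; congr (_ * _); rewrite /phi; ring.
    rewrite mean_onB//; last 2 first.
    - by apply: integrable_add; apply: integrable_scale => //; exact: integrable_scale.
    - by apply: integrable_sub => //; exact: integrable_scale.
    rewrite subr_ge0; apply: (@le_trans _ _ (mean_on (A i) (fun w => dot (K w) (q i)))).
      apply: le_Rintegral => //.
      + by apply: integrable_indic_mul => //; apply: integrable_sub => //; exact: integrable_scale.
      + by apply: integrable_indic_mul => //; exact: (l2_dot hK (l2_cst _)).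
      move=> w _; rewrite indicE; have [wA|_] := boolP (w \in A i); last by rewrite !mul0r.
      move: wA; rewrite inE /A/= => wA; rewrite !mul1r lerBlDr -lerBlDl -dotBr.
      apply: (le_trans (dot_ler _ _)); rewrite mulrC ler_wpM2r//.
      have := hc N (xi w); rewrite wA => /ltW hq; apply: (le_trans hq); exact: hN.
    apply: (le_trans (h _ _ (sA i))).
    rewrite -mean_onZ//; apply: le_Rintegral => //.
    + by apply: integrable_indic_mul => //; exact: integrable_scale.
    + by apply: integrable_indic_mul => //; apply: integrable_add; apply: integrable_scale => //; exact: integrable_scale.
    move=> w _; rewrite indicE; have [wA|_] := boolP (w \in A i); last by rewrite !mul0r.
    move: wA; rewrite inE /A/= => wA; rewrite !mul1r.
    have -> : C * (`|xi w| * `|D w|) + eta * (C * `|D w|) = C * (`|xi w| + eta) * `|D w| by ring.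
    rewrite ler_wpM2r// ler_wpM2l//.
    have := hc N (xi w); rewrite wA => /ltW hq.
    have -> : q i = xi w - (xi w - q i) by rewrite opprB addrC subrK.
    by apply: (le_trans (ler_normB _ _)); rewrite lerD2l; apply: (le_trans hq); exact: hN.
  rewrite -lee_fin /Rintegral fineK; last exact: (integrable_fin_num measurableT iphi).
  have UA : \bigcup_i A i = setT by apply/seteqP; split=> w _ //; exists (c N (xi w)).
  rewrite -UA integral_bigcup//; last by rewrite UA.
    apply: nneseries_ge0 => i _ _; have := hA i.
    rewrite /mean_on -lee_fin /Rintegral fineK; last first.
      exact: (integrable_fin_num measurableT (integrable_indic_mul (mA i) iphi)).
    rewrite [X in (_ <= X -> _)%E](_ : _ = \int[P]_(w in A i) (phi w)%:E)%E//.
    rewrite [RHS]integral_mkcond; apply: eq_integral => w _.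
    by rewrite patchE indicE; case: (w \in A i); rewrite ?mul1r ?mul0r.
  by move=> i j _ _ [w [/= <- <-]].
rewrite -RintegralZl// -subr_ge0; apply/ler_addgt0Pr => e e0.
set J := \int[P]_w (C * `|D w| + `|K w|).
have J0 : 0 <= J by apply: Rintegral_ge0 => w _; rewrite addr_ge0// mulr_ge0.
have [eta /andP[eta0 eta1] he] := small_factor e0 J0.
apply: (le_trans (key _ eta0 eta1)); rewrite RintegralD//; last 2 first.
- by apply: integrable_sub => //; exact: integrable_scale.
- by apply: integrable_scale; apply: integrable_add => //; exact: integrable_scale.
rewrite RintegralB//; last exact: integrable_scale.
rewrite (RintegralZl eta)//; last by apply: integrable_add => //; exact: integrable_scale.
by rewrite lerD2l.
Qed.

End MeanSquareSpace.

Lemma sum_of_squares_le {R : realType} (y1 y2 y3 z1 z2 z3 z4 : R) : y3 <= z1 -> z1 <= z2 -> y1 <= z3 ->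
  y2 <= z3 -> 0 <= z4 -> y1 + y2 + 2 * y3 <= 2 * z3 + 2 * z2 + z4.
Proof. by lra. Qed.

Lemma triangular_sum {R : realType} (c y : nat -> R) (m : nat) :
  \sum_(n < m) \sum_(j < n) c (n - j.+1)%N * y j = \sum_(j < m) y j * \sum_(i < m - j.+1) c i.
Proof.
elim: m => [|m IH]; first by rewrite !big_ord0.
rewrite big_ord_recr/= IH [RHS]big_ord_recr/= subnn big_ord0 mulr0 addr0 -big_split/=.
apply: eq_bigr => j _; have -> : (m.+1 - j.+1 = (m - j.+1).+1)%N by rewrite subSn.
by rewrite big_ord_recr/= mulrDr (mulrC (c _)).
Qed.

(** The inequality is summed over time instead of being iterated: after exchanging the sums each
    [y j] carries at most the total mass of [k], which is at most 1/2, so half of the sum is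
    absorbed. The term [4 * eps] comes from [y 0 <= 2], about which the recursion says nothing. *)
Lemma discrete_gronwall {R : realType} (y a k : nat -> R) (n : nat) (eps E del : R) : 0 <= eps -> 0 <= E ->
  (forall j, (j < n)%N -> 0 <= y j <= 2) -> (forall i, (i < n)%N -> 0 <= k i /\ 0 <= a i) -> 0 <= del ->
  \sum_(i < n) eps * k i <= 2^-1 ->
  (forall m, (m.+1 < n)%N -> y m.+1 <= a m * E + \sum_(j < m.+1) eps * k (m.+1 - j.+1)%N * y j + del) ->
  \sum_(j < n) eps * y j <= 2 * (\sum_(i < n) eps * a i) * E + 4 * eps + 2 * (n%:R * eps) * del.
Proof.
move=> eps0 E0 hy hka del0 hk h; case: n => [|n] in hy hka hk h *.
  by rewrite !big_ord0 mulr0 !mul0r mulr0 mul0r addr0 add0r mulr_ge0.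
set Y := \sum_(j < n.+1) eps * y j.
have y0 j : (j < n.+1)%N -> 0 <= y j by move=> /hy/andP[].
have Y0 : 0 <= Y by apply: sumr_ge0 => j _; rewrite mulr_ge0// y0.
have le1 : Y <= eps * 2 + \sum_(m < n) eps * (a m * E + \sum_(j < m.+1) eps * k (m.+1 - j.+1)%N * y j + del).
  rewrite /Y big_ord_recl/=; apply: lerD; first by rewrite ler_wpM2l//; have /andP[] := hy 0%N (ltn0Sn n).
  apply: ler_sum => m _; rewrite ler_wpM2l//; apply: h; rewrite /bump/= ltnS.
  by case: m.
have le2 : \sum_(m < n) eps * (\sum_(j < m.+1) eps * k (m.+1 - j.+1)%N * y j) <= 2^-1 * Y.
  apply: (@le_trans _ _ (\sum_(m < n.+1) \sum_(j < m) eps * k (m - j.+1)%N * (eps * y j))).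
    rewrite big_ord_recl/= big_ord0 add0r; apply: ler_sum => m _.
    by rewrite mulr_sumr; apply: ler_sum => j _; rewrite mulrCA.
  rewrite (triangular_sum (fun i => eps * k i) (fun j => eps * y j)) mulr_sumr.
  apply: ler_sum => j _; rewrite [leRHS]mulrC ler_wpM2l ?mulr_ge0 ?y0//; apply: le_trans hk.
  have hj : (n.+1 - j.+1 <= n.+1)%N by rewrite leq_subr.
  rewrite (big_ord_widen n.+1 (fun i => eps * k i) hj) [leRHS](bigID (fun i : 'I_n.+1 => (i < n.+1 - j.+1)%N))/=.
  by rewrite lerDl; apply: sumr_ge0 => i _; rewrite mulr_ge0//; have [] := hka i (ltn_ord i).
have le3 : \sum_(m < n) eps * (a m * E) <= (\sum_(i < n.+1) eps * a i) * E.
  rewrite big_ord_recr/= mulrDl mulr_suml; apply: ler_wpDr.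
    by rewrite !mulr_ge0//; have [] := hka n (ltnSn n).
  by apply: ler_sum => m _; rewrite mulrA.
have le4 : \sum_(m < n) eps * del <= n.+1%:R * eps * del.
  by rewrite sumr_const card_ord -[leLHS]mulr_natl [leLHS]mulrA ler_wpM2r// ler_wpM2r// ler_nat leqnSn.
move: le1; under eq_bigr do rewrite !mulrDr.
by rewrite !big_split/=; move: le2 le3 le4; rewrite -!mulrA; lra.
Qed.

(** * Volterra inequality, almost orthogonality and stability *)

Section Comparison.
Context {R : realType} d (Omega : measurableType d) (P : probability Omega R).
Context {U H : hilbertType R} (F : R -> set (set Omega)) (W : cylindrical Omega U).
Hypothesis hN : normal_filtration P F.
Hypothesis hW : cylindrical_wiener P F W.
Hypothesis sepH : separable_space H.
Context (S : R -> H -> H) (G : U -> H).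
Hypothesis hS : C0_semigroup S.
Context (b : H -> H) (Cb theta : R).
Hypotheses (theta01 : 0 < theta < 1) (Cb0 : 0 < Cb) (hb1 : forall x, `|b x| <= Cb).
Hypothesis hb2 : forall x y, `|b x - b y| <= Cb * `|x - y| `^ theta.
Context (T : R) (T0 : 0 < T) (Z : R -> Omega -> H).
Hypothesis hZ : forall t, 0 <= t <= T -> sint P W 0 t (conv_kernel W S G t) (Z t).
Variable M : R.
Hypotheses (M1 : 1 <= M) (hM : forall t x, 0 <= t <= T -> `|S t x| <= M * `|x|).

Local Notation mean_on := (mean_on P).
Local Notation intb f := (P.-integrable setT (EFin \o f)).
Local Notation l2 := (l2 P).

Let M0 : 0 <= M. Proof. exact: le_trans M1. Qed.

Let bZ t : 0 <= t <= T -> borel_on setT (Z t).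
Proof. by move=> ht; have [] := hZ ht. Qed.

Let fZ := ms_conv_finite hW sepH hS T0 hZ.
Let bZi := borel_Zinc hW sepH hS hZ.
Let sZ := ms_Zinc_small hW sepH hS T0 hZ.

Let cb : continuous b. Proof. exact: (continuous_drift theta01 (ltW Cb0) hb2). Qed.

Lemma filtration_sub u : 0 <= u -> F u `<=` measurable.
Proof. by move=> u0; have [] := filtration_measurable hN u0. Qed.

Section OneSolution.
Context (x0 : H) (X : R -> Omega -> H).
Hypothesis hX : mild_solution P F S b T Z x0 X.

Let bX t : 0 <= t <= T -> borel_on setT (X t).
Proof. by move=> ht; exact: (mild_borel hN hX ht). Qed.

(** The value of [h] at time [r] if the drift is switched off after time [u]. It interpolates
    between the solution itself, for [u = r], and the smoothing of [h] evaluated at an earlier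
    time. *)
Definition flow (h : H -> R) (u r : R) (w : Omega) : R := h (S (r - u) (X u w) + Zinc S Z u r w).

Lemma flow_end h r w : flow h r r w = h (X r w).
Proof. by rewrite /flow /Zinc subrr; have [_ S0 _ _] := hS; rewrite !S0 subrr addr0. Qed.

Lemma flow_integrable (h : H -> R) u r : 0 <= u -> u <= r -> r <= T -> ucont h -> (forall x, `|h x| <= 1) ->
  intb (flow h u r).
Proof.
move=> u0 ur rT uh h1; apply: (@integrable_bounded _ _ _ P _ 1); last by move=> w; exact: h1.
apply: (ucont_measurable sepH uh); apply: borelD => //; last exact: bZi.
apply: borel_sg => //; first by rewrite subr_ge0.
by apply: bX; rewrite u0 (le_trans ur).
Qed.

Lemma mean_smoothed A (V : Omega -> H) (h : H -> R) u r : 0 <= u -> u < r -> r <= T -> F u A ->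
  borel_on setT (V : g_sigma_algebraType (F u) -> H) -> ucont h -> (forall x, `|h x| <= 1) ->
  mean_on A (fun w => h (S (r - u) (V w) + Zinc S Z u r w)) =
  mean_on A (fun w => smoothed P S u r (Zinc S Z u r) h (V w)).
Proof.
move=> u0 ur rT FA bV uh h1.
have sZi := sint_Zinc hW sepH hS hZ u0 (ltW ur) rT.
have bSV : borel_on setT ((fun w => S (r - u) (V w)) : g_sigma_algebraType (F u) -> H).
  by apply: borel_sg => //; rewrite subr_ge0 ltW.
exact: (sint_mean hN hW sepH u0 sZi FA bSV uh h1).
Qed.

(** The drift over [[u, v]] is replaced by an Euler step from [X u]; the error is carried to time
    [r] by the semigroup and by the Lipschitz constant of [h]. What remains is determined by the
    past of [u], and the noise after [u] can be averaged out. *)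
Lemma flow_step A (h : H -> R) u v r (Lam e : R) : 0 <= u -> u < v -> v <= r -> r <= T -> F u A ->
  ucont h -> (forall x, `|h x| <= 1) -> 0 <= Lam -> (forall x y, `|h x - h y| <= Lam * `|x - y|) ->
  (\int[P]_w `|drift_inc S Z X u v w - (v - u) *: S (v - u) (b (X u w))|%:E <= e%:E)%E ->
  `|mean_on A (flow h v r) - mean_on A (fun w => smoothed P S u r (Zinc S Z u r) h (X u w + (v - u) *: b (X u w)))|
    <= Lam * M * e.
Proof.
move=> u0 uv vr rT FA uh h1 Lam0 hLam he.
have ur : u < r by exact: lt_le_trans vr.
have hu : 0 <= u <= T by rewrite u0 (le_trans (ltW ur)).
have v0 : 0 <= v by rewrite (le_trans u0)// ltW.
have ru0 : 0 <= r - u by rewrite subr_ge0 ltW.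
have rv0 : 0 <= r - v by rewrite subr_ge0.
have vu0 : 0 <= v - u by rewrite subr_ge0 ltW.
have mA := filtration_sub u0 FA; have [_ _ Sadd _] := hS.
have cV : continuous (fun x => x + (v - u) *: b x).
  by move=> x; apply: cvgD; [exact: cvg_id|apply: cvgZ; [exact: cvg_cst|exact: cb]].
have bV : borel_on setT ((fun w => X u w + (v - u) *: b (X u w)) : g_sigma_algebraType (F u) -> H).
  exact: (borel_comp cV (mild_borel_past hX hu)).
have bV' : borel_on setT (fun w => X u w + (v - u) *: b (X u w)) by exact: (borel_comp cV (bX hu)).
rewrite -(mean_smoothed u0 ur rT FA bV uh h1).
have i1 := flow_integrable v0 vr rT uh h1.
have i2 : intb (fun w => h (S (r - u) (X u w + (v - u) *: b (X u w)) + Zinc S Z u r w)).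
  apply: (@integrable_bounded _ _ _ P _ 1) => //; apply: (ucont_measurable sepH uh).
  by apply: borelD => //; [exact: borel_sg|apply: bZi => //; exact: ltW].
rewrite -mean_onB//; apply: (le_trans (mean_on_norm mA (integrable_sub i1 i2))).
set Y := fun w => drift_inc S Z X u v w - (v - u) *: S (v - u) (b (X u w)) in he.
have bY : borel_on setT Y.
  apply: borelB => //; first exact: (borel_drift_inc sepH hN hS bZ hX u0 (ltW uv) (le_trans vr rT)).
  apply: (borel_comp (f := fun x : H => (v - u) *: x)).
    by move=> x; apply: cvgZ; [exact: cvg_cst|exact: cvg_id].
  by apply: borel_sg => //; exact: (borel_comp cb (bX hu)).
have mY : measurable_fun setT (fun w => `|Y w|).
  by have /(_ 0) := (borel_normP sepH measurableT _).1 bY; apply: eq_measurable_fun => w _; rewrite subr0.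
have i3 := integrable_norm (integrable_sub i1 i2).
rewrite -lee_fin /Rintegral fineK; last exact: (integrable_fin_num measurableT i3).
have le : (\int[P]_w `|flow h v r w - h (S (r - u) (X u w + (v - u) *: b (X u w)) + Zinc S Z u r w)|%:E <=
    \int[P]_w ((Lam * M)%:E * `|Y w|%:E))%E.
  apply: ge0_le_integral => //.
  - by have [] := integrableP _ _ _ i3.
  - by apply: emeasurable_funM; [exact: measurable_cst|exact/measurable_EFinP].
  move=> w _; rewrite -EFinM lee_fin; apply: (le_trans (hLam _ _)); rewrite -mulrA ler_wpM2l//.
  have -> : S (r - v) (X v w) + Zinc S Z v r w - (S (r - u) (X u w + (v - u) *: b (X u w)) + Zinc S Z u r w) = S (r - v) (Y w).
    have eS x : S (r - u) x = S (r - v) (S (v - u) x).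
      by rewrite -(Sadd _ _ _ rv0 vu0); congr (S _ _); ring.
    rewrite (mild_step S Z X w u0 (ltW uv)) /Y /Zinc !eS.
    by rewrite !(bopB (sg_bop hS rv0), bopD (sg_bop hS rv0), bopB (sg_bop hS vu0), bopD (sg_bop hS vu0), bopZ (sg_bop hS vu0), bopZ (sg_bop hS rv0)); hring.
  by apply: hM; rewrite rv0/=; lra.
apply: (le_trans le); rewrite ge0_integralZl//.
- by rewrite (EFinM (Lam * M) e); apply: lee_wpmul2l => //; rewrite lee_fin mulr_ge0.
- exact/measurable_EFinP.
- by rewrite lee_fin mulr_ge0.
Qed.

End OneSolution.
Section TwoSolutions.
Context (x1 x2 : H) (X1 X2 : R -> Omega -> H).
Hypothesis hX1 : mild_solution P F S b T Z x1 X1.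
Hypothesis hX2 : mild_solution P F S b T Z x2 X2.
Variables (a k : R -> R).
Local Notation sm u r f := (smoothed P S u r (Zinc S Z u r) f).
Hypothesis ha : forall u r f, 0 <= u -> u < r -> r <= T -> unit_holder theta f ->
  forall x y, `|sm u r f x - sm u r f y| <= a (r - u) * `|x - y|.
Hypothesis hk : forall u r f (eps : R), 0 <= u -> u < r -> r <= T -> unit_holder theta f -> 0 <= eps ->
  let q x := sm u r f (x + eps *: b x) - sm u r f x in
  (forall x, `|q x| <= eps * k (r - u)) /\ (forall x y, `|q x - q y| <= eps * k (r - u) * `|x - y| `^ theta).
Hypothesis ak0 : forall s, 0 < s -> s <= T -> 0 <= a s /\ 0 < k s.

Let bX1 t : 0 <= t <= T -> borel_on setT (X1 t).
Proof. by move=> ht; exact: (mild_borel hN hX1 ht). Qed.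

Let bX2 t : 0 <= t <= T -> borel_on setT (X2 t).
Proof. by move=> ht; exact: (mild_borel hN hX2 ht). Qed.

Let l2X1 t : 0 <= t <= T -> l2 (X1 t).
Proof.
by move=> ht; split; [exact: bX1|exact: (mild_ms_finite sepH hN hS theta01 (ltW Cb0) hb1 hb2 T0 bZ fZ bZi hX1 M1 hM ht)].
Qed.

Let l2X2 t : 0 <= t <= T -> l2 (X2 t).
Proof.
by move=> ht; split; [exact: bX2|exact: (mild_ms_finite sepH hN hS theta01 (ltW Cb0) hb1 hb2 T0 bZ fZ bZi hX2 M1 hM ht)].
Qed.

Definition gap_values (A : set Omega) (u : R) : set R := [set z | exists2 f, unit_holder theta f &
  z = `|mean_on A (fun w => f (X1 u w)) - mean_on A (fun w => f (X2 u w))|].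

(** The quantity [n(u)] of the overview. All the values are at most 2, so the supremum is a genuine
    one. *)
Definition gap A u : R := sup (gap_values A u).

Let intf (f : H -> R) (X : R -> Omega -> H) t : unit_holder theta f -> borel_on setT (X t) -> intb (fun w => f (X t w)).
Proof.
move=> uf bX; apply: (@integrable_bounded _ _ _ P _ 1); last by move=> w; exact: uf.1.
exact: (ucont_measurable sepH (unit_holder_ucont theta01 uf) bX).
Qed.

Let mean_le1 A (f : H -> R) (X : R -> Omega -> H) t : measurable A -> unit_holder theta f -> borel_on setT (X t) ->
  `|mean_on A (fun w => f (X t w))| <= 1.
Proof.
move=> mA uf bX; have i := intf uf bX; apply: (le_trans (mean_on_norm mA i)).
have mf : measurable_fun setT (fun w => `|f (X t w)|).
  by apply: measurableT_comp => //; exact: (ucont_measurable sepH (unit_holder_ucont theta01 uf) bX).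
have := Rint_le_bound P (C := 1) mf; rewrite ger0_norm.
  by apply=> w; rewrite normr_id; exact: uf.1.
by apply: Rintegral_ge0.
Qed.

Lemma gap_value_le2 A u : measurable A -> 0 <= u <= T -> ubound (gap_values A u) 2.
Proof.
move=> mA hu z [f uf ->]; apply: (le_trans (ler_normB _ _)).
by have := mean_le1 mA uf (bX1 hu); have := mean_le1 mA uf (bX2 hu); lra.
Qed.

Lemma unit_holder0 : unit_holder theta (fun _ : H => 0).
Proof. by split=> [x|x y]; rewrite ?subrr normr0 ?powR_ge0. Qed.

Lemma gap_ub A u f : measurable A -> 0 <= u <= T -> unit_holder theta f ->
  `|mean_on A (fun w => f (X1 u w)) - mean_on A (fun w => f (X2 u w))| <= gap A u.
Proof.
move=> mA hu uf; apply: ub_le_sup; last by exists f.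
by exists 2; exact: gap_value_le2.
Qed.

Lemma gap_le A u (c : R) : (forall f, unit_holder theta f ->
  `|mean_on A (fun w => f (X1 u w)) - mean_on A (fun w => f (X2 u w))| <= c) -> gap A u <= c.
Proof.
move=> h; apply: ge_sup; last by move=> z [f uf ->]; exact: h.
by exists `|mean_on A (fun w => 0) - mean_on A (fun w => 0)|; exists (fun=> 0) => //; exact: unit_holder0.
Qed.

Lemma gap_bounds A u : measurable A -> 0 <= u <= T -> 0 <= gap A u <= 2.
Proof.
move=> mA hu; apply/andP; split; first exact: (le_trans (normr_ge0 _) (gap_ub mA hu unit_holder0)).
by apply: gap_le => f uf; apply: (gap_value_le2 mA hu); exists f.
Qed.

Let err X u v := (\int[P]_w `|drift_inc S Z X u v w - (v - u) *: S (v - u) (b (X u w))|%:E)%E.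

(** Switching the drift off earlier, at [u] instead of [v], changes the mean by that of an increment
    of the smoothed function along the drift. Divided by [(v - u) * k (r - u)] this increment is
    again in the unit ball, so the two solutions differ there by at most [gap A u]. *)
Lemma volterra_step A (h : H -> R) u v r (Lam e : R) : 0 <= u -> u < v -> v <= r -> r <= T -> F u A ->
  unit_holder theta h -> 0 <= Lam -> (forall x y, `|h x - h y| <= Lam * `|x - y|) ->
  (err X1 u v <= e%:E)%E -> (err X2 u v <= e%:E)%E ->
  `|(mean_on A (flow X1 h v r) - mean_on A (flow X2 h v r)) - (mean_on A (flow X1 h u r) - mean_on A (flow X2 h u r))|
  <= (v - u) * k (r - u) * gap A u + 2 * (Lam * M * e).
Proof.
move=> u0 uv vr rT FA uh Lam0 hLam he1 he2.
have ur : u < r by exact: lt_le_trans vr.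
have hu : 0 <= u <= T by rewrite u0 (le_trans (ltW ur)).
have vu0 : 0 < v - u by rewrite subr_gt0.
have mA := filtration_sub u0 FA; have uch := unit_holder_ucont theta01 uh.
have s1 := flow_step hX1 u0 uv vr rT FA uch uh.1 Lam0 hLam he1.
have s2 := flow_step hX2 u0 uv vr rT FA uch uh.1 Lam0 hLam he2.
have e1 : mean_on A (flow X1 h u r) = mean_on A (fun w => sm u r h (X1 u w)).
  exact: (mean_smoothed u0 ur rT FA (mild_borel_past hX1 hu) uch uh.1).
have e2 : mean_on A (flow X2 h u r) = mean_on A (fun w => sm u r h (X2 u w)).
  exact: (mean_smoothed u0 ur rT FA (mild_borel_past hX2 hu) uch uh.1).
have [q1 q2] := hk u0 ur rT uh (ltW vu0).
have ru0 : 0 <= r - u by rewrite subr_ge0 ltW.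
have ruT : r - u <= T by rewrite lerBlDr (le_trans rT)// lerDl.
have [_ k0] : 0 <= a (r - u) /\ 0 < k (r - u) by apply: ak0; rewrite ?subr_gt0.
pose c := (v - u) * k (r - u); have c0 : 0 < c by rewrite mulr_gt0.
pose q x := c^-1 * (sm u r h (x + (v - u) *: b x) - sm u r h x).
have uq : unit_holder theta q.
  split=> [x|x y]; first by rewrite normrM gtr0_norm ?invr_gt0// ler_pdivrMl// mulr1; exact: q1.
  by rewrite /q -mulrBr normrM gtr0_norm ?invr_gt0// ler_pdivrMl//; exact: q2.
have ism X : (forall t, 0 <= t <= T -> borel_on setT (X t)) -> intb (fun w => sm u r h (X u w)) /\
    intb (fun w => sm u r h (X u w + (v - u) *: b (X u w))).
  move=> bX; have bZu : borel_on setT (Zinc S Z u r) by apply: bZi => //; exact: ltW.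
  have cS : ucont (sm u r h).
    apply: (@ucont_comp _ _ (S (r - u)) (fun y => \int[P]_w h (y + Zinc S Z u r w)) M) => //.
      move=> x y; rewrite -(bopB (sg_bop hS ru0)).
      by apply: hM; rewrite ru0.
    exact: (ucont_mean P sepH uch uh.1 bZu).
  have sm1 x : `|sm u r h x| <= 1.
    apply: Rint_le_bound => [|w]; last exact: uh.1.
    by apply: (ucont_measurable sepH uch); apply: borelD => //; exact: borel_cst.
  have cV : continuous (fun x => x + (v - u) *: b x).
    by move=> x; apply: cvgD; [exact: cvg_id|apply: cvgZ; [exact: cvg_cst|exact: cb]].
  split; apply: (@integrable_bounded _ _ _ P _ 1) => //; apply: (ucont_measurable sepH cS).
    exact: bX.
  exact: (borel_comp cV (bX _ hu)).
have [i1 j1] := ism X1 bX1; have [i2 j2] := ism X2 bX2.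
have qE X : intb (fun w => sm u r h (X u w)) -> intb (fun w => sm u r h (X u w + (v - u) *: b (X u w))) ->
    mean_on A (fun w => sm u r h (X u w + (v - u) *: b (X u w))) - mean_on A (fun w => sm u r h (X u w)) =
    c * mean_on A (fun w => q (X u w)).
  move=> i j; rewrite -mean_onB// -mean_onZ//; last by apply: integrable_scale; exact: integrable_sub.
  by apply: eq_Rintegral => w _; rewrite /q (mulrA c) mulfV ?gt_eqF// mul1r.
have E1 := qE X1 i1 j1; have E2 := qE X2 i2 j2.
have := gap_ub mA hu uq; rewrite -(ler_pM2l c0) => hg.
rewrite e1 e2; set y1 := mean_on A (fun w => q (X1 u w)) in E1 hg; set y2 := mean_on A (fun w => q (X2 u w)) in E2 hg.
have hg' : `|c * y1 - c * y2| <= c * gap A u by rewrite -mulrBr normrM (gtr0_norm c0).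
move: s1 s2 hg'; rewrite -E1 -E2.
set z1 := mean_on A (flow X1 h v r); set z2 := mean_on A (flow X2 h v r).
set m1 := mean_on A _; set m2 := mean_on A _; set n1 := mean_on A _; set n2 := mean_on A _.
move=> s1 s2 hg'.
have -> : z1 - z2 - (n1 - n2) = (z1 - m1) - (z2 - m2) + (m1 - n1 - (m2 - n2)) by ring.
apply: (le_trans (ler_normD _ _)); rewrite addrC; apply: lerD => //.
have -> : 2 * (Lam * M * e) = Lam * M * e + Lam * M * e by ring.
exact: (le_trans (ler_normB _ _) (lerD s1 s2)).
Qed.

(** The steps are telescoped from [r] back to [s], where the Lipschitz bound of the smoothed
    function applies. The test function is first regularized, since the Euler errors are multiplied
    by its Lipschitz constant; [alpha] is to be fixed before the mesh tends to 0. *)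
Lemma gap_volterra A s m (eps alpha e : R) : 0 <= s -> F s A -> 0 < eps -> s + m.+1%:R * eps <= T -> 0 < alpha -> 0 <= e ->
  (forall j, (j <= m)%N -> (err X1 (s + j%:R * eps) (s + j.+1%:R * eps) <= (e * eps)%:E)%E /\
                           (err X2 (s + j%:R * eps) (s + j.+1%:R * eps) <= (e * eps)%:E)%E) ->
  gap A (s + m.+1%:R * eps) <= a (m.+1%:R * eps) * mean_on A (fun w => `|X1 s w - X2 s w|) +
    \sum_(j < m.+1) eps * k ((m.+1 - j.+1).+1%:R * eps) * gap A (s + j%:R * eps) +
    (2 * alpha `^ (- theta) + 2 * (alpha `^ (1 - theta) * M * e) * (m.+1%:R * eps)).
Proof.
move=> s0 FA eps0 rT alpha0 e0 he; set r := s + m.+1%:R * eps.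
pose u j : R := s + j%:R * eps.
have uS j : u j.+1 - u j = eps by rewrite /u -natr1; ring.
have uu j : u j < u j.+1 by rewrite -subr_gt0 uS.
have u_ge j : s <= u j by rewrite lerDl mulr_ge0// ltW.
have u0 j : 0 <= u j by exact: le_trans (u_ge j).
have ur j : (j <= m.+1)%N -> u j <= r by move=> jm; rewrite lerD2l ler_pM2r// ler_nat.
have FuA j : F (u j) A by have [_ h _ _] := hN; apply: (h s).
have mA := filtration_sub s0 FA.
have hs : 0 <= s <= T by rewrite s0 (le_trans (u_ge m.+1)).
have hr : 0 <= r <= T by rewrite (u0 m.+1).
have sr : s < r by rewrite ltrDl mulr_gt0// ltr0n.
apply: gap_le => f uf; have [h [uh hLip fh]] := inf_convolution theta01 uf alpha0.
set Lam := alpha `^ (1 - theta) in hLip *; have Lam0 : 0 <= Lam by exact: powR_ge0.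
pose df v := mean_on A (flow X1 h v r) - mean_on A (flow X2 h v r).
(* The kernel is taken at [r - u j = (m + 1 - j) * eps], which is at least [eps]; the written form
   of this index matches the right Riemann sums of [k]. *)
have tele j : (j <= m.+1)%N -> `|df (u j) - df (u 0%N)| <=
    \sum_(i < j) eps * k ((m.+1 - i.+1).+1%:R * eps) * gap A (u i) + 2 * (Lam * M * e) * (j%:R * eps).
  elim: j => [_|j IH jm]; first by rewrite subrr normr0 big_ord0 mul0r mulr0 addr0.
  have [h1 h2] := he j jm.
  have := volterra_step (u0 j) (uu j) (ur _ jm) rT (FuA j) uh Lam0 hLip h1 h2.
  rewrite -/(df (u j.+1)) -/(df (u j)) uS.
  have -> : r - u j = (m.+1 - j.+1).+1%:R * eps.
    rewrite -subSn// subSS natrB 1?ltnW// /r /u; ring.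
  rewrite big_ord_recr/= => hstep; have := IH (ltnW jm); move: hstep.
  rewrite -[j.+1%:R]natr1 => hstep hIH.
  rewrite (_ : df (u j.+1) - df (u 0%N) = (df (u j.+1) - df (u j)) + (df (u j) - df (u 0%N))); last by ring.
  apply: (le_trans (ler_normD _ _)); apply: (le_trans (lerD hstep hIH)).
  by rewrite le_eqVlt; apply/orP; left; apply/eqP; ring.
have := tele m.+1 (leqnn _).
have uE : u 0%N = s by rewrite /u mul0r addr0.
have smE X x0 (hX : mild_solution P F S b T Z x0 X) : mean_on A (flow X h s r) = mean_on A (fun w => sm s r h (X s w)).
  exact: (mean_smoothed s0 sr rT FA (mild_borel_past hX hs) (unit_holder_ucont theta01 uh) uh.1).
have endE X : mean_on A (flow X h r r) = mean_on A (fun w => h (X r w)).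
  by apply: eq_Rintegral => w _; rewrite flow_end.
rewrite uE -/r {1}/df !endE /df (smE X1 x1)// (smE X2 x2)//.
have iD : intb (fun w => `|X1 s w - X2 s w|) by apply: (l2_norm sepH); apply: l2B => //; [exact: l2X1|exact: l2X2].
have hA : `|mean_on A (fun w => sm s r h (X1 s w)) - mean_on A (fun w => sm s r h (X2 s w))| <=
    a (m.+1%:R * eps) * mean_on A (fun w => `|X1 s w - X2 s w|).
  have arE : a (m.+1%:R * eps) = a (r - s) by congr a; rewrite /r; ring.
  have [i1 i2] : intb (fun w => sm s r h (X1 s w)) /\ intb (fun w => sm s r h (X2 s w)).
    have usm : ucont (sm s r h).
      apply: (@lipschitz_ucont _ _ _ (a (r - s))); last by move=> x y; exact: ha.
      by have [] := @ak0 (r - s) _ _; rewrite ?subr_gt0//; lra.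
    have sm1 x : `|sm s r h x| <= 1.
      apply: Rint_le_bound => [|w]; last exact: uh.1.
      apply: (ucont_measurable sepH (unit_holder_ucont theta01 uh)).
      by apply: borelD => //; [exact: borel_cst|apply: bZi => //; exact: ltW].
    split; apply: (@integrable_bounded _ _ _ P _ 1) => //; apply: (ucont_measurable sepH usm); [exact: bX1|exact: bX2].
  rewrite -mean_onB// -mean_onZ//; apply: (le_trans (le_normr_Rintegral _ _)) => //.
    by apply: integrable_indic_mul => //; exact: integrable_sub.
  apply: le_Rintegral => //.
  - by have := integrable_norm (integrable_indic_mul mA (integrable_sub i1 i2)).
  - by apply: integrable_indic_mul => //; exact: integrable_scale.
  move=> w _; rewrite normrM ger0_norm ?indicE// ler_wpM2l// arE; exact: ha.
have fhX X : borel_on setT (X r) -> `|mean_on A (fun w => f (X r w)) - mean_on A (fun w => h (X r w))| <= alpha `^ (- theta).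
  move=> bX; have i1 := intf uf bX; have i2 := intf uh bX.
  rewrite -mean_onB//; apply: (le_trans (mean_on_norm mA (integrable_sub i1 i2))).
  have := Rint_le_bound P (f := fun w => `|f (X r w) - h (X r w)|) (C := alpha `^ (- theta)).
  rewrite ger0_norm; first apply.
  - apply: measurableT_comp => //; apply: measurable_funB.
      exact: (ucont_measurable sepH (unit_holder_ucont theta01 uf) bX).
    exact: (ucont_measurable sepH (unit_holder_ucont theta01 uh) bX).
  - by move=> w; rewrite normr_id.
  - by apply: Rintegral_ge0.
move: (fhX X1 (bX1 hr)) (fhX X2 (bX2 hr)) hA.
set m1 := mean_on A (fun w => f (X1 r w)); set m2 := mean_on A (fun w => f (X2 r w)).
set n1 := mean_on A (fun w => h (X1 r w)); set n2 := mean_on A (fun w => h (X2 r w)).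
set o1 := mean_on A (fun w => sm s r h (X1 s w)); set o2 := mean_on A (fun w => sm s r h (X2 s w)).
move=> f1 f2 hA ht.
have -> : m1 - m2 = (m1 - n1) - (m2 - n2) + (n1 - n2 - (o1 - o2)) + (o1 - o2) by ring.
apply: (le_trans (ler_normD _ _)); apply: (le_trans (lerD (ler_normD _ _) (lexx _))).
move: ht hA; rewrite /u; set SS := \sum_(_ < _) _; set aE := a _ * _ => ht hA.
have := ler_normB (m1 - n1) (m2 - n2); move: ht hA; lra.
Qed.

Variables (omega V : R -> R) (tau : R).
Hypothesis tau0 : 0 < tau.
Hypothesis hksum : forall (eps : R) n, 0 < eps -> n%:R * eps <= tau -> \sum_(i < n) eps * k (i.+1%:R * eps) <= 2^-1.
Hypothesis hasum : forall (eps : R) n, 0 < eps -> n%:R * eps <= T ->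
  \sum_(i < n) eps * a (i.+1%:R * eps) <= omega (n%:R * eps).
Hypothesis hV0 : forall h, 0 <= h -> h <= T -> 0 <= omega h /\ 0 <= V h.
Hypothesis hV1 : forall h, 0 < h -> h <= T -> Num.sqrt 2 * V (h / 2) + omega (h / 2) <= V h.
Hypothesis hV2 : forall h, 0 < h -> h <= tau -> 2 * M * Cb * V h <= 2^-1.

Let D t w := X1 t w - X2 t w.

Let l2D' t : 0 <= t <= T -> l2 (D t).
Proof. by move=> ht; apply: l2B => //; [exact: l2X1|exact: l2X2]. Qed.

Lemma err_small (e : R) : 0 < e -> exists2 del : R, 0 < del & forall u v, 0 <= u -> u <= v -> v <= T ->
  v - u <= del -> (err X1 u v <= (e * (v - u))%:E)%E /\ (err X2 u v <= (e * (v - u))%:E)%E.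
Proof.
move=> e0.
have [d1 d10 h1] := drift_consistency sepH hN hS theta01 (ltW Cb0) hb1 hb2 T0 bZ fZ bZi sZ hX1 M1 hM e0.
have [d2 d20 h2] := drift_consistency sepH hN hS theta01 (ltW Cb0) hb1 hb2 T0 bZ fZ bZi sZ hX2 M1 hM e0.
exists (Num.min d1 d2); first by rewrite lt_min d10.
by move=> u v u0 uv vT; rewrite le_min => /andP[v1 v2]; split; [exact: h1|exact: h2].
Qed.

(** The discrete bound for the integral of [gap]. The mesh threshold does not depend on [s] or [A],
    and the total mass of [k] below [tau], at most 1/2, makes the Gronwall step possible. *)
Lemma gap_sum (e : R) : 0 < e -> exists2 del : R, 0 < del & forall s A (eps : R) n, 0 <= s -> F s A -> 0 < eps ->
  eps <= del -> s + n%:R * eps <= T -> n%:R * eps <= tau ->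
  \sum_(j < n) eps * gap A (s + j%:R * eps) <= 2 * omega (n%:R * eps) * mean_on A (fun w => `|D s w|) + e.
Proof.
move=> e0; have e30 : 0 < e / 3 by rewrite divr_gt0.
have [c /andP[c0 _] hc] := small_factor e30 (mulr_ge0 (ler0n R 4) (ltW T0)).
(* With this [alpha] the regularization error [alpha^(- theta)] equals [c]. The resulting Lipschitz
   constant may be huge, and is compensated by [e1]. *)
have /andP[th0 _] := theta01; pose alpha := c `^ (- theta^-1).
have alpha0 : 0 < alpha by rewrite powR_gt0.
have alphaE : alpha `^ (- theta) = c.
  by rewrite /alpha -powRrM mulrNN mulVf ?gt_eqF// powRr1// ltW.
have L0 : 0 <= alpha `^ (1 - theta) by exact: powR_ge0.
have B0 : 0 <= 4 * T * (alpha `^ (1 - theta) * M * T) by rewrite !mulr_ge0// ltW.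
have [e1 /andP[e10 _] he1] := small_factor e30 B0.
have [d1 d10 hd1] := err_small e10.
exists (Num.min d1 (e / 12)); first by rewrite lt_min d10 divr_gt0.
move=> s A eps n s0 FA eps0; rewrite le_min => /andP[ed1 ee] nT ntau.
have mA := filtration_sub s0 FA.
have sT : s <= T by apply: le_trans nT; rewrite lerDl mulr_ge0// ltW.
have jn j : (j <= n)%N -> s + j%:R * eps <= T.
  by move=> h; apply: le_trans nT; rewrite lerD2l ler_pM2r// ler_nat.
have j0 (j : nat) : 0 <= s + j%:R * eps by rewrite addr_ge0// mulr_ge0// ltW.
have neT : n%:R * eps <= T by apply: le_trans nT; rewrite lerDr.
have ne0 : 0 <= n%:R * eps by rewrite mulr_ge0// ltW.
have E0 : 0 <= mean_on A (fun w => `|D s w|) by exact: mean_on_ge0.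
pose del := 2 * c + 2 * (alpha `^ (1 - theta) * M * e1) * T.
have del0 : 0 <= del.
  by rewrite addr_ge0// ?mulr_ge0// ?mulr_ge0// ?mulr_ge0// ltW.
have := @discrete_gronwall R (fun j => gap A (s + j%:R * eps)) (fun i => a (i.+1%:R * eps))
  (fun i => k (i.+1%:R * eps)) n eps _ del (ltW eps0) E0.
have hy j : (j < n)%N -> 0 <= gap A (s + j%:R * eps) <= 2.
  by move=> /ltnW/jn h; apply: gap_bounds => //; rewrite j0.
have hka i : (i < n)%N -> 0 <= k (i.+1%:R * eps) /\ 0 <= a (i.+1%:R * eps).
  move=> lt; have [] := @ak0 (i.+1%:R * eps) _ _; first by rewrite mulr_gt0.
    by apply: le_trans neT; rewrite ler_pM2r// ler_nat.
  by move=> h1 h2; split=> //; exact: ltW.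
move=> /(_ hy hka del0 (hksum eps0 ntau)) => h.
apply: (le_trans (h _)).
  move=> m mn; have hj j : (j <= m)%N -> (err X1 (s + j%:R * eps) (s + j.+1%:R * eps) <= (e1 * eps)%:E)%E /\
       (err X2 (s + j%:R * eps) (s + j.+1%:R * eps) <= (e1 * eps)%:E)%E.
    move=> jm; have vE : s + j.+1%:R * eps - (s + j%:R * eps) = eps by rewrite -natr1; ring.
    have := hd1 _ _ (j0 j) _ (jn j.+1 _); rewrite vE; apply => //.
      by rewrite -subr_ge0 vE ltW.
    by rewrite (leq_trans _ (ltnW mn)).
  apply: (le_trans (gap_volterra s0 FA eps0 (jn _ (ltnW mn)) alpha0 (ltW e10) hj)).
  rewrite lerD2l alphaE /del lerD2l ler_wpM2l//.
    by rewrite !mulr_ge0// ltW.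
  by apply: le_trans neT; rewrite ler_pM2r// ler_nat ltnW.
have k1 : 2 * (\sum_(i < n) eps * a (i.+1%:R * eps)) * mean_on A (fun w => `|D s w|) <=
    2 * omega (n%:R * eps) * mean_on A (fun w => `|D s w|).
  by rewrite ler_wpM2r// ler_wpM2l//; exact: hasum.
have k2 : 2 * (n%:R * eps) * del <= 2 * T * del by rewrite ler_wpM2r// ler_wpM2l.
rewrite -addrA; apply: lerD => //; apply: (le_trans (lerD (lexx _) k2)).
have k3 : 2 * T * del = c * (4 * T) + e1 * (4 * T * (alpha `^ (1 - theta) * M * T)) by rewrite /del; ring.
rewrite k3; move: hc he1 ee; move: (c * _) (e1 * _) => p q; lra.
Qed.

(** The difference transported to a fixed time [t]: the linear flow is factored out, so that only
    drifts contribute, and increments over adjacent intervals add up. *)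
Definition increment t u v w := S (t - v) (D v w) - S (t - u) (D u w).
Local Notation Kt := increment.

Let l2_sg r (Y : Omega -> H) : 0 <= r <= T -> l2 Y -> l2 (fun w => S r (Y w)).
Proof.
move=> hr hY; have /andP[r0 _] := hr.
have bY : borel_on setT (fun w => S r (Y w)) by apply: borel_sg => //; exact: hY.1.
by have [] := l2_le sepH bY hY M0 (fun w => hM _ hr).
Qed.

Lemma increment_l2 t u v : 0 <= u -> u <= v -> v <= t -> t <= T -> l2 (Kt t u v).
Proof.
move=> u0 uv vt tT; have v0 := le_trans u0 uv; have ut := le_trans uv vt.
apply: l2B => //; apply: l2_sg; try apply: l2D'.
- by rewrite subr_ge0 vt/= lerBlDr (le_trans tT)// lerDl.
- by rewrite v0 (le_trans vt).
- by rewrite subr_ge0 ut/= lerBlDr (le_trans tT)// lerDl.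
- by rewrite u0 (le_trans ut).
Qed.

Let D_step u v w : 0 <= u -> u <= v ->
  D v w = S (v - u) (D u w) + (drift_inc S Z X1 u v w - drift_inc S Z X2 u v w).
Proof.
move=> u0 uv; rewrite /D (mild_step S Z X1 w u0 uv) (mild_step S Z X2 w u0 uv).
by rewrite (bopB (sg_bop hS _)) ?subr_ge0//; hring.
Qed.

Let sgE t u v x : u <= v -> v <= t -> S (t - u) x = S (t - v) (S (v - u) x).
Proof.
move=> uv vt; have [_ _ Sadd _] := hS.
by rewrite -(Sadd (t - v) (v - u)) ?subr_ge0//; congr (S _ _); ring.
Qed.

Lemma increment_drift t u v w : 0 <= u -> u <= v -> v <= t ->
  Kt t u v w = S (t - v) (drift_inc S Z X1 u v w - drift_inc S Z X2 u v w).
Proof.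
move=> u0 uv vt; have tv0 : 0 <= t - v by rewrite subr_ge0.
by rewrite /increment (D_step w u0 uv) (sgE _ uv vt) (bopD (sg_bop hS tv0)); hring.
Qed.

Lemma incrementD t u v r w : Kt t u r w = Kt t u v w + Kt t v r w.
Proof. by rewrite /increment; hring. Qed.

(** Up to the Euler error, the increment tested against [y] is [v - u] times a difference of values
    of [dot (S (t - u) (b x)) y]. This function is [M * Cb * |y|] times one of the unit ball, which
    brings in [gap]; the normalization requires [y] to be nonzero. *)
Lemma mean_increment_step t u v A y (e : R) : 0 <= u -> u < v -> v <= t -> t <= T -> F u A -> 0 <= e ->
  (err X1 u v <= e%:E)%E -> (err X2 u v <= e%:E)%E ->
  `|mean_on A (fun w => dot (Kt t u v w) y)| <= (v - u) * (M * Cb * `|y|) * gap A u + 2 * (M * `|y| * e).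
Proof.
move=> u0 uv vt tT FA e0 he1 he2; have mA := filtration_sub u0 FA.
have uv' := ltW uv; have vT := le_trans vt tT; have ut := le_trans uv' vt.
have hu : 0 <= u <= T by rewrite u0 (le_trans ut).
have hv : 0 <= v <= T by rewrite (le_trans u0 uv').
have tv0 : 0 <= t - v by rewrite subr_ge0.
have vu0 : 0 <= v - u by rewrite subr_ge0.
have tu0 : 0 <= t - u by rewrite subr_ge0.
have htv : 0 <= t - v <= T by rewrite tv0/= lerBlDr (le_trans tT)// lerDl; case/andP: hv.
have htu : 0 <= t - u <= T by rewrite tu0/= lerBlDr (le_trans tT)// lerDl.
have hvu : 0 <= v - u <= T by rewrite vu0/= lerBlDr (le_trans vT)// lerDl.
pose Y X w := drift_inc S Z X u v w - (v - u) *: S (v - u) (b (X u w)).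
have bcont (X : R -> Omega -> H) : borel_on setT (X u) -> borel_on setT (fun w => b (X u w)) by exact: (borel_comp cb).
have l2b (X : R -> Omega -> H) : borel_on setT (X u) -> l2 (fun w => b (X u w)).
  by move=> bX; have [] := l2_bound sepH (P := P) (bcont X bX) (ltW Cb0) (aeW _ (fun w => hb1 (X u w))).
have scont (c : R) : continuous (fun x : H => c *: x).
  by move=> x; apply: cvgZ; [exact: cvg_cst|exact: cvg_id].
have l2Y (X : R -> Omega -> H) : l2 (X u) -> l2 (X v) -> l2 (Y X).
  move=> lu lv; apply: l2B => //.
    rewrite /drift_inc /Zinc; apply: l2B => //; first by apply: l2B => //; exact: l2_sg.
    by apply: l2B => //; [split; [exact: bZ|exact: fZ]|apply: l2_sg => //; split; [exact: bZ|exact: fZ]].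
  have lS := l2_sg hvu (l2b X lu.1).
  have bS' : borel_on setT (fun w => (v - u) *: S (v - u) (b (X u w))) by exact: (borel_comp (scont _) lS.1).
  have [] := @l2_le _ _ sepH _ _ P _ _ (v - u) bS' lS vu0; last by [].
  by move=> w; rewrite normrZ ger0_norm.
have Yle (X : R -> Omega -> H) : l2 (X u) -> l2 (X v) -> (err X u v <= e%:E)%E -> `|mean_on A (fun w => dot (S (t - v) (Y X w)) y)| <= M * `|y| * e.
  move=> lu lv he; have lY := l2Y X lu lv; have lSY := l2_sg htv lY.
  have i1 := l2_dot sepH lSY (l2_cst sepH P y); have i2 := l2_norm sepH lY.
  apply: (le_trans (mean_on_norm mA i1)).
  apply: (@le_trans _ _ (\int[P]_w (M * `|y| * `|Y X w|))).
    apply: le_Rintegral => //; first by have := integrable_norm i1.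
      exact: integrable_scale.
    move=> w _; apply: (le_trans (dot_le _ _)); rewrite mulrAC ler_wpM2r//; exact: hM.
  rewrite RintegralZl// ler_wpM2l ?mulr_ge0//.
  by rewrite -lee_fin /Rintegral fineK//; exact: (integrable_fin_num measurableT i2).
have n1 := Yle X1 (l2X1 hu) (l2X1 hv) he1; have n2 := Yle X2 (l2X2 hu) (l2X2 hv) he2.
have i1 := l2_dot sepH (l2_sg htv (l2Y X1 (l2X1 hu) (l2X1 hv))) (l2_cst sepH P y).
have i2 := l2_dot sepH (l2_sg htv (l2Y X2 (l2X2 hu) (l2X2 hv))) (l2_cst sepH P y).
have j1 := l2_dot sepH (l2_sg htu (l2b X1 (bX1 hu))) (l2_cst sepH P y).
have j2 := l2_dot sepH (l2_sg htu (l2b X2 (bX2 hu))) (l2_cst sepH P y).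
have eK : mean_on A (fun w => dot (Kt t u v w) y) =
    mean_on A (fun w => dot (S (t - v) (Y X1 w)) y) - mean_on A (fun w => dot (S (t - v) (Y X2 w)) y) +
    (v - u) * (mean_on A (fun w => dot (S (t - u) (b (X1 u w))) y) - mean_on A (fun w => dot (S (t - u) (b (X2 u w))) y)).
  rewrite -!mean_onB// -mean_onZ//; last exact: integrable_sub.
  rewrite -mean_onD//; last 2 first.
  - exact: integrable_sub.
  - by apply: integrable_scale; exact: integrable_sub.
  apply: eq_Rintegral => w _; congr (_ * _); rewrite (increment_drift w u0 uv' vt) /Y.
  rewrite !(sgE _ uv' vt) !(bopB (sg_bop hS tv0)) !(bopZ (sg_bop hS tv0)) !dotBl !dotZl; ring.
have ng : `|mean_on A (fun w => dot (S (t - u) (b (X1 u w))) y) - mean_on A (fun w => dot (S (t - u) (b (X2 u w))) y)|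
    <= M * Cb * `|y| * gap A u.
  have [->|yn] := eqVneq y 0.
    rewrite -mean_onB//; last 2 first.
    - by have := integrable_scale 0 j1; apply: eq_integrable => // w _; rewrite /= dot0r mul0r.
    - by have := integrable_scale 0 j2; apply: eq_integrable => // w _; rewrite /= dot0r mul0r.
    rewrite normr0 mulr0 mul0r (_ : mean_on A _ = \int[P]_w (cst 0 w)); first by rewrite Rint_cst normr0.
    by apply: eq_Rintegral => w _; rewrite !dot0r subrr mulr0.
  have y0 : 0 < `|y| by rewrite normr_gt0.
  set c := M * Cb * `|y|; have c0 : 0 < c by rewrite !mulr_gt0// (lt_le_trans _ M1).
  pose f x := c^-1 * dot (S (t - u) (b x)) y.
  have uf : unit_holder theta f.
    split=> [x|x x']; rewrite /f -?mulrBr normrM (gtr0_norm (_ : 0 < c^-1)) ?invr_gt0// ler_pdivrMl// ?mulr1.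
      apply: (le_trans (dot_le _ _)); rewrite ler_wpM2r//; apply: (le_trans (hM _ htu)).
      by rewrite ler_wpM2l.
    rewrite -dotBl -(bopB (sg_bop hS tu0)); apply: (le_trans (dot_le _ _)).
    rewrite /c mulrAC ler_wpM2r// -mulrA; apply: (le_trans (hM _ htu)).
    by rewrite ler_wpM2l//; exact: hb2.
  have := gap_ub mA hu uf; rewrite -(ler_pM2l c0) => hg.
  have eqf X : intb (fun w => dot (S (t - u) (b (X u w))) y) ->
      mean_on A (fun w => dot (S (t - u) (b (X u w))) y) = c * mean_on A (fun w => f (X u w)).
    move=> i; rewrite -mean_onZ//; last exact: integrable_scale.
    by apply: eq_Rintegral => w _; rewrite /f (mulrA c) mulfV ?gt_eqF// mul1r.
  by rewrite (eqf X1 j1) (eqf X2 j2) -mulrBr normrM (gtr0_norm c0).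
rewrite eK; apply: (le_trans (ler_normD _ _)); rewrite addrC; apply: lerD.
  by rewrite normrM (ger0_norm vu0) -mulrA ler_wpM2l.
have -> : 2 * (M * `|y| * e) = M * `|y| * e + M * `|y| * e by ring.
exact: (le_trans (ler_normB _ _) (lerD n1 n2)).
Qed.

(** The one-step bound is summed over a fine grid: [gap_sum] handles the main term, and the
    consistency errors, proportional to the mesh, add up to an arbitrarily small quantity. *)
Lemma mean_increment t u v A y : 0 <= u -> u <= v -> v <= t -> t <= T -> v - u <= tau -> F u A ->
  `|mean_on A (fun w => dot (Kt t u v w) y)| <= 2 * M * Cb * omega (v - u) * `|y| * mean_on A (fun w => `|D u w|).
Proof.
move=> u0; rewrite le_eqVlt => /predU1P[<-|uv] vt tT vtau FA.
  have [om0 _] : 0 <= omega (u - u) /\ 0 <= V (u - u) by rewrite subrr; apply: hV0 => //; exact: ltW.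
  rewrite (_ : mean_on A _ = \int[P]_w (cst 0 w)); first by rewrite Rint_cst normr0 !mulr_ge0 ?(ltW Cb0)//; exact: mean_on_ge0.
  by apply: eq_Rintegral => w _; rewrite /increment subrr dot0l mulr0.
have mA := filtration_sub u0 FA; have vu0 : 0 < v - u by rewrite subr_gt0.
have vT := le_trans vt tT.
have uT : u <= T by rewrite (le_trans (ltW uv)).
have vuT : v - u <= T by rewrite lerBlDr (le_trans vT)// lerDl.
apply/ler_addgt0Pr => e e0; have e20 : 0 < e / 2 by rewrite divr_gt0.
have c0 : 0 <= M * Cb * `|y| by rewrite !mulr_ge0// ltW.
have d0 : 0 <= 2 * M * `|y| * T by rewrite !mulr_ge0// ltW.
have [e1 /andP[e10 _] he1] := small_factor e20 c0.
have [e2 /andP[e20' _] he2] := small_factor e20 d0.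
have [d1 d10 hd1] := gap_sum e10; have [d2 d20 hd2] := err_small e20'.
have dd0 : 0 < Num.min d1 d2 / (v - u) by rewrite divr_gt0// lt_min d10.
have [N hN'] := inv_nat_le dd0; pose n := N.+1; pose eps := (v - u) / n%:R.
have eps0 : 0 < eps by rewrite divr_gt0.
have neps : n%:R * eps = v - u by rewrite /eps mulrC divfK// pnatr_eq0.
have : eps <= Num.min d1 d2.
  by rewrite /eps mulrC -ler_pdivlMr//; apply: hN'.
rewrite le_min => /andP[ed1 ed2].
pose p (j : nat) := u + j%:R * eps.
have pS j : p j.+1 - p j = eps by rewrite /p -natr1; ring.
have pp j : p j < p j.+1 by rewrite -subr_gt0 pS.
have p_ge j : u <= p j by rewrite lerDl mulr_ge0// ltW.
have pn : p n = v by rewrite /p neps; ring.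
have pv j : (j <= n)%N -> p j <= v by move=> jn; rewrite -pn lerD2l ler_pM2r// ler_nat.
have iK i j : (i <= j)%N -> (j <= n)%N -> intb (fun w => dot (Kt t (p i) (p j) w) y).
  move=> ij jn; apply: l2_dot => //; last exact: l2_cst.
  apply: increment_l2 => //; first exact: le_trans (p_ge i).
    by rewrite lerD2l ler_pM2r// ler_nat.
  exact: le_trans (pv j jn) vt.
have tele j : (j <= n)%N -> `|mean_on A (fun w => dot (Kt t (p 0%N) (p j) w) y)| <=
    \sum_(i < j) (M * Cb * `|y| * (eps * gap A (p i)) + 2 * (M * `|y| * (e2 * eps))).
  elim: j => [_|j IH jn].
    rewrite big_ord0 (_ : mean_on A _ = \int[P]_w (cst 0 w)); first by rewrite Rint_cst normr0.
    by apply: eq_Rintegral => w _; rewrite /increment subrr dot0l mulr0.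
  have -> : mean_on A (fun w => dot (Kt t (p 0%N) (p j.+1) w) y) =
      mean_on A (fun w => dot (Kt t (p 0%N) (p j) w) y) + mean_on A (fun w => dot (Kt t (p j) (p j.+1) w) y).
    rewrite -mean_onD//; [|exact: (iK 0%N j (leq0n j) (ltnW jn))|exact: (iK j j.+1)].
    by apply: eq_Rintegral => w _; rewrite (incrementD t (p 0%N) (p j)) dotDl.
  rewrite big_ord_recr/=; apply: (le_trans (ler_normD _ _)); apply: lerD; first exact: (IH (ltnW jn)).
  have [b1 b2] := hd2 (p j) (p j.+1) (le_trans u0 (p_ge j)) (ltW (pp j)) (le_trans (pv _ jn) vT) (eq_ind_r (fun z => z <= d2) ed2 (pS j)).
  rewrite pS in b1 b2.
  have FpA : F (p j) A by have [_ hF _ _] := hN; apply: (hF u).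
  have := mean_increment_step y (le_trans u0 (p_ge j)) (pp j) (le_trans (pv _ jn) vt) tT FpA (mulr_ge0 (ltW e20') (ltW eps0)) b1 b2.
  by rewrite pS (mulrC eps) -(mulrA _ eps).
have := tele n (leqnn n); rewrite pn {1}/p mul0r addr0 => h; apply: (le_trans h).
rewrite big_split/= -mulr_sumr sumr_const card_ord -[X in _ + X]mulr_natl.
have := hd1 u A eps n u0 FA eps0 ed1; rewrite neps => /(_ _ vtau) hg.
have {}hg := ler_wpM2l c0 (hg _).
apply: (@le_trans _ _ (M * Cb * `|y| * (2 * omega (v - u) * mean_on A (fun w => `|D u w|) + e1) + e2 * (2 * M * `|y| * (n%:R * eps)))).
  apply: lerD; first by apply: hg; rewrite addrC subrK.
  by rewrite le_eqVlt; apply/orP; left; apply/eqP; ring.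
have k2 : e2 * (2 * M * `|y| * (n%:R * eps)) <= e / 2.
  apply: le_trans he2; rewrite ler_wpM2l ?(ltW e20')// ler_wpM2l ?mulr_ge0// neps //.
have -> : M * Cb * `|y| * (2 * omega (v - u) * mean_on A (fun w => `|D u w|) + e1) =
  2 * M * Cb * omega (v - u) * `|y| * mean_on A (fun w => `|D u w|) + e1 * (M * Cb * `|y|) by ring.
move: k2 he1; move: (e1 * _) (e2 * _) => z1 z2 k2 he1; rewrite -addrA lerD2l; lra.
Qed.

Let borel_past_sg q t u : 0 <= u -> u <= q -> q <= T -> 0 <= t ->
  borel_on setT ((fun w => S t (D u w)) : g_sigma_algebraType (F q) -> H).
Proof.
move=> u0 uq qT t0; have q0 := le_trans u0 uq; have hu : 0 <= u <= T by rewrite u0 (le_trans uq).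
have [_ hF _ _] := hN.
have past X x0 : mild_solution P F S b T Z x0 X -> borel_on setT (X u : g_sigma_algebraType (F q) -> H).
  move=> hX O oO; rewrite setTI; apply: sub_sigma_algebra; apply: (hF u) => //; exact: (mild_adapted hX).
have bD : borel_on setT (D u : g_sigma_algebraType (F q) -> H).
  by apply: borelB => //; [exact: (past _ _ hX1)|exact: (past _ _ hX2)].
exact: (borel_comp (sg_bop hS t0).2 bD).
Qed.

(** The earlier increment is known at time [q], so it may serve as a random test direction for the
    later one. *)
Lemma increment_dot t p q r : 0 <= p -> p <= q -> q <= r -> r <= t -> t <= T -> r - q <= tau ->
  \int[P]_w dot (Kt t q r w) (Kt t p q w) <=
  2 * M * Cb * omega (r - q) * \int[P]_w (`|Kt t p q w| * `|D q w|).
Proof.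
move=> p0 pq qr rt tT qrtau; have q0 := le_trans p0 pq; have qt := le_trans qr rt.
have hq : 0 <= q <= T by rewrite q0 (le_trans qt).
have rT := le_trans rt tT; have qT := le_trans qr rT.
have [om0 _] : 0 <= omega (r - q) /\ 0 <= V (r - q).
  by apply: hV0; rewrite ?subr_ge0// lerBlDr (le_trans rT)// lerDl.
have [mF sF] := filtration_measurable hN q0.
apply: (mean_dot_random sepH (G := F q)) => //.
- by rewrite sF.
- exact: increment_l2.
- exact: increment_l2.
- exact: l2D'.
- by rewrite !mulr_ge0// ltW.
- have tq0 : 0 <= t - q by rewrite subr_ge0.
  have tp0 : 0 <= t - p by rewrite subr_ge0 (le_trans pq).
  by apply: borelB => //; exact: borel_past_sg.
- by move=> A v; rewrite sF => FA; apply: (le_trans (ler_norm _)); exact: mean_increment.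
Qed.

(** A bound that ignores all cancellation and only serves to start the bisection. *)
Lemma increment_as_bound t u v : 0 <= u -> u <= v -> v <= t -> t <= T ->
  {ae P, forall w, `|Kt t u v w| <= 2 * M * (M * Cb) * (v - u)}.
Proof.
move=> u0 uv vt tT; have vT := le_trans vt tT.
have tv0 : 0 <= t - v by rewrite subr_ge0.
have htv : 0 <= t - v <= T by rewrite tv0/= lerBlDr (le_trans tT)// lerDl (le_trans u0).
have k1 := drift_inc_K sepH hS theta01 (ltW Cb0) hb1 hb2 hX1 M1 hM u0 uv vT.
have k2 := drift_inc_K sepH hS theta01 (ltW Cb0) hb1 hb2 hX2 M1 hM u0 uv vT.
apply: filterS2 k1 k2 => w h1 h2; rewrite (increment_drift w u0 uv vt).
apply: (le_trans (hM _ htv)).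
have -> : 2 * M * (M * Cb) * (v - u) = M * (M * Cb * (v - u) + M * Cb * (v - u)) by ring.
by rewrite ler_wpM2l//; apply: (le_trans (ler_normB _ _)); exact: lerD.
Qed.

(** After [n] bisections the crude linear bound has been divided by [2^n] through the length and
    multiplied by [sqrt 2 ^ n] through the recursion. It is thus damped geometrically, while [V]
    reproduces itself by [hV1]. *)
Lemma increment_recursion t s (m : R) n : 0 <= s -> t <= T -> 0 <= m ->
  (forall u, s <= u -> u <= t -> \int[P]_w (`|D u w| ^+ 2) <= m ^+ 2) ->
  forall p h, s <= p -> 0 < h -> p + h <= t -> h <= tau ->
  \int[P]_w (`|Kt t p (p + h) w| ^+ 2) <=
    (2 * M * Cb * m * V h + (Num.sqrt 2 / 2) ^+ n * (2 * M * (M * Cb) * h)) ^+ 2.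
Proof.
move=> s0 tT m0 hD; have C0 : 0 <= 2 * M * Cb * m by rewrite !mulr_ge0// ltW.
have B0 h : 0 < h -> 0 <= 2 * M * (M * Cb) * h by move=> h0; rewrite !mulr_ge0// ltW.
have q0 : 0 <= Num.sqrt 2 / 2 :> R by rewrite divr_ge0// sqrtr_ge0.
elim: n => [|n IH] p h sp h0 pht htau.
  have p0 := le_trans s0 sp; have pph : p <= p + h by rewrite lerDl ltW.
  have hT : h <= T by apply: (le_trans _ tT); apply: (le_trans _ pht); rewrite lerDr.
  have [_ V0] := hV0 (ltW h0) hT.
  have ab := increment_as_bound p0 pph pht tT.
  have hE : p + h - p = h by ring.
  have cc0 : 0 <= 2 * M * (M * Cb) * (p + h - p) by rewrite hE; exact: B0.
  have [_ le] := l2_bound sepH (increment_l2 p0 pph pht tT).1 cc0 ab.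
  apply: (le_trans le); rewrite hE.
  rewrite expr0 mul1r ler_sqr ?nnegrE ?addr_ge0 ?B0//; last by rewrite mulr_ge0.
  by rewrite lerDr mulr_ge0.
have hh0 : 0 < h / 2 by rewrite divr_gt0.
have hle : h / 2 <= h by rewrite ler_pdivrMr//; apply: ler_peMr; [exact: ltW|rewrite ler1n].
have hhtau : h / 2 <= tau by exact: le_trans htau.
have hT : h <= T by apply: (le_trans _ tT); apply: (le_trans _ pht); rewrite lerDr (le_trans s0).
have hhT : h / 2 <= T by exact: le_trans hT.
have [om0 V0] := hV0 (ltW hh0) hhT.
have p0 := le_trans s0 sp.
set r := p + h / 2; have pr : p <= r by rewrite lerDl ltW.
have rph : r <= p + h by rewrite lerD2l.
have rt : r <= t by exact: le_trans pht.
have eph : p + h = r + h / 2 by rewrite /r; field.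
set kap := 2 * M * Cb * m * V (h / 2) + (Num.sqrt 2 / 2) ^+ n * (2 * M * (M * Cb) * (h / 2)).
have kap0 : 0 <= kap by rewrite addr_ge0// mulr_ge0// ?exprn_ge0// B0.
have I1 : \int[P]_w (`|Kt t p r w| ^+ 2) <= kap ^+ 2 by exact: IH.
have I2 : \int[P]_w (`|Kt t r (p + h) w| ^+ 2) <= kap ^+ 2.
  by rewrite eph; apply: IH => //; [exact: le_trans pr|rewrite -eph].
have l1 : l2 (Kt t p r) by exact: increment_l2.
have l2' : l2 (Kt t r (p + h)) by apply: increment_l2 => //; exact: le_trans pr.
have hr : 0 <= r <= T by rewrite (le_trans p0)// (le_trans rt).
have phr : p + h - r = h / 2 by rewrite eph; ring.
have dt := increment_dot p0 pr rph pht tT; rewrite phr in dt.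
have {}dt := dt hhtau.
have cs := l2_cauchy sepH l1 (l2D' hr) kap0 m0 I1 (hD r (le_trans sp pr) rt).
have -> : \int[P]_w (`|Kt t p (p + h) w| ^+ 2) = \int[P]_w (`|Kt t p r w + Kt t r (p + h) w| ^+ 2).
  by apply: eq_Rintegral => w _; rewrite -incrementD.
rewrite (l2_expand sepH l1 l2').
have dt' : \int[P]_w dot (Kt t p r w) (Kt t r (p + h) w) <= 2 * M * Cb * omega (h / 2) * (kap * m).
  have -> : \int[P]_w dot (Kt t p r w) (Kt t r (p + h) w) = \int[P]_w dot (Kt t r (p + h) w) (Kt t p r w).
    by apply: eq_Rintegral => w _; rewrite dotC.
  by apply: (le_trans dt); rewrite ler_wpM2l// !mulr_ge0// ltW.
have sq0 : 0 <= Num.sqrt 2 :> R by exact: sqrtr_ge0.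
have sq2 : Num.sqrt 2 ^+ 2 = 2 :> R by rewrite sqr_sqrtr.
have sq1 : 1 <= Num.sqrt 2 :> R by rewrite -[leLHS]sqrtr1 ler_sqrt// ler1n.
pose c := 2 * M * Cb * m * omega (h / 2); have c0 : 0 <= c by rewrite mulr_ge0.
(* The two halves contribute [kap^2] each and the cross term at most [2 * kap * c], which is less
   than [2 * sqrt 2 * kap * c]: the square is completed. *)
apply: (@le_trans _ _ ((Num.sqrt 2 * kap + c) ^+ 2)).
  have -> : (Num.sqrt 2 * kap + c) ^+ 2 = Num.sqrt 2 ^+ 2 * kap ^+ 2 + 2 * (Num.sqrt 2 * (kap * c)) + c ^+ 2 by ring.
  rewrite sq2; have kc : kap * c <= Num.sqrt 2 * (kap * c) by rewrite ler_peMl// mulr_ge0.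
  have e1 : 2 * M * Cb * omega (h / 2) * (kap * m) = kap * c by rewrite /c; ring.
  by rewrite e1 in dt'; exact: (sum_of_squares_le dt' kc I1 I2 (sqr_ge0 c)).
have hV := hV1 h0 hT; have [_ Vh0] := hV0 (ltW h0) hT.
rewrite ler_sqr ?nnegrE; last 2 first.
- by rewrite addr_ge0// mulr_ge0.
- by rewrite addr_ge0// mulr_ge0// ?exprn_ge0// B0.
have -> : Num.sqrt 2 * kap + c = 2 * M * Cb * m * (Num.sqrt 2 * V (h / 2) + omega (h / 2)) +
    (Num.sqrt 2 / 2) ^+ n.+1 * (2 * M * (M * Cb) * h) by rewrite /kap /c exprS; field.
by rewrite lerD2r ler_wpM2l.
Qed.

Lemma increment_bound t s (m : R) : 0 <= s -> t <= T -> 0 <= m ->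
  (forall u, s <= u -> u <= t -> \int[P]_w (`|D u w| ^+ 2) <= m ^+ 2) ->
  forall h, 0 < h -> s + h <= t -> h <= tau -> \int[P]_w (`|Kt t s (s + h) w| ^+ 2) <= (m / 2) ^+ 2.
Proof.
move=> s0 tT m0 hD h h0 sht htau.
have hT : h <= T by apply: (le_trans _ tT); apply: (le_trans _ sht); rewrite lerDr.
have [_ V0] := hV0 (ltW h0) hT.
have x0 : 0 <= 2 * M * Cb * m * V h by rewrite !mulr_ge0// ltW.
have y0 : 0 <= 2 * M * (M * Cb) * h by rewrite !mulr_ge0// ltW.
apply: (@le_trans _ _ ((2 * M * Cb * m * V h) ^+ 2)); last first.
  rewrite ler_sqr ?nnegrE ?divr_ge0// mulrAC [leRHS]mulrC ler_wpM2r//; exact: hV2.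
set I := Rintegral _ _ _; have I0 : 0 <= I by apply: Rintegral_ge0 => w _; exact: sqr_ge0.
rewrite -[leLHS]sqr_sqrtr// ler_sqr ?nnegrE ?sqrtr_ge0//.
apply/ler_addgt0Pr => e e0.
have q1 : `|Num.sqrt 2 / 2| < 1 :> R.
  rewrite ger0_norm ?divr_ge0 ?sqrtr_ge0// ltr_pdivrMr// mul1r.
  rewrite -(@ltr_pXn2r _ 2)// ?nnegrE ?sqrtr_ge0// sqr_sqrtr//; lra.
have [x /andP[xx0 _] hx] := small_factor e0 y0.
have /cvgrPdist_le/(_ x xx0)[n _ /(_ n (leqnn n))] := cvg_expr q1.
rewrite sub0r normrN ger0_norm ?exprn_ge0 ?divr_ge0 ?sqrtr_ge0// => hn.
have := increment_recursion n s0 tT m0 hD (lexx s) h0 sht htau; rewrite -/I => hI.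
have z0 : 0 <= 2 * M * Cb * m * V h + (Num.sqrt 2 / 2) ^+ n * (2 * M * (M * Cb) * h).
  by rewrite addr_ge0// mulr_ge0// exprn_ge0// divr_ge0// sqrtr_ge0.
apply: (@le_trans _ _ (2 * M * Cb * m * V h + (Num.sqrt 2 / 2) ^+ n * (2 * M * (M * Cb) * h))).
  by rewrite -[leRHS]ger0_norm// -sqrtr_sqr ler_wsqrtr.
by rewrite lerD2l; apply: le_trans hx; rewrite ler_wpM2r.
Qed.

(** An almost sure a priori bound for the difference: the noises cancel and the drifts are
    bounded. *)
Let m0 := M * `|x1 - x2| + 2 * (M * Cb) * T.

Let m00 : 0 <= m0. Proof. by rewrite addr_ge0// !mulr_ge0// ltW. Qed.

Let D0E : {ae P, forall w, D 0 w = x1 - x2}.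
Proof.
have i1 := mild_initial sepH hS theta01 (ltW Cb0) hb1 hb2 T0 hX1 M1 hM.
have i2 := mild_initial sepH hS theta01 (ltW Cb0) hb1 hb2 T0 hX2 M1 hM.
by apply: filterS2 i1 i2 => w e1 e2; rewrite /D e1 e2; hring.
Qed.

Let D_crude t : 0 <= t <= T -> \int[P]_w (`|D t w| ^+ 2) <= m0 ^+ 2.
Proof.
move=> ht; have /andP[t0 tT] := ht.
suff h : {ae P, forall w, `|D t w| <= m0} by have [] := l2_bound sepH (l2D' ht).1 m00 h.
have k1 := drift_inc_K sepH hS theta01 (ltW Cb0) hb1 hb2 hX1 M1 hM (lexx 0) t0 tT.
have k2 := drift_inc_K sepH hS theta01 (ltW Cb0) hb1 hb2 hX2 M1 hM (lexx 0) t0 tT.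
apply: filterS3 D0E k1 k2 => w e h1 h2; rewrite subr0 in h1 h2.
rewrite (D_step w (lexx 0) t0) subr0 e; apply: (le_trans (ler_normD _ _)); apply: lerD; first exact: hM.
apply: (le_trans (ler_normB _ _)); apply: (le_trans (lerD h1 h2)).
have -> : M * Cb * t + M * Cb * t = 2 * (M * Cb) * t by ring.
by rewrite ler_wpM2l// !mulr_ge0// ltW.
Qed.

(** A bound [m] on [[s, t]] improves to [M * dl + m / 2], by [increment_bound] and the triangle
    inequality in mean square. Iterating from the a priori bound [m0] leads to the fixed point
    [2 * M * dl]. *)
Lemma local_stability s (dl : R) t : 0 <= s -> s <= t -> t <= T -> t - s <= tau -> 0 <= dl ->
  \int[P]_w (`|D s w| ^+ 2) <= dl ^+ 2 -> \int[P]_w (`|D t w| ^+ 2) <= (2 * M * dl) ^+ 2.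
Proof.
move=> s0 st tT ts dl0 hs.
have Md0 : 0 <= M * dl by rewrite mulr_ge0.
have iter n : forall u, s <= u -> u <= t -> \int[P]_w (`|D u w| ^+ 2) <= (2 * M * dl + 2^-1 ^+ n * m0) ^+ 2.
  elim: n => [|n IH] u su ut.
    apply: (le_trans (D_crude _)); first by rewrite (le_trans s0)// (le_trans ut).
    rewrite expr0 mul1r ler_sqr ?nnegrE ?m00//; first by rewrite lerDr -mulrA mulr_ge0.
    by rewrite addr_ge0// -mulrA mulr_ge0.
  set m := 2 * M * dl + 2^-1 ^+ n * m0 in IH.
  have mm0 : 0 <= m by rewrite addr_ge0// ?mulr_ge0// ?exprn_ge0// ?invr_ge0// mulr_ge0.
  have emm : 2 * M * dl + 2^-1 ^+ n.+1 * m0 = M * dl + m / 2 by rewrite /m exprS; field.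
  rewrite emm; have uT := le_trans ut tT.
  have hs' : 0 <= s <= T by rewrite s0 (le_trans su).
  have us0 : 0 <= u - s <= T.
    by rewrite subr_ge0 su/= lerBlDr (le_trans uT)// lerDl.
  have lS := l2_sg us0 (l2D' hs').
  have nS : \int[P]_w (`|S (u - s) (D s w)| ^+ 2) <= (M * dl) ^+ 2.
    have [_ le] := l2_le sepH lS.1 (l2D' hs') M0 (fun w => hM (D s w) us0).
    by apply: (le_trans le); rewrite exprMn ler_wpM2l// sqr_ge0.
  move: su; rewrite le_eqVlt => /predU1P[su|su].
    rewrite -su; apply: (le_trans hs); rewrite ler_sqr ?nnegrE ?addr_ge0 ?divr_ge0//.
    by apply: (@le_trans _ _ (M * dl)); [rewrite ler_peMl|rewrite lerDl divr_ge0].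
  have us : 0 < u - s by rewrite subr_gt0.
  have nK := @increment_bound u s m s0 uT mm0 (fun v sv vu => IH v sv (le_trans vu ut)) (u - s) us.
  have sus : s + (u - s) = u by ring.
  rewrite sus in nK; have {}nK := nK (lexx u) (le_trans (lerB ut (lexx s)) ts).
  have lK := increment_l2 s0 (ltW su) (lexx u) uT.
  have := l2_triangle sepH lS lK Md0 (divr_ge0 mm0 (ler0n _ 2)) nS nK.
  rewrite (_ : \int[P]_w (`|S (u - s) (D s w) + Kt u s u w| ^+ 2) = \int[P]_w (`|D u w| ^+ 2))//.
  apply: eq_Rintegral => w _; rewrite /increment subrr; have [_ S0 _ _] := hS.
  by rewrite S0 addrC subrK.
set I := Rintegral _ _ _; have I0 : 0 <= I by apply: Rintegral_ge0 => w _; exact: sqr_ge0.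
have x0 : 0 <= 2 * M * dl by rewrite -mulrA mulr_ge0.
rewrite -[leLHS]sqr_sqrtr// ler_sqr ?nnegrE ?sqrtr_ge0//.
apply/ler_addgt0Pr => e e0.
have q1 : `|2^-1| < 1 :> R by rewrite ger0_norm// invf_lt1// ltr1n.
have [x /andP[xx0 _] hx] := small_factor e0 m00.
have /cvgrPdist_le/(_ x xx0)[n _ /(_ n (leqnn n))] := cvg_expr q1.
rewrite sub0r normrN ger0_norm ?exprn_ge0// => hn.
have := iter n t st (lexx t); rewrite -/I => hI.
have z0 : 0 <= 2 * M * dl + 2^-1 ^+ n * m0 by rewrite addr_ge0// mulr_ge0// exprn_ge0.
apply: (@le_trans _ _ (2 * M * dl + 2^-1 ^+ n * m0)).
  by rewrite -[leRHS]ger0_norm// -sqrtr_sqr ler_wsqrtr.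
by rewrite lerD2l; apply: le_trans hx; rewrite ler_wpM2r.
Qed.

(** Each interval of length at most [tau] multiplies the mean square norm by at most [2 * M]. *)
Lemma stability n t : 0 <= t <= T -> t <= n%:R * tau ->
  \int[P]_w (`|X1 t w - X2 t w| ^+ 2) <= ((2 * M) ^+ n * `|x1 - x2|) ^+ 2.
Proof.
elim: n t => [|n IH] t /andP[t0 tT] tn.
  have -> : t = 0 by apply/le_anti; rewrite t0 andbT; move: tn; rewrite mul0r.
  have T00 : 0 <= (0 : R) <= T by rewrite lexx ltW.
  have h0 : {ae P, forall w, `|D 0 w| <= `|x1 - x2|} by apply: filterS D0E => w ->.
  by rewrite expr0 mul1r; have [] := l2_bound sepH (l2D' T00).1 (normr_ge0 (x1 - x2)) h0.
have M20 : 0 <= 2 * M by rewrite mulr_ge0.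
have dl0 : 0 <= (2 * M) ^+ n * `|x1 - x2| by rewrite mulr_ge0// exprn_ge0.
have -> : (2 * M) ^+ n.+1 * `|x1 - x2| = 2 * M * ((2 * M) ^+ n * `|x1 - x2|) by rewrite exprS mulrA.
have [tt|tt] := leP t tau.
  apply: (local_stability (lexx 0) t0 tT _ dl0); first by rewrite subr0.
  apply: IH; first by rewrite lexx ltW.
  by rewrite mulr_ge0// ltW.
have ts0 : 0 <= t - tau by rewrite subr_ge0 ltW.
have tst : t - tau <= t by rewrite gerBl ltW.
apply: (local_stability ts0 tst tT _ dl0); first by have -> : t - (t - tau) = tau by ring.
apply: IH; first by rewrite ts0 (le_trans tst).
by rewrite lerBlDr; move: tn; rewrite -natr1 mulrDl mul1r.
Qed.

End TwoSolutions.
End Comparison.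

(** * The stability estimate *)

Section Stability.
Context {R : realType} {H U : hilbertType R} (theta : R) (Dom : set H) (A : H -> H) (S : R -> H -> H).
Context (G Gt : U -> H) (L B : H -> H) (Hn : nat -> set H).
Hypotheses (sepH : separable_space H) (hypI : hypotheses_I theta Dom A S G Gt L B Hn).
Local Notation mu := (@lebesgue_measure R).
Local Notation Gam := (Gamma_op S G).

Let hS : C0_semigroup S. Proof. by have [] := hI_generator hypI. Qed.

Let bGt : bounded_operator Gt. Proof. by have [] := hI_G hypI. Qed.

Let bG : bounded_operator G.
Proof.
have [_ [V [bV GE]]] := hI_G hypI.
have -> : G = Gt \o V by apply/funext => u; rewrite GE.
exact: bop_comp.
Qed.

Let theta01 := hI_theta hypI.

Let theta1 : theta < 1. Proof. by have /andP[] := theta01. Qed.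

Lemma drift_factorization : exists (K : U -> U) (Bt : H -> U) (CK CB : R),
  [/\ bounded_operator K, 0 < CK, forall v, `|K v| <= CK * `|v| & 0 < CB] /\
  [/\ forall x, `|Bt x| <= CB, forall x y, `|Bt x - Bt y| <= CB * `|x - y| `^ theta &
      forall x, L (B x) = Gt (K (Bt x))].
Proof.
have [_ [Bt [[[M1 h1] [M2 h2]] BE]]] := hI_B hypI.
have [_ [K [bK LE]]] := hI_L hypI.
have [CK CK0 hCK] := bop_bound bK.
exists K, Bt, (CK + 1), (`|M1| + `|M2| + 1); split; split.
- exact: bK.
- by rewrite ltr_wpDl.
- by move=> v; apply: (le_trans (hCK v)); rewrite ler_wpM2r// lerDl.
- by rewrite ltr_wpDl// addr_ge0.
- move=> x; apply: (le_trans (h1 x)); apply: (le_trans (ler_norm _)).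
  by rewrite -addrA lerDl addr_ge0.
- move=> x y; apply: (le_trans (h2 x y)); rewrite ler_wpM2r ?powR_ge0//.
  by apply: (le_trans (ler_norm _)); rewrite -addrA addrCA lerDl addr_ge0.
- by move=> x; rewrite BE LE.
Qed.

Context (J : set nat) (g : nat -> U) (hg : orthonormal_basis J g).

(** The factors [M + 4] and [kap] are the ones of [smoothed_lipschitz] and [smoothed_drift].
    Monotonicity of [Gamma] in time supplies the measurability of the kernels. *)
Lemma Gamma_kernels T (M kap : R) : 0 < T -> 1 <= M -> 0 < kap ->
  let a s := (M + 4) * opnorm (Gam s) `^ (1 - theta) in
  let k s := kap * opnorm (Gam s \o Gt) in
  exists2 c : R, 0 < c & [/\ decreasing_kernel T a, decreasing_kernel T k,
    forall s, 0 < s -> s <= T -> [/\ c <= a s, c <= k s & c <= k s * Num.sqrt s] &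
    (\int[mu]_(s in `]0%R, T]) (a s * k s)%:E < +oo)%E].
Proof.
move=> T0 M1 kap0 a k; have M0 : 0 <= M by exact: le_trans M1.
have M40 : 0 <= M + 4 by rewrite addr_ge0.
(* The hypotheses on [Gamma] concern open intervals; passing to [T + 1] includes the end point
   [T]. *)
have T10 : 0 < T + 1 by rewrite addr_gt0.
have hrange := hI_range hypI; have hlow := hI_Gamma_lower hypI.
have [c1 c10 hc1] := opnorm_Gamma_lower sepH hS bG bGt hg theta1 hrange hlow T10.
have [c2 [c20 hc2]] := hlow _ T10.
have th : 0 <= 1 - theta by rewrite subr_ge0 ltW.
have dk T' : decreasing_kernel T' (fun s => opnorm (Gam s) `^ (1 - theta)) /\
    decreasing_kernel T' (fun s => opnorm (Gam s \o Gt)).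
  split; split=> [s s0 _|s t s0 st _].
  - exact: powR_ge0.
  - have [h _] := opnorm_Gamma_mono (Gt := Gt) sepH hS bG hg theta1 hrange hlow s0 st.
    by apply: (ge0_ler_powR th); rewrite ?nnegrE ?opnorm_ge0.
  - exact: opnorm_ge0.
  - by have [_ h] := opnorm_Gamma_mono sepH hS bG hg theta1 hrange hlow s0 st.
have [d1 d2] := dk T; have [[a0 ad] [k0 kd]] := (d1, d2).
exists (Num.min c2 (Num.min (kap * c2) (kap * c1))); first by rewrite !lt_min c20 !mulr_gt0.
split.
- split=> [s s0 sT|s t s0 st tT]; first by rewrite mulr_ge0// a0.
  exact: (ler_wpM2l M40 (ad s t s0 st tT)).
- split=> [s s0 sT|s t s0 st tT]; first by rewrite mulr_ge0 ?(ltW kap0)// k0.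
  exact: (ler_wpM2l (ltW kap0) (kd s t s0 st tT)).
- move=> s s0 sT; have sT1 : s < T + 1 by rewrite (le_lt_trans sT)// ltrDl.
  have [|h1 h2] := hc2 s; first by rewrite s0.
  split.
  + apply: (@le_trans _ _ c2); first by rewrite ge_min lexx.
    by apply: (le_trans h1); rewrite ler_peMl ?powR_ge0// ler_wpDl// ler1n.
  + apply: (@le_trans _ _ (kap * c2)); first by rewrite !ge_min lexx orbT.
    by rewrite ler_wpM2l// ltW.
  + apply: (@le_trans _ _ (kap * c1)); first by rewrite !ge_min lexx !orbT.
    by rewrite /k -mulrA ler_wpM2l ?(ltW kap0)//; exact: hc1.
have [e1 e2] := dk (T + 1).
pose f (s : R) := opnorm (Gam s) `^ (1 - theta) * opnorm (Gam s \o Gt).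
have mI (x : R) : measurable (`]0, x]%classic : set (measurableTypeR R)) by exact: measurable_itv.
have mf1 : measurable_fun (`]0, T + 1] : set (measurableTypeR R)) (f : measurableTypeR R -> R).
  by apply: measurable_funM; exact: kernel_measurable.
have f0 s : 0 <= f s by rewrite mulr_ge0 ?powR_ge0 ?opnorm_ge0.
have sub1 : (`]0, T]%classic : set R) `<=` `]0, T + 1[.
  by move=> s; rewrite /= !in_itv/= => /andP[-> h]; rewrite (le_lt_trans h)// ltrDl.
have sub2 : (`]0, T + 1[%classic : set R) `<=` `]0, T + 1].
  by move=> s; rewrite /= !in_itv/= => /andP[-> /ltW].
have mO : measurable (`]0, T + 1[%classic : set (measurableTypeR R)) by exact: measurable_itv.
have foo : (\int[mu]_(s in `]0%R, T]) (f s)%:E < +oo)%E.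
  apply: le_lt_trans (hI_Gamma hypI T10); apply: ge0_subset_integral => //.
    by apply/measurable_EFinP; exact: (measurable_funS (mI _) sub2 mf1).
  by move=> s _; rewrite lee_fin.
have C0 : 0 <= (M + 4) * kap by rewrite mulr_ge0// ltW.
rewrite (_ : (\int[mu]_(s in `]0%R, T]) (a s * k s)%:E)%E =
    (((M + 4) * kap)%:E * \int[mu]_(s in `]0%R, T]) (f s)%:E)%E); last first.
  rewrite -(ge0_integralZl mu (mI T))//.
  - by apply: eq_integral => s _; rewrite -EFinM /a /k /f; congr EFin; ring.
  - apply/measurable_EFinP; apply: (measurable_funS (mI (T + 1)) _ mf1).
    by apply: subset_trans sub1 sub2.
  - by move=> s _; rewrite lee_fin.
by apply: lte_mul_pinfty => //; rewrite lee_fin.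
Qed.

(** The step [tau] and the number [n] of steps depend only on the kernels and on bounds for the
    coefficients. The constant [(2 * M)^(2 * n)] is thus the same for all initial data and all
    probability spaces. *)
Lemma mean_square_stability (T : R) : 0 < T -> exists2 C : R, 0 < C &
  forall (x1 x2 : H) d (Omega : measurableType d) (P : probability Omega R) (F : R -> set (set Omega))
    (W : cylindrical Omega U) (X1 X2 : R -> Omega -> H),
    weak_mild_solution S L B G T x1 P F W X1 -> weak_mild_solution S L B G T x2 P F W X2 ->
    forall t, 0 <= t <= T -> borel_on setT (fun w => X1 t w - X2 t w) /\
      (\int[P]_w (`|X1 t w - X2 t w| ^+ 2)%:E <= (C * `|x1 - x2| ^+ 2)%:E)%E.
Proof.
move=> T0; have [K [Bt [CK [CB [[bK CK0 hCK CB0] [hB1 hB2 hLK]]]]]] := drift_factorization.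
have [Cg Cg0 hCg] := bop_bound bGt; have [M M1 hM] := sg_bound hS T.
have M0 : 0 < M by exact: lt_le_trans M1.
pose b x := L (B x); pose Cb := (Cg + 1) * (CK * CB).
have Cb0 : 0 < Cb by rewrite !mulr_gt0// ltr_wpDl.
have hCg' u : `|Gt u| <= (Cg + 1) * `|u| by apply: (le_trans (hCg u)); rewrite ler_wpM2r// lerDl.
have Cg1 : 0 <= Cg + 1 by rewrite addr_ge0.
have hb1 x : `|b x| <= Cb.
  rewrite /b hLK; apply: (le_trans (hCg' _)); rewrite ler_wpM2l//; apply: (le_trans (hCK _)).
  by rewrite ler_wpM2l// ltW.
have hb2 x y : `|b x - b y| <= Cb * `|x - y| `^ theta.
  rewrite /b !hLK -(bopB bGt) -(bopB bK); apply: (le_trans (hCg' _)); rewrite -mulrA ler_wpM2l//.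
  by apply: (le_trans (hCK _)); rewrite -mulrA ler_wpM2l ?(ltW CK0).
pose kap := 8 * M * CK * CB; have kap0 : 0 < kap by rewrite !mulr_gt0.
have [c c0 [da dk hc foo]] := Gamma_kernels T0 M1 kap0.
set a := fun s => _ in da hc foo; set k := fun s => _ in dk hc foo.
have [ksum [omega [V [hasum hV0 hV1 hV2]]]] := kernel_estimates T0 c0 da dk hc foo.
have half0 : 0 < 2^-1 :> R by rewrite invr_gt0.
have [tau1 /andP[tau10 tau1T] hks] := ksum 2^-1 half0.
have MC0 : 0 < 2 * M * Cb by rewrite mulr_gt0// mulr_gt0.
have B0 : 0 < 2^-1 / (2 * M * Cb) by rewrite divr_gt0.
have [tau2 /andP[tau20 tau2T] hVs] := hV2 _ B0.
(* Below [tau1] the Volterra kernel has mass at most 1/2; below [tau2] the increments are at most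
   half of the bound assumed for [D]. *)
pose tau := Num.min tau1 tau2; have tau0 : 0 < tau by rewrite lt_min tau10.
pose n := (Num.truncn (T / tau)).+1.
have nT : T <= n%:R * tau by rewrite -ler_pdivrMr//; apply: ltW; exact: truncnS_gt.
exists (((2 * M) ^+ n) ^+ 2); first by rewrite !exprn_gt0// mulr_gt0.
move=> x1 x2 d Omega P F W X1 X2 s1 s2 t ht.
have [hN hW ad1 me1 eq1] := s1; have [_ _ ad2 me2 eq2] := s2.
(* The mild equation yields a convolution separately at each time, and for each solution. Those of
   [X1] are assembled into one process [Z], and [sint_uniq] lets [X2] use it as well. *)
have exZ r : exists Zr : Omega -> H, 0 <= r <= T ->
    stoch_integral P W r (fun s u => S (r - s) (G u)) Zr /\
    {ae P, forall w, exists I : H, has_bochner `[0, r] (fun s => S (r - s) (b (X1 s w))) I /\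
       X1 r w = S r x1 + I + Zr w}.
  have [hr|nr] := pselect (0 <= r <= T); last by exists (fun=> 0).
  by have [Zr h] := eq1 r hr; exists Zr.
have [Z hZ'] := choice exZ.
have hZ r : 0 <= r <= T -> sint P W 0 r (conv_kernel W S G r) (Z r).
  by move=> hr; exact: (stoch_integral_conv sepH hS (hZ' r hr).1).
have hX1 : mild_solution P F S b T Z x1 X1.
  by split=> // r hr; have [] := hZ' r hr.
have hX2 : mild_solution P F S b T Z x2 X2.
  split=> // r hr; have [Z2 [st2 e2]] := eq2 r hr.
  have uq := sint_uniq hW sepH (lexx 0) (hZ r hr) (stoch_integral_conv sepH hS st2).
  by apply: filterS2 e2 uq => w [I [hI eX]] eZ; exists I; rewrite eZ.
have hrange := hI_range hypI; have hlow := hI_Gamma_lower hypI.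
have hMr u r : 0 <= u -> u < r -> r <= T -> forall x, `|S (r - u) x| <= M * `|x|.
  move=> u0 ur rT x; apply: hM; rewrite subr_ge0 (ltW ur)/= lerBlDr (le_trans rT)// lerDl.
  exact: u0.
have ha u r f : 0 <= u -> u < r -> r <= T -> unit_holder theta f -> forall x y,
    `|smoothed P S u r (Zinc S Z u r) f x - smoothed P S u r (Zinc S Z u r) f y| <= a (r - u) * `|x - y|.
  move=> u0 ur rT uf x y; have sz := sint_Zinc hW sepH hS hZ u0 (ltW ur) rT.
  exact: (smoothed_lipschitz hW sepH hS bG theta01 hrange hlow u0 ur sz (hMr u r u0 ur rT) x y uf).
have hk u r f (eps : R) : 0 <= u -> u < r -> r <= T -> unit_holder theta f -> 0 <= eps ->
  let q x := smoothed P S u r (Zinc S Z u r) f (x + eps *: b x) - smoothed P S u r (Zinc S Z u r) f x in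
  (forall x, `|q x| <= eps * k (r - u)) /\ (forall x y, `|q x - q y| <= eps * k (r - u) * `|x - y| `^ theta).
  move=> u0 ur rT uf eps0; have sz := sint_Zinc hW sepH hS hZ u0 (ltW ur) rT.
  exact: (smoothed_drift hW sepH hS bG bGt theta01 hrange hlow u0 ur sz M1 (hMr u r u0 ur rT) bK (ltW CK0) hCK hLK
    (ltW CB0) hB1 hB2 uf eps0).
have ak0 s : 0 < s -> s <= T -> 0 <= a s /\ 0 < k s.
  by move=> s0' sT; have [h1 h2 _] := hc s s0' sT; split; [exact: le_trans (ltW c0) h1|exact: lt_le_trans h2].
have hksum (eps : R) m : 0 < eps -> m%:R * eps <= tau -> \sum_(i < m) eps * k (i.+1%:R * eps) <= 2^-1.
  by move=> e0; rewrite le_min => /andP[h _]; exact: hks.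
have hV2' h : 0 < h -> h <= tau -> 2 * M * Cb * V h <= 2^-1.
  move=> h0; rewrite le_min => /andP[_ ht2]; rewrite mulrC -ler_pdivlMr//; exact: hVs.
have tn : t <= n%:R * tau by case/andP: ht => _ tT; exact: le_trans nT.
have st := stability hN hW sepH hS theta01 Cb0 hb1 hb2 T0 hZ M1 hM hX1 hX2 ha hk ak0 tau0 hksum hasum hV0 hV1 hV2' ht tn.
have bZ r : 0 <= r <= T -> borel_on setT (Z r) by move=> hr; have [] := hZ r hr.
have fZ := ms_conv_finite hW sepH hS T0 hZ; have bZi := borel_Zinc hW sepH hS hZ.
have l1 : l2 P (X1 t).
  split; first exact: (mild_borel hN hX1 ht).
  exact: (mild_ms_finite sepH hN hS theta01 (ltW Cb0) hb1 hb2 T0 bZ fZ bZi hX1 M1 hM ht).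
have l2' : l2 P (X2 t).
  split; first exact: (mild_borel hN hX2 ht).
  exact: (mild_ms_finite sepH hN hS theta01 (ltW Cb0) hb1 hb2 T0 bZ fZ bZi hX2 M1 hM ht).
have lD := l2B sepH l1 l2'; split; first exact: lD.1.
rewrite -exprMn; move: st; rewrite -lee_fin /Rintegral fineK//.
exact: (integrable_fin_num measurableT (l2_sqr sepH lD)).
Qed.

End Stability.

Theorem theorem3p8 (R : realType) (H U : hilbertType R)
  (theta : R) (Dom : set H) (A : H -> H) (S : R -> H -> H)
  (G Gt : U -> H) (L B : H -> H) (Hn : nat -> set H)
  (separableH : separable_space H) (separableU : separable_space U)
  (hypI : hypotheses_I theta Dom A S G Gt L B Hn)
  (hypII : hypotheses_II theta Dom A L B Hn)
  (standing : forall (T : R) (x : H), 0 < T ->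
     unique_weak_mild_solution S L B G T x) :
  (forall (T : R) (x : H), 0 < T -> pathwise_uniqueness S L B G T x) /\
  (forall T : R, 0 < T -> exists CT : R, 0 < CT /\
     forall (x1 x2 : H)
       (d : measure_display) (Omega : measurableType d)
       (P : probability Omega R) (F : R -> set (set Omega))
       (W : cylindrical Omega U) (X1 X2 : R -> Omega -> H),
       weak_mild_solution S L B G T x1 P F W X1 ->
       weak_mild_solution S L B G T x2 P F W X2 ->
       (ereal_sup [set 'E_P[fun w => (`|X1 t w - X2 t w| ^+ 2)%R]
                  | t in [set t : R | (0 <= t <= T)%R]]
        <= (CT * `|x1 - x2| ^+ 2)%R%:E)%E).
Proof.
(* The constant has to be fixed before the solutions that are compared, so an orthonormal basis of
   [U] is taken from the Wiener process of one given solution. *)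
have [ex _] := standing 1 0 ltr01.
destruct ex as (d & Omega & P & F & W & X & sol).
case: sol => _ [hg _ _ _ _] _ _ _.
split=> [T x T0 d' Omega' P' F' W' X1 X2 s1 s2 t ht|T T0].
  have [C _ hC] := mean_square_stability separableH hypI hg T0.
  have [bD] := hC x x _ _ _ _ _ _ _ s1 s2 t ht; rewrite subrr normr0 expr0n mulr0 => le.
  by apply: filterS (ms_eq0 separableH bD le) => w /eqP; rewrite subr_eq0 => /eqP.
have [C C0 hC] := mean_square_stability separableH hypI hg T0; exists C; split => //.
move=> x1 x2 d' Omega' P' F' W' X1 X2 s1 s2; apply: ub_ereal_sup => _ [t ht <-].
by rewrite unlock; have [_] := hC x1 x2 _ _ _ _ _ _ _ s1 s2 t ht.
Qed.
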